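(* For every $N\in[5..2^w]$, after an $\tilde O(N)$-time preprocessing, the following holds. Given the sparse encoding $\mathrm{senc}(A)$ of a bitmask $A[0..n)$ with $n\in2^{O(w)}$ and $|\mathrm{senc}(A)|=O(\mathrm{poly}(N))$, one can compute a data structure for $O(1)$-time select queries on $A$ in $O(1+|\mathrm{senc}(A)|/\lg N)$ time and $O\left(|\mathrm{senc}(A)|\cdot(1+\lg n/\lg N)\right)$ bits of space.
   Context: Model: word RAM with machine words of $w$ bits; bitmasks are stored packed. $[i..j]=\{h\in\mathbb Z:i\le h\le j\}$, $[i..j)=[i..j-1]$, $\lg x=\log_2\max(1,x)$; $\tilde O$ hides polylogarithmic factors. Elias-$\gamma$ code: for $x\in\mathbb Z_+$, $\gamma(x)=\mathtt0^{\ell}\cdot X$, where $\ell=\lfloor\log_2x\rfloor$ and $X$ is the $(\ell+1)$-bit binary representation of $x$ (most significant bit first). Sparse encoding: for a string $A$ of non-negative integers, $\mathrm{senc}(A)$ is the bitmask encoding $A$ from left to right as follows: each symbol $u>0$ is stored as a literal token $\mathtt1\cdot\gamma(u)$, and each inclusion-wise maximal fragment of the form $0^x$, $x\in\mathbb Z_+$, is stored as a zero-run token $\mathtt0\cdot\gamma(x)$. $|\mathrm{senc}(A)|$ is its length in bits. Select query: for a bitmask $A$ and $i\in[1..|\{j:A[j]=1\}|]$, $\mathrm{select}_A(i)$ is the $i$-th smallest position $j$ with $A[j]=1$. *)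

(* Defs.v *)
(* Stdlib world: concrete reals and nat bit operations (Nat.testbit, Nat.land, etc). *)
From Stdlib Require Import Reals Arith List Bool.
Import ListNotations.

Definition lg (x : R) : R := (ln (Rmax 1 x) / ln 2)%R.

(** * Bitmasks and encodings *)

(* A bitmask is a [list bool]; position 0 is the head of the list. *)

Definition gamma (x : nat) : list bool :=
  repeat false (Nat.log2 x) ++
  rev (map (Nat.testbit x) (seq 0 (S (Nat.log2 x)))).

Definition zero_run (x : nat) : list bool :=
  match x with
  | 0 => []
  | S _ => false :: gamma x
  end.

(* [senc_from z A] encodes [A] when it is preceded by a pending run of exactly
   [z] zeros whose token has not been emitted yet; emitting only at the next
   nonzero symbol, or at the end, is what makes the runs maximal. *)
Fixpoint senc_from (z : nat) (A : list nat) : list bool :=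
  match A with
  | [] => zero_run z
  | 0 :: A' => senc_from (S z) A'
  | u :: A' => zero_run z ++ (true :: gamma u) ++ senc_from 0 A'
  end.

Definition senc (A : list nat) : list bool := senc_from 0 A.

Definition senc_mask (A : list bool) : list bool := senc (map Nat.b2n A).

Definition ones (A : list bool) : list nat :=
  filter (fun j => nth j A false) (seq 0 (length A)).

(* Meaningful for 1 <= i <= length (ones A). *)
Definition select (A : list bool) (i : nat) : nat := nth (i - 1) (ones A) 0.

(** * The word RAM *)

(* Machine words are the naturals below 2^w.  The memory is organised into
   arrays: [mem s k a] is the word in cell [a] of array [k].  A program names
   finitely many arrays and registers, so an array plays the role of a base
   pointer, and the registers amount to O(1) words. *)
Definition memory : Type := nat -> nat -> nat.

Record state : Type := State { regs : nat -> nat; mem : memory }.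

Definition word_memory (w : nat) (m : memory) : Prop :=
  forall k a, m k a < 2 ^ w.

Inductive op : Type :=
| Add | Sub | Mul | Div | Mod | And | Or | Xor | Shl | Shr | Lt | Eq.

(* Division by zero yields 0 and [x] modulo zero is [x], as in Stdlib. *)
Definition eval_op (w : nat) (o : op) (x y : nat) : nat :=
  match o with
  | Add => (x + y) mod 2 ^ w
  | Sub => (x + 2 ^ w - y) mod 2 ^ w
  | Mul => (x * y) mod 2 ^ w
  | Div => x / y
  | Mod => x mod y
  | And => Nat.land x y
  | Or => Nat.lor x y
  | Xor => Nat.lxor x y
  | Shl => Nat.shiftl x y mod 2 ^ w
  | Shr => Nat.shiftr x y
  | Lt => Nat.b2n (x <? y)
  | Eq => Nat.b2n (x =? y)
  end.

(* Integers of O(w) bits, in particular cell indices, span several words,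
   least significant word first. *)
Definition limbs (w k x : nat) : list nat :=
  map (fun j => x / 2 ^ (w * j) mod 2 ^ w) (seq 0 k).

Definition of_limbs (w : nat) (l : list nat) : nat :=
  fold_right (fun x acc => x + 2 ^ w * acc) 0 l.

Inductive cmd : Type :=
| Skip
| Const (d v : nat)                      (* reg d := v mod 2^w *)
| Op (d : nat) (o : op) (r1 r2 : nat)
| Read (d k : nat) (idx : list nat)      (* registers idx hold the cell index *)
| Write (k : nat) (idx : list nat) (r : nat)
| Seq (c1 c2 : cmd)
| If (r : nat) (c1 c2 : cmd)             (* c1 when reg r is nonzero *)
| While (r : nat) (c : cmd).

Definition upd {X : Type} (f : nat -> X) (i : nat) (v : X) : nat -> X :=
  fun j => if j =? i then v else f j.

Definition set_reg (s : state) (d v : nat) : state :=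
  State (upd (regs s) d v) (mem s).

Definition set_mem (s : state) (k a v : nat) : state :=
  State (regs s) (upd (mem s) k (upd (mem s k) a v)).

Definition index (w : nat) (s : state) (idx : list nat) : nat :=
  of_limbs w (map (regs s) idx).

(* [exec w c s s' t]: on words of [w] bits, [c] started in [s] halts in [s']
   after [t] unit-cost steps. *)
Inductive exec (w : nat) : cmd -> state -> state -> nat -> Prop :=
| exec_Skip s :
    exec w Skip s s 1
| exec_Const d v s :
    exec w (Const d v) s (set_reg s d (v mod 2 ^ w)) 1
| exec_Op d o r1 r2 s :
    exec w (Op d o r1 r2) s
      (set_reg s d (eval_op w o (regs s r1) (regs s r2))) 1
| exec_Read d k idx s :
    exec w (Read d k idx) s (set_reg s d (mem s k (index w s idx))) 1
| exec_Write k idx r s :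
    exec w (Write k idx r) s (set_mem s k (index w s idx) (regs s r)) 1
| exec_Seq c1 c2 s s1 s2 t1 t2 :
    exec w c1 s s1 t1 -> exec w c2 s1 s2 t2 ->
    exec w (Seq c1 c2) s s2 (t1 + t2)
| exec_If_true r c1 c2 s s1 t :
    regs s r <> 0 -> exec w c1 s s1 t -> exec w (If r c1 c2) s s1 (S t)
| exec_If_false r c1 c2 s s1 t :
    regs s r = 0 -> exec w c2 s s1 t -> exec w (If r c1 c2) s s1 (S t)
| exec_While_false r c s :
    regs s r = 0 -> exec w (While r c) s s 1
| exec_While_true r c s s1 s2 t1 t2 :
    regs s r <> 0 -> exec w c s s1 t1 -> exec w (While r c) s1 s2 t2 ->
    exec w (While r c) s s2 (S (t1 + t2)).

(* Arguments are passed in registers 0, 1, 2, and so on. *)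
Definition start (args : list nat) (m : memory) : state :=
  State (fun r => nth r args 0) m.

Definition result (k : nat) (s : state) : list nat := map (regs s) (seq 0 k).

(* Bit [j] of the bitmask is bit [j mod w] (0 = least significant) of word
   [j / w]; the padding bits of the last word are unconstrained. *)
Definition packed (w : nat) (a : nat -> nat) (B : list bool) : Prop :=
  forall j, j < length B -> Nat.testbit (a (j / w)) (j mod w) = nth j B false.

(** * Arrays used by the select structure *)

Definition TAB : nat := 0.   (* tables built by the preprocessing *)
Definition INP : nat := 1.   (* the packed input encoding *)
Definition OUT : nat := 2.   (* the data structure *)

(* Number of words that hold a number bounded by 2^(c*w). *)
Definition width (c : nat) : nat := S c.

(* The first [T] cells of the table array are the same in [m] and [m']. *)
Definition same_tables (T : nat) (m m' : memory) : Prop :=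
  forall a, a < T -> m' TAB a = m TAB a.

(* Outside array [k], and in the cells of array [k] lying entirely at or after
   its bit number [b], the memories [m] and [m'] are the same. *)
Definition writes_within_bits (w k : nat) (b : R) (m m' : memory) : Prop :=
  forall k' a, ~ (k' = k /\ (INR (a * w) < b)%R) -> m' k' a = m k' a.

(* [sel] answers select queries on [A] in at most [t] steps, without changing
   the memory, given only the tables and a packed copy of [D]. *)
Definition answers_select
    (w c T : nat) (mt : memory) (D A : list bool) (sel : cmd) (t : nat) : Prop :=
  forall (m : memory) (i : nat),
    word_memory w m -> same_tables T mt m -> packed w (m OUT) D ->
    1 <= i <= length (ones A) ->
    exists (s : state) (t' : nat),
      exec w sel (start (limbs w (width c) i) m) s t' /\
      t' <= t /\
      (forall k a, mem s k a = m k a) /\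
      result (width c) s = limbs w (width c) (select A i).

(* Main.v *)
Require Import Defs.
From Stdlib Require Import Reals Arith List Bool Lia Lra.
Import ListNotations.

(** Let b be a power of two with 4 b <= lg N < 8 b.  A decoder reads the encoding
    bit by bit; its state is a mode and a counter (the length of a unary part, or
    the number of bits of a binary part still to come).  A table indexed by a
    state with counter at most b and by a chunk of b bits gives the effect of the
    chunk: the new state, the gain in position, and the ones it produces.  While
    the counter is larger than b, no token starts inside a chunk, and subtracting
    e from the counter divides the gain by 2^e; so a chunk always costs one
    lookup.

    The structure stores, for each chunk that produces ones, its position, its
    state and bits, and the number of ones before it; and for each block of b
    consecutive ones, the set of those that are the first of their chunk and the
    number of such chunks before the block.  A population count then finds the
    chunk of a given one, and the table finds the one in its chunk.  All of this
    is O(|senc(A)| / b) numbers of O(b 2^e) bits, where a preliminary scan doubles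
    2^e whenever a counter exceeds 2 b 2^e.  A counter r means a zero run of
    length at least 2^r, so e = 0 or 2^(b 2^e) <= n, which bounds the space.

    Positions are below 2^(O(w)), so they occupy O(1) words, and arithmetic on
    numbers of O(1) words has constant overhead.  If w or N is bounded by a
    constant, then so is |senc(A)|, and decision trees on the bits of the encoding
    suffice. *)

(** * Bits and limbs *)

(** Four constraints shape the construction. The programs are fixed before [w] and [N], and [w] may
    exceed every function of [N]: even the logarithm of [w] cannot be found by counting within the
    time allowed. So the logarithm of the number of fields per word is searched only up to a bound
    O(lg N), at which all fields lie in the first word anyway. The length n is not an argument of
    the build program; the field width is therefore derived from the counters met while decoding,
    and positions are bounded through them. The query sees only the tables and D, while the layout
    of D depends on e; so e is kept in the lowest field, whose place is the same in every layout,
    and the lowest bit tells this structure from an encoding of at most b bits that is stored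
    verbatim. Whole chunks run past the end of the encoding into arbitrary padding, which is
    harmless because whatever is decoded there comes after the genuine ones. Sizes are powers of
    two, so that shifts replace multi-word multiplication and division. *)

Lemma testbit_small (x n p : nat) : x < 2 ^ n -> n <= p -> Nat.testbit x p = false.
Proof.
  intros Hx Hp. rewrite <- (Nat.mod_small x (2 ^ n)) by assumption.
  now apply Nat.mod_pow2_bits_high.
Qed.

Lemma lt_pow2_of_testbit (x n : nat) :
  (forall p, n <= p -> Nat.testbit x p = false) -> x < 2 ^ n.
Proof.
  intros H. enough (E : x = x mod 2 ^ n).
  { rewrite E. apply Nat.mod_upper_bound. now apply Nat.pow_nonzero. }
  apply Nat.bits_inj. intros p. destruct (Nat.lt_ge_cases p n).
  - now rewrite Nat.mod_pow2_bits_low.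
  - rewrite Nat.mod_pow2_bits_high by assumption. now apply H.
Qed.

Lemma testbit_concat (x y n p : nat) :
  x < 2 ^ n ->
  Nat.testbit (x + y * 2 ^ n) p =
    if p <? n then Nat.testbit x p else Nat.testbit y (p - n).
Proof.
  intros Hx. assert (Hn : 2 ^ n <> 0) by now apply Nat.pow_nonzero.
  destruct (Nat.ltb_spec p n).
  - rewrite <- (Nat.mod_pow2_bits_low (x + y * 2 ^ n) n p) by assumption.
    rewrite Nat.Div0.mod_add, Nat.mod_small; auto.
  - replace p with (p - n + n) at 1 by lia. rewrite <- Nat.div_pow2_bits.
    rewrite Nat.div_add, Nat.div_small; auto.
Qed.

Lemma pow2_pos (n : nat) : 0 < 2 ^ n.
Proof. apply Nat.neq_0_lt_0. now apply Nat.pow_nonzero. Qed.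

(** Unlike [of_limbs], the recursion splits off the most significant digit; this matches the loops
    over limbs, which append high limbs one at a time. *)
Fixpoint limbsum (w : nat) (g : nat -> nat) (n : nat) : nat :=
  match n with
  | 0 => 0
  | S n' => limbsum w g n' + g n' * 2 ^ (w * n')
  end.

Lemma limbsum_ext w g h n :
  (forall i, i < n -> g i = h i) -> limbsum w g n = limbsum w h n.
Proof.
  induction n; simpl; intros H; [reflexivity|].
  rewrite IHn, H; auto.
Qed.

Lemma limbsum_lt w g n :
  (forall i, i < n -> g i < 2 ^ w) -> limbsum w g n < 2 ^ (w * n).
Proof.
  induction n; simpl; intros H; [apply pow2_pos|].
  assert (A := IHn (fun i Hi => H i (Nat.lt_lt_succ_r _ _ Hi))).
  assert (B := H n (Nat.lt_succ_diag_r n)).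
  replace (w * S n) with (w + w * n) by lia. rewrite Nat.pow_add_r. nia.
Qed.

Lemma testbit_limbsum_S w g n p :
  (forall i, i < n -> g i < 2 ^ w) ->
  Nat.testbit (limbsum w g (S n)) p =
    if p <? w * n then Nat.testbit (limbsum w g n) p
    else Nat.testbit (g n) (p - w * n).
Proof. intros H. simpl. apply testbit_concat. now apply limbsum_lt. Qed.

Lemma testbit_limbsum w g n i p :
  (forall j, j < n -> g j < 2 ^ w) -> i < n -> p < w ->
  Nat.testbit (limbsum w g n) (w * i + p) = Nat.testbit (g i) p.
Proof.
  induction n; intros H Hi Hp; [lia|].
  rewrite testbit_limbsum_S by auto.
  destruct (Nat.ltb_spec (w * i + p) (w * n)).
  - apply IHn; auto. nia.
  - assert (i = n) by nia. subst. f_equal. lia.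
Qed.

Lemma testbit_limbsum_high w g n p :
  (forall j, j < n -> g j < 2 ^ w) -> w * n <= p ->
  Nat.testbit (limbsum w g n) p = false.
Proof. intros H Hp. apply testbit_small with (w * n); auto. now apply limbsum_lt. Qed.

Lemma limbsum_digits w n x :
  limbsum w (fun j => x / 2 ^ (w * j) mod 2 ^ w) n = x mod 2 ^ (w * n).
Proof.
  induction n; cbn [limbsum].
  - now rewrite Nat.mul_0_r, Nat.pow_0_r, Nat.mod_1_r.
  - rewrite IHn. replace (w * S n) with (w * n + w) by lia.
    rewrite Nat.pow_add_r, Nat.Div0.mod_mul_r. lia.
Qed.

Lemma limbsum_digit w g n j :
  (forall i, i < n -> g i < 2 ^ w) -> j < n ->
  limbsum w g n / 2 ^ (w * j) mod 2 ^ w = g j.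
Proof.
  intros H Hj. apply Nat.bits_inj. intros p.
  destruct (Nat.lt_ge_cases p w).
  - rewrite Nat.mod_pow2_bits_low, Nat.div_pow2_bits, Nat.add_comm by assumption.
    now apply testbit_limbsum.
  - rewrite Nat.mod_pow2_bits_high by assumption. symmetry.
    apply testbit_small with w; auto.
Qed.

Lemma of_limbs_limbsum w f a n :
  of_limbs w (map f (seq a n)) = limbsum w (fun j => f (a + j)) n.
Proof.
  assert (G : forall n a, limbsum w (fun j => f (a + j)) (S n)
              = f a + 2 ^ w * limbsum w (fun j => f (S a + j)) n).
  { clear. induction n; intros a; simpl.
    - rewrite Nat.add_0_r, Nat.mul_0_r. simpl. lia.
    - simpl in IHn. rewrite IHn. rewrite Nat.mul_add_distr_l, Nat.add_assoc. f_equal.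
      replace (w * S n) with (w + w * n) by lia. rewrite Nat.pow_add_r.
      replace (a + S n) with (S (a + n)) by lia. lia. }
  revert a. induction n; intros a; [reflexivity|].
  rewrite G. cbn [seq map of_limbs fold_right].
  fold (of_limbs w (map f (seq (S a) n))). now rewrite IHn.
Qed.

(** * Straight-line programs *)

(** A function in place of the relation [exec], so that the effect of straight-line code is found by
    reduction. The value on [While] is a default, excluded by [loopfree] wherever [run] is turned
    into an execution. *)
Fixpoint run (w : nat) (c : cmd) (s : state) : state :=
  match c with
  | Skip | While _ _ => s
  | Const d v => set_reg s d (v mod 2 ^ w)
  | Op d o r1 r2 => set_reg s d (eval_op w o (regs s r1) (regs s r2))
  | Read d k idx => set_reg s d (mem s k (index w s idx))
  | Write k idx r => set_mem s k (index w s idx) (regs s r)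
  | Seq c1 c2 => run w c2 (run w c1 s)
  | If r c1 c2 => if regs s r =? 0 then run w c2 s else run w c1 s
  end.

Fixpoint loopfree (c : cmd) : bool :=
  match c with
  | While _ _ => false
  | Seq c1 c2 | If _ c1 c2 => loopfree c1 && loopfree c2
  | _ => true
  end.

Fixpoint cost (c : cmd) : nat :=
  match c with
  | Seq c1 c2 => cost c1 + cost c2
  | If _ c1 c2 => S (Nat.max (cost c1) (cost c2))
  | _ => 1
  end.

Lemma run_exec w c s :
  loopfree c = true -> exists t, t <= cost c /\ exec w c s (run w c s) t.
Proof.
  revert s. induction c; intros s H; simpl in *;
    try (apply andb_prop in H; destruct H as [H1 H2]);
    try (exists 1; split; [lia | constructor]; fail); [| |discriminate].
  - destruct (IHc1 s H1) as (t1 & A1 & B1).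
    destruct (IHc2 (run w c1 s) H2) as (t2 & A2 & B2).
    exists (t1 + t2). split; [lia|]. econstructor; eauto.
  - destruct (Nat.eqb_spec (regs s r) 0).
    + destruct (IHc2 s H2) as (t2 & A2 & B2).
      exists (S t2). split; [lia|]. now constructor.
    + destruct (IHc1 s H1) as (t2 & A2 & B2).
      exists (S t2). split; [lia|]. now constructor.
Qed.

Definition word_state (w : nat) (s : state) : Prop :=
  (forall r, regs s r < 2 ^ w) /\ word_memory w (mem s).

Lemma eval_op_lt w o x y : 0 < w -> x < 2 ^ w -> y < 2 ^ w -> eval_op w o x y < 2 ^ w.
Proof.
  intros Hw Hx Hy. assert (P := pow2_pos w).
  assert (1 < 2 ^ w) by (apply Nat.pow_gt_1; lia).
  destruct o; simpl; try (apply Nat.mod_upper_bound; lia).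
  - destruct (Nat.eq_dec y 0) as [->|]; [simpl; lia|].
    apply Nat.le_lt_trans with x; auto. apply Nat.Div0.div_le_upper_bound. nia.
  - destruct (Nat.eq_dec y 0) as [->|]; [assumption|].
    apply Nat.lt_trans with y; auto. now apply Nat.mod_upper_bound.
  - apply lt_pow2_of_testbit. intros p Hp.
    now rewrite Nat.land_spec, (testbit_small x w).
  - apply lt_pow2_of_testbit. intros p Hp.
    now rewrite Nat.lor_spec, (testbit_small x w), (testbit_small y w).
  - apply lt_pow2_of_testbit. intros p Hp.
    now rewrite Nat.lxor_spec, (testbit_small x w), (testbit_small y w).
  - rewrite Nat.shiftr_div_pow2. apply Nat.le_lt_trans with x; auto.
    apply Nat.Div0.div_le_upper_bound. assert (Q := pow2_pos y). nia.
  - destruct (x <? y); simpl Nat.b2n; lia.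
  - destruct (x =? y); simpl Nat.b2n; lia.
Qed.

Lemma word_state_set_reg w s d v :
  word_state w s -> v < 2 ^ w -> word_state w (set_reg s d v).
Proof.
  intros [A B] H. split; simpl; auto. intros r. unfold upd. destruct (r =? d); auto.
Qed.

Lemma word_memory_upd w m k a v :
  word_memory w m -> v < 2 ^ w -> word_memory w (upd m k (upd (m k) a v)).
Proof.
  intros A H k' a'. unfold upd. destruct (Nat.eqb_spec k' k); auto.
  destruct (a' =? a); auto.
Qed.

Lemma run_word_state w c s : 0 < w -> word_state w s -> word_state w (run w c s).
Proof.
  intros Hw. revert s. induction c; intros s H; simpl; auto.
  - apply word_state_set_reg; auto. apply Nat.mod_upper_bound. now apply Nat.pow_nonzero.
  - apply word_state_set_reg; auto. apply eval_op_lt; auto; apply H.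
  - apply word_state_set_reg; auto. apply H.
  - destruct H as [A B]. split; simpl; auto. now apply word_memory_upd.
  - destruct (regs s r =? 0); auto.
Qed.

(** * Multi-word arithmetic *)

Module Limbs.

Lemma upd_eq {X : Type} (f : nat -> X) i v : upd f i v i = v.
Proof. unfold upd. now rewrite Nat.eqb_refl. Qed.

Lemma upd_neq {X : Type} (f : nat -> X) i v j : j <> i -> upd f i v j = f j.
Proof. intros H. unfold upd. now apply Nat.eqb_neq in H as ->. Qed.

Fixpoint for_cmd (n : nat) (f : nat -> cmd) : cmd :=
  match n with
  | 0 => Skip
  | S n' => Seq (for_cmd n' f) (f n')
  end.

Lemma run_seq w a b s : run w (Seq a b) s = run w b (run w a s).
Proof. reflexivity. Qed.

Lemma loopfree_for n f :
  (forall i, i < n -> loopfree (f i) = true) -> loopfree (for_cmd n f) = true.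
Proof.
  induction n; simpl; intros H; auto. rewrite IHn, H; auto.
Qed.

Lemma b2n_lor a b : Nat.lor (Nat.b2n a) (Nat.b2n b) = Nat.b2n (a || b).
Proof. now destruct a, b. Qed.

(** A sum is smaller than its summand exactly when it wrapped around. The two additions cannot both
    wrap: after the first wrap the partial sum is at most B - 2. So the disjunction of the two tests
    is the carry. *)
Lemma add_carry B x y c :
  1 < B -> x < B -> y < B -> c <= 1 ->
  let s := (x + y) mod B in
  let t := (s + c) mod B in
  let c' := Nat.lor (Nat.b2n (s <? x)) (Nat.b2n (t <? s)) in
  c' <= 1 /\ t + c' * B = x + y + c.
Proof.
  intros HB Hx Hy Hc s t c'. subst c'. rewrite b2n_lor.
  assert (Hs : s = x + y /\ x + y < B \/ s + B = x + y).
  { destruct (Nat.lt_ge_cases (x + y) B).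
    - left. split; auto. now apply Nat.mod_small.
    - right. unfold s. replace (x + y) with (x + y - B + 1 * B) at 1 by lia.
      rewrite Nat.Div0.mod_add, Nat.mod_small; lia. }
  assert (Hs' : s < B) by (apply Nat.mod_upper_bound; lia).
  clearbody s. assert (Ht : t = s + c /\ s + c < B \/ t + B = s + c).
  { destruct (Nat.lt_ge_cases (s + c) B).
    - left. split; auto. now apply Nat.mod_small.
    - right. unfold t. replace (s + c) with (s + c - B + 1 * B) at 1 by lia.
      rewrite Nat.Div0.mod_add, Nat.mod_small; lia. }
  clearbody t.
  destruct (Nat.ltb_spec s x), (Nat.ltb_spec t s); cbn [Nat.b2n orb]; lia.
Qed.

(** The second subtraction borrows only when the partial difference is 0, which it is not after a
    first borrow; so the disjunction of the two tests is the borrow. *)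
Lemma sub_borrow B x y c :
  x < B -> y < B -> c <= 1 ->
  let s := (x + B - y) mod B in
  let t := (s + B - c) mod B in
  let c' := Nat.lor (Nat.b2n (x <? y)) (Nat.b2n (s <? c)) in
  c' <= 1 /\ t + y + c = x + c' * B.
Proof.
  intros Hx Hy Hc s t c'. subst c'. rewrite b2n_lor.
  assert (Hs : y <= x /\ s + y = x \/ x < y /\ s + y = x + B).
  { unfold s. destruct (Nat.lt_ge_cases x y).
    - right. rewrite Nat.mod_small; lia.
    - left. replace (x + B - y) with (x - y + 1 * B) by lia.
      rewrite Nat.Div0.mod_add, Nat.mod_small; lia. }
  assert (Hs' : s < B) by (apply Nat.mod_upper_bound; lia).
  assert (Ht : c <= s /\ t + c = s \/ s < c /\ t + c = s + B).
  { unfold t. destruct (Nat.lt_ge_cases s c).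
    - right. rewrite Nat.mod_small; lia.
    - left. replace (s + B - c) with (s - c + 1 * B) by lia.
      rewrite Nat.Div0.mod_add, Nat.mod_small; lia. }
  clearbody t.
  destruct (Nat.ltb_spec x y), (Nat.ltb_spec s c); cbn [Nat.b2n orb]; lia.
Qed.

Section BigNumbers.
Context (w K : nat).
Context (HK : 8 <= K) (Hw : 4 * (K * w) + 4 * K < 2 ^ w).

(* Variable 0 sits in registers 0, ..., K-1, where arguments and results are
   passed; registers K, ..., 2K-1 are scratch, and register K holds w. *)
Definition slot (x : nat) : nat := match x with 0 => 0 | S _ => S x end.
Definition reg (x j : nat) : nat := j + K * slot x.
Definition scratch (n : nat) : nat := K + n.

Definition val (s : state) (x : nat) : nat :=
  limbsum w (fun j => regs s (reg x j)) K.

Lemma reg_neq x i y j : i < K -> j < K -> x <> y \/ i <> j -> reg x i <> reg y j.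
Proof.
  unfold reg. intros Hi Hj H E.
  assert (slot x = slot y) by nia.
  assert (x = y) by (destruct x, y; simpl in *; lia). subst. lia.
Qed.

Lemma reg_neq_scratch x i n : i < K -> n < K -> reg x i <> scratch n.
Proof.
  unfold reg, scratch. intros Hi Hn E. destruct x; simpl in E; nia.
Qed.

Lemma scratch_neq m n : m <> n -> scratch m <> scratch n.
Proof. unfold scratch. lia. Qed.

Ltac neq_regs :=
  match goal with
  | H : ?a <> ?b |- ?a <> ?b => exact H
  | |- reg _ _ <> reg _ _ => apply reg_neq; lia
  | |- reg _ _ <> scratch _ => apply reg_neq_scratch; lia
  | |- scratch _ <> reg _ _ => apply not_eq_sym, reg_neq_scratch; lia
  | |- scratch _ <> scratch _ => apply scratch_neq; lia
  | H : forall j, _ -> ?r <> reg _ j |- ?r <> reg _ _ => apply H; lia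
  | H : forall j, _ -> ?r <> scratch j |- ?r <> scratch _ => apply H; lia
  end.

Ltac simpl_regs :=
  cbn [run regs mem set_reg set_mem];
  repeat first [rewrite upd_eq | rewrite upd_neq by neq_regs].

(** Temporaries are allocated upwards from [d], so what an evaluation has to respect is the
    variables below [d], the memory, and the copy of the word width in scratch register 0. *)
Definition frame (d : nat) (s s' : state) : Prop :=
  mem s' = mem s /\ regs s' (scratch 0) = regs s (scratch 0) /\
  forall x j, x < d -> j < K -> regs s' (reg x j) = regs s (reg x j).

Lemma frame_refl d s : frame d s s.
Proof. repeat split; auto. Qed.

Lemma frame_trans d d' s1 s2 s3 : d <= d' -> frame d s1 s2 -> frame d' s2 s3 -> frame d s1 s3.
Proof.
  intros L (A & B & C) (A' & B' & C'). repeat split; try congruence.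
  intros x j Hx Hj. rewrite C', C; auto. lia.
Qed.

Lemma frame_val d s s' x : frame d s s' -> x < d -> val s' x = val s x.
Proof.
  intros (_ & _ & H) Hx. apply limbsum_ext. intros i Hi. now apply H.
Qed.

Lemma w_pos : 0 < w.
Proof. destruct w; simpl in Hw; lia. Qed.

Lemma val_lt s x : word_state w s -> val s x < 2 ^ (w * K).
Proof. intros [H _]. apply limbsum_lt. auto. Qed.

(** Finer than [frame]: the induction over a loop on limbs needs the limbs of [d] from [n] on to be
    still untouched. *)
Definition only (d n : nat) (s s' : state) : Prop :=
  mem s' = mem s /\
  forall r, (forall j, j < n -> r <> reg d j) -> (forall j, 1 <= j < 8 -> r <> scratch j) ->
  regs s' r = regs s r.

Lemma only_frame d n s s' : n <= K -> only d n s s' -> frame d s s'.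
Proof.
  intros Hn [A B]. repeat split; auto.
  - apply B; intros; neq_regs.
  - intros x j Hx Hj. apply B; intros; neq_regs.
Qed.

Definition add_limb (d b j : nat) : cmd :=
  Seq (Op (scratch 2) Defs.Add (reg d j) (reg b j))
  (Seq (Op (scratch 3) Lt (scratch 2) (reg d j))
  (Seq (Op (reg d j) Defs.Add (scratch 2) (scratch 1))
  (Seq (Op (scratch 4) Lt (reg d j) (scratch 2))
       (Op (scratch 1) Or (scratch 3) (scratch 4))))).

Definition add_big (d b : nat) : cmd :=
  Seq (Const (scratch 1) 0) (for_cmd K (add_limb d b)).

Definition sub_limb (d b j : nat) : cmd :=
  Seq (Op (scratch 2) Sub (reg d j) (reg b j))
  (Seq (Op (scratch 3) Lt (reg d j) (reg b j))
  (Seq (Op (reg d j) Sub (scratch 2) (scratch 1))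
  (Seq (Op (scratch 4) Lt (scratch 2) (scratch 1))
       (Op (scratch 1) Or (scratch 3) (scratch 4))))).

Definition sub_big (d b : nat) : cmd :=
  Seq (Const (scratch 1) 0) (for_cmd K (sub_limb d b)).

(** Limbs are compared from the least significant one, so that a strict difference at a later limb
    overrides the verdict so far, kept in scratch 1. On bits, [Lt] computes the conjunction of the
    second with the negation of the first. *)
Definition lt_limb (d b j : nat) : cmd :=
  Seq (Op (scratch 2) Lt (reg d j) (reg b j))
  (Seq (Op (scratch 3) Lt (reg b j) (reg d j))
  (Seq (Op (scratch 3) Lt (scratch 3) (scratch 1))
       (Op (scratch 1) Or (scratch 2) (scratch 3)))).

Definition small_big (d r : nat) : cmd :=
  Seq (Op (reg d 0) Or r r) (for_cmd (K - 1) (fun j => Const (reg d (S j)) 0)).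

Definition lt_big (d b : nat) : cmd :=
  Seq (Const (scratch 1) 0)
  (Seq (for_cmd K (lt_limb d b)) (small_big d (scratch 1))).

Definition copy_big (d x : nat) : cmd :=
  for_cmd K (fun j => Op (reg d j) Or (reg x j) (reg x j)).

Lemma run_add_limbs d b s n :
  d <> b -> word_state w s -> n <= K -> regs s (scratch 1) = 0 ->
  let s' := run w (for_cmd n (add_limb d b)) s in
  only d n s s' /\ regs s' (scratch 1) <= 1 /\
  limbsum w (fun j => regs s' (reg d j)) n + regs s' (scratch 1) * 2 ^ (w * n) =
  limbsum w (fun j => regs s (reg d j)) n + limbsum w (fun j => regs s (reg b j)) n.
Proof.
  intros Hdb Hs. induction n; intros Hn H1.
  - simpl. rewrite H1. repeat split; auto.
  - destruct IHn as (A & B & C); [lia|assumption|].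
    cbn [for_cmd run].
    set (s1 := run w (for_cmd n (add_limb d b)) s) in *.
    assert (W1 : word_state w s1) by (apply run_word_state; auto using w_pos).
    assert (Ed : regs s1 (reg d n) = regs s (reg d n)) by (apply A; intros; neq_regs).
    assert (Eb : regs s1 (reg b n) = regs s (reg b n)) by (apply A; intros; neq_regs).
    destruct (add_carry (2 ^ w) (regs s1 (reg d n)) (regs s1 (reg b n)) (regs s1 (scratch 1)))
      as (D & E); [lia | apply W1 | apply W1 | assumption |].
    split; [|split].
    + destruct A as [A1 A2]. split; [exact A1|]. intros r Hr1 Hr2.
      unfold add_limb. simpl_regs. apply A2; auto.
    + unfold add_limb. simpl_regs. exact D.
    + unfold add_limb. simpl_regs. cbn [limbsum].
      cbn [eval_op]. simpl_regs.
      rewrite (limbsum_ext w _ (fun j => regs s1 (reg d j))) by (intros; simpl_regs; reflexivity).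
      replace (w * S n) with (w + w * n) by lia. rewrite Nat.pow_add_r.
      simpl in D, E. rewrite Ed, Eb in *. nia.
Qed.

Lemma run_sub_limbs d b s n :
  d <> b -> word_state w s -> n <= K -> regs s (scratch 1) = 0 ->
  let s' := run w (for_cmd n (sub_limb d b)) s in
  only d n s s' /\ regs s' (scratch 1) <= 1 /\
  limbsum w (fun j => regs s' (reg d j)) n + limbsum w (fun j => regs s (reg b j)) n =
  limbsum w (fun j => regs s (reg d j)) n + regs s' (scratch 1) * 2 ^ (w * n).
Proof.
  intros Hdb Hs. induction n; intros Hn H1.
  - simpl. rewrite H1. repeat split; auto.
  - destruct IHn as (A & B & C); [lia|assumption|].
    cbn [for_cmd run].
    set (s1 := run w (for_cmd n (sub_limb d b)) s) in *.
    assert (W1 : word_state w s1) by (apply run_word_state; auto using w_pos).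
    assert (Ed : regs s1 (reg d n) = regs s (reg d n)) by (apply A; intros; neq_regs).
    assert (Eb : regs s1 (reg b n) = regs s (reg b n)) by (apply A; intros; neq_regs).
    destruct (sub_borrow (2 ^ w) (regs s1 (reg d n)) (regs s1 (reg b n)) (regs s1 (scratch 1)))
      as (D & E); [apply W1 | apply W1 | assumption |].
    split; [|split].
    + destruct A as [A1 A2]. split; [exact A1|]. intros r Hr1 Hr2.
      unfold sub_limb. simpl_regs. apply A2; auto.
    + unfold sub_limb. simpl_regs. exact D.
    + unfold sub_limb. simpl_regs. cbn [limbsum].
      cbn [eval_op]. simpl_regs.
      rewrite (limbsum_ext w _ (fun j => regs s1 (reg d j))) by (intros; simpl_regs; reflexivity).
      replace (w * S n) with (w + w * n) by lia. rewrite Nat.pow_add_r.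
      simpl in D, E. rewrite Ed, Eb in *. nia.
Qed.

Lemma run_lt_limbs d b s n :
  word_state w s -> n <= K -> regs s (scratch 1) = 0 ->
  let s' := run w (for_cmd n (lt_limb d b)) s in
  only d 0 s s' /\
  regs s' (scratch 1) =
  Nat.b2n (limbsum w (fun j => regs s (reg d j)) n <? limbsum w (fun j => regs s (reg b j)) n).
Proof.
  intros Hs. induction n; intros Hn H1.
  - simpl. repeat split; auto.
  - destruct IHn as (A & B); [lia|assumption|].
    cbn [for_cmd run].
    set (s1 := run w (for_cmd n (lt_limb d b)) s) in *.
    assert (Ed : regs s1 (reg d n) = regs s (reg d n)) by (apply A; intros; neq_regs).
    assert (Eb : regs s1 (reg b n) = regs s (reg b n)) by (apply A; intros; neq_regs).
    split.
    + destruct A as [A1 A2]. split; [exact A1|]. intros r Hr1 Hr2.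
      unfold lt_limb. simpl_regs. apply A2; auto.
    + unfold lt_limb. simpl_regs. cbn [limbsum eval_op]. rewrite B, Ed, Eb, b2n_lor.
      assert (L1 : limbsum w (fun j => regs s (reg d j)) n < 2 ^ (w * n))
        by (apply limbsum_lt; intros; apply Hs).
      assert (L2 : limbsum w (fun j => regs s (reg b j)) n < 2 ^ (w * n))
        by (apply limbsum_lt; intros; apply Hs).
      f_equal. apply eq_iff_eq_true. rewrite Bool.orb_true_iff, !Nat.ltb_lt.
      set (x := limbsum w (fun j => regs s (reg d j)) n) in *.
      set (y := limbsum w (fun j => regs s (reg b j)) n) in *.
      set (P := 2 ^ (w * n)) in *. clearbody x y P.
      destruct (Nat.ltb_spec (regs s (reg b n)) (regs s (reg d n)));
        destruct (Nat.ltb_spec x y); simpl; nia.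
Qed.

Lemma run_small_big d r s :
  word_state w s -> (forall j, j < K -> r <> reg d (S j)) ->
  let s' := run w (small_big d r) s in
  only d K s s' /\ val s' d = regs s r.
Proof.
  intros Hs Hr.
  assert (G : forall n s0, n <= K - 1 ->
    let s' := run w (for_cmd n (fun j => Const (reg d (S j)) 0)) s0 in
    only d K s0 s' /\ regs s' (reg d 0) = regs s0 (reg d 0) /\
    (forall j, j < n -> regs s' (reg d (S j)) = 0)).
  { induction n; intros s0 Hn.
    - simpl. repeat split; intros; lia.
    - destruct (IHn s0) as ((A1 & A2) & B & C); [lia|]. cbn [for_cmd run].
      set (s1 := run w (for_cmd n _) s0) in *.
      rewrite Nat.Div0.mod_0_l.
      repeat split.
      + exact A1.
      + intros r0 H1 H2. simpl_regs. auto.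
      + simpl_regs. assumption.
      + intros j Hj. destruct (Nat.eq_dec j n) as [->|]; simpl_regs; auto.
        apply C. lia. }
  cbn [small_big run]. set (s1 := set_reg s _ _).
  destruct (G (K - 1) s1) as ((A1 & A2) & B & C); [lia|].
  set (s' := run w _ s1) in *.
  repeat split.
  - rewrite A1. reflexivity.
  - intros r0 H1 H2. rewrite A2 by auto. unfold s1. simpl_regs. reflexivity.
  - unfold val. replace K with (S (K - 1)) by lia.
    assert (Z : forall n, n <= K - 1 ->
       limbsum w (fun j => regs s' (reg d j)) (S n) = regs s' (reg d 0)).
    { induction n; intros Hn; [simpl; rewrite Nat.mul_0_r; simpl; lia|].
      cbn [limbsum] in *. rewrite C by lia. rewrite IHn by lia. lia. }
    rewrite Z by lia. rewrite B. unfold s1. simpl_regs.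
    cbn [eval_op]. apply Nat.lor_diag.
Qed.

Lemma run_copy_big d x s :
  d <> x ->
  let s' := run w (copy_big d x) s in
  only d K s s' /\ val s' d = val s x.
Proof.
  intros Hd.
  assert (G : forall n, n <= K ->
    let s' := run w (for_cmd n (fun j => Op (reg d j) Or (reg x j) (reg x j))) s in
    only d n s s' /\ (forall j, j < n -> regs s' (reg d j) = regs s (reg x j))).
  { induction n; intros Hn; [repeat split; intros; lia|].
    destruct IHn as ((A & B) & C); [lia|]. cbn [for_cmd run].
    set (s1 := run w (for_cmd n _) s) in *. cbn [eval_op]. rewrite Nat.lor_diag.
    repeat split.
    - exact A.
    - intros r H1 H2. simpl_regs. apply B; auto.
    - intros j Hj. destruct (Nat.eq_dec j n) as [->|].
      + simpl_regs. apply B; intros; neq_regs.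
      + simpl_regs. apply C. lia. }
  destruct (G K) as (A & B); [lia|]. split; [exact A|].
  apply limbsum_ext. exact B.
Qed.

Lemma run_const_scratch s :
  let s' := run w (Const (scratch 1) 0) s in
  only 0 0 s s' /\ regs s' (scratch 1) = 0.
Proof.
  cbn [run]. rewrite Nat.Div0.mod_0_l. repeat split.
  - intros r _ H. simpl_regs. reflexivity.
  - simpl_regs. reflexivity.
Qed.

Lemma only_trans d n m s1 s2 s3 : only d n s1 s2 -> only d m s2 s3 -> n <= K -> m <= K -> only d K s1 s3.
Proof.
  intros [A B] [A' B'] Hn Hm. split; [congruence|].
  intros r H1 H2. rewrite B', B; auto; intros; apply H1; lia.
Qed.

Lemma only_0 d d' s s' : only d 0 s s' -> only d' 0 s s'.
Proof. intros [A B]. split; auto. intros r _ H. apply B; auto; intros; lia. Qed.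

Lemma only_val d n s s' x : n <= K -> only d n s s' -> x <> d -> val s' x = val s x.
Proof. intros Hn [_ B] Hx. apply limbsum_ext. intros i Hi. apply B; intros; neq_regs. Qed.

Lemma only_0_val s s' d x : only d 0 s s' -> val s' x = val s x.
Proof. intros [_ B]. apply limbsum_ext. intros i Hi. apply B; intros; try lia; neq_regs. Qed.

Lemma run_add_big d b s :
  d <> b -> word_state w s -> val s d + val s b < 2 ^ (w * K) ->
  let s' := run w (add_big d b) s in
  only d K s s' /\ val s' d = val s d + val s b.
Proof.
  intros Hd Hs Hlt. cbv zeta. unfold add_big. rewrite !run_seq.
  destruct (run_const_scratch s) as (A & B). set (s1 := run w (Const _ 0) s) in *.
  assert (W1 : word_state w s1) by (apply run_word_state; auto using w_pos).
  destruct (run_add_limbs d b s1 K Hd W1) as (C & D & E); auto.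
  set (s2 := run w (for_cmd K _) s1) in *.
  split; [apply (only_trans d 0 K s s1); [apply only_0 with 0; exact A|exact C|lia|lia]|].
  change (val s2 d + regs s2 (scratch 1) * 2 ^ (w * K) = val s1 d + val s1 b) in E.
  rewrite !(only_0_val s s1 0) in E by assumption.
  destruct (regs s2 (scratch 1)) as [|[|]]; lia.
Qed.

Lemma run_sub_big d b s :
  d <> b -> word_state w s -> val s b <= val s d ->
  let s' := run w (sub_big d b) s in
  only d K s s' /\ val s' d = val s d - val s b.
Proof.
  intros Hd Hs Hlt. cbv zeta. unfold sub_big. rewrite !run_seq.
  destruct (run_const_scratch s) as (A & B). set (s1 := run w (Const _ 0) s) in *.
  assert (W1 : word_state w s1) by (apply run_word_state; auto using w_pos).
  destruct (run_sub_limbs d b s1 K Hd W1) as (C & D & E); auto.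
  set (s2 := run w (for_cmd K _) s1) in *.
  split; [apply (only_trans d 0 K s s1); [apply only_0 with 0; exact A|exact C|lia|lia]|].
  assert (L : val s2 d < 2 ^ (w * K)) by (apply val_lt, run_word_state; auto using w_pos).
  change (val s2 d + val s1 b = val s1 d + regs s2 (scratch 1) * 2 ^ (w * K)) in E.
  rewrite !(only_0_val s s1 0) in E by assumption.
  destruct (regs s2 (scratch 1)) as [|[|]]; lia.
Qed.

Lemma run_lt_big d b s :
  word_state w s ->
  let s' := run w (lt_big d b) s in
  only d K s s' /\ val s' d = Nat.b2n (val s d <? val s b).
Proof.
  intros Hs. cbv zeta. unfold lt_big. rewrite !run_seq.
  destruct (run_const_scratch s) as (A & B). set (s1 := run w (Const _ 0) s) in *.
  assert (W1 : word_state w s1) by (apply run_word_state; auto using w_pos).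
  destruct (run_lt_limbs d b s1 K W1) as (C & D); auto.
  set (s2 := run w (for_cmd K _) s1) in *.
  assert (W2 : word_state w s2) by (apply run_word_state; auto using w_pos).
  destruct (run_small_big d (scratch 1) s2 W2) as (E & F); [intros; unfold scratch, reg; destruct d; simpl; nia|].
  split.
  - apply (only_trans d K K s s2); [|exact E|lia|lia].
    apply (only_trans d 0 0 s s1); [apply only_0 with 0; exact A|exact C|lia|lia].
  - rewrite F, D. change (limbsum w (fun j => regs s1 (reg d j)) K) with (val s1 d).
    change (limbsum w (fun j => regs s1 (reg b j)) K) with (val s1 b).
    now rewrite !(only_0_val s s1 0).
Qed.

(* Adds to the limb [i] of [d] the contribution of the limb [j] of [a] to
   [a * 2^x] ([left = true]) or [a / 2^x], where [x] is the value of [amt]. *)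
Definition shift_limb (left : bool) (d a amt i j : nat) : cmd :=
  Seq (Const (scratch 2) j)
  (Seq (Op (scratch 2) Mul (scratch 2) (scratch 0))
  (Seq (Const (scratch 3) i)
  (Seq (Op (scratch 3) Mul (scratch 3) (scratch 0))
  (Seq (if left then Op (scratch 2) Defs.Add (scratch 2) (reg amt 0)
        else Op (scratch 3) Defs.Add (scratch 3) (reg amt 0))
  (Seq (Op (scratch 4) Lt (scratch 2) (scratch 3))
  (Seq (If (scratch 4)
          (Seq (Op (scratch 3) Sub (scratch 3) (scratch 2))
               (Op (scratch 3) Shr (reg a j) (scratch 3)))
          (Seq (Op (scratch 3) Sub (scratch 2) (scratch 3))
               (Op (scratch 3) Shl (reg a j) (scratch 3))))
       (Op (reg d i) Or (reg d i) (scratch 3)))))))).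

(** Every source limb is shifted towards every target limb, at a cost quadratic in the constant [K].
    Pairs that do not overlap contribute 0, since a word shifted by [w] or more vanishes; hence no
    case distinction on the amount. *)
Definition shift_big (left : bool) (d a amt : nat) : cmd :=
  for_cmd K (fun i => Seq (Const (reg d i) 0) (for_cmd K (shift_limb left d a amt i))).

(** With the shift charged to one side, the source limb starts at bit [u] and the target limb at bit
    [v] of a common axis, so the word moves by the difference. The bound [Hw] makes [u] and [v] fit
    into single registers. *)
Lemma run_shift_limb (left : bool) d a amt s i j :
  word_state w s -> d <> a -> d <> amt -> i < K -> j < K ->
  regs s (scratch 0) = w -> regs s (reg amt 0) <= w * K ->
  let x := regs s (reg amt 0) in
  let u := w * j + (if left then x else 0) in
  let v := w * i + (if left then 0 else x) in
  let s' := run w (shift_limb left d a amt i j) s in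
  mem s' = mem s /\
  (forall r, r <> reg d i -> (forall j, 1 <= j < 8 -> r <> scratch j) -> regs s' r = regs s r) /\
  (forall p, Nat.testbit (regs s' (reg d i)) p =
     Nat.testbit (regs s (reg d i)) p ||
     ((p <? w) && (u <=? p + v) && Nat.testbit (regs s (reg a j)) (p + v - u))).
Proof.
  intros Hs Hda Hdm Hi Hj Hw0 Hx x u v.
  assert (Bj : w * j <= K * w) by nia. assert (Bi : w * i <= K * w) by nia.
  assert (Ej : (j mod 2 ^ w * w) mod 2 ^ w = w * j).
  { rewrite (Nat.mod_small j), Nat.mod_small by lia. lia. }
  assert (Ei : (i mod 2 ^ w * w) mod 2 ^ w = w * i).
  { rewrite (Nat.mod_small i), Nat.mod_small by lia. lia. }
  pose (c5 := if left then Op (scratch 2) Defs.Add (scratch 2) (reg amt 0)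
              else Op (scratch 3) Defs.Add (scratch 3) (reg amt 0)).
  set (s4 := run w (Op (scratch 3) Mul (scratch 3) (scratch 0))
     (run w (Const (scratch 3) i) (run w (Op (scratch 2) Mul (scratch 2) (scratch 0))
       (run w (Const (scratch 2) j) s)))).
  assert (A4 : mem s4 = mem s /\ (forall r, (forall j, 1 <= j < 8 -> r <> scratch j) -> regs s4 r = regs s r)
     /\ regs s4 (scratch 2) = w * j /\ regs s4 (scratch 3) = w * i).
  { unfold s4. repeat split.
    - intros r H. simpl_regs. reflexivity.
    - simpl_regs. cbn [eval_op]. simpl_regs. now rewrite Hw0.
    - simpl_regs. cbn [eval_op]. simpl_regs. now rewrite Hw0. }
  set (s5 := run w c5 s4).
  assert (A5 : mem s5 = mem s /\ (forall r, (forall j, 1 <= j < 8 -> r <> scratch j) -> regs s5 r = regs s r)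
     /\ regs s5 (scratch 2) = u /\ regs s5 (scratch 3) = v).
  { destruct A4 as (A & B & C & D).
    assert (Ex : regs s4 (reg amt 0) = x) by (apply B; intros; neq_regs).
    assert (Hx' : x <= K * w) by (unfold x; lia).
    unfold s5, c5, u, v. destruct left; repeat split; auto.
    - intros r H. simpl_regs. now apply B.
    - simpl_regs. cbn [eval_op]. rewrite Ex, C. apply Nat.mod_small. lia.
    - simpl_regs. lia.
    - intros r H. simpl_regs. now apply B.
    - simpl_regs. lia.
    - simpl_regs. cbn [eval_op]. rewrite Ex, D. apply Nat.mod_small. lia. }
  assert (Hu : u < 2 ^ w) by (unfold u, x; destruct left; lia).
  assert (Hv : v < 2 ^ w) by (unfold v, x; destruct left; lia).
  change (run w (shift_limb left d a amt i j) s) with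
    (run w (Seq (Op (scratch 4) Lt (scratch 2) (scratch 3))
       (Seq (If (scratch 4)
          (Seq (Op (scratch 3) Sub (scratch 3) (scratch 2))
               (Op (scratch 3) Shr (reg a j) (scratch 3)))
          (Seq (Op (scratch 3) Sub (scratch 2) (scratch 3))
               (Op (scratch 3) Shl (reg a j) (scratch 3))))
       (Op (reg d i) Or (reg d i) (scratch 3)))) s5).
  destruct A5 as (A & B & C & D).
  assert (Ea : regs s5 (reg a j) = regs s (reg a j)) by (apply B; intros; neq_regs).
  assert (Ed : regs s5 (reg d i) = regs s (reg d i)) by (apply B; intros; neq_regs).
  clearbody s5 u v. clear A4 s4.
  cbn [run regs set_reg]. rewrite upd_eq. cbn [eval_op]. rewrite C, D.
  destruct (Nat.ltb_spec u v) as [Hlt|Hlt]; cbn [Nat.b2n Nat.eqb].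
  - repeat split.
    + exact A.
    + intros r H1 H2. simpl_regs. apply B; auto.
    + intros p. simpl_regs. rewrite C, D, Ea, Ed.
      rewrite Nat.lor_spec. f_equal.
      replace (v + 2 ^ w - u) with (v - u + 1 * 2 ^ w) by lia.
      rewrite Nat.Div0.mod_add, (Nat.mod_small (v - u)) by lia.
      rewrite Nat.shiftr_spec by lia.
      replace (p + (v - u)) with (p + v - u) by lia.
      destruct (Nat.leb_spec u (p + v)); [|lia]. rewrite andb_true_r.
      destruct (Nat.ltb_spec p w); simpl; auto.
      apply testbit_small with w; [apply Hs|lia].
  - repeat split.
    + exact A.
    + intros r H1 H2. simpl_regs. apply B; auto.
    + intros p. simpl_regs. rewrite C, D, Ea, Ed.
      rewrite Nat.lor_spec. f_equal.
      replace (u + 2 ^ w - v) with (u - v + 1 * 2 ^ w) by lia.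
      rewrite Nat.Div0.mod_add, (Nat.mod_small (u - v)) by lia.
      destruct (Nat.ltb_spec p w); simpl.
      * rewrite Nat.mod_pow2_bits_low by lia.
        destruct (Nat.leb_spec u (p + v)); simpl.
        -- rewrite Nat.shiftl_spec_high by lia. f_equal. lia.
        -- apply Nat.shiftl_spec_low. lia.
      * apply Nat.mod_pow2_bits_high. lia.
Qed.

Lemma run_shift_limbs (left : bool) d a amt s i n :
  word_state w s -> d <> a -> d <> amt -> i < K -> n <= K ->
  regs s (scratch 0) = w -> regs s (reg amt 0) <= w * K -> regs s (reg d i) = 0 ->
  let x := regs s (reg amt 0) in
  let u := if left then x else 0 in
  let v := w * i + (if left then 0 else x) in
  let s' := run w (for_cmd n (shift_limb left d a amt i)) s in
  mem s' = mem s /\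
  (forall r, r <> reg d i -> (forall j, 1 <= j < 8 -> r <> scratch j) -> regs s' r = regs s r) /\
  (forall p, Nat.testbit (regs s' (reg d i)) p =
     (p <? w) && (u <=? p + v) && Nat.testbit (limbsum w (fun j => regs s (reg a j)) n) (p + v - u)).
Proof.
  intros Hs Hda Hdm Hi. induction n; intros Hn Hw0 Hx Hz x u v.
  - simpl. rewrite Hz. repeat split; auto. intros p.
    now rewrite !Nat.bits_0, andb_false_r.
  - destruct IHn as (A & B & C); [lia|assumption..|]. cbn [for_cmd run].
    set (s1 := run w (for_cmd n _) s) in *.
    assert (W1 : word_state w s1) by (apply run_word_state; auto using w_pos).
    assert (E0 : regs s1 (scratch 0) = w).
    { rewrite B; auto; intros; try neq_regs. }
    assert (Ex : regs s1 (reg amt 0) = x).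
    { apply B; intros; try neq_regs. }
    assert (Ea : regs s1 (reg a n) = regs s (reg a n)).
    { apply B; intros; try neq_regs. }
    destruct (run_shift_limb left d a amt s1 i n) as (A' & B' & C'); auto; try lia.
    set (s2 := run w (shift_limb left d a amt i n) s1) in *.
    repeat split.
    + congruence.
    + intros r H1 H2. rewrite B', B; auto.
    + intros p. rewrite C', C, Ex, Ea.
      rewrite (testbit_limbsum_S w (fun j => regs s (reg a j)))
        by (intros; apply Hs).
      fold x u v. replace (w * n + (if left then x else 0)) with (w * n + u)
        by (unfold u; destruct left; lia).
      change (w * i + (if left then 0 else x)) with v.
      destruct (Nat.ltb_spec p w); simpl; auto.
      destruct (Nat.leb_spec u (p + v)); simpl.
      * destruct (Nat.ltb_spec (p + v - u) (w * n)).
        -- destruct (Nat.leb_spec (w * n + u) (p + v)); [lia|].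
           simpl. apply orb_false_r.
        -- rewrite testbit_limbsum_high by (auto; intros; apply Hs).
           destruct (Nat.leb_spec (w * n + u) (p + v)); [|lia].
           simpl. f_equal. lia.
      * destruct (Nat.leb_spec (w * n + u) (p + v)); [lia|reflexivity].
Qed.

Lemma run_shift_big (left : bool) d a amt s :
  word_state w s -> d <> a -> d <> amt ->
  regs s (scratch 0) = w -> val s amt <= w * K ->
  let x := val s amt in
  (left = true -> val s a * 2 ^ x < 2 ^ (w * K)) ->
  let s' := run w (shift_big left d a amt) s in
  only d K s s' /\ val s' d = if left then val s a * 2 ^ x else val s a / 2 ^ x.
Proof.
  intros Hs Hda Hdm Hw0 Hx x Hlt.
  (* The amount is at most w K, which is below 2^w, so its lowest limb is all of it. *)
  assert (E0 : x = regs s (reg amt 0)).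
  { unfold x. assert (D := limbsum_digit w (fun j => regs s (reg amt j)) K 0).
    rewrite Nat.mul_0_r, Nat.pow_0_r, Nat.div_1_r in D.
    rewrite <- D; [|intros; apply Hs|lia]. symmetry. apply Nat.mod_small. fold (val s amt). lia. }
  set (u := if left then x else 0). set (v := if left then 0 else x).
  assert (G : forall n, n <= K ->
    let s' := run w (for_cmd n (fun i => Seq (Const (reg d i) 0)
                  (for_cmd K (shift_limb left d a amt i)))) s in
    only d n s s' /\ forall i p, i < n -> Nat.testbit (regs s' (reg d i)) p =
       (p <? w) && (u <=? w * i + p + v) && Nat.testbit (val s a) (w * i + p + v - u)).
  { induction n; intros Hn; [repeat split; intros; lia|].
    destruct IHn as ((A & B) & C); [lia|]. cbn [for_cmd run].
    set (s1 := run w (for_cmd n _) s) in *.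
    rewrite Nat.Div0.mod_0_l. set (s2 := set_reg s1 (reg d n) 0).
    assert (W2 : word_state w s2).
    { apply word_state_set_reg; [|apply pow2_pos]. apply run_word_state; auto using w_pos. }
    assert (B2 : forall r, (forall j, j < S n -> r <> reg d j) ->
       (forall j, 1 <= j < 8 -> r <> scratch j) -> regs s2 r = regs s r).
    { intros r H1 H2. unfold s2. simpl_regs. apply B; auto. }
    assert (Em : regs s2 (reg amt 0) = x).
    { rewrite E0. apply B2; intros; neq_regs. }
    destruct (run_shift_limbs left d a amt s2 n K) as (A' & B' & C'); auto.
    { rewrite B2; auto; intros; neq_regs. }
    { rewrite Em. exact Hx. }
    { unfold s2. simpl_regs. reflexivity. }
    set (s3 := run w (for_cmd K _) s2) in *.
    repeat split.
    - rewrite A'. exact A.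
    - intros r H1 H2. rewrite B', B2; auto.
    - intros i p Hi. destruct (Nat.eq_dec i n) as [->|].
      + rewrite C', Em.
        rewrite (limbsum_ext w _ (fun j => regs s (reg a j)))
          by (intros; apply B2; intros; neq_regs).
        change (limbsum w (fun j => regs s (reg a j)) K) with (val s a).
        fold u. replace (p + (w * n + (if left then 0 else x))) with (w * n + p + v)
          by (unfold v; lia).
        reflexivity.
      + rewrite B' by (intros; neq_regs). unfold s2. simpl_regs. apply C. lia. }
  destruct (G K) as (A & B); [lia|]. fold (shift_big left d a amt) in A, B.
  set (s' := run w (shift_big left d a amt) s) in *.
  assert (W' : word_state w s') by (apply run_word_state; auto using w_pos).
  split; [exact A|]. apply Nat.bits_inj. intros q.
  assert (P := w_pos).
  destruct (Nat.lt_ge_cases q (w * K)) as [Hq|Hq].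
  - rewrite (Nat.div_mod q w) by lia.
    assert (Hi : q / w < K) by (apply Nat.Div0.div_lt_upper_bound; lia).
    assert (Hp : q mod w < w) by (apply Nat.mod_upper_bound; lia).
    unfold val at 1. rewrite testbit_limbsum; auto; [|intros; apply W'].
    rewrite B by assumption. destruct (Nat.ltb_spec (q mod w) w); [|lia].
    rewrite <- (Nat.div_mod q w) by lia. cbn [andb]. unfold u, v. destruct left.
    + rewrite Nat.add_0_r. destruct (Nat.leb_spec x q); simpl.
      * now rewrite Nat.mul_pow2_bits_high.
      * now rewrite Nat.mul_pow2_bits_low.
    + rewrite Nat.sub_0_r, Nat.div_pow2_bits. reflexivity.
  - rewrite (testbit_small (val s' d) (w * K)) by (auto using val_lt).
    symmetry. destruct left.
    + apply testbit_small with (w * K); auto.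
    + rewrite Nat.div_pow2_bits. apply testbit_small with (w * K); [now apply val_lt|lia].
Qed.

End BigNumbers.

End Limbs.
Import Limbs.

(** * A language over big numbers *)

(** No multiplication, division or bitwise operation: block lengths, field widths and strides are
    powers of two, so shifts, sums and differences suffice. *)
Inductive expr : Type :=
| EVar (x : nat)
| ECst (n : nat)
| EAdd (a b : expr)
| ESub (a b : expr)
| EShl (a b : expr)
| EShr (a b : expr)
| ELt (a b : expr)
| ERd (k : nat) (a : expr).

Inductive hcmd : Type :=
| HSkip
| HSet (x : nat) (e : expr)
| HWrite (k : nat) (a v : expr)
| HSeq (c1 c2 : hcmd)
| HIf (e : expr) (c1 c2 : hcmd)
| HWhile (e : expr) (c : hcmd).

Fixpoint ev (s : state) (e : expr) : nat :=
  match e with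
  | EVar x => regs s x
  | ECst n => n
  | EAdd a b => ev s a + ev s b
  | ESub a b => ev s a - ev s b
  | EShl a b => ev s a * 2 ^ ev s b
  | EShr a b => ev s a / 2 ^ ev s b
  | ELt a b => Nat.b2n (ev s a <? ev s b)
  | ERd k a => mem s k (ev s a)
  end.

Fixpoint evars (e : expr) : nat :=
  match e with
  | EVar x => S x
  | ECst _ => 0
  | EAdd a b | ESub a b | EShl a b | EShr a b | ELt a b => Nat.max (evars a) (evars b)
  | ERd _ a => evars a
  end.

Fixpoint hvars (c : hcmd) : nat :=
  match c with
  | HSkip => 0
  | HSet x e => Nat.max (S x) (evars e)
  | HWrite _ a v => Nat.max (evars a) (evars v)
  | HSeq c1 c2 => Nat.max (hvars c1) (hvars c2)
  | HIf e c1 c2 => Nat.max (evars e) (Nat.max (hvars c1) (hvars c2))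
  | HWhile e c => Nat.max (evars e) (hvars c)
  end.

Definition lowbits (e k : expr) : expr := ESub e (EShl (EShr e k) k).

Lemma ev_lowbits s e k : ev s (lowbits e k) = ev s e mod 2 ^ ev s k.
Proof.
  cbn [lowbits ev]. assert (A := Nat.div_mod_eq (ev s e) (2 ^ ev s k)). lia.
Qed.

Section Compile.
Context (w K : nat).

(* [ev] computes with unbounded naturals; it agrees with K-word arithmetic when
   no operation over- or underflows. *)
Fixpoint safe (s : state) (e : expr) : Prop :=
  match e with
  | EVar _ => True
  | ECst n => n < 2 ^ w
  | EAdd a b => safe s a /\ safe s b /\ ev s a + ev s b < 2 ^ (w * K)
  | ESub a b => safe s a /\ safe s b /\ ev s b <= ev s a
  | EShl a b => safe s a /\ safe s b /\ ev s a * 2 ^ ev s b < 2 ^ (w * K) /\ ev s b <= w * K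
  | EShr a b => safe s a /\ safe s b /\ ev s b <= w * K
  | ELt a b => safe s a /\ safe s b
  | ERd _ a => safe s a
  end.

(** Guards and values written to memory must fit into one word, because the compiled code takes them
    from the lowest limb alone. *)
Inductive hexec : hcmd -> state -> state -> nat -> Prop :=
| hexec_Skip s : hexec HSkip s s 1
| hexec_Set x e s : safe s e -> hexec (HSet x e) s (set_reg s x (ev s e)) 1
| hexec_Write k a v s :
    safe s a -> safe s v -> ev s v < 2 ^ w ->
    hexec (HWrite k a v) s (set_mem s k (ev s a) (ev s v)) 1
| hexec_Seq c1 c2 s s1 s2 t1 t2 :
    hexec c1 s s1 t1 -> hexec c2 s1 s2 t2 -> hexec (HSeq c1 c2) s s2 (t1 + t2)
| hexec_If_true e c1 c2 s s1 t :
    safe s e -> 0 < ev s e < 2 ^ w -> hexec c1 s s1 t -> hexec (HIf e c1 c2) s s1 (S t)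
| hexec_If_false e c1 c2 s s1 t :
    safe s e -> ev s e = 0 -> hexec c2 s s1 t -> hexec (HIf e c1 c2) s s1 (S t)
| hexec_While_false e c s : safe s e -> ev s e = 0 -> hexec (HWhile e c) s s 1
| hexec_While_true e c s s1 s2 t1 t2 :
    safe s e -> 0 < ev s e < 2 ^ w -> hexec c s s1 t1 -> hexec (HWhile e c) s1 s2 t2 ->
    hexec (HWhile e c) s s2 (S (t1 + t2)).

Notation reg := (reg K).
Notation scratch := (scratch K).

(** Variables from [d] on act as an evaluation stack. For shifts the operands go to [S d] and
    [S (S d)], since [shift_big] accumulates its result in a variable distinct from its source. *)
Fixpoint compile_expr (e : expr) (d : nat) : cmd :=
  match e with
  | EVar x => copy_big K d x
  | ECst n => Seq (Const (scratch 1) n) (small_big K d (scratch 1))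
  | EAdd a b => Seq (compile_expr a d) (Seq (compile_expr b (S d)) (add_big K d (S d)))
  | ESub a b => Seq (compile_expr a d) (Seq (compile_expr b (S d)) (sub_big K d (S d)))
  | ELt a b => Seq (compile_expr a d) (Seq (compile_expr b (S d)) (lt_big K d (S d)))
  | EShl a b => Seq (compile_expr a (S d))
      (Seq (compile_expr b (S (S d))) (shift_big K true d (S d) (S (S d))))
  | EShr a b => Seq (compile_expr a (S d))
      (Seq (compile_expr b (S (S d))) (shift_big K false d (S d) (S (S d))))
  | ERd k a => Seq (compile_expr a d)
      (Seq (Read (scratch 1) k (map (reg d) (seq 0 K))) (small_big K d (scratch 1)))
  end.

(* Variables from [B] on are temporaries. *)
Fixpoint compile (B : nat) (c : hcmd) : cmd :=
  match c with
  | HSkip => Skip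
  | HSet x e => Seq (compile_expr e B) (copy_big K x B)
  | HWrite k a v => Seq (compile_expr a B) (Seq (compile_expr v (S B))
      (Write k (map (reg B) (seq 0 K)) (reg (S B) 0)))
  | HSeq c1 c2 => Seq (compile B c1) (compile B c2)
  | HIf e c1 c2 => Seq (compile_expr e B) (If (reg B 0) (compile B c1) (compile B c2))
  | HWhile e c => Seq (compile_expr e B)
      (While (reg B 0) (Seq (compile B c) (compile_expr e B)))
  end.

(** A factor and not a running time: it bounds the machine steps spent per unit of [hexec] time.
    Hence a maximum at a sequence, and no iteration count at a loop. *)
Fixpoint hcost (B : nat) (c : hcmd) : nat :=
  match c with
  | HSkip | HSet _ _ | HWrite _ _ _ => cost (compile B c)
  | HSeq c1 c2 => Nat.max (hcost B c1) (hcost B c2)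
  | HIf e c1 c2 => S (cost (compile_expr e B)) + Nat.max (hcost B c1) (hcost B c2)
  | HWhile e c => S (cost (compile_expr e B)) + hcost B c
  end.

(** Both are of type [state], but a register of [s] holds a whole number and a register of [S] only
    one limb. *)
Definition represents (d : nat) (s S : state) : Prop :=
  word_state w S /\ regs S (scratch 0) = w /\ mem S = mem s /\
  forall x, x < d -> val w K S x = regs s x.

Lemma loopfree_seq a b : loopfree (Seq a b) = loopfree a && loopfree b.
Proof. reflexivity. Qed.

Lemma loopfree_small d r : loopfree (small_big K d r) = true.
Proof.
  unfold small_big. rewrite loopfree_seq. now apply loopfree_for.
Qed.

Lemma loopfree_copy d x : loopfree (copy_big K d x) = true.
Proof. now apply loopfree_for. Qed.

Lemma loopfree_add d b : loopfree (add_big K d b) = true.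
Proof. unfold add_big. rewrite loopfree_seq. now apply loopfree_for. Qed.

Lemma loopfree_sub d b : loopfree (sub_big K d b) = true.
Proof. unfold sub_big. rewrite loopfree_seq. now apply loopfree_for. Qed.

Lemma loopfree_lt d b : loopfree (lt_big K d b) = true.
Proof.
  unfold lt_big. rewrite !loopfree_seq, loopfree_small, andb_true_r. now apply loopfree_for.
Qed.

Lemma loopfree_shift l d a b : loopfree (shift_big K l d a b) = true.
Proof.
  apply loopfree_for. intros. rewrite loopfree_seq. apply loopfree_for.
  intros. destruct l; reflexivity.
Qed.

Lemma loopfree_expr e d : loopfree (compile_expr e d) = true.
Proof.
  revert d. induction e; intros d; cbn [compile_expr];
    rewrite ?loopfree_seq, ?IHe, ?IHe1, ?IHe2, ?loopfree_small, ?loopfree_copy, ?loopfree_add,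
      ?loopfree_sub, ?loopfree_lt, ?loopfree_shift; reflexivity.
Qed.

Context (HK : 8 <= K) (Hw : 4 * (K * w) + 4 * K < 2 ^ w).

Lemma represents_frame d s S S' :
  represents d s S -> frame K d S S' -> word_state w S' -> represents d s S'.
Proof.
  intros (A & B & C & D) F W. destruct F as (F1 & F2 & F3).
  repeat split; try apply W; try congruence.
  intros x Hx. rewrite <- D by assumption. apply limbsum_ext. intros; now apply F3.
Qed.

Lemma val_word S x : word_state w S -> val w K S x < 2 ^ w -> val w K S x = regs S (reg x 0).
Proof.
  intros W H. assert (D := limbsum_digit w (fun j => regs S (reg x j)) K 0).
  rewrite Nat.mul_0_r, Nat.pow_0_r, Nat.div_1_r in D.
  rewrite <- D; [|intros; apply W|lia]. symmetry. now apply Nat.mod_small.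
Qed.

Lemma represents_set B s S x e :
  represents B s S -> x < B ->
  forall S' v, only K x K S S' -> word_state w S' -> val w K S' x = v -> e = v ->
  represents B (set_reg s x e) S'.
Proof.
  intros (A & D & C & E) Hx S' v O W V Ev. subst e.
  assert (F := only_frame w K HK Hw x K S S' (Nat.le_refl _) O).
  split; [exact W|]. split; [destruct F as (_ & F & _); congruence|].
  split; [destruct F as (F & _); simpl; congruence|].
  intros y Hy. simpl. unfold upd. destruct (Nat.eqb_spec y x) as [->|]; auto.
  rewrite <- E by assumption. now apply (only_val w K HK Hw x K S S').
Qed.

Lemma run_compile_expr e B s :
  evars e <= B -> safe s e -> forall d S, 1 <= d -> B <= d -> represents B s S ->
  let S' := run w (compile_expr e d) S in
  frame K d S S' /\ val w K S' d = ev s e.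
Proof.
  assert (Wp : 0 < w) by (eapply w_pos; eauto).
  assert (RF : forall d S S', B <= d -> represents B s S -> frame K d S S' ->
    word_state w S' -> represents B s S').
  { intros d S S' Hd HR F W. apply represents_frame with S; auto.
    apply (frame_trans w K HK Hw B d S S S'); auto. apply frame_refl. }
  induction e; intros Hv Hs d S Hd HB HR; cbn [evars safe ev compile_expr] in *; cbv zeta.
  - destruct (run_copy_big w K HK Hw d x S) as (O & E); [lia|].
    split; [apply (only_frame w K HK Hw d K); auto|]. rewrite E. apply HR. lia.
  - rewrite run_seq. set (S1 := run w (Const _ _) S).
    assert (O : only K d 0 S S1).
    { split; [reflexivity|]. intros r _ H. unfold S1. cbn [run regs set_reg].
      apply upd_neq, H. lia. }
    assert (W1 : word_state w S1) by (apply run_word_state; auto; apply HR).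
    destruct (run_small_big w K HK Hw d (scratch 1) S1 W1) as (O' & E).
    { intros. apply not_eq_sym. unfold Limbs.reg, Limbs.scratch. destruct d; simpl; nia. }
    split.
    + apply (only_frame w K HK Hw d K); auto.
      apply (only_trans w K HK Hw d 0 K S S1); auto; lia.
    + rewrite E. unfold S1. cbn [run regs set_reg]. rewrite upd_eq. now apply Nat.mod_small.
  - destruct Hs as (Ha & Hb & Hlt). rewrite !run_seq.
    destruct (IHe1 ltac:(lia) Ha d S Hd HB HR) as (F1 & E1).
    set (S1 := run w (compile_expr e1 d) S) in *.
    assert (W1 : word_state w S1) by (apply run_word_state; auto; apply HR).
    assert (R1 := RF d S S1 HB HR F1 W1).
    destruct (IHe2 ltac:(lia) Hb (Datatypes.S d) S1 ltac:(lia) ltac:(lia) R1) as (F2 & E2).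
    set (S2 := run w (compile_expr e2 (Datatypes.S d)) S1) in *.
    assert (W2 : word_state w S2) by (apply run_word_state; auto).
    assert (E1' : val w K S2 d = ev s e1) by (rewrite (frame_val w K _ S1 S2 d F2); auto).
    destruct (run_add_big w K HK Hw d (Datatypes.S d) S2) as (O & E); auto; try congruence; try lia.
    split; [|congruence].
    apply (frame_trans w K HK Hw d d S S1); auto.
    apply (frame_trans w K HK Hw d d S1 S2); auto; [|apply (only_frame w K HK Hw d K); auto].
    destruct F2 as (? & ? & ?). repeat split; auto.
  - destruct Hs as (Ha & Hb & Hlt). rewrite !run_seq.
    destruct (IHe1 ltac:(lia) Ha d S Hd HB HR) as (F1 & E1).
    set (S1 := run w (compile_expr e1 d) S) in *.
    assert (W1 : word_state w S1) by (apply run_word_state; auto; apply HR).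
    assert (R1 := RF d S S1 HB HR F1 W1).
    destruct (IHe2 ltac:(lia) Hb (Datatypes.S d) S1 ltac:(lia) ltac:(lia) R1) as (F2 & E2).
    set (S2 := run w (compile_expr e2 (Datatypes.S d)) S1) in *.
    assert (W2 : word_state w S2) by (apply run_word_state; auto).
    assert (E1' : val w K S2 d = ev s e1) by (rewrite (frame_val w K _ S1 S2 d F2); auto).
    destruct (run_sub_big w K HK Hw d (Datatypes.S d) S2) as (O & E); auto; try congruence; try lia.
    split; [|congruence].
    apply (frame_trans w K HK Hw d d S S1); auto.
    apply (frame_trans w K HK Hw d d S1 S2); auto; [|apply (only_frame w K HK Hw d K); auto].
    destruct F2 as (? & ? & ?). repeat split; auto.
  - destruct Hs as (Ha & Hb & Hlt & Hsh). rewrite !run_seq.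
    destruct (IHe1 ltac:(lia) Ha (Datatypes.S d) S ltac:(lia) ltac:(lia) HR) as (F1 & E1).
    set (S1 := run w (compile_expr e1 _) S) in *.
    assert (W1 : word_state w S1) by (apply run_word_state; auto; apply HR).
    assert (R1 := RF (Datatypes.S d) S S1 ltac:(lia) HR F1 W1).
    destruct (IHe2 ltac:(lia) Hb (Datatypes.S (Datatypes.S d)) S1 ltac:(lia) ltac:(lia) R1) as (F2 & E2).
    set (S2 := run w (compile_expr e2 _) S1) in *.
    assert (W2 : word_state w S2) by (apply run_word_state; auto).
    assert (E1' : val w K S2 (Datatypes.S d) = ev s e1)
      by (rewrite (frame_val w K _ S1 S2 _ F2); auto).
    assert (D2 : regs S2 (scratch 0) = w) by (destruct F2 as (_ & -> & _); apply R1).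
    destruct (run_shift_big w K HK Hw true d (Datatypes.S d) (Datatypes.S (Datatypes.S d)) S2)
      as (O & E); auto; try lia.
    { intros _. rewrite E1', E2. exact Hlt. }
    split; [|rewrite E, E1', E2; reflexivity].
    apply (frame_trans w K HK Hw d d S S1); auto.
    { destruct F1 as (? & ? & ?). repeat split; auto. }
    apply (frame_trans w K HK Hw d d S1 S2); auto; [|apply (only_frame w K HK Hw d K); auto].
    destruct F2 as (? & ? & ?). repeat split; auto.
  - destruct Hs as (Ha & Hb & Hsh). rewrite !run_seq.
    destruct (IHe1 ltac:(lia) Ha (Datatypes.S d) S ltac:(lia) ltac:(lia) HR) as (F1 & E1).
    set (S1 := run w (compile_expr e1 _) S) in *.
    assert (W1 : word_state w S1) by (apply run_word_state; auto; apply HR).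
    assert (R1 := RF (Datatypes.S d) S S1 ltac:(lia) HR F1 W1).
    destruct (IHe2 ltac:(lia) Hb (Datatypes.S (Datatypes.S d)) S1 ltac:(lia) ltac:(lia) R1) as (F2 & E2).
    set (S2 := run w (compile_expr e2 _) S1) in *.
    assert (W2 : word_state w S2) by (apply run_word_state; auto).
    assert (E1' : val w K S2 (Datatypes.S d) = ev s e1)
      by (rewrite (frame_val w K _ S1 S2 _ F2); auto).
    assert (D2 : regs S2 (scratch 0) = w) by (destruct F2 as (_ & -> & _); apply R1).
    destruct (run_shift_big w K HK Hw false d (Datatypes.S d) (Datatypes.S (Datatypes.S d)) S2)
      as (O & E); auto; try lia.
    split; [|rewrite E, E1', E2; reflexivity].
    apply (frame_trans w K HK Hw d d S S1); auto.
    { destruct F1 as (? & ? & ?). repeat split; auto. }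
    apply (frame_trans w K HK Hw d d S1 S2); auto; [|apply (only_frame w K HK Hw d K); auto].
    destruct F2 as (? & ? & ?). repeat split; auto.
  - destruct Hs as (Ha & Hb). rewrite !run_seq.
    destruct (IHe1 ltac:(lia) Ha d S Hd HB HR) as (F1 & E1).
    set (S1 := run w (compile_expr e1 d) S) in *.
    assert (W1 : word_state w S1) by (apply run_word_state; auto; apply HR).
    assert (R1 := RF d S S1 HB HR F1 W1).
    destruct (IHe2 ltac:(lia) Hb (Datatypes.S d) S1 ltac:(lia) ltac:(lia) R1) as (F2 & E2).
    set (S2 := run w (compile_expr e2 (Datatypes.S d)) S1) in *.
    assert (W2 : word_state w S2) by (apply run_word_state; auto).
    assert (E1' : val w K S2 d = ev s e1) by (rewrite (frame_val w K _ S1 S2 d F2); auto).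
    destruct (run_lt_big w K HK Hw d (Datatypes.S d) S2) as (O & E); auto; try congruence; try lia.
    split; [|rewrite E, E1', E2; reflexivity].
    apply (frame_trans w K HK Hw d d S S1); auto.
    apply (frame_trans w K HK Hw d d S1 S2); auto; [|apply (only_frame w K HK Hw d K); auto].
    destruct F2 as (? & ? & ?). repeat split; auto.
  - rewrite !run_seq.
    destruct (IHe ltac:(lia) Hs d S Hd HB HR) as (F1 & E1).
    set (S1 := run w (compile_expr e d) S) in *.
    assert (W1 : word_state w S1) by (apply run_word_state; auto; apply HR).
    assert (R1 := RF d S S1 HB HR F1 W1).
    set (S2 := run w (Read _ _ _) S1).
    assert (O2 : only K d 0 S1 S2).
    { split; [reflexivity|]. intros r _ H. unfold S2. cbn [run regs set_reg].
      apply upd_neq, H. lia. }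
    assert (W2 : word_state w S2) by (apply run_word_state; auto).
    destruct (run_small_big w K HK Hw d (scratch 1) S2 W2) as (O' & E).
    { intros. apply not_eq_sym. unfold Limbs.reg, Limbs.scratch. destruct d; simpl; nia. }
    split.
    + apply (frame_trans w K HK Hw d d S S1); auto.
      apply (only_frame w K HK Hw d K); auto.
      apply (only_trans w K HK Hw d 0 K S1 S2); auto; lia.
    + rewrite E. unfold S2. cbn [run regs set_reg]. rewrite upd_eq.
      destruct R1 as (_ & _ & -> & _). f_equal.
      unfold index. rewrite map_map, of_limbs_limbsum. exact E1.
Qed.

Lemma run_guard e B s S :
  evars e <= B -> 1 <= B -> safe s e -> ev s e < 2 ^ w -> represents B s S ->
  represents B s (run w (compile_expr e B) S) /\
  regs (run w (compile_expr e B) S) (reg B 0) = ev s e.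
Proof.
  intros Hv HB Hs Hlt HR.
  destruct (run_compile_expr e B s Hv Hs B S HB (le_n _) HR) as (F & E).
  assert (W : word_state w (run w (compile_expr e B) S)).
  { apply run_word_state; [eapply w_pos; eauto|apply HR]. }
  split; [now apply represents_frame with S|].
  rewrite <- E. symmetry. apply val_word; auto. now rewrite E.
Qed.

Lemma compile_sound c s s' t B :
  hexec c s s' t -> hvars c <= B -> 1 <= B -> forall S, represents B s S ->
  exists S' t', exec w (compile B c) S S' t' /\ represents B s' S' /\ t' <= hcost B c * t.
Proof.
  assert (Wp : 0 < w) by (eapply w_pos; eauto).
  intros H Hv HB. induction H; intros S HR; cbn [hvars compile hcost] in *.
  - exists S, 1. repeat split; try apply HR; try constructor; simpl; lia.
  - destruct (run_exec w (Seq (compile_expr e B) (copy_big K x B)) S) as (t & Ht & Hx).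
    { now rewrite loopfree_seq, loopfree_expr, loopfree_copy. }
    exists (run w (Seq (compile_expr e B) (copy_big K x B)) S), t.
    split; [exact Hx|]. split; [|lia].
    destruct (run_compile_expr e B s ltac:(lia) H B S HB (le_n _) HR) as (F & E).
    rewrite run_seq. set (S1 := run w (compile_expr e B) S) in *.
    assert (W1 : word_state w S1) by (apply run_word_state; auto; apply HR).
    destruct (run_copy_big w K HK Hw x B S1) as (O & E'); [lia|].
    apply represents_set with S1 (ev s e); auto; try lia; try congruence.
    + now apply represents_frame with S.
    + apply run_word_state; auto.
  - set (cc := Seq (compile_expr a B) (Seq (compile_expr v (Datatypes.S B))
      (Write k (map (reg B) (seq 0 K)) (reg (Datatypes.S B) 0)))).
    destruct (run_exec w cc S) as (t & Ht & Hx).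
    { unfold cc. now rewrite !loopfree_seq, !loopfree_expr. }
    exists (run w cc S), t. split; [exact Hx|]. split; [|lia].
    assert (WW : word_state w (run w cc S)) by (apply run_word_state; auto; apply HR).
    revert WW. unfold cc. rewrite !run_seq.
    destruct (run_compile_expr a B s ltac:(lia) H B S HB (le_n _) HR) as (F1 & E1).
    set (S1 := run w (compile_expr a B) S) in *.
    assert (W1 : word_state w S1) by (apply run_word_state; auto; apply HR).
    assert (R1 : represents B s S1) by now apply represents_frame with S.
    destruct (run_compile_expr v B s ltac:(lia) H0 (Datatypes.S B) S1 ltac:(lia) ltac:(lia) R1) as (F2 & E2).
    set (S2 := run w (compile_expr v _) S1) in *.
    assert (W2 : word_state w S2) by (apply run_word_state; auto).
    assert (R2 : represents B s S2).
    { apply represents_frame with S1; auto. destruct F2 as (? & ? & ?). repeat split; auto. }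
    cbn [run]. intros WW.
    replace (index w S2 (map (reg B) (seq 0 K))) with (ev s a) in *.
    2:{ unfold index. rewrite map_map, of_limbs_limbsum. change (ev s a = val w K S2 B).
        rewrite <- E1. symmetry. apply (frame_val w K _ S1 S2 B F2). lia. }
    replace (regs S2 (reg (Datatypes.S B) 0)) with (ev s v) in *.
    2:{ rewrite <- E2. apply val_word; auto. now rewrite E2. }
    destruct R2 as (_ & D & M & V). repeat split; auto; try apply WW.
    simpl. now rewrite M.
  - destruct (IHhexec1 ltac:(lia) S HR) as (S1 & t1' & X1 & R1 & L1).
    destruct (IHhexec2 ltac:(lia) S1 R1) as (S2 & t2' & X2 & R2 & L2).
    exists S2, (t1' + t2'). split; [econstructor; eauto|]. split; auto. nia.
  - destruct (run_guard e B s S) as (R1 & E1); auto; try lia.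
    destruct (run_exec w (compile_expr e B) S (loopfree_expr _ _)) as (t0 & Ht & Hx).
    destruct (IHhexec ltac:(lia) _ R1) as (S2 & t2 & X2 & R2 & L2).
    exists S2, (t0 + Datatypes.S t2). split.
    { econstructor; [eassumption|]. apply exec_If_true; [rewrite E1; lia|eassumption]. }
    split; auto. nia.
  - destruct (run_guard e B s S) as (R1 & E1); auto; try lia.
    destruct (run_exec w (compile_expr e B) S (loopfree_expr _ _)) as (t0 & Ht & Hx).
    destruct (IHhexec ltac:(lia) _ R1) as (S2 & t2 & X2 & R2 & L2).
    exists S2, (t0 + Datatypes.S t2). split.
    { econstructor; [eassumption|]. apply exec_If_false; [rewrite E1; lia|eassumption]. }
    split; auto. nia.
  - destruct (run_guard e B s S) as (R1 & E1); auto; try lia.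
    destruct (run_exec w (compile_expr e B) S (loopfree_expr _ _)) as (t0 & Ht & Hx).
    exists (run w (compile_expr e B) S), (t0 + 1). split.
    { econstructor; [eassumption|]. apply exec_While_false; rewrite E1; lia. }
    split; auto. nia.
  - destruct (run_guard e B s S) as (R1 & E1); auto; try lia.
    destruct (run_exec w (compile_expr e B) S (loopfree_expr _ _)) as (t0 & Ht & Hx).
    destruct (IHhexec1 ltac:(lia) _ R1) as (S2 & t1' & X2 & R2 & L2).
    destruct (IHhexec2 ltac:(lia) _ R2) as (S3 & t2' & X3 & R3 & L3).
    (* The hypothesis for the remaining iterations begins with an evaluation of the guard; it is
       split off here because the compiled loop performs it at the end of its body. *)
    inversion X3; subst.
    exists S3, (t0 + Datatypes.S ((t1' + t3) + t4)). split.
    { econstructor; eauto. eapply exec_While_true; eauto; [rewrite E1; lia|].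
      econstructor; eauto. }
    split; auto. nia.
Qed.

Lemma safe_lowbits s e k :
  safe s e -> safe s k -> ev s k <= w * K -> ev s e < 2 ^ (w * K) ->
  safe s (lowbits e k).
Proof using Type.
  clear HK Hw. intros A B C D. cbn [lowbits safe ev].
  assert (E := Nat.Div0.mul_div_le (ev s e) (2 ^ ev s k)).
  repeat split; auto; lia.
Qed.

Lemma w_le_wK : w <= w * K.
Proof using HK. clear Hw. nia. Qed.

Lemma word_lt_big x : x < 2 ^ w -> x < 2 ^ (w * K).
Proof using HK.
  clear Hw. intros H. apply Nat.lt_le_trans with (2 ^ w); auto. apply Nat.pow_le_mono_r; [lia|]. apply w_le_wK.
Qed.

(** * Weakest preconditions *)

(** Existential, so termination is included. The time is an argument of the postcondition, which
    lets correctness and running time be proved together. *)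
Definition wp (c : hcmd) (Q : state -> nat -> Prop) (s : state) : Prop :=
  exists s' t, hexec c s s' t /\ Q s' t.

Lemma wp_mono c (Q Q' : state -> nat -> Prop) s :
  wp c Q s -> (forall s' t, Q s' t -> Q' s' t) -> wp c Q' s.
Proof. intros (s' & t & A & B) H. exists s', t. auto. Qed.

Lemma wp_skip (Q : state -> nat -> Prop) s : Q s 1 -> wp HSkip Q s.
Proof. intros H. exists s, 1. split; auto. constructor. Qed.

Lemma wp_seq c1 c2 (Q : state -> nat -> Prop) s :
  wp c1 (fun s1 t1 => wp c2 (fun s2 t2 => Q s2 (t1 + t2)) s1) s -> wp (HSeq c1 c2) Q s.
Proof.
  intros (s1 & t1 & A & s2 & t2 & B & C). exists s2, (t1 + t2). split; auto.
  econstructor; eauto.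
Qed.

Lemma wp_set x e (Q : state -> nat -> Prop) s v :
  safe s e -> ev s e = v -> Q (set_reg s x v) 1 -> wp (HSet x e) Q s.
Proof. intros A <- B. exists (set_reg s x (ev s e)), 1. split; auto. now constructor. Qed.

Lemma wp_write k a e (Q : state -> nat -> Prop) s i v :
  safe s a -> safe s e -> ev s a = i -> ev s e = v -> v < 2 ^ w ->
  Q (set_mem s k i v) 1 -> wp (HWrite k a e) Q s.
Proof.
  intros A B <- <- C D. exists (set_mem s k (ev s a) (ev s e)), 1. split; auto. now constructor.
Qed.

Lemma wp_if_lt a b c1 c2 (Q : state -> nat -> Prop) s :
  safe s a -> safe s b ->
  (ev s a < ev s b -> wp c1 (fun s' t => Q s' (S t)) s) ->
  (ev s b <= ev s a -> wp c2 (fun s' t => Q s' (S t)) s) ->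
  wp (HIf (ELt a b) c1 c2) Q s.
Proof.
  intros A B C D. destruct (Nat.lt_ge_cases (ev s a) (ev s b)) as [L|L].
  - destruct (C L) as (s' & t & X & Y). exists s', (S t). split; auto.
    apply hexec_If_true; simpl; auto. apply Nat.ltb_lt in L. rewrite L. simpl. lia.
  - destruct (D L) as (s' & t & X & Y). exists s', (S t). split; auto.
    apply hexec_If_false; simpl; auto. apply Nat.ltb_ge in L. now rewrite L.
Qed.

(** The number of iterations is given in advance and indexes the invariant, which yields termination
    and the time bound without a variant. *)
Lemma wp_while_lt a b c (I : nat -> state -> Prop) n T s :
  (forall j s, j < n -> I j s ->
     safe s a /\ safe s b /\ ev s a < ev s b /\ wp c (fun s' t => t <= T /\ I (S j) s') s) ->
  (forall s, I n s -> safe s a /\ safe s b /\ ev s b <= ev s a) ->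
  I 0 s -> wp (HWhile (ELt a b) c) (fun s' t => t <= n * (T + 1) + 1 /\ I n s') s.
Proof.
  intros H1 H2.
  enough (G : forall m j s, j + m = n -> I j s ->
    wp (HWhile (ELt a b) c) (fun s' t => t <= m * (T + 1) + 1 /\ I n s') s).
  { intros H0. apply (G n 0); auto. }
  induction m; intros j s0 Hj H0.
  - replace j with n in H0 by lia. destruct (H2 _ H0) as (A & B & C).
    exists s0, 1. split; [|split; [lia|assumption]].
    apply hexec_While_false; simpl; auto. apply Nat.ltb_ge in C. now rewrite C.
  - destruct (H1 j s0) as (A & B & C & s1 & t1 & X & Y & Z); [lia|assumption|].
    destruct (IHm (S j) s1) as (s2 & t2 & X' & Y' & Z'); [lia|assumption|].
    exists s2, (S (t1 + t2)). split; [|split; [lia|assumption]].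
    eapply hexec_While_true; simpl; eauto. apply Nat.ltb_lt in C. rewrite C. simpl. lia.
Qed.

End Compile.

(** * A bit-serial decoder *)

(* The state [(0, r)] expects the last [r] bits of the binary part of a code
   (and [(0, 0)] a new token), [(1, r)] has read [r] zeros of a unary part, and
   [(2, 0)] is inside the literal [11].  Bits of the binary part are credited
   to the position as they are read, so that no partial value is needed. *)
Definition dec_next (q : nat * nat) (bt : bool) : nat * nat :=
  match q with
  | (0, 0) => if bt then (2, 0) else (1, 0)
  | (0, S r) => (0, r)
  | (1, r) => if bt then (0, r) else (1, S r)
  | _ => (0, 0)
  end.

Definition dec_gain (q : nat * nat) (bt : bool) : nat :=
  match q with
  | (0, 0) => 0
  | (0, S r) => Nat.b2n bt * 2 ^ r
  | (1, r) => Nat.b2n bt * 2 ^ r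
  | _ => 1
  end.

(** The only literal in a mask is 1, encoded as [11]; its one is produced when the second bit is
    read. That bit is not inspected, which keeps the decoder total on arbitrary padding. *)
Definition dec_emits (q : nat * nat) : bool := 2 <=? fst q.

Fixpoint dec_state (q : nat * nat) (bs : list bool) : nat * nat :=
  match bs with
  | [] => q
  | bt :: bs' => dec_state (dec_next q bt) bs'
  end.

Fixpoint dec_total (q : nat * nat) (bs : list bool) : nat :=
  match bs with
  | [] => 0
  | bt :: bs' => dec_gain q bt + dec_total (dec_next q bt) bs'
  end.

Fixpoint dec_ones (q : nat * nat) (bs : list bool) : list nat :=
  match bs with
  | [] => []
  | bt :: bs' => (if dec_emits q then [0] else []) ++
      map (Nat.add (dec_gain q bt)) (dec_ones (dec_next q bt) bs')
  end.

Lemma dec_state_app q xs ys : dec_state q (xs ++ ys) = dec_state (dec_state q xs) ys.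
Proof. revert q. induction xs; simpl; auto. Qed.

Lemma dec_total_app q xs ys :
  dec_total q (xs ++ ys) = dec_total q xs + dec_total (dec_state q xs) ys.
Proof. revert q. induction xs; intros q; simpl; auto. rewrite IHxs. lia. Qed.

Lemma map_add_0 l : map (Nat.add 0) l = l.
Proof. now rewrite map_id. Qed.

Lemma map_add_add x y l : map (Nat.add x) (map (Nat.add y) l) = map (Nat.add (x + y)) l.
Proof. rewrite map_map. apply map_ext. intros. lia. Qed.

Lemma dec_ones_app q xs ys :
  dec_ones q (xs ++ ys) =
  dec_ones q xs ++ map (Nat.add (dec_total q xs)) (dec_ones (dec_state q xs) ys).
Proof.
  revert q. induction xs as [|x xs IH]; intros q; simpl.
  - now rewrite map_id.
  - now rewrite IH, map_app, map_add_add, app_assoc.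
Qed.

Lemma dec_zeros r m :
  dec_state (1, r) (repeat false m) = (1, r + m) /\
  dec_total (1, r) (repeat false m) = 0 /\ dec_ones (1, r) (repeat false m) = [].
Proof.
  revert r. induction m; intros r; simpl; [now rewrite Nat.add_0_r|].
  destruct (IHm (S r)) as (A & B & C). rewrite A, B, C, Nat.add_succ_r. auto.
Qed.

Lemma mod_pow2_S y r : y mod 2 ^ S r = Nat.b2n (Nat.testbit y r) * 2 ^ r + y mod 2 ^ r.
Proof.
  rewrite Nat.testbit_spec'.
  replace (2 ^ S r) with (2 ^ r * 2) by (simpl; lia). rewrite Nat.Div0.mod_mul_r. lia.
Qed.

Lemma dec_binary y r :
  let bs := rev (map (Nat.testbit y) (seq 0 r)) in
  dec_state (0, r) bs = (0, 0) /\ dec_total (0, r) bs = y mod 2 ^ r /\ dec_ones (0, r) bs = [].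
Proof.
  induction r.
  - simpl. auto.
  - cbv zeta. rewrite seq_S, map_app, rev_app_distr. cbn [map rev app Nat.add].
    destruct IHr as (A & B & C).
    cbn [dec_state dec_total dec_ones dec_next dec_gain].
    rewrite A, B, C, mod_pow2_S. auto.
Qed.

(** The leading one of the binary part ends the unary part. It is credited with 2^l while the mode
    changes, and the l bits after it add the rest of x. *)
Lemma dec_gamma x :
  0 < x ->
  dec_state (1, 0) (gamma x) = (0, 0) /\ dec_total (1, 0) (gamma x) = x /\
  dec_ones (1, 0) (gamma x) = [].
Proof.
  intros Hx. unfold gamma. set (l := Nat.log2 x).
  destruct (dec_zeros 0 l) as (A & B & C). cbn [Nat.add] in A.
  rewrite dec_state_app, dec_total_app, dec_ones_app, A, B, C.
  destruct (dec_binary x l) as (D & E & F).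
  rewrite seq_S, map_app, rev_app_distr. cbn [map rev app Nat.add].
  assert (T : Nat.testbit x l = true) by (now apply Nat.bit_log2; lia).
  rewrite T. cbn [dec_state dec_total dec_ones dec_next dec_gain].
  rewrite D, E, F. cbn [dec_emits fst Nat.leb app map Nat.b2n]. repeat split.
  rewrite <- (Nat.mod_small x (2 ^ S l)) at 2 by (apply Nat.log2_spec; lia).
  rewrite mod_pow2_S, T. reflexivity.
Qed.

Lemma dec_zero_run z :
  dec_state (0, 0) (zero_run z) = (0, 0) /\ dec_total (0, 0) (zero_run z) = z /\
  dec_ones (0, 0) (zero_run z) = [].
Proof.
  destruct z; [auto|]. cbn [zero_run dec_state dec_total dec_ones dec_next dec_gain].
  destruct (dec_gamma (S z)) as (A & B & C); [lia|]. rewrite A, B, C. auto.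
Qed.

Lemma ones_cons a A : ones (a :: A) = (if a then [0] else []) ++ map S (ones A).
Proof.
  unfold ones. cbn [length seq]. rewrite <- seq_shift.
  assert (E : forall l, filter (fun j => nth j (a :: A) false) (map S l) =
     map S (filter (fun j => nth j A false) l)).
  { induction l as [|x l IHl]; cbn [map filter]; auto. rewrite IHl.
    change (nth (S x) (a :: A) false) with (nth x A false). now destruct (nth x A false). }
  cbn [filter]. rewrite E. now destruct a.
Qed.

(** Generalised over the pending run: those zeros shift every later position by [z], whether their
    token has been emitted or not. *)
Lemma dec_senc_from A z :
  let bs := senc_from z (map Nat.b2n A) in
  dec_state (0, 0) bs = (0, 0) /\ dec_total (0, 0) bs = z + length A /\
  dec_ones (0, 0) bs = map (Nat.add z) (ones A).
Proof.
  revert z. induction A as [|a A IH]; intros z; cbv zeta.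
  - cbn [map senc_from length]. destruct (dec_zero_run z) as (B & C & D).
    rewrite B, C, D, Nat.add_0_r. auto.
  - rewrite ones_cons. destruct a; cbn [map Nat.b2n senc_from length].
    + destruct (dec_zero_run z) as (B & C & D).
      rewrite dec_state_app, dec_total_app, dec_ones_app, B, C, D.
      destruct (IH 0) as (E & F & G).
      change (gamma 1) with [true].
      cbn [app dec_state dec_total dec_ones dec_next dec_gain dec_emits fst Nat.leb].
      rewrite E, F, G, map_add_0. split; [reflexivity|]. split; [lia|].
      cbn [map app]. f_equal.
      rewrite !map_map. apply map_ext. intros. lia.
    + destruct (IH (S z)) as (E & F & G). rewrite E, F, G. split; [reflexivity|]. split; [lia|].
      cbn [app]. rewrite map_map. apply map_ext. intros. lia.
Qed.

Lemma dec_senc_mask A :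
  dec_state (0, 0) (senc_mask A) = (0, 0) /\ dec_total (0, 0) (senc_mask A) = length A /\
  dec_ones (0, 0) (senc_mask A) = ones A.
Proof.
  destruct (dec_senc_from A 0) as (B & C & D). rewrite map_add_0 in D. auto.
Qed.

(** The bits come from a function on all naturals and not from a list, so that the last chunk may
    extend into the padding. *)
Definition window (f : nat -> bool) (a n : nat) : list bool := map f (seq a n).

Lemma window_app f a n m : window f a (n + m) = window f a n ++ window f (a + n) m.
Proof. unfold window. now rewrite seq_app, map_app. Qed.

Lemma window_length f a n : length (window f a n) = n.
Proof. unfold window. now rewrite length_map, length_seq. Qed.

Lemma window_ext f g a n :
  (forall i, a <= i < a + n -> f i = g i) -> window f a n = window g a n.
Proof. intros H. apply map_ext_in. intros i Hi. apply in_seq in Hi. now apply H. Qed.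

Lemma window_nth bs : window (fun j => nth j bs false) 0 (length bs) = bs.
Proof.
  apply nth_ext with false false; rewrite window_length; auto.
  intros n Hn. unfold window. rewrite nth_indep with (d' := nth 0 bs false).
  - rewrite map_nth with (d := 0) (f := fun j => nth j bs false), seq_nth; auto.
  - now rewrite length_map, length_seq.
Qed.

(** Decoding more bits than the encoding has only appends ones to the list, so the answers to legal
    queries do not depend on the padding. *)
Lemma dec_select f A M i :
  (forall j, j < length (senc_mask A) -> f j = nth j (senc_mask A) false) ->
  length (senc_mask A) <= M -> 1 <= i <= length (ones A) ->
  i <= length (dec_ones (0, 0) (window f 0 M)) /\
  nth (i - 1) (dec_ones (0, 0) (window f 0 M)) 0 = select A i.
Proof.
  intros Hf HM Hi. set (l := length (senc_mask A)) in *.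
  replace M with (l + (M - l)) by lia. rewrite window_app, dec_ones_app.
  replace (window f 0 l) with (senc_mask A).
  2:{ rewrite <- (window_nth (senc_mask A)) at 1. apply window_ext. intros. symmetry. apply Hf.
      unfold l in *. lia. }
  destruct (dec_senc_mask A) as (_ & _ & E). rewrite E. split.
  - rewrite length_app. lia.
  - rewrite app_nth1 by lia. reflexivity.
Qed.

(** * Growth of the counter and of the decoded position *)

Lemma dec_gain_le q bt : dec_gain q bt <= 2 ^ snd q.
Proof.
  destruct q as [[|[|md]] r]; cbn [dec_gain snd].
  - destruct r; [simpl; lia|]. cbn [Nat.pow]. destruct bt; simpl; lia.
  - destruct bt; simpl; lia.
  - assert (P := pow2_pos r). lia.
Qed.

Lemma dec_next_le q bt : snd (dec_next q bt) <= S (snd q).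
Proof. destruct q as [[|[|md]] [|r]], bt; simpl; lia. Qed.

Lemma dec_state_le q bs : snd (dec_state q bs) <= snd q + length bs.
Proof.
  revert q. induction bs as [|bt bs IH]; intros q; simpl; [lia|].
  specialize (IH (dec_next q bt)). assert (H := dec_next_le q bt). lia.
Qed.

Lemma dec_total_le q bs : dec_total q bs <= length bs * 2 ^ (snd q + length bs).
Proof.
  revert q. induction bs as [|bt bs IH]; intros q; simpl; [lia|].
  specialize (IH (dec_next q bt)). assert (H := dec_next_le q bt).
  assert (G := dec_gain_le q bt).
  assert (2 ^ snd q <= 2 ^ (snd q + S (length bs))) by (apply Nat.pow_le_mono_r; lia).
  assert (2 ^ (snd (dec_next q bt) + length bs) <= 2 ^ (snd q + S (length bs)))
    by (apply Nat.pow_le_mono_r; lia).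
  nia.
Qed.

Lemma dec_ones_length q bs : length (dec_ones q bs) <= length bs.
Proof.
  revert q. induction bs as [|bt bs IH]; intros q; simpl; [lia|].
  rewrite length_app, length_map. specialize (IH (dec_next q bt)).
  destruct (dec_emits q); simpl; lia.
Qed.

Lemma dec_ones_le q bs x : In x (dec_ones q bs) -> x <= dec_total q bs.
Proof.
  revert q x. induction bs as [|bt bs IH]; intros q x; simpl; [tauto|].
  rewrite in_app_iff, in_map_iff. intros [H|(y & <- & H)].
  - destruct (dec_emits q); simpl in H; [destruct H; [lia|tauto] | tauto].
  - apply IH in H. lia.
Qed.

(** Inside a literal the counter is 0. Hence a state with a large counter has mode 0 or 1, as
    [dec_shift] requires. *)
Definition dec_ok (q : nat * nat) : Prop := fst q <= 1 \/ q = (2, 0).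

Lemma dec_ok_state q bs : dec_ok q -> dec_ok (dec_state q bs).
Proof.
  revert q. induction bs as [|bt bs IH]; intros q H; simpl; auto. apply IH.
  destruct q as [[|[|md]] [|r]], bt; unfold dec_ok in *; simpl; auto.
Qed.

(* While the counter exceeds the number of bits to be read, the decoder does
   not start a new token, and an offset of the counter only scales the gain. *)
Lemma dec_shift bs md r e :
  md <= 1 -> length bs <= r ->
  dec_state (md, r + e) bs =
    (fst (dec_state (md, r) bs), snd (dec_state (md, r) bs) + e) /\
  dec_total (md, r + e) bs = dec_total (md, r) bs * 2 ^ e /\
  dec_ones (md, r + e) bs = [].
Proof.
  revert md r. induction bs as [|bt bs IH]; intros md r Hm Hr; simpl in *; [auto|].
  destruct r as [|r]; [lia|].
  destruct md as [|[|md]]; [| |lia].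
  - destruct (IH 0 r) as (A & B & C); [lia..|].
    cbn [Nat.add dec_next dec_gain dec_emits fst Nat.leb app].
    rewrite A, B, C. repeat split. rewrite Nat.mul_add_distr_r, Nat.pow_add_r. lia.
  - cbn [Nat.add dec_next dec_gain dec_emits fst Nat.leb app].
    replace (S (r + e)) with (S r + e) by lia. destruct bt; cbn [Nat.b2n].
    + destruct (IH 0 (S r)) as (A & B & C); [lia..|].
      rewrite A, B, C. repeat split.
      rewrite Nat.mul_add_distr_r, Nat.pow_add_r. lia.
    + destruct (IH 1 (S (S r))) as (A & B & C); [lia..|].
      replace (S (S r + e)) with (S (S r) + e) by lia.
      rewrite A, B, C. auto.
Qed.

(** The one that ends the unary part is read at a counter of at least [r], and it alone is worth 2
    to that counter. *)
Lemma dec_run_le bs r :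
  fst (dec_state (1, r) bs) <> 1 -> 2 ^ r <= dec_total (1, r) bs.
Proof.
  revert r. induction bs as [|bt bs IH]; intros r; simpl; [tauto|].
  destruct bt; intros H; [simpl; lia|]. apply IH in H. simpl in *. lia.
Qed.

(** The leading one of the number being read was credited with 2 to the counter of that moment, and
    the counter only decreases within the binary part. The credit from before [bs] enters as [p]. *)
Lemma dec_binary_le bs q p :
  (fst q = 0 -> 0 < snd q -> 2 ^ snd q <= p) ->
  let q' := dec_state q bs in
  fst q' = 0 -> 0 < snd q' -> 2 ^ snd q' <= p + dec_total q bs.
Proof.
  revert q p. induction bs as [|bt bs IH]; intros q p H; cbv zeta; simpl.
  - rewrite Nat.add_0_r. exact H.
  - rewrite Nat.add_assoc. apply IH.
    destruct q as [[|[|md]] r]; cbn [dec_next dec_gain].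
    + destruct r; [destruct bt; simpl; lia|]. cbn [fst snd] in *. intros _ _.
      specialize (H eq_refl ltac:(lia)). simpl in H. lia.
    + destruct bt; cbn [fst snd Nat.b2n]; lia.
    + cbn [fst snd]. lia.
Qed.

(** The source of the space bound: a large counter forces a long mask. In a binary part the leading
    one has already been gained; in a unary part it is still to come, because a valid encoding ends
    in state (0, 0). *)
Lemma dec_counter_le A xs ys :
  xs ++ ys = senc_mask A ->
  let r := snd (dec_state (0, 0) xs) in
  dec_total (0, 0) xs <= length A /\ (0 < r -> 2 ^ r <= length A).
Proof.
  intros E r. destruct (dec_senc_mask A) as (HS & HT & _).
  rewrite <- E, dec_state_app in HS. rewrite <- E, dec_total_app in HT.
  split; [lia|]. intros Hr. unfold r in *.
  assert (O := dec_ok_state (0, 0) xs (or_introl (Nat.le_0_l 1))).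
  destruct (dec_state (0, 0) xs) as [[|[|md]] r'] eqn:Eq; cbn [snd] in *.
  - assert (H := dec_binary_le xs (0, 0) 0 ltac:(simpl; lia)). cbv zeta in H.
    rewrite Eq in H. specialize (H eq_refl Hr). cbn [snd] in H. lia.
  - assert (H := dec_run_le ys r'). rewrite HS in H. cbn [fst] in H. lia.
  - destruct O as [O|O]; [simpl in O; lia|]. inversion O. lia.
Qed.

(** * Packed fields *)

Definition put_bits (x sh f v : nat) : nat := x - (x / 2 ^ sh mod 2 ^ f) * 2 ^ sh + v * 2 ^ sh.

Lemma testbit_put_bits x sh f v p :
  v < 2 ^ f ->
  Nat.testbit (put_bits x sh f v) p =
    if p <? sh then Nat.testbit x p
    else if p <? sh + f then Nat.testbit v (p - sh) else Nat.testbit x p.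
Proof.
  intros Hv. unfold put_bits.
  assert (E : x = x mod 2 ^ sh + (x / 2 ^ sh mod 2 ^ f + x / 2 ^ (sh + f) * 2 ^ f) * 2 ^ sh).
  { rewrite Nat.pow_add_r, <- Nat.Div0.div_div.
    assert (A := Nat.div_mod_eq x (2 ^ sh)). assert (B := Nat.div_mod_eq (x / 2 ^ sh) (2 ^ f)).
    nia. }
  replace (x - (x / 2 ^ sh mod 2 ^ f) * 2 ^ sh + v * 2 ^ sh)
    with (x mod 2 ^ sh + (v + x / 2 ^ (sh + f) * 2 ^ f) * 2 ^ sh) by nia.
  clear E. rewrite testbit_concat by (apply Nat.mod_upper_bound, Nat.pow_nonzero; lia).
  destruct (Nat.ltb_spec p sh).
  - now apply Nat.mod_pow2_bits_low.
  - rewrite testbit_concat by assumption.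
    destruct (Nat.ltb_spec p (sh + f)), (Nat.ltb_spec (p - sh) f); try lia; auto.
    rewrite Nat.div_pow2_bits. f_equal. lia.
Qed.

Lemma put_bits_lt x sh f v n : v < 2 ^ f -> x < 2 ^ n -> sh + f <= n -> put_bits x sh f v < 2 ^ n.
Proof.
  intros Hv Hx Hn. apply lt_pow2_of_testbit. intros p Hp. rewrite testbit_put_bits by assumption.
  destruct (Nat.ltb_spec p sh); [lia|]. destruct (Nat.ltb_spec p (sh + f)); [lia|].
  now apply testbit_small with n.
Qed.

(** Either each field has a word of its own and any width up to [w], or a word has 2^rho slots of
    2^phi bits. Bits at the top of a word may stay idle, as [w] need not be a power of two; so a
    field never straddles words. *)
Definition layout_ok (w rho f phi : nat) : Prop :=
  1 <= f <= w /\ (rho = 0 \/ f = 2 ^ phi /\ 2 ^ (rho + phi) <= w).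

Section Layout.
Context (w K ks rho f phi : nat).

Definition slot_pos (v : nat) : nat := v mod 2 ^ rho * 2 ^ phi.

Definition field (a : nat -> nat) (v : nat) : nat := a (v / 2 ^ rho) / 2 ^ slot_pos v mod 2 ^ f.

(** A number occupies one field per limb, with stride 2^ks instead of [K] so that the first field is
    found by a shift. *)
Definition item (a : nat -> nat) (u : nat) : nat :=
  limbsum w (fun j => field a (u * 2 ^ ks + j)) K.

(** Limbs remain w-bit digits even when fields are narrower than words. A number below 2^f then sits
    in its lowest field and the others are 0, a waste of a constant factor only. *)
Definition storable (x : nat) : Prop :=
  x < 2 ^ (w * K) /\ forall j, j < K -> x / 2 ^ (w * j) mod 2 ^ w < 2 ^ f.

Lemma testbit_field a v p :
  Nat.testbit (field a v) p = (p <? f) && Nat.testbit (a (v / 2 ^ rho)) (p + slot_pos v).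
Proof.
  unfold field. destruct (Nat.ltb_spec p f).
  - now rewrite Nat.mod_pow2_bits_low, Nat.div_pow2_bits.
  - now rewrite Nat.mod_pow2_bits_high.
Qed.

Lemma field_lt a v : field a v < 2 ^ f.
Proof. apply Nat.mod_upper_bound, Nat.pow_nonzero. lia. Qed.

Lemma field_ext a a' v :
  (forall p, p < f -> Nat.testbit (a (v / 2 ^ rho)) (p + slot_pos v) =
                      Nat.testbit (a' (v / 2 ^ rho)) (p + slot_pos v)) ->
  field a v = field a' v.
Proof.
  intros H. apply Nat.bits_inj. intros p. rewrite !testbit_field.
  destruct (Nat.ltb_spec p f); simpl; auto.
Qed.

Context (HL : layout_ok w rho f phi).

Lemma slot_pos_le v : slot_pos v + f <= w.
Proof.
  destruct HL as (A & [B|(B & C)]); unfold slot_pos.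
  - rewrite B, Nat.pow_0_r, Nat.mod_1_r. lia.
  - rewrite Nat.pow_add_r in C. rewrite B.
    assert (v mod 2 ^ rho < 2 ^ rho) by (apply Nat.mod_upper_bound, Nat.pow_nonzero; lia).
    nia.
Qed.

Lemma slot_pos_disjoint v v' :
  v <> v' -> v / 2 ^ rho = v' / 2 ^ rho ->
  slot_pos v + f <= slot_pos v' \/ slot_pos v' + f <= slot_pos v.
Proof.
  intros Hne Hd. unfold slot_pos.
  assert (Hm : v mod 2 ^ rho <> v' mod 2 ^ rho).
  { intros Hm. apply Hne. rewrite (Nat.div_mod_eq v (2 ^ rho)), (Nat.div_mod_eq v' (2 ^ rho)). lia. }
  destruct HL as (A & [B|(B & C)]).
  - rewrite B, Nat.pow_0_r, !Nat.mod_1_r in Hm. lia.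
  - rewrite B. nia.
Qed.

Definition put_field (a : nat -> nat) (v x : nat) : nat -> nat :=
  upd a (v / 2 ^ rho) (put_bits (a (v / 2 ^ rho)) (slot_pos v) f x).

Lemma field_put a v x v' :
  x < 2 ^ f -> field (put_field a v x) v' = if v' =? v then x else field a v'.
Proof.
  intros Hx. destruct (Nat.eqb_spec v' v) as [->|Hv].
  - apply Nat.bits_inj. intros p. rewrite testbit_field. unfold put_field. rewrite upd_eq.
    destruct (Nat.ltb_spec p f); simpl.
    + rewrite testbit_put_bits by assumption.
      destruct (Nat.ltb_spec (p + slot_pos v) (slot_pos v)); [lia|].
      destruct (Nat.ltb_spec (p + slot_pos v) (slot_pos v + f)); [|lia]. f_equal. lia.
    + symmetry. now apply testbit_small with f.
  - apply field_ext. intros p Hp. unfold put_field.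
    destruct (Nat.eq_dec (v' / 2 ^ rho) (v / 2 ^ rho)) as [E|E].
    + rewrite E, upd_eq, testbit_put_bits by assumption.
      destruct (slot_pos_disjoint v v'); auto;
        destruct (Nat.ltb_spec (p + slot_pos v') (slot_pos v));
        destruct (Nat.ltb_spec (p + slot_pos v') (slot_pos v + f)); auto; lia.
    + now rewrite upd_neq.
Qed.

Lemma item_lt a u : item a u < 2 ^ (w * K).
Proof.
  apply limbsum_lt. intros i Hi. eapply Nat.lt_le_trans; [apply field_lt|].
  apply Nat.pow_le_mono_r; [lia|]. apply HL.
Qed.

Context (HK : 8 <= K) (Hw : 4 * (K * w) + 4 * K < 2 ^ w) (Hks : K <= 2 ^ ks).

(** Setting a field rewrites its whole word, so changes are tracked by words. *)
Definition out_only (V : nat) (m m' : memory) : Prop :=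
  forall k a, ~ (k = OUT /\ exists v, v < V /\ a = v / 2 ^ rho) -> m' k a = m k a.

Lemma out_only_refl V m : out_only V m m.
Proof. intros k a _. reflexivity. Qed.

Lemma out_only_trans V m1 m2 m3 : out_only V m1 m2 -> out_only V m2 m3 -> out_only V m1 m3.
Proof. intros A B k a H. rewrite B, A; auto. Qed.

(* Temporary variables are numbered from 30 on; the layout is read from the
   variables 13, 14 and 15. *)
Definition set_field : hcmd :=
  HSeq (HSet 32 (EShr (EVar 30) (EVar 13)))
  (HSeq (HSet 33 (EShl (lowbits (EVar 30) (EVar 13)) (EVar 15)))
  (HSeq (HSet 34 (ERd OUT (EVar 32)))
  (HSeq (HSet 35 (EShl (lowbits (EShr (EVar 34) (EVar 33)) (EVar 14)) (EVar 33)))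
        (HWrite OUT (EVar 32)
          (EAdd (ESub (EVar 34) (EVar 35)) (EShl (EVar 31) (EVar 33))))))).

Definition get_field : expr :=
  lowbits (EShr (ERd OUT (EShr (EVar 30) (EVar 13)))
                (EShl (lowbits (EVar 30) (EVar 13)) (EVar 15))) (EVar 14).

Fixpoint set_limbs (n : nat) : hcmd :=
  match n with
  | 0 => HSkip
  | S n' => HSeq (set_limbs n')
      (HSeq (HSet 30 (EAdd (EShl (EVar 40) (ECst ks)) (ECst n')))
      (HSeq (HSet 31 (lowbits (EVar 41) (EVar 2)))
      (HSeq set_field
            (HSet 41 (EShr (EVar 41) (EVar 2))))))
  end.

Definition set_item (u x : expr) : hcmd :=
  HSeq (HSet 40 u) (HSeq (HSet 41 x) (set_limbs K)).

(** Evaluated from the top limb down as in Horner's rule: the partial number moves up by one word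
    per limb. *)
Fixpoint get_limbs (n : nat) : hcmd :=
  match n with
  | 0 => HSkip
  | S n' => HSeq (HSet 30 (EAdd (EShl (EVar 40) (ECst ks)) (ECst n')))
      (HSeq (HSet 41 (EAdd (EShl (EVar 41) (EVar 2)) get_field))
            (get_limbs n'))
  end.

Definition get_item (u : expr) : hcmd :=
  HSeq (HSet 40 u) (HSeq (HSet 41 (ECst 0)) (get_limbs K)).

Definition has_layout (s : state) : Prop :=
  regs s 2 = w /\ regs s 13 = rho /\ regs s 14 = f /\ regs s 15 = phi /\
  word_memory w (mem s).

Context (Hrho : rho <= w * K) (Hphi : phi <= w * K).

Ltac lookup :=
  cbn [regs mem set_reg set_mem]; repeat first [rewrite upd_eq | rewrite upd_neq by discriminate].

Lemma wp_set_field s v x :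
  has_layout s -> regs s 30 = v -> regs s 31 = x -> x < 2 ^ f -> v < 2 ^ (w * K) ->
  wp w K set_field (fun s' t => t = 5 /\
    (forall y, y < 30 \/ 40 <= y -> regs s' y = regs s y) /\
    mem s' = upd (mem s) OUT (put_field (mem s OUT) v x)) s.
Proof.
  intros (E2 & E13 & E14 & E15 & WM) Ev Ex Hx Hv.
  assert (SP := slot_pos_le v). assert (WK := (w_le_wK w K HK)).
  assert (Pw : w < 2 ^ (w * K)) by (apply (word_lt_big w K HK); lia).
  set (sh := slot_pos v) in *. set (a := v / 2 ^ rho).
  assert (Hw0 : mem s OUT a < 2 ^ w) by apply WM.
  set (y := mem s OUT a) in *.
  assert (Hy : y < 2 ^ (w * K)) by now apply (word_lt_big w K HK).
  assert (Hdiv : y / 2 ^ sh <= y) by (apply Nat.Div0.div_le_upper_bound; assert (P := pow2_pos sh); nia).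
  assert (Hmid : (y / 2 ^ sh mod 2 ^ f) * 2 ^ sh <= y).
  { assert (A := Nat.Div0.mod_le (y / 2 ^ sh) (2 ^ f)).
    assert (B := Nat.Div0.mul_div_le y (2 ^ sh)). nia. }
  assert (HP : put_bits y sh f x < 2 ^ w) by (apply put_bits_lt; auto; lia).
  unfold put_bits in HP.
  apply wp_seq, wp_set with (v := a); [cbn [safe ev]; lookup; lia | cbn [ev]; lookup; now rewrite Ev, E13 |].
  apply wp_seq, wp_set with (v := sh).
  { cbn [safe]. rewrite ev_lowbits. cbn [ev]. lookup. rewrite Ev, E13, E15.
    split; [apply safe_lowbits; cbn [safe ev]; lookup; auto; lia|].
    split; [exact I|]. split; [|assumption].
    change (sh < 2 ^ (w * K)). lia. }
  { cbn [ev]. rewrite ev_lowbits. cbn [ev]. lookup. now rewrite Ev, E13, E15. }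
  apply wp_seq, wp_set with (v := y); [cbn [safe]; auto | cbn [ev]; lookup; reflexivity|].
  apply wp_seq, wp_set with (v := (y / 2 ^ sh mod 2 ^ f) * 2 ^ sh).
  { cbn [safe]. rewrite ev_lowbits. cbn [ev]. lookup. rewrite E14.
    split; [apply safe_lowbits; cbn [safe ev]; lookup; rewrite ?E14; auto; try lia|].
    destruct HL. lia. }
  { cbn [ev]. rewrite ev_lowbits. cbn [ev]. lookup. now rewrite E14. }
  apply wp_write with (i := a) (v := put_bits y sh f x).
  - exact I.
  - cbn [safe ev]. lookup. rewrite Ex.
    assert (Q : y - y / 2 ^ sh mod 2 ^ f * 2 ^ sh + x * 2 ^ sh < 2 ^ (w * K)) by now apply (word_lt_big w K HK).
    repeat split; auto; lia.
  - cbn [ev]. lookup. reflexivity.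
  - cbn [ev]. lookup. rewrite Ex. reflexivity.
  - exact HP.
  - split; [reflexivity|]. split; [|reflexivity].
    intros z Hz. lookup. rewrite !upd_neq by lia. reflexivity.
Qed.

Lemma safe_get_field s v :
  has_layout s -> regs s 30 = v -> v < 2 ^ (w * K) ->
  safe w K s get_field /\ ev s get_field = field (mem s OUT) v.
Proof.
  intros (E2 & E13 & E14 & E15 & WM) Ev Hv.
  assert (SP := slot_pos_le v). assert (WK := (w_le_wK w K HK)).
  assert (Pw : w < 2 ^ (w * K)) by (apply (word_lt_big w K HK); lia).
  assert (Hw0 : mem s OUT (v / 2 ^ rho) < 2 ^ (w * K)) by (apply (word_lt_big w K HK), WM).
  unfold get_field. split.
  - apply safe_lowbits; cbn [safe]; try (cbn [ev]; rewrite E14; destruct HL; lia); auto.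
    + split; [cbn [ev]; lia|]. rewrite ev_lowbits. cbn [ev]. rewrite ev_lowbits. cbn [ev].
      rewrite Ev, E13, E15. fold (slot_pos v).
      split; [split; [apply safe_lowbits; cbn [safe ev]; auto; lia|]|]; lia.
    + cbn [ev]. rewrite ev_lowbits. cbn [ev]. rewrite Ev, E13, E15. fold (slot_pos v).
      eapply Nat.le_lt_trans; [|exact Hw0]. apply Nat.Div0.div_le_upper_bound.
      assert (P := pow2_pos (slot_pos v)). nia.
  - rewrite ev_lowbits. cbn [ev]. rewrite ev_lowbits. cbn [ev]. now rewrite Ev, E13, E14, E15.
Qed.

Lemma has_layout_frame s s' :
  has_layout s -> (forall y, y < 30 -> regs s' y = regs s y) -> word_memory w (mem s') -> has_layout s'.
Proof. intros (A & B & C & D & E) F G. repeat split; try apply G; rewrite F by lia; assumption. Qed.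

Lemma word_memory_put_field m v x :
  word_memory w m -> x < 2 ^ f -> word_memory w (upd m OUT (put_field (m OUT) v x)).
Proof.
  intros WM Hx. unfold put_field. apply word_memory_upd; auto.
  apply put_bits_lt; auto. apply slot_pos_le.
Qed.

Lemma item_index_lt u j V : (u + 1) * 2 ^ ks <= V -> j < K -> u * 2 ^ ks + j < V.
Proof. nia. Qed.

Lemma wp_set_limbs n s u x V :
  n <= K -> has_layout s -> regs s 40 = u -> regs s 41 = x -> storable x ->
  (u + 1) * 2 ^ ks <= V -> V <= 2 ^ (w * K) ->
  wp w K (set_limbs n) (fun s' t => t = 8 * n + 1 /\
    (forall y, y < 30 -> regs s' y = regs s y) /\ regs s' 40 = u /\
    regs s' 41 = x / 2 ^ (w * n) /\ word_memory w (mem s') /\ out_only V (mem s) (mem s') /\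
    forall v, field (mem s' OUT) v =
      if (u * 2 ^ ks <=? v) && (v <? u * 2 ^ ks + n)
      then x / 2 ^ (w * (v - u * 2 ^ ks)) mod 2 ^ w else field (mem s OUT) v) s.
Proof.
  intros Hn HS Eu Ex [Sx1 Sx2] HV HV'. induction n.
  - apply wp_skip. split; [reflexivity|]. split; [reflexivity|]. split; [assumption|].
    split; [now rewrite Nat.mul_0_r, Nat.pow_0_r, Nat.div_1_r|].
    split; [apply HS|]. split; [apply out_only_refl|].
    intros v. destruct (Nat.leb_spec (u * 2 ^ ks) v), (Nat.ltb_spec v (u * 2 ^ ks + 0)); simpl; auto; lia.
  - cbn [set_limbs]. apply wp_seq. eapply wp_mono; [apply IHn; lia|].
    intros s1 t1 (-> & F1 & U1 & X1 & W1 & O1 & FD1).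
    assert (HS1 : has_layout s1) by (eapply has_layout_frame; eauto).
    assert (HS1' := HS1). destruct HS1' as (E2 & E13 & E14 & E15 & _).
    assert (WK := (w_le_wK w K HK)).
    assert (Hidx := item_index_lt u n V HV ltac:(lia)).
    assert (Hx1 : x / 2 ^ (w * n) <= x) by
      (apply Nat.Div0.div_le_upper_bound; assert (P := pow2_pos (w * n)); nia).
    assert (Kw : K < 2 ^ w) by lia.
    assert (Hks' : 2 ^ ks <= 2 ^ (w * K)) by nia.
    assert (ksw : ks <= w * K) by (apply Nat.pow_le_mono_r_iff in Hks'; lia).
    assert (Kks : ks < 2 ^ w).
    { apply Nat.le_lt_trans with (w * K); [assumption|]. nia. }
    apply wp_seq, wp_set with (v := u * 2 ^ ks + n).
    { cbn [safe ev]. rewrite U1. repeat split; auto; lia. }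
    { cbn [ev]. now rewrite U1. }
    apply wp_seq, wp_set with (v := x / 2 ^ (w * n) mod 2 ^ w).
    { apply safe_lowbits; cbn [safe ev]; lookup; rewrite ?X1, ?E2; auto; lia. }
    { rewrite ev_lowbits. cbn [ev]. lookup. now rewrite X1, E2. }
    apply wp_seq. eapply wp_mono.
    { apply wp_set_field with (v := u * 2 ^ ks + n) (x := x / 2 ^ (w * n) mod 2 ^ w);
        lookup; auto; try lia. }
    intros s2 t2 (-> & F2 & M2).
    assert (F2' : forall y, y < 30 -> regs s2 y = regs s1 y).
    { intros y Hy. rewrite F2 by lia. lookup. now rewrite !upd_neq by lia. }
    assert (WM2 : word_memory w (mem s2)).
    { rewrite M2. lookup. apply word_memory_put_field; auto. }
    assert (X2 : regs s2 41 = x / 2 ^ (w * n)) by (rewrite F2 by lia; lookup; assumption).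
    apply wp_set with (v := x / 2 ^ (w * S n)).
    { cbn [safe ev]. rewrite F2' by lia. rewrite E2. auto. }
    { cbn [ev]. rewrite X2, F2' by lia. rewrite E2, Nat.Div0.div_div, <- Nat.pow_add_r.
      do 2 f_equal. lia. }
    split; [lia|]. split; [|split; [|split; [|split; [|split]]]]; lookup.
    + intros y Hy. rewrite upd_neq, F2', F1 by lia. reflexivity.
    + rewrite F2 by lia. lookup. assumption.
    + reflexivity.
    + assumption.
    + apply out_only_trans with (mem s1); auto. rewrite M2. lookup.
      intros k a Ha. unfold upd. destruct (Nat.eqb_spec k OUT) as [->|]; auto.
      unfold put_field, upd. destruct (Nat.eqb_spec a ((u * 2 ^ ks + n) / 2 ^ rho)); auto.
      exfalso. apply Ha. split; auto. eauto.
    + intros v. rewrite M2. lookup. rewrite field_put by (apply Sx2; lia). rewrite FD1.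
      destruct (Nat.eqb_spec v (u * 2 ^ ks + n)) as [->|Hne].
      * destruct (Nat.leb_spec (u * 2 ^ ks) (u * 2 ^ ks + n)); [|lia].
        destruct (Nat.ltb_spec (u * 2 ^ ks + n) (u * 2 ^ ks + S n)); [|lia]. simpl.
        do 4 f_equal. lia.
      * destruct (Nat.leb_spec (u * 2 ^ ks) v), (Nat.ltb_spec v (u * 2 ^ ks + n)),
          (Nat.ltb_spec v (u * 2 ^ ks + S n)); simpl; auto; lia.
Qed.

Lemma wp_set_item s eu ex u x V :
  has_layout s -> safe w K s eu -> safe w K s ex -> ev s eu = u ->
  (forall v, ev (set_reg s 40 v) ex = x) -> (forall v, safe w K (set_reg s 40 v) ex) ->
  storable x -> (u + 1) * 2 ^ ks <= V -> V <= 2 ^ (w * K) ->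
  wp w K (set_item eu ex) (fun s' t => t = 8 * K + 3 /\
    (forall y, y < 30 -> regs s' y = regs s y) /\
    word_memory w (mem s') /\ out_only V (mem s) (mem s') /\
    forall u', item (mem s' OUT) u' = if u' =? u then x else item (mem s OUT) u') s.
Proof.
  intros HS Su Sx Eu Ex Sx' ST HV HV'.
  apply wp_seq, wp_set with (v := u); auto.
  apply wp_seq, wp_set with (v := x); auto.
  eapply wp_mono.
  { apply wp_set_limbs with (u := u) (x := x) (V := V); lookup; auto. }
  intros s' t (-> & F & _ & _ & W & O & FD).
  split; [lia|]. split; [|split; [assumption|split; [assumption|]]].
  - intros y Hy. rewrite F by assumption. lookup. now rewrite !upd_neq by lia.
  - intros u'. unfold item. destruct (Nat.eqb_spec u' u) as [->|Hne].
    + destruct ST as [S1 S2]. transitivity (x mod 2 ^ (w * K)); [|now apply Nat.mod_small].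
      rewrite <- limbsum_digits. apply limbsum_ext. intros j Hj. rewrite FD.
      destruct (Nat.leb_spec (u * 2 ^ ks) (u * 2 ^ ks + j)); [|lia].
      destruct (Nat.ltb_spec (u * 2 ^ ks + j) (u * 2 ^ ks + K)); [|lia]. simpl.
      do 4 f_equal. lia.
    + apply limbsum_ext. intros j Hj. rewrite FD.
      destruct (Nat.leb_spec (u * 2 ^ ks) (u' * 2 ^ ks + j)),
        (Nat.ltb_spec (u' * 2 ^ ks + j) (u * 2 ^ ks + K)); simpl; auto.
      exfalso. assert (u' < u \/ u < u') as [?|?] by lia; nia.
Qed.

Lemma limbsum_top g n y :
  y * 2 ^ (w * S n) + limbsum w g (S n) = (y * 2 ^ w + g n) * 2 ^ (w * n) + limbsum w g n.
Proof.
  cbn [limbsum]. replace (w * S n) with (w + w * n) by lia. rewrite Nat.pow_add_r. lia.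
Qed.

Lemma wp_get_limbs n s u y V :
  n <= K -> has_layout s -> regs s 40 = u -> regs s 41 = y -> y < 2 ^ (w * (K - n)) ->
  (u + 1) * 2 ^ ks <= V -> V <= 2 ^ (w * K) ->
  wp w K (get_limbs n) (fun s' t => t = 2 * n + 1 /\
    (forall y, y < 30 -> regs s' y = regs s y) /\ mem s' = mem s /\
    regs s' 41 = y * 2 ^ (w * n) + limbsum w (fun j => field (mem s OUT) (u * 2 ^ ks + j)) n) s.
Proof.
  intros Hn. revert s y. induction n; intros s y HS Eu Ey Hy HV HV'.
  - apply wp_skip. repeat split; auto. rewrite Nat.mul_0_r. simpl. lia.
  - assert (HS' := HS). destruct HS' as (E2 & E13 & E14 & E15 & W).
    assert (WK := (w_le_wK w K HK)).
    assert (Hidx := item_index_lt u n V HV ltac:(lia)).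
    assert (Kw : K < 2 ^ w) by lia.
    assert (Hks' : 2 ^ ks <= 2 ^ (w * K)) by nia.
    assert (ksw : ks <= w * K) by (apply Nat.pow_le_mono_r_iff in Hks'; lia).
    assert (Kks : ks < 2 ^ w).
    { apply Nat.le_lt_trans with (w * K); [assumption|]. nia. }
    cbn [get_limbs]. apply wp_seq, wp_set with (v := u * 2 ^ ks + n).
    { cbn [safe ev]. rewrite Eu. repeat split; auto; lia. }
    { cbn [ev]. now rewrite Eu. }
    set (s1 := set_reg s 30 (u * 2 ^ ks + n)).
    assert (HS1 : has_layout s1).
    { apply has_layout_frame with s; auto. intros z Hz. unfold s1. lookup. now rewrite upd_neq by lia. }
    destruct (safe_get_field s1 (u * 2 ^ ks + n)) as (SG & EG); auto; try lia.
    set (g := fun j => field (mem s OUT) (u * 2 ^ ks + j)).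
    assert (Hg : g n < 2 ^ w).
    { eapply Nat.lt_le_trans; [apply field_lt|]. apply Nat.pow_le_mono_r; [lia|apply HL]. }
    assert (Hy' : y * 2 ^ w + g n < 2 ^ (w * (K - n))).
    { replace (w * (K - n)) with (w * (K - S n) + w) by nia. rewrite Nat.pow_add_r. nia. }
    assert (Hbig : 2 ^ (w * (K - n)) <= 2 ^ (w * K)) by (apply Nat.pow_le_mono_r; nia).
    assert (E41 : regs s1 41 = y) by (unfold s1; lookup; assumption).
    assert (E2' : regs s1 2 = w) by apply HS1.
    apply wp_seq, wp_set with (v := y * 2 ^ w + g n).
    { cbn [safe ev]. rewrite E41, E2', EG. change (mem s1) with (mem s). fold (g n).
      split; [split; [exact I|split; [exact I|split; lia]]|split; [exact SG|lia]]. }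
    { cbn [ev]. rewrite E41, E2', EG. reflexivity. }
    eapply wp_mono.
    { apply IHn with (y := y * 2 ^ w + g n); auto; try lia; lookup; auto. }
    intros s' t (-> & F & M & R). split; [lia|]. split; [|split].
    + intros z Hz. rewrite F by assumption. unfold s1. lookup. now rewrite !upd_neq by lia.
    + exact M.
    + rewrite R, limbsum_top. reflexivity.
Qed.

Lemma wp_get_item s eu u V :
  has_layout s -> safe w K s eu -> ev s eu = u ->
  (u + 1) * 2 ^ ks <= V -> V <= 2 ^ (w * K) ->
  wp w K (get_item eu) (fun s' t => t = 2 * K + 3 /\
    (forall y, y < 30 -> regs s' y = regs s y) /\ mem s' = mem s /\
    regs s' 41 = item (mem s OUT) u) s.
Proof.
  intros HS Su Eu HV HV'.
  apply wp_seq, wp_set with (v := u); auto.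
  apply wp_seq, wp_set with (v := 0); [apply pow2_pos|reflexivity|].
  eapply wp_mono.
  { apply wp_get_limbs with (u := u) (y := 0) (V := V); lookup; auto. apply pow2_pos. }
  intros s' t (-> & F & M & R). split; [lia|]. split; [|split].
  - intros y Hy. rewrite F by assumption. lookup. now rewrite !upd_neq by lia.
  - exact M.
  - exact R.
Qed.

End Layout.

(** * The table *)

Fixpoint popcount (n x : nat) : nat :=
  match n with
  | 0 => 0
  | S n' => popcount n' x + Nat.b2n (Nat.testbit x n')
  end.

Lemma popcount_le n x : popcount n x <= n.
Proof. induction n; simpl; [lia|]. destruct (Nat.testbit x n); simpl; lia. Qed.

(* Keys pack a decoder state and a chunk of [b] bits. *)
Definition key_state (b key : nat) : nat * nat := ((key / 2 ^ b) mod 4, key / 2 ^ b / 4).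

Definition key_bits (b key : nat) : list bool := window (Nat.testbit key) 0 b.

(** Eight header cells, then rows of 2 b cells: the first half summarises the effect of the chunk,
    the second lists its at most b ones. *)
Definition row_of (beta key : nat) : nat := 8 + key * 2 ^ S beta.

(** Counters 0 to b, two bits for the mode, b bits for the chunk. *)
Definition key_count (b : nat) : nat := (b + 1) * 2 ^ (b + 2).

(** Cell 3 depends on the chunk bits alone; through it the same table serves for population counts
    of b-bit masks. *)
Definition good_row (beta : nat) (a : nat -> nat) (key : nat) : Prop :=
  let b := 2 ^ beta in
  let q := key_state b key in
  let bs := key_bits b key in
  let q' := dec_state q bs in
  let row := row_of beta key in
  a row = snd q' * 4 + fst q' /\
  a (row + 1) = dec_total q bs /\
  a (row + 2) = length (dec_ones q bs) /\
  a (row + 3) = popcount b key /\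
  forall j, j < length (dec_ones q bs) -> a (row + b + j) = nth j (dec_ones q bs) 0.

Lemma dec_state_snoc q xs x : dec_state q (xs ++ [x]) = dec_next (dec_state q xs) x.
Proof. now rewrite dec_state_app. Qed.

Lemma dec_total_snoc q xs x :
  dec_total q (xs ++ [x]) = dec_total q xs + dec_gain (dec_state q xs) x.
Proof. rewrite dec_total_app. simpl. lia. Qed.

Lemma dec_ones_snoc q xs x :
  dec_ones q (xs ++ [x]) =
  dec_ones q xs ++ (if dec_emits (dec_state q xs) then [dec_total q xs] else []).
Proof.
  rewrite dec_ones_app. f_equal. simpl. destruct (dec_emits _); simpl; auto.
  f_equal. lia.
Qed.

Lemma window_S f a n : window f a (S n) = window f a n ++ [f (a + n)].
Proof. replace (S n) with (n + 1) by lia. now rewrite window_app. Qed.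

Lemma odd_mod x : x mod 2 ^ 1 = Nat.b2n (Nat.testbit x 0).
Proof. rewrite Nat.bit0_mod. now rewrite Nat.pow_1_r. Qed.

(* Variables: 8 and 9 hold the decoder state, 10 the position, 11 the number of
   ones, 26 the remaining bits, 28 the population count, 29 the bit index. *)
Definition step_cmd : hcmd :=
  HIf (ELt (EVar 8) (ECst 1))
    (HIf (ELt (ECst 0) (EVar 9))
       (HSeq (HSet 9 (ESub (EVar 9) (ECst 1)))
             (HSet 10 (EAdd (EVar 10) (EShl (EVar 30) (EVar 9)))))
       (HSet 8 (EAdd (ECst 1) (EVar 30))))
    (HIf (ELt (EVar 8) (ECst 2))
       (HIf (ELt (ECst 0) (EVar 30))
          (HSeq (HSet 10 (EAdd (EVar 10) (EShl (ECst 1) (EVar 9)))) (HSet 8 (ECst 0)))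
          (HSet 9 (EAdd (EVar 9) (ECst 1))))
       (HSeq (HWrite TAB (EAdd (EAdd (EVar 21) (EVar 4)) (EVar 11)) (EVar 10))
       (HSeq (HSet 11 (EAdd (EVar 11) (ECst 1)))
       (HSeq (HSet 10 (EAdd (EVar 10) (ECst 1)))
       (HSeq (HSet 8 (ECst 0)) (HSet 9 (ECst 0))))))).

Definition bit_cmd : hcmd :=
  HSeq (HSet 30 (lowbits (EVar 26) (ECst 1)))
  (HSeq (HSet 26 (EShr (EVar 26) (ECst 1)))
  (HSeq (HSet 28 (EAdd (EVar 28) (EVar 30)))
  (HSeq step_cmd (HSet 29 (EAdd (EVar 29) (ECst 1)))))).

Definition row_cmd : hcmd :=
  HSeq (HSet 26 (lowbits (EVar 20) (EVar 4)))
  (HSeq (HSet 27 (EShr (EVar 20) (EVar 4)))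
  (HSeq (HSet 9 (EShr (EVar 27) (ECst 2)))
  (HSeq (HSet 8 (lowbits (EVar 27) (ECst 2)))
  (HSeq (HSet 10 (ECst 0))
  (HSeq (HSet 11 (ECst 0))
  (HSeq (HSet 28 (ECst 0))
  (HSeq (HSet 29 (ECst 0))
  (HSeq (HWhile (ELt (EVar 29) (EVar 4)) bit_cmd)
  (HSeq (HWrite TAB (EVar 21) (EAdd (EShl (EVar 9) (ECst 2)) (EVar 8)))
  (HSeq (HWrite TAB (EAdd (EVar 21) (ECst 1)) (EVar 10))
  (HSeq (HWrite TAB (EAdd (EVar 21) (ECst 2)) (EVar 11))
        (HWrite TAB (EAdd (EVar 21) (ECst 3)) (EVar 28))))))))))))).

Definition rows_cmd : hcmd :=
  HSeq (HSet 20 (ECst 0))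
  (HSeq (HSet 21 (ECst 8))
  (HSeq (HSet 25 (EShl (EAdd (EVar 4) (ECst 1)) (EAdd (EVar 4) (ECst 2))))
        (HWhile (ELt (EVar 20) (EVar 25))
           (HSeq row_cmd
           (HSeq (HSet 20 (EAdd (EVar 20) (ECst 1)))
                 (HSet 21 (EAdd (EVar 21) (EShl (ECst 2) (EVar 3))))))))).

Ltac lookup :=
  cbn [regs mem set_reg set_mem]; repeat first [rewrite upd_eq | rewrite upd_neq by discriminate].

Ltac branch H :=
  apply wp_if_lt;
  [assumption | assumption | solve [cbn [safe ev]; auto; lia] | solve [cbn [safe ev]; auto; lia] |
   cbn [ev]; lookup; intros H | cbn [ev]; lookup; intros H].

Section Table.
Context (w K beta : nat).
Context (HK : 8 <= K) (Hw : 4 * (K * w) + 4 * K < 2 ^ w).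
Notation b := (2 ^ beta).
Context (Hb : 4 * b <= w) (Hb8 : 8 <= b) .

Definition in_row (key : nat) (k a : nat) : Prop :=
  k = TAB /\ row_of beta key <= a < row_of beta (S key).

Definition row_inv (key : nat) (m : memory) (u : nat) (s : state) : Prop :=
  let q := key_state b key in
  let bs := window (Nat.testbit key) 0 u in
  regs s 2 = w /\ regs s 3 = beta /\ regs s 4 = b /\ regs s 20 = key /\
  regs s 21 = row_of beta key /\ regs s 25 = key_count b /\
  regs s 8 = fst (dec_state q bs) /\ regs s 9 = snd (dec_state q bs) /\
  regs s 10 = dec_total q bs /\ regs s 11 = length (dec_ones q bs) /\
  regs s 26 = key mod 2 ^ b / 2 ^ u /\ regs s 28 = popcount u key /\ regs s 29 = u /\
  word_memory w (mem s) /\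
  (forall k a, ~ in_row key k a -> mem s k a = m k a) /\
  forall j, j < length (dec_ones q bs) ->
    mem s TAB (row_of beta key + b + j) = nth j (dec_ones q bs) 0.

(** The reason for taking 4 b at most lg N: the entire table, header included, has at most N
    cells. *)
Lemma key_count_le : key_count b * (2 * b) + 8 <= 2 ^ (4 * b).
Proof.
  unfold key_count. replace (4 * b) with (b + b + b + b) by lia. rewrite !Nat.pow_add_r.
  assert (b < 2 ^ b) by (apply Nat.pow_gt_lin_r; lia).
  assert (2 ^ 8 <= 2 ^ b) by (apply Nat.pow_le_mono_r; lia).
  change (2 ^ 8) with 256 in *. change (2 ^ 2) with 4. set (P := 2 ^ b) in *.
  clearbody P. generalize dependent b. intros x. intros.
  assert ((x + 1) * (P * 4) * (2 * x) + 8 <= P * (P * 4) * (2 * P) + 8) by nia.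
  nia.
Qed.

Lemma word_pow_le : 2 ^ (4 * b) <= 2 ^ w.
Proof. apply Nat.pow_le_mono_r; lia. Qed.

Lemma wp_step s md r p c bt :
  regs s 8 = md -> regs s 9 = r -> regs s 10 = p -> regs s 11 = c -> regs s 30 = Nat.b2n bt ->
  p + 2 ^ r < 2 ^ w -> r < w ->
  regs s 21 + regs s 4 + c + 1 < 2 ^ (w * K) ->
  wp w K step_cmd (fun s' t => t <= 7 /\
    regs s' 8 = fst (dec_next (md, r) bt) /\ regs s' 9 = snd (dec_next (md, r) bt) /\
    regs s' 10 = p + dec_gain (md, r) bt /\
    regs s' 11 = c + Nat.b2n (dec_emits (md, r)) /\
    (forall y, y < 8 \/ 12 <= y -> regs s' y = regs s y) /\
    mem s' = if dec_emits (md, r)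
             then upd (mem s) TAB (upd (mem s TAB) (regs s 21 + regs s 4 + c) p) else mem s) s.
Proof.
  intros E8 E9 E10 E11 E30 Hp Hr Ha.
  assert (WK : 2 ^ w <= 2 ^ (w * K)) by (apply Nat.pow_le_mono_r; nia).
  assert (W2 : 2 < 2 ^ w) by nia. assert (wK : w <= w * K) by nia.
  assert (ww : w < 2 ^ w) by (apply Nat.pow_gt_lin_r; lia).
  assert (B1 : Nat.b2n bt <= 1) by (destruct bt; simpl; lia).
  branch Hmd; rewrite E8 in Hmd.
  - assert (X : md = 0) by lia. rewrite X in E8 |- *.
    replace (dec_emits (0, r)) with false by reflexivity. cbn [Nat.b2n].
    branch Hr0; rewrite E9 in Hr0.
    + destruct r as [|r]; [lia|]. cbn [dec_next dec_gain fst snd].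
      assert (Q : Nat.b2n bt * 2 ^ r <= 2 ^ S r) by (simpl; nia).
      apply wp_seq, wp_set with (v := r);
        [cbn [safe ev]; rewrite ?E9; repeat split; auto; lia | cbn [ev]; rewrite E9; lia |].
      apply wp_set with (v := p + Nat.b2n bt * 2 ^ r).
      { cbn [safe ev]. lookup. rewrite E10, E30. repeat split; auto; lia. }
      { cbn [ev]. lookup. now rewrite E10, E30. }
      lookup. repeat split; auto; try lia.
      intros y Hy. now rewrite !upd_neq by lia.
    + assert (Y : r = 0) by lia. rewrite Y in E9 |- *. cbn [dec_next dec_gain fst snd].
      apply wp_set with (v := 1 + Nat.b2n bt).
      { cbn [safe ev]. rewrite E30. repeat split; auto; lia. }
      { cbn [ev]. now rewrite E30. }
      lookup. destruct bt; cbn [fst snd]; repeat split; auto; try lia;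
        intros y Hy; now rewrite !upd_neq by lia.
  - branch Hmd'; rewrite E8 in Hmd'.
    + assert (X : md = 1) by lia. rewrite X in E8 |- *.
      replace (dec_emits (1, r)) with false by reflexivity. cbn [Nat.b2n].
      branch Hbt; rewrite E30 in Hbt.
      * destruct bt; simpl in Hbt; [|lia]. cbn [dec_next dec_gain fst snd Nat.b2n].
        apply wp_seq, wp_set with (v := p + 1 * 2 ^ r).
        { cbn [safe ev]. rewrite E9, E10. repeat split; auto; lia. }
        { cbn [ev]. now rewrite E9, E10. }
        apply wp_set with (v := 0); [cbn [safe]; lia | reflexivity |].
        lookup. repeat split; auto; try lia.
        intros y Hy. now rewrite !upd_neq by lia.
      * destruct bt; simpl in Hbt; [lia|]. cbn [dec_next dec_gain fst snd Nat.b2n].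
        apply wp_set with (v := S r).
        { cbn [safe ev]. rewrite E9. repeat split; auto; lia. }
        { cbn [ev]. rewrite E9. lia. }
        lookup. repeat split; auto; try lia.
        intros y Hy. now rewrite !upd_neq by lia.
    + destruct md as [|[|md]]; try lia.
      replace (dec_emits (S (S md), r)) with true by reflexivity.
      cbn [dec_next dec_gain fst snd Nat.b2n].
      assert (P := pow2_pos r).
      apply wp_seq, wp_write with (i := regs s 21 + regs s 4 + c) (v := p).
      { cbn [safe ev]. rewrite E11. repeat split; auto; lia. }
      { exact I. }
      { cbn [ev]. now rewrite E11. }
      { cbn [ev]. assumption. }
      { lia. }
      apply wp_seq, wp_set with (v := c + 1).
      { cbn [safe ev]. lookup. rewrite E11. repeat split; auto; lia. }
      { cbn [ev]. lookup. now rewrite E11. }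
      apply wp_seq, wp_set with (v := p + 1).
      { cbn [safe ev]. lookup. rewrite E10. repeat split; auto; lia. }
      { cbn [ev]. lookup. now rewrite E10. }
      apply wp_seq, wp_set with (v := 0); [cbn [safe]; lia | reflexivity |].
      apply wp_set with (v := 0); [cbn [safe]; lia | reflexivity |].
      lookup. repeat split; auto; try lia.
      intros y Hy. now rewrite !upd_neq by lia.
Qed.

Lemma key_state_le key : key < key_count b -> snd (key_state b key) <= b.
Proof.
  unfold key_count, key_state. cbn [snd]. rewrite Nat.Div0.div_div, Nat.pow_add_r.
  change (2 ^ 2) with 4. intros H.
  enough (key / (2 ^ b * 4) < b + 1) by lia.
  apply Nat.Div0.div_lt_upper_bound. lia.
Qed.

Lemma row_bound key : key < key_count b -> row_of beta (S key) <= 2 ^ w.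
Proof.
  intros H. unfold row_of. assert (A := key_count_le). assert (B := word_pow_le).
  rewrite Nat.pow_succ_r'. nia.
Qed.

Lemma dec_key_bounds key u :
  key < key_count b -> u <= b ->
  let bs := window (Nat.testbit key) 0 u in
  dec_total (key_state b key) bs <= b * 2 ^ (2 * b) /\
  snd (dec_state (key_state b key) bs) <= b + u /\
  length (dec_ones (key_state b key) bs) <= u.
Proof.
  intros Hk Hu bs. assert (R := key_state_le key Hk).
  assert (L : length bs = u) by apply window_length.
  assert (A := dec_total_le (key_state b key) bs).
  assert (B := dec_state_le (key_state b key) bs).
  assert (C := dec_ones_length (key_state b key) bs). rewrite L in *.
  split; [|lia].
  assert (2 ^ (snd (key_state b key) + u) <= 2 ^ (2 * b)) by (apply Nat.pow_le_mono_r; lia).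
  nia.
Qed.

Lemma small_pow : b * 2 ^ (2 * b) + 2 ^ (2 * b) < 2 ^ w.
Proof.
  apply Nat.lt_le_trans with (2 ^ (4 * b)); [|apply word_pow_le].
  replace (4 * b) with (b + b + 2 * b) by lia. rewrite !(Nat.pow_add_r 2 _ (2 * b)), Nat.pow_add_r.
  assert (b < 2 ^ b) by (apply Nat.pow_gt_lin_r; lia).
  assert (P := pow2_pos (2 * b)).
  assert (E : (b + 1) * 2 ^ (2 * b) <= 2 ^ b * 2 ^ (2 * b)) by (apply Nat.mul_le_mono_r; lia).
  assert (2 ^ b * 2 ^ (2 * b) < 2 ^ b * 2 ^ b * 2 ^ (2 * b)); [|lia].
  apply Nat.mul_lt_mono_pos_r; nia.
Qed.

Lemma wp_bit key m u s :
  key < key_count b -> u < b -> row_inv key m u s ->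
  wp w K bit_cmd (fun s' t => t <= 11 /\ row_inv key m (S u) s') s.
Proof.
  intros Hk Hu (E2 & E3 & E4 & E20 & E21 & E25 & E8 & E9 & E10 & E11 & E26 & E28 & E29 & WM & M & T).
  destruct (dec_key_bounds key u Hk ltac:(lia)) as (B1 & B2 & B3).
  set (q := key_state b key) in *. set (bs := window (Nat.testbit key) 0 u) in *.
  assert (WK : 2 ^ w + 2 ^ w <= 2 ^ (w * K)).
  { change (2 ^ w + 2 ^ w) with (2 * 2 ^ w) || replace (2 ^ w + 2 ^ w) with (2 ^ S w) by (simpl; lia).
    apply Nat.pow_le_mono_r; nia. }
  assert (wK : w <= w * K) by nia.
  assert (ww : w < 2 ^ w) by (apply Nat.pow_gt_lin_r; lia).
  assert (SP := small_pow). assert (RB := row_bound key Hk).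
  assert (Ebit : (key mod 2 ^ b / 2 ^ u) mod 2 ^ 1 = Nat.b2n (Nat.testbit key u)).
  { rewrite odd_mod. f_equal. rewrite Nat.div_pow2_bits. now apply Nat.mod_pow2_bits_low. }
  assert (Hx : key mod 2 ^ b / 2 ^ u < 2 ^ w).
  { apply Nat.le_lt_trans with (key mod 2 ^ b).
    - apply Nat.Div0.div_le_upper_bound. assert (P := pow2_pos u). nia.
    - apply Nat.lt_le_trans with (2 ^ b); [apply Nat.mod_upper_bound, Nat.pow_nonzero; lia|].
      apply Nat.pow_le_mono_r; lia. }
  set (bt := Nat.testbit key u) in *.
  assert (PC := popcount_le u key).
  assert (Bt : Nat.b2n bt <= 1) by (destruct bt; simpl; lia).
  apply wp_seq, wp_set with (v := Nat.b2n bt).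
  { apply safe_lowbits; cbn [safe ev]; rewrite ?E26; auto; lia. }
  { rewrite ev_lowbits. cbn [ev]. now rewrite E26. }
  apply wp_seq, wp_set with (v := key mod 2 ^ b / 2 ^ S u).
  { cbn [safe ev]. lookup. repeat split; auto; lia. }
  { cbn [ev]. lookup. rewrite E26, Nat.Div0.div_div, <- Nat.pow_add_r. do 2 f_equal. lia. }
  apply wp_seq, wp_set with (v := popcount (S u) key).
  { cbn [safe ev]. lookup. rewrite E28. repeat split; auto; lia. }
  { cbn [ev]. lookup. rewrite E28. reflexivity. }
  apply wp_seq. eapply wp_mono.
  { apply wp_step with (md := fst (dec_state q bs)) (r := snd (dec_state q bs))
      (p := dec_total q bs) (c := length (dec_ones q bs)) (bt := bt); lookup; auto; try lia.
    - assert (2 ^ snd (dec_state q bs) <= 2 ^ (2 * b)) by (apply Nat.pow_le_mono_r; lia). lia.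
    - rewrite E21, E4. unfold row_of in *. rewrite Nat.pow_succ_r' in *. nia. }
  rewrite <- surjective_pairing.
  intros s1 t1 (Ht & F8 & F9 & F10 & F11 & F & FM). revert FM. lookup. intros FM.
  apply wp_set with (v := S u).
  { cbn [safe ev]. rewrite F by lia. lookup. rewrite E29. repeat split; auto; lia. }
  { cbn [ev]. rewrite F by lia. lookup. rewrite E29. lia. }
  split; [lia|]. unfold row_inv. fold q.
  rewrite window_S, dec_state_snoc, dec_total_snoc, dec_ones_snoc. fold bs. cbn [Nat.add]. fold bt.
  assert (HR : row_of beta key + b + length (dec_ones q bs) < row_of beta (S key)).
  { unfold row_of. rewrite Nat.pow_succ_r'. nia. }
  assert (Epos : length (dec_ones q bs ++ (if dec_emits (dec_state q bs) then [dec_total q bs] else []))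
     = length (dec_ones q bs) + Nat.b2n (dec_emits (dec_state q bs))).
  { rewrite length_app. now destruct (dec_emits _). }
  rewrite Epos. lookup.
  rewrite (F 2), (F 3), (F 4), (F 20), (F 21), (F 25), (F 26), (F 28) by lia. lookup.
  do 13 (split; [assumption || reflexivity|]).
  rewrite E21, E4 in FM. split; [|split].
  - rewrite FM. destruct (dec_emits _); auto. apply word_memory_upd; auto. lia.
  - intros k a Ha. rewrite FM. destruct (dec_emits _); auto.
    unfold upd. destruct (Nat.eqb_spec k TAB) as [->|]; auto.
    destruct (Nat.eqb_spec a (row_of beta key + b + length (dec_ones q bs))); auto.
    exfalso. apply Ha. split; auto. lia.
  - intros j Hj. rewrite FM. destruct (dec_emits (dec_state q bs)); simpl in Hj.
    + rewrite upd_eq. destruct (Nat.eq_dec j (length (dec_ones q bs))) as [->|].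
      * rewrite upd_eq, app_nth2, Nat.sub_diag by lia. reflexivity.
      * rewrite upd_neq, app_nth1 by lia. apply T. lia.
    + rewrite app_nil_r. apply T. lia.
Qed.

Definition row_pre (key : nat) (s : state) : Prop :=
  regs s 2 = w /\ regs s 3 = beta /\ regs s 4 = b /\ regs s 20 = key /\
  regs s 21 = row_of beta key /\ regs s 25 = key_count b /\ word_memory w (mem s).

Lemma wp_row key s :
  key < key_count b -> row_pre key s ->
  wp w K row_cmd (fun s' t => t <= 12 * b + 13 /\ row_pre key s' /\
    good_row beta (mem s' TAB) key /\
    forall k a, ~ in_row key k a -> mem s' k a = mem s k a) s.
Proof.
  intros Hk (E2 & E3 & E4 & E20 & E21 & E25 & WM).
  assert (WK : 2 ^ w + 2 ^ w <= 2 ^ (w * K)).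
  { replace (2 ^ w + 2 ^ w) with (2 ^ S w) by (simpl; lia). apply Nat.pow_le_mono_r; nia. }
  assert (wK : w <= w * K) by nia.
  assert (ww : w < 2 ^ w) by (apply Nat.pow_gt_lin_r; lia).
  assert (RB := row_bound key Hk).
  assert (HkW : key < 2 ^ w).
  { unfold row_of in RB. rewrite Nat.pow_succ_r' in RB. nia. }
  assert (Hdiv : key / 2 ^ b <= key).
  { apply Nat.Div0.div_le_upper_bound. assert (P := pow2_pos b). nia. }
  apply wp_seq, wp_set with (v := key mod 2 ^ b).
  { apply safe_lowbits; cbn [safe ev]; rewrite ?E20, ?E4; auto; lia. }
  { rewrite ev_lowbits. cbn [ev]. now rewrite E20, E4. }
  apply wp_seq, wp_set with (v := key / 2 ^ b).
  { cbn [safe ev]; lookup. rewrite E4. repeat split; auto; lia. }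
  { cbn [ev]. lookup. now rewrite E20, E4. }
  apply wp_seq, wp_set with (v := key / 2 ^ b / 4).
  { cbn [safe ev]; lookup. repeat split; auto; lia. }
  { cbn [ev]. lookup. reflexivity. }
  apply wp_seq, wp_set with (v := (key / 2 ^ b) mod 4).
  { apply safe_lowbits; cbn [safe ev]; lookup; auto; lia. }
  { rewrite ev_lowbits. cbn [ev]. lookup. reflexivity. }
  do 4 (apply wp_seq, wp_set with (v := 0); [apply pow2_pos | reflexivity |]).
  apply wp_seq. eapply wp_mono.
  { apply wp_while_lt with (I := row_inv key (mem s)) (n := b) (T := 11); auto.
    - intros u s1 Hu HI. assert (HI' := HI).
      destruct HI' as (_ & _ & F4 & _ & _ & _ & _ & _ & _ & _ & _ & _ & F29 & _).
      cbn [safe ev]. rewrite F4, F29. repeat split; auto. apply wp_bit; auto.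
    - intros s1 (_ & _ & F4 & _ & _ & _ & _ & _ & _ & _ & _ & _ & F29 & _).
      cbn [safe ev]. rewrite F4, F29. repeat split; auto.
    - unfold row_inv. lookup. cbn [window seq map dec_state dec_total dec_ones length].
      rewrite Nat.pow_0_r, Nat.div_1_r.
      repeat split; auto. intros j Hj. inversion Hj. }
  intros s1 t1 (Ht & F2 & F3 & F4 & F20 & F21 & F25 & F8 & F9 & F10 & F11 & F26 & F28 & F29 & W1 & M1 & T1).
  destruct (dec_key_bounds key b Hk (le_n _)) as (B1 & B2 & B3).
  set (q := key_state b key) in *. fold (key_bits b key) in *.
  set (bs := key_bits b key) in *.
  (* The two mode bits of a key can also read 3, which no decoder reaches from (0, 0); such rows are
     filled as well, so the bound must cover them. *)
  assert (B4 : fst (dec_state q bs) <= 3).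
  { assert (Hm : (key / 2 ^ b) mod 4 < 4) by (apply Nat.mod_upper_bound; lia).
    assert (G : forall l q, fst q <= 3 -> fst (dec_state q l) <= 3).
    { induction l as [|x l IH]; intros q0 H; simpl; auto. apply IH.
      destruct q0 as [[|[|md]] [|r]], x; simpl; lia. }
    apply G. unfold q, key_state. cbn [fst]. lia. }
  assert (SP := small_pow). assert (PC := popcount_le b key).
  assert (RW : row_of beta (S key) = row_of beta key + 2 * b).
  { unfold row_of. rewrite Nat.pow_succ_r'. lia. }
  assert (W8 : 4 * (2 * b) + 3 < 2 ^ w) by nia.
  apply wp_seq, wp_write with (i := row_of beta key) (v := snd (dec_state q bs) * 4 + fst (dec_state q bs)).
  { exact I. }
  { cbn [safe ev]. rewrite F8, F9. change (2 ^ 2) with 4. repeat split; auto; lia. }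
  { exact F21. }
  { cbn [ev]. rewrite F8, F9. reflexivity. }
  { lia. }
  apply wp_seq, wp_write with (i := row_of beta key + 1) (v := dec_total q bs).
  { cbn [safe ev]. lookup. repeat split; auto; lia. }
  { exact I. }
  { cbn [ev]. lookup. now rewrite F21. }
  { exact F10. }
  { lia. }
  apply wp_seq, wp_write with (i := row_of beta key + 2) (v := length (dec_ones q bs)).
  { cbn [safe ev]. lookup. repeat split; auto; lia. }
  { exact I. }
  { cbn [ev]. lookup. now rewrite F21. }
  { exact F11. }
  { lia. }
  apply wp_write with (i := row_of beta key + 3) (v := popcount b key).
  { cbn [safe ev]. lookup. repeat split; auto; lia. }
  { exact I. }
  { cbn [ev]. lookup. now rewrite F21. }
  { exact F28. }
  { lia. }
  split; [lia|]. split; [|split].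
  - lookup. repeat split; auto. repeat (apply word_memory_upd; [|lia]). exact W1.
  - unfold good_row. fold q bs. lookup.
    repeat split; [..|intros j Hj];
      repeat first [rewrite upd_eq | rewrite upd_neq by lia]; auto.
  - intros k a Ha. unfold in_row in *. lookup. unfold upd.
    destruct (Nat.eqb_spec k TAB) as [->|]; [|apply M1; unfold in_row; tauto].
    repeat match goal with |- context [?x =? ?y] => destruct (Nat.eqb_spec x y); [exfalso; apply Ha; lia|] end.
    apply M1. unfold in_row. tauto.
Qed.

Lemma row_of_mono k1 k2 : k1 <= k2 -> row_of beta k1 <= row_of beta k2.
Proof. intros H. unfold row_of. nia. Qed.

Definition table_size : nat := row_of beta (key_count b).

Lemma good_row_ext a a' key :
  (forall i, row_of beta key <= i < row_of beta (S key) -> a' i = a i) ->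
  good_row beta a key -> good_row beta a' key.
Proof.
  intros H (A & B & C & D & E).
  assert (RW : row_of beta (S key) = row_of beta key + 2 * b).
  { unfold row_of. rewrite Nat.pow_succ_r'. lia. }
  assert (L := dec_ones_length (key_state b key) (key_bits b key)).
  unfold key_bits in L at 2. rewrite window_length in L.
  unfold good_row. repeat split; try (rewrite H by lia; assumption).
  intros j Hj. rewrite H by lia. now apply E.
Qed.

Definition table_inv (m : memory) (n : nat) (s : state) : Prop :=
  row_pre n s /\ (forall key, key < n -> good_row beta (mem s TAB) key) /\
  forall k a, ~ (k = TAB /\ 8 <= a < row_of beta n) -> mem s k a = m k a.

Lemma wp_rows s :
  regs s 2 = w -> regs s 3 = beta -> regs s 4 = b -> word_memory w (mem s) ->
  wp w K rows_cmd (fun s' t => t <= 32 * 2 ^ (4 * b) /\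
    (forall key, key < key_count b -> good_row beta (mem s' TAB) key) /\
    word_memory w (mem s') /\
    forall k a, ~ (k = TAB /\ 8 <= a < table_size) -> mem s' k a = mem s k a) s.
Proof.
  intros E2 E3 E4 WM.
  assert (WK : 2 ^ w + 2 ^ w <= 2 ^ (w * K)).
  { replace (2 ^ w + 2 ^ w) with (2 ^ S w) by (simpl; lia). apply Nat.pow_le_mono_r; nia. }
  assert (wK : w <= w * K) by nia.
  assert (ww : w < 2 ^ w) by (apply Nat.pow_gt_lin_r; lia).
  assert (KC := key_count_le). assert (PW := word_pow_le).
  assert (bb : beta < b) by (apply Nat.pow_gt_lin_r; lia).
  assert (KC' : key_count b < 2 ^ w) by nia.
  apply wp_seq, wp_set with (v := 0); [apply pow2_pos | reflexivity |].
  apply wp_seq, wp_set with (v := 8); [cbn [safe]; lia | reflexivity |].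
  apply wp_seq, wp_set with (v := key_count b).
  { cbn [safe ev]. lookup. rewrite E4. fold (key_count b). repeat split; auto; lia. }
  { cbn [ev]. lookup. now rewrite E4. }
  eapply wp_mono.
  { apply wp_while_lt with (I := table_inv (mem s)) (n := key_count b) (T := 12 * b + 15); auto.
    - intros n s1 Hn (HP & HG & HM). assert (HP' := HP).
      destruct HP' as (_ & F3 & F4 & F20 & F21 & F25 & W1).
      cbn [safe ev]. rewrite F20, F25. do 3 (split; auto).
      apply wp_seq. eapply wp_mono; [apply wp_row; eauto|].
      intros s2 t2 (Ht & (G2 & G3 & G4 & G20 & G21 & G25 & W2) & GR & M2).
      assert (RB := row_bound n Hn).
      assert (RW : row_of beta (S n) = row_of beta n + 2 * b).
      { unfold row_of. rewrite Nat.pow_succ_r'. lia. }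
      apply wp_seq, wp_set with (v := S n).
      { cbn [safe ev]. rewrite G20. repeat split; auto; lia. }
      { cbn [ev]. rewrite G20. lia. }
      apply wp_set with (v := row_of beta (S n)).
      { cbn [safe ev]. lookup. rewrite G21, G3. repeat split; auto; lia. }
      { cbn [ev]. lookup. rewrite G21, G3. lia. }
      split; [lia|]. split; [|split].
      + unfold row_pre. lookup. repeat split; auto.
      + intros key Hkey. lookup. destruct (Nat.eq_dec key n) as [->|]; auto.
        apply good_row_ext with (mem s1 TAB); [|apply HG; lia].
        intros i Hi. apply M2. unfold in_row.
        assert (row_of beta (S key) <= row_of beta n) by (apply row_of_mono; lia). lia.
      + intros k a Ha. lookup. rewrite M2; [apply HM|unfold in_row]; intros (-> & Hr); apply Ha; split; auto; try lia.
        assert (8 <= row_of beta n) by (unfold row_of; lia). lia.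
    - intros s1 (( _ & F3 & F4 & F20 & F21 & F25 & W1) & _).
      cbn [safe ev]. rewrite F20, F25. auto.
    - unfold table_inv, row_pre. lookup.
      split; [repeat split; auto|]. split; [intros key Hkey; lia | auto]. }
  intros s' t (Ht & (_ & _ & _ & _ & _ & _ & W') & HG & HM).
  split; [|split; [assumption|split; [assumption|]]].
  - assert (b < 2 ^ b) by (apply Nat.pow_gt_lin_r; lia). nia.
  - exact HM.
Qed.
End Table.

(** Gives the iteration count of a search loop before the loop is analysed, as [wp_while_lt]
    demands. *)
Lemma least_true (P : nat -> bool) n :
  P n = true -> exists m, m <= n /\ P m = true /\ forall i, i < m -> P i = false.
Proof.
  intros Hn. enough (G : forall k, (forall i, i < k -> P i = false) \/
    exists m, m < k /\ P m = true /\ forall i, i < m -> P i = false).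
  { destruct (G (S n)) as [H|(m & A & B & C)].
    - rewrite H in Hn; [discriminate|lia].
    - exists m. repeat split; auto. lia. }
  induction k; [left; lia|]. destruct IHk as [H|(m & A & B & C)].
  - destruct (P k) eqn:E.
    + right. exists k. auto.
    + left. intros i Hi. destruct (Nat.eq_dec i k) as [->|]; auto. apply H. lia.
  - right. exists m. auto.
Qed.

(** * The preprocessing *)

Section Preprocess.
Context (b0 kp kr : nat).

(** Stops at the least power of two b with N < 2^(8 b). Unless b = 1, its half failed the test,
    whence 2^(4 b) <= N. *)
Definition block_size_cmd : hcmd :=
  HSeq (HSet 3 (ECst 0))
  (HSeq (HSet 4 (ECst 1))
        (HWhile (ELt (EShl (ECst 1) (EShl (EVar 4) (ECst 3))) (EAdd (EVar 24) (ECst 1)))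
           (HSeq (HSet 3 (EAdd (EVar 3) (ECst 1)))
                 (HSet 4 (EShl (EVar 4) (ECst 1)))))).

(** The guard is a conjunction, written as a sum of two bits that exceeds 1. The first comparison
    stops the search after b 2^kr steps, however large [w] is. *)
Definition fields_per_word_cmd : hcmd :=
  HSeq (HSet 25 (ECst 0))
  (HSeq (HSet 27 (EShl (EVar 4) (ECst kr)))
        (HWhile (ELt (ECst 1) (EAdd (ELt (EVar 25) (EVar 27))
             (ELt (EShl (ECst 1) (EAdd (EAdd (EVar 3) (EVar 25)) (ECst (S kp))))
                  (EAdd (EVar 2) (ECst 1)))))
           (HSet 25 (EAdd (EVar 25) (ECst 1))))).

Definition prep_cmd : hcmd :=
  HSeq (HWrite TAB (ECst 0) (EVar 2))
  (HSeq block_size_cmd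
        (HIf (ELt (EVar 4) (ECst b0))
           (HWrite TAB (ECst 1) (ECst 1))
           (HSeq (HWrite TAB (ECst 1) (ECst 0))
           (HSeq (HWrite TAB (ECst 2) (EVar 3))
           (HSeq fields_per_word_cmd
           (HSeq (HWrite TAB (ECst 3) (EVar 25)) rows_cmd)))))).

(* [2^(beta + kp + R) <= w], and [R] is maximal unless it reaches the bound
   [2^(beta + kr)], beyond which the structure never leaves its first word. *)
Definition good_log (w beta R : nat) : Prop :=
  (R = 0 \/ 2 ^ (beta + kp + R) <= w) /\
  (R = 2 ^ beta * 2 ^ kr \/ w < 2 ^ (beta + kp + S R)) /\ R <= 2 ^ beta * 2 ^ kr.

Definition good_tables (w beta : nat) (a : nat -> nat) : Prop :=
  a 0 = w /\ a 1 = 0 /\ a 2 = beta /\ good_log w beta (a 3) /\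
  forall key, key < key_count (2 ^ beta) -> good_row beta a key.

Context (w K : nat) (HK : 8 <= K) (Hw : 4 * (K * w) + 4 * K < 2 ^ w).
Context (Hc : b0 + kp + kr + 16 < w) (Hb0 : 8 <= b0).

Lemma wp_block_size s N :
  regs s 24 = N -> 5 <= N <= 2 ^ w ->
  wp w K block_size_cmd (fun s' t => exists beta, t <= 3 * beta + 3 /\
    regs s' 3 = beta /\ regs s' 4 = 2 ^ beta /\ regs s' 2 = regs s 2 /\ mem s' = mem s /\
    N < 2 ^ (8 * 2 ^ beta) /\ (beta = 0 \/ 2 ^ (4 * 2 ^ beta) <= N)) s.
Proof.
  intros E24 HN.
  destruct (least_true (fun i => N <? 2 ^ (8 * 2 ^ i)) N) as (beta & _ & Hb & Hl).
  { apply Nat.ltb_lt. apply Nat.lt_trans with (2 ^ N); [apply Nat.pow_gt_lin_r; lia|].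
    apply Nat.pow_lt_mono_r; [lia|]. assert (N < 2 ^ N) by (apply Nat.pow_gt_lin_r; lia). lia. }
  apply Nat.ltb_lt in Hb.
  assert (Hl' : forall i, i < beta -> 2 ^ (8 * 2 ^ i) <= N).
  { intros i Hi. apply Hl in Hi. now apply Nat.ltb_ge in Hi. }
  clear Hl.
  (* The guard is evaluated once more at the final exponent, up to twice the last successful one,
     and must not overflow there. *)
  assert (Hs : forall i, i <= beta -> 8 * 2 ^ i <= 8 + 2 * w).
  { intros [|i] Hi; [simpl; lia|]. assert (H := Hl' i Hi).
    assert (8 * 2 ^ i <= w) by (apply (Nat.pow_le_mono_r_iff 2); lia). simpl in *. lia. }
  assert (WK : 2 ^ (w + 1) <= 2 ^ (w * K)) by (apply Nat.pow_le_mono_r; nia).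
  rewrite Nat.pow_add_r, Nat.pow_1_r in WK.
  assert (ww : w < 2 ^ w) by (apply Nat.pow_gt_lin_r; lia).
  assert (wK : 3 * w <= w * K) by nia.
  apply wp_seq, wp_set with (v := 0); [apply pow2_pos | reflexivity |].
  apply wp_seq, wp_set with (v := 1); [cbn [safe]; lia | reflexivity |].
  eapply wp_mono.
  { apply wp_while_lt with (n := beta) (T := 2) (I := fun j s' =>
      regs s' 3 = j /\ regs s' 4 = 2 ^ j /\ regs s' 24 = N /\ regs s' 2 = regs s 2 /\ mem s' = mem s); auto.
    - intros j s1 Hj (F3 & F4 & F24 & F2 & M). cbn [safe ev]. rewrite F4, F24.
      change (2 ^ 3) with 8. assert (A := Hl' j Hj). assert (B := Hs j ltac:(lia)).
      replace (2 ^ j * 8) with (8 * 2 ^ j) by lia.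
      assert (X : 8 * 2 ^ j < 2 ^ (w * K)) by nia.
      assert (Y : 8 * 2 ^ j <= w * K) by nia.
      split; [repeat split; auto; lia|]. split; [repeat split; auto; lia|]. split; [lia|].
      apply wp_seq, wp_set with (v := S j).
      { cbn [safe ev]. rewrite F3. assert (j < 2 ^ j) by (apply Nat.pow_gt_lin_r; lia).
        repeat split; auto; lia. }
      { cbn [ev]. lia. }
      apply wp_set with (v := 2 ^ S j).
      { cbn [safe ev]. lookup. rewrite F4, Nat.pow_1_r. repeat split; auto; lia. }
      { cbn [ev]. lookup. rewrite F4. simpl. lia. }
      lookup. repeat split; auto; lia.
    - intros s1 (F3 & F4 & F24 & F2 & M). cbn [safe ev]. rewrite F4, F24.
      change (2 ^ 3) with 8. assert (B := Hs beta ltac:(lia)).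
      replace (2 ^ beta * 8) with (8 * 2 ^ beta) by lia.
      assert (X : 8 * 2 ^ beta < 2 ^ (w * K)) by nia.
      assert (Y : 8 * 2 ^ beta < w * K) by nia.
      assert (Z : 2 ^ (8 * 2 ^ beta) < 2 ^ (w * K)) by (apply Nat.pow_lt_mono_r; lia).
      split; [repeat split; auto; lia|]. split; [repeat split; auto; lia|]. lia. }
  intros s' t (Ht & F3 & F4 & F24 & F2 & M). exists beta.
  repeat split; auto; try lia.
  destruct beta as [|i]; [auto|right]. assert (A := Hl' i ltac:(lia)).
  replace (4 * 2 ^ S i) with (8 * 2 ^ i) by (simpl; lia). exact A.
Qed.

Lemma wp_fields_per_word s beta :
  regs s 2 = w -> regs s 3 = beta -> regs s 4 = 2 ^ beta -> 4 * 2 ^ beta <= w ->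
  wp w K fields_per_word_cmd (fun s' t => exists R, t <= 2 * (2 ^ beta * 2 ^ kr) + 3 /\
    regs s' 25 = R /\ good_log w beta R /\ R < 2 ^ w /\
    regs s' 2 = w /\ regs s' 3 = beta /\ regs s' 4 = 2 ^ beta /\ mem s' = mem s) s.
Proof.
  intros E2 E3 E4 Hb. set (cap := 2 ^ beta * 2 ^ kr).
  assert (WK : 2 ^ (w + w + w) <= 2 ^ (w * K)) by (apply Nat.pow_le_mono_r; nia).
  assert (wK : 3 * w <= w * K) by nia.
  assert (WK' : 2 ^ w * 2 < 2 ^ (w * K)).
  { eapply Nat.lt_le_trans; [|exact WK]. rewrite Nat.mul_comm, <- Nat.pow_succ_r'.
    apply Nat.pow_lt_mono_r; lia. }
  assert (ww : w < 2 ^ w) by (apply Nat.pow_gt_lin_r; lia).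
  assert (bw : beta < w).
  { assert (beta < 2 ^ beta) by (apply Nat.pow_gt_lin_r; lia). lia. }
  assert (krw : 2 ^ kr <= 2 ^ w) by (apply Nat.pow_le_mono_r; lia).
  assert (Hcap : cap < 2 ^ (w * K)).
  { eapply Nat.lt_le_trans; [|exact WK]. rewrite !Nat.pow_add_r. unfold cap. nia. }
  destruct (least_true (fun i => negb ((i <? cap) && (2 ^ (beta + i + S kp) <? w + 1))) cap)
    as (R & HR & Hf & Hl).
  { now rewrite Nat.ltb_irrefl. }
  assert (Hl' : forall i, i < R -> i < cap /\ 2 ^ (beta + i + S kp) <= w).
  { intros i Hi. apply Hl in Hi. apply negb_false_iff, andb_true_iff in Hi.
    rewrite !Nat.ltb_lt in Hi. lia. }
  assert (Hs : forall i, i <= R -> i <= w /\ beta + i + S kp <= 3 * w /\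
    2 ^ (beta + i + S kp) < 2 ^ (w * K)).
  { intros i Hi. assert (i <= w).
    { destruct i; [lia|]. destruct (Hl' i Hi) as [_ A].
      assert (beta + i + S kp < 2 ^ (beta + i + S kp)) by (apply Nat.pow_gt_lin_r; lia). lia. }
    split; [assumption|]. split; [lia|].
    eapply Nat.lt_le_trans; [|exact WK]. apply Nat.pow_lt_mono_r; lia. }
  apply wp_seq, wp_set with (v := 0); [apply pow2_pos | reflexivity |].
  apply wp_seq, wp_set with (v := cap).
  { cbn [safe ev]. lookup. rewrite E4. fold cap. repeat split; auto; lia. }
  { cbn [ev]. lookup. now rewrite E4. }
  assert (G : forall j s1, j <= R -> regs s1 25 = j /\ regs s1 27 = cap /\ regs s1 2 = w /\ regs s1 3 = beta ->
    let cond := EAdd (ELt (EVar 25) (EVar 27))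
             (ELt (EShl (ECst 1) (EAdd (EAdd (EVar 3) (EVar 25)) (ECst (S kp))))
                  (EAdd (EVar 2) (ECst 1))) in
    safe w K s1 cond /\ ev s1 cond = Nat.b2n (j <? cap) + Nat.b2n (2 ^ (beta + j + S kp) <? w + 1)).
  { intros j s1 Hj (F25 & F27 & F2 & F3) cond. unfold cond. cbn [safe ev]. rewrite F25, F27, F2, F3.
    destruct (Hs j Hj) as (A & B & C). rewrite Nat.mul_1_l.
    split; [|reflexivity].
    assert (D : Nat.b2n (j <? cap) + Nat.b2n (2 ^ (beta + j + S kp) <? w + 1) <= 2)
      by (assert (T : forall x, Nat.b2n x <= 1) by (intros []; simpl; lia);
          assert (T1 := T (j <? cap)); assert (T2 := T (2 ^ (beta + j + S kp) <? w + 1)); lia).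
    repeat split; auto; lia. }
  eapply wp_mono.
  { apply wp_while_lt with (n := R) (T := 1) (I := fun j s' => j <= R /\ (
      regs s' 25 = j /\ regs s' 27 = cap /\ regs s' 2 = w /\ regs s' 3 = beta) /\
      regs s' 4 = 2 ^ beta /\ mem s' = mem s); auto.
    - intros j s1 Hj (HjR & HF & F4 & M). destruct (G j s1 HjR HF) as (A & B).
      destruct (Hl' j Hj) as (C & D).
      split; [cbn [safe]; lia|]. split; [exact A|]. split.
      { rewrite B. cbn [ev]. destruct (Nat.ltb_spec j cap); [|lia].
        destruct (Nat.ltb_spec (2 ^ (beta + j + S kp)) (w + 1)); simpl; lia. }
      destruct HF as (F25 & F27 & F2 & F3). destruct (Hs j ltac:(lia)) as (X & _).
      apply wp_set with (v := S j).
      { cbn [safe ev]. rewrite F25. repeat split; auto; lia. }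
      { cbn [ev]. lia. }
      lookup. repeat split; auto.
    - intros s1 (_ & HF & _). destruct (G R s1 (le_n _) HF) as (A & B).
      split; [cbn [safe]; lia|]. split; [exact A|]. rewrite B. cbn [ev].
      apply negb_true_iff, andb_false_iff in Hf.
      assert (T : forall x, Nat.b2n x <= 1) by (intros []; simpl; lia).
      assert (T1 := T (R <? cap)). assert (T2 := T (2 ^ (beta + R + S kp) <? w + 1)).
      destruct Hf as [Hf|Hf]; rewrite Hf in *; simpl Nat.b2n in *; lia.
    - lookup. repeat split; auto. lia. }
  intros s' t (Ht & _ & (F25 & F27 & F2 & F3) & F4 & M). exists R.
  split; [lia|]. split; [assumption|]. split; [|split].
  - unfold good_log. fold cap. split; [|split; [|assumption]].
    + destruct R as [|R]; [auto|right]. destruct (Hl' R ltac:(lia)) as (_ & A).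
      replace (beta + kp + S R) with (beta + R + S kp) by lia. exact A.
    + apply negb_true_iff, andb_false_iff in Hf. destruct Hf as [Hf|Hf]; apply Nat.ltb_ge in Hf.
      * left. lia.
      * right. replace (beta + kp + S R) with (beta + R + S kp) by lia. lia.
  - destruct (Hs R (le_n _)). lia.
  - auto.
Qed.

Lemma wp_prep s N :
  regs s 2 = w -> regs s 24 = N -> 5 <= N <= 2 ^ w -> word_memory w (mem s) ->
  wp w K prep_cmd (fun s' t => exists beta, t <= (2 * 2 ^ kr + 60) * N /\
    N < 2 ^ (8 * 2 ^ beta) /\
    (2 ^ beta < b0 /\ mem s' TAB 0 = w /\ mem s' TAB 1 = 1 /\
      (forall k a, ~ (k = TAB /\ a < 2) -> mem s' k a = mem s k a) \/
     b0 <= 2 ^ beta /\ 2 ^ (4 * 2 ^ beta) <= N /\ good_tables w beta (mem s' TAB) /\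
      (forall k a, ~ (k = TAB /\ a < table_size beta) -> mem s' k a = mem s k a))) s.
Proof.
  intros E2 E24 HN WM.
  assert (ww : w < 2 ^ w) by (apply Nat.pow_gt_lin_r; lia).
  apply wp_seq, wp_write with (i := 0) (v := w); auto; try (cbn [safe]; lia).
  apply wp_seq. eapply wp_mono.
  { apply wp_block_size with (N := N); auto. }
  intros s1 t1 (beta & Ht1 & F3 & F4 & F2 & M & HN1 & HN2).
  revert F2 M. lookup. rewrite E2. intros F2 M.
  assert (WM1 : word_memory w (mem s1)) by (rewrite M; apply word_memory_upd; auto; lia).
  assert (bb : beta < 2 ^ beta) by (apply Nat.pow_gt_lin_r; lia).
  assert (K2 := pow2_pos kr).
  apply wp_if_lt; [assumption|assumption|exact I|cbn [safe]; lia| |]; cbn [ev]; rewrite F4; intros Hb.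
  - apply wp_write with (i := 1) (v := 1); auto; try (cbn [safe]; lia); try lia.
    exists beta. split; [|split; [assumption|left]].
    + assert (beta <= N).
      { destruct HN2 as [->|HN2]; [lia|].
        assert (4 * 2 ^ beta < 2 ^ (4 * 2 ^ beta)) by (apply Nat.pow_gt_lin_r; lia). lia. }
      nia.
    + split; [assumption|]. lookup. rewrite M. lookup. repeat split; auto.
      intros k a Ha. unfold upd. destruct (Nat.eqb_spec k TAB) as [->|]; auto.
      destruct (Nat.eqb_spec a 1); [exfalso; apply Ha; lia|].
      destruct (Nat.eqb_spec a 0); [exfalso; apply Ha; lia|]. reflexivity.
  - destruct HN2 as [->|HN2]; [simpl in Hb; lia|].
    assert (H4w : 4 * 2 ^ beta <= w) by (apply (Nat.pow_le_mono_r_iff 2); lia).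
    apply wp_seq, wp_write with (i := 1) (v := 0); auto; try (cbn [safe]; lia); try lia.
    apply wp_seq, wp_write with (i := 2) (v := beta); auto; try (cbn [safe]; lia); try lia.
    apply wp_seq. eapply wp_mono.
    { apply wp_fields_per_word with (beta := beta); lookup; auto. }
    intros s2 t2 (R & Ht2 & G25 & GL & GR & G2 & G3 & G4 & M2).
    revert M2. lookup. intros M2.
    apply wp_seq, wp_write with (i := 3) (v := R); auto; try (cbn [safe]; lia).
    set (s3 := set_mem s2 TAB 3 R).
    assert (WM3 : word_memory w (mem s3)).
    { unfold s3. lookup. apply word_memory_upd; auto. rewrite M2.
      intros k a. assert (W1 := WM1 k a). assert (W2 := WM1 TAB a). unfold upd.
      repeat match goal with |- context [?x =? ?y] => destruct (x =? y) end; lia. }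
    eapply wp_mono; [apply wp_rows with (beta := beta); auto; lia|].
    intros s' t (Ht & HG & WM' & M').
    exists beta. split; [|split; [assumption|right]].
    + assert (4 * 2 ^ beta < 2 ^ (4 * 2 ^ beta)) by (apply Nat.pow_gt_lin_r; lia). nia.
    + split; [assumption|]. split; [assumption|]. split.
      * unfold good_tables. rewrite !M' by lia. unfold s3. lookup. rewrite M2. lookup.
        rewrite M. lookup. do 3 (split; [reflexivity|]). split; [exact GL|exact HG].
      * assert (8 <= table_size beta) by (unfold table_size, row_of; lia).
        intros k a Ha. rewrite M' by lia. unfold s3. lookup.
        rewrite M2. lookup. rewrite M. unfold upd.
        destruct (Nat.eqb_spec k TAB) as [->|]; auto.
        repeat match goal with |- context [?x =? ?y] =>
          destruct (Nat.eqb_spec x y); [try (exfalso; apply Ha; lia)|try tauto] end.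
Qed.

End Preprocess.

(** * Scanning the encoding *)

Module Scan.

Lemma div_mod_unique a b q r : r < b -> a = q * b + r -> a / b = q /\ a mod b = r.
Proof.
  intros Hr ->. split.
  - rewrite Nat.div_add_l, Nat.div_small; lia.
  - rewrite Nat.add_comm, Nat.Div0.mod_add. now apply Nat.mod_small.
Qed.

Lemma le_mul_of_pos x y z : 0 < y -> x * y <= z -> x <= z.
Proof. nia. Qed.

Lemma seq_add_map x y : seq x y = map (Nat.add x) (seq 0 y).
Proof.
  revert x. induction y; intros x; auto. cbn [seq map]. rewrite Nat.add_0_r. f_equal.
  rewrite (IHy (S x)), <- seq_shift, map_map. apply map_ext. intros. lia.
Qed.

(** Two words are joined because b need not divide [w] and a chunk may straddle them. The counter
    enters the key capped at b; variable 23 keeps the excess. *)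
Definition next_chunk_cmd : hcmd :=
  HSeq (HSet 30 (EShr (EAdd (ERd INP (EVar 6))
                            (EShl (ERd INP (EAdd (EVar 6) (ECst 1))) (EVar 2))) (EVar 7)))
  (HSeq (HSet 31 (lowbits (EVar 30) (EVar 4)))
  (HSeq (HIf (ELt (EVar 4) (EVar 9)) (HSet 32 (EVar 4)) (HSet 32 (EVar 9)))
  (HSeq (HSet 23 (ESub (EVar 9) (EVar 32)))
  (HSeq (HSet 20 (EAdd (EShl (EAdd (EShl (EVar 32) (ECst 2)) (EVar 8)) (EVar 4)) (EVar 31)))
  (HSeq (HSet 21 (EAdd (ECst 8) (EShl (EVar 20) (EAdd (EVar 3) (ECst 1)))))
        (HSet 22 (ERd TAB (EAdd (EVar 21) (ECst 2))))))))).

(** The excess scales the gain and is added back to the new counter. Word index and offset, in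
    variables 6 and 7, are carried along because division by [w] is not a shift. *)
Definition advance_cmd : hcmd :=
  HSeq (HSet 10 (EAdd (EVar 10) (EShl (ERd TAB (EAdd (EVar 21) (ECst 1))) (EVar 23))))
  (HSeq (HSet 11 (EAdd (EVar 11) (EVar 22)))
  (HSeq (HSet 24 (ERd TAB (EVar 21)))
  (HSeq (HSet 8 (lowbits (EVar 24) (ECst 2)))
  (HSeq (HSet 9 (EAdd (EShr (EVar 24) (ECst 2)) (EVar 23)))
  (HSeq (HSet 7 (EAdd (EVar 7) (EVar 4)))
  (HSeq (HIf (ELt (EVar 7) (EVar 2)) HSkip
           (HSeq (HSet 7 (ESub (EVar 7) (EVar 2))) (HSet 6 (EAdd (EVar 6) (ECst 1)))))
        (HSet 5 (EAdd (EVar 5) (EVar 4))))))))).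

Definition rewind_cmd : hcmd :=
  HSeq (HSet 5 (ECst 0)) (HSeq (HSet 6 (ECst 0)) (HSeq (HSet 7 (ECst 0))
  (HSeq (HSet 8 (ECst 0)) (HSeq (HSet 9 (ECst 0)) (HSeq (HSet 10 (ECst 0)) (HSet 11 (ECst 0))))))).

Definition scan_cmd (hook : hcmd) : hcmd :=
  HSeq rewind_cmd
    (HWhile (ELt (EVar 5) (EVar 0)) (HSeq next_chunk_cmd (HSeq hook advance_cmd))).

Section Scan.
Context (w K c kp kr beta : nat) (tab : nat -> nat) (A : list bool) (inp : nat -> nat).
Notation b := (2 ^ beta).
Notation n := (length A).
Notation l := (length (senc_mask A)).
Definition stream (j : nat) : bool := Nat.testbit (inp (j / w)) (j mod w).

Definition q_at (j : nat) : nat * nat := dec_state (0, 0) (window stream 0 (j * b)).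
Definition pos_at (j : nat) : nat := dec_total (0, 0) (window stream 0 (j * b)).
Definition ones_at (j : nat) : list nat := dec_ones (0, 0) (window stream 0 (j * b)).
Definition cnt_at (j : nat) : nat := length (ones_at j).
Definition chunk_at (j : nat) : list bool := window stream (j * b) b.

Definition is_key (j key : nat) : Prop :=
  key < key_count b /\ key_state b key = (fst (q_at j), Nat.min (snd (q_at j)) b) /\
  key_bits b key = chunk_at j.

(** For r > b this is [dec_shift] at counter b with offset r - b. By the last clause a chunk that
    produces ones is never scaled, so the relative positions in its row can be used as they
    stand. *)
Lemma dec_chunk md r bs :
  dec_ok (md, r) -> length bs = b ->
  let rr := Nat.min r b in
  dec_state (md, r) bs = (fst (dec_state (md, rr) bs), snd (dec_state (md, rr) bs) + (r - rr)) /\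
  dec_total (md, r) bs = dec_total (md, rr) bs * 2 ^ (r - rr) /\
  dec_ones (md, r) bs = dec_ones (md, rr) bs /\
  (dec_ones (md, rr) bs <> [] -> r <= b).
Proof.
  intros Hq Hlen rr. unfold rr. destruct (Nat.le_gt_cases r b) as [H|H].
  - rewrite (Nat.min_l r b), Nat.sub_diag, Nat.pow_0_r, Nat.add_0_r, Nat.mul_1_r by lia.
    rewrite <- surjective_pairing. auto.
  - rewrite (Nat.min_r r b) by lia.
    assert (Hmd : md <= 1) by (destruct Hq as [Hq|Hq]; [exact Hq|inversion Hq; lia]).
    destruct (dec_shift bs md b (r - b) Hmd ltac:(lia)) as (X & Y & Z).
    destruct (dec_shift bs md b 0 Hmd ltac:(lia)) as (_ & _ & Z').
    rewrite Nat.add_0_r in Z'. replace (b + (r - b)) with r in * by lia.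
    rewrite Z, Z'. repeat split; auto. tauto.
Qed.

Lemma window_chunk_S j : window stream 0 (S j * b) = window stream 0 (j * b) ++ chunk_at j.
Proof. unfold chunk_at. rewrite <- window_app. f_equal. lia. Qed.

Lemma at_0 : q_at 0 = (0, 0) /\ pos_at 0 = 0 /\ ones_at 0 = [].
Proof. unfold q_at, pos_at, ones_at. cbn. auto. Qed.

Lemma q_at_ok j : dec_ok (q_at j).
Proof. apply dec_ok_state. left. simpl. lia. Qed.

Lemma chunk_length j : length (chunk_at j) = b.
Proof. apply window_length. Qed.

Lemma chunk_step j key :
  is_key j key ->
  let q' := dec_state (key_state b key) (key_bits b key) in
  let e := snd (q_at j) - b in
  q_at (S j) = (fst q', snd q' + e) /\
  pos_at (S j) = pos_at j + dec_total (key_state b key) (key_bits b key) * 2 ^ e /\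
  ones_at (S j) = ones_at j ++ map (Nat.add (pos_at j)) (dec_ones (key_state b key) (key_bits b key)) /\
  (dec_ones (key_state b key) (key_bits b key) <> [] -> snd (q_at j) <= b).
Proof.
  intros (H1 & H2 & H3) q' e. unfold q'. rewrite H2, H3.
  assert (Hq := q_at_ok j). destruct (q_at j) as [md r] eqn:E. cbn [fst snd] in *.
  destruct (dec_chunk md r (chunk_at j) Hq (chunk_length j)) as (X & Y & Z & U).
  replace (r - Nat.min r b) with e in * by (unfold e; lia).
  unfold q_at, pos_at, ones_at in *. rewrite window_chunk_S.
  rewrite dec_state_app, dec_total_app, dec_ones_app, E. rewrite <- X, <- Y, <- Z.
  repeat split; auto. now rewrite <- Z in U.
Qed.

Context (Hp : packed w inp (senc_mask A)).

Lemma stream_senc j : j < l -> stream j = nth j (senc_mask A) false.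
Proof. intros H. now apply Hp. Qed.

Lemma window_senc k : k <= l -> exists ys, window stream 0 k ++ ys = senc_mask A.
Proof.
  intros H. exists (window (fun j => nth j (senc_mask A) false) k (l - k)).
  rewrite <- (window_nth (senc_mask A)) at 2.
  replace l with (k + (l - k)) at 2 by lia. rewrite window_app. f_equal.
  apply window_ext. intros i Hi. apply stream_senc. lia.
Qed.

Lemma at_bounds j :
  j * b <= l -> pos_at j <= n /\ (0 < snd (q_at j) -> 2 ^ snd (q_at j) <= n).
Proof.
  intros H. destruct (window_senc _ H) as (ys & E). apply (dec_counter_le _ _ _ E).
Qed.

(** At the end of the encoding the decoder is back in state (0, 0), and from there at most b bits of
    padding are read. *)
Lemma at_end_bounds j : l <= j * b <= l + b -> pos_at j <= n + b * 2 ^ b /\ snd (q_at j) <= b.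
Proof.
  intros H. unfold pos_at, q_at. replace (j * b) with (l + (j * b - l)) by lia.
  rewrite window_app. replace (window stream 0 l) with (senc_mask A).
  2:{ rewrite <- (window_nth (senc_mask A)) at 1. apply window_ext. intros. symmetry.
      apply stream_senc. lia. }
  destruct (dec_senc_mask A) as (X & Y & _). rewrite dec_total_app, dec_state_app, X, Y.
  set (bs := window stream (0 + l) (j * b - l)).
  assert (L : length bs = j * b - l) by apply window_length.
  assert (U := dec_total_le (0, 0) bs). assert (V := dec_state_le (0, 0) bs).
  rewrite L in *. cbn [snd Nat.add] in *. split; [|lia].
  assert (2 ^ (j * b - l) <= 2 ^ b) by (apply Nat.pow_le_mono_r; lia). nia.
Qed.

Definition good_memory (m : memory) : Prop :=
  word_memory w m /\ (forall a, a < table_size beta -> m TAB a = tab a) /\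
  forall a, m INP a = inp a.

Definition scanning (j : nat) (s : state) : Prop :=
  regs s 0 = l /\ regs s 2 = w /\ regs s 3 = beta /\ regs s 4 = b /\ regs s 5 = j * b /\
  regs s 6 * w + regs s 7 = j * b /\ regs s 7 < w /\
  regs s 8 = fst (q_at j) /\ regs s 9 = snd (q_at j) /\ regs s 10 = pos_at j /\
  regs s 11 = cnt_at j /\ good_memory (mem s).

Definition in_chunk (j : nat) (s : state) : Prop :=
  scanning j s /\ is_key j (regs s 20) /\ regs s 21 = row_of beta (regs s 20) /\
  regs s 22 = length (dec_ones (key_state b (regs s 20)) (key_bits b (regs s 20))) /\
  regs s 23 = snd (q_at j) - b.

Lemma in_chunk_frame j s s' :
  in_chunk j s -> (forall y, y < 12 \/ 20 <= y < 24 -> regs s' y = regs s y) ->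
  good_memory (mem s') -> in_chunk j s'.
Proof.
  intros (S1 & S2 & S3 & S4 & S5) F G. unfold in_chunk, scanning in *.
  rewrite !F by lia. intuition.
Qed.

Context (HK : 8 <= K) (Hw : 4 * (K * w) + 4 * K < 2 ^ w) (HcK : c + 4 <= K).
Context (Hb : 4 * b <= w) (Hb8 : 8 <= b) (Ht : good_tables kp kr w beta tab).
Context (Hn : n <= 2 ^ (c * w)) (Hl : l <= 2 ^ (c * w)).

(** Counters are not bounded by b, but 2 to the counter is at most n, which makes them legal shift
    amounts. *)
Lemma counter_le j : j * b < l + b -> snd (q_at j) <= w * K /\ snd (q_at j) < 2 ^ w.
Proof.
  intros H. enough (G : snd (q_at j) <= w * K) by nia.
  destruct (Nat.le_gt_cases (j * b) l) as [H'|H'].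
  - destruct (at_bounds j H') as (_ & X).
    destruct (Nat.eq_0_gt_0_cases (snd (q_at j))) as [->|Hr]; [lia|].
    specialize (X Hr). assert (Y : snd (q_at j) <= c * w) by (apply (Nat.pow_le_mono_r_iff 2); lia). nia.
  - destruct (at_end_bounds j ltac:(lia)) as (_ & X). nia.
Qed.

Lemma pos_le j : j * b < l + b -> pos_at j <= 2 ^ (c * w) + b * 2 ^ b.
Proof.
  intros H. destruct (Nat.le_gt_cases (j * b) l) as [H'|H'].
  - destruct (at_bounds j H'). lia.
  - destruct (at_end_bounds j ltac:(lia)). lia.
Qed.

Lemma big_room :
  4 * 2 ^ (c * w) <= 2 ^ (w * K) /\ 4 * 2 ^ w <= 2 ^ (w * K) /\
  4 * (2 ^ w * 2 ^ w) <= 2 ^ (w * K) /\ 3 * w <= w * K.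
Proof.
  change 4 with (2 ^ 2). rewrite <- !Nat.pow_add_r.
  assert (c * w + 4 * w <= w * K) by nia.
  repeat split; try (apply Nat.pow_le_mono_r; nia). nia.
Qed.

Lemma b_pow : b * 2 ^ b < 2 ^ w.
Proof.
  assert (b < 2 ^ b) by (apply Nat.pow_gt_lin_r; lia).
  apply Nat.lt_le_trans with (2 ^ b * 2 ^ b); [nia|].
  rewrite <- Nat.pow_add_r. apply Nat.pow_le_mono_r; lia.
Qed.

Lemma testbit_chunk a o P p :
  a * w + o = P -> o < w -> p < b -> inp a < 2 ^ w ->
  Nat.testbit ((inp a + inp (a + 1) * 2 ^ w) / 2 ^ o) p = stream (P + p).
Proof.
  intros HP Ho Hpb Ha. rewrite Nat.div_pow2_bits, testbit_concat by assumption. unfold stream.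
  destruct (Nat.ltb_spec (p + o) w).
  - destruct (div_mod_unique (P + p) w a (p + o)) as (-> & ->); auto. lia.
  - destruct (div_mod_unique (P + p) w (a + 1) (p + o - w)) as (-> & ->); auto; lia.
Qed.

Lemma compose_key j ch :
  ch < 2 ^ b -> (forall p, p < b -> Nat.testbit ch p = stream (j * b + p)) ->
  is_key j ((Nat.min (snd (q_at j)) b * 4 + fst (q_at j)) * 2 ^ b + ch).
Proof.
  intros Hch Hbits. set (md := fst (q_at j)). set (rr := Nat.min (snd (q_at j)) b).
  assert (Hmd : md < 4).
  { unfold md. destruct (q_at_ok j) as [H|H]; [lia|rewrite H; simpl; lia]. }
  assert (Hrr : rr <= b) by (unfold rr; lia).
  set (key := (rr * 4 + md) * 2 ^ b + ch).
  destruct (div_mod_unique key (2 ^ b) (rr * 4 + md) ch Hch eq_refl) as (D & M).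
  destruct (div_mod_unique (rr * 4 + md) 4 rr md Hmd eq_refl) as (D' & M').
  split; [|split].
  - unfold key_count. rewrite Nat.pow_add_r. change (2 ^ 2) with 4. unfold key. nia.
  - unfold key_state. rewrite D, D', M'. reflexivity.
  - unfold key_bits, chunk_at, window.
    rewrite (seq_add_map (j * b)).
    rewrite map_map. apply map_ext_in. intros p Hp'. apply in_seq in Hp'.
    rewrite <- Hbits by lia. rewrite <- M. symmetry. apply Nat.mod_pow2_bits_low. lia.
Qed.

Lemma table_row key :
  key < key_count b -> row_of beta key + 2 * b <= table_size beta /\ table_size beta <= 2 ^ w.
Proof.
  intros Hk. unfold table_size, row_of. rewrite Nat.pow_succ_r'.
  assert (X := key_count_le w K beta HK Hw Hb Hb8). assert (Y := word_pow_le w K beta HK Hw Hb Hb8). nia.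
Qed.

Lemma wp_next_chunk j s :
  j * b < l -> scanning j s ->
  wp w K next_chunk_cmd (fun s' t => t = 8 /\ in_chunk j s' /\ mem s' = mem s /\
    forall y, 12 <= y < 20 -> regs s' y = regs s y) s.
Proof.
  intros Hj HS. assert (HS' := HS).
  destruct HS' as (E0 & E2 & E3 & E4 & E5 & E67 & E7 & E8 & E9 & E10 & E11 & (WM & MT & MI)).
  destruct big_room as (BR1 & BR2 & BR3 & wK).
  assert (PWw := pow2_pos w). assert (Pcw := pow2_pos (c * w)).
  assert (bw : b < 2 ^ b) by (apply Nat.pow_gt_lin_r; lia).
  assert (ww : w < 2 ^ w) by (apply Nat.pow_gt_lin_r; lia).
  assert (betab : beta < b) by (apply Nat.pow_gt_lin_r; lia).
  destruct (counter_le j ltac:(lia)) as (CL & CL').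
  set (a := regs s 6) in *. set (o := regs s 7) in *.
  assert (Ha : a <= 2 ^ (c * w)) by (assert (a <= a * w) by nia; lia).
  assert (I1 := WM INP a). assert (I2 := WM INP (a + 1)).
  set (x := mem s INP a + mem s INP (a + 1) * 2 ^ w).
  assert (Hx : x < 2 ^ (w * K)).
  { unfold x. assert (mem s INP (a + 1) * 2 ^ w <= 2 ^ w * 2 ^ w) by (apply Nat.mul_le_mono_r; lia). lia. }
  set (ch := x / 2 ^ o mod 2 ^ b).
  assert (Hch : ch < 2 ^ b) by (apply Nat.mod_upper_bound, Nat.pow_nonzero; lia).
  assert (Hbits : forall p, p < b -> Nat.testbit ch p = stream (j * b + p)).
  { intros p Hpb. unfold ch, x. rewrite Nat.mod_pow2_bits_low by assumption.
    rewrite !MI. apply testbit_chunk; auto. rewrite <- MI. apply WM. }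
  assert (Hxo : x / 2 ^ o <= x).
  { apply Nat.Div0.div_le_upper_bound. assert (P := pow2_pos o). nia. }
  set (md := fst (q_at j)) in *. set (r := snd (q_at j)) in *. set (rr := Nat.min r b).
  assert (Key := compose_key j ch Hch Hbits). fold md r rr in Key.
  set (key := (rr * 4 + md) * 2 ^ b + ch) in *.
  destruct (table_row key (proj1 Key)) as (TR & TW).
  assert (Hkey : key < 2 ^ w) by (unfold row_of in TR; rewrite Nat.pow_succ_r' in TR;
    apply Nat.le_lt_trans with (key * (2 * b)); [apply le_mul_of_pos with (2 * b)|]; lia).
  assert (Hrr4 : (rr * 4 + md) * 2 ^ b <= key) by (unfold key; lia).
  assert (Pb := pow2_pos b).
  assert (Hrr4' : rr * 4 + md <= key) by (now apply le_mul_of_pos with (2 ^ b)).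
  apply wp_seq, wp_set with (v := x / 2 ^ o).
  { cbn [safe ev]. fold a o. rewrite E2. fold x. repeat split; auto; unfold x in *; lia. }
  { cbn [ev]. fold a o. rewrite E2. reflexivity. }
  apply wp_seq, wp_set with (v := ch).
  { apply safe_lowbits; cbn [safe ev]; lookup; rewrite ?E4; auto; lia. }
  { rewrite ev_lowbits. cbn [ev]. lookup. now rewrite E4. }
  apply wp_seq.
  apply wp_mono with (fun s' t => t = 2 /\ s' = set_reg (set_reg (set_reg s 30 (x / 2 ^ o)) 31 ch) 32 rr).
  { branch Hlt; rewrite E4, E9 in Hlt; fold r in Hlt;
      apply wp_set with (v := rr); try exact I; cbn [ev]; lookup; auto;
      rewrite ?E4, ?E9; unfold rr; fold r; lia. }
  intros s3 t3 (-> & ->).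
  apply wp_seq, wp_set with (v := r - b).
  { cbn [safe ev]. lookup. rewrite E9. fold r. repeat split; auto. unfold rr. lia. }
  { cbn [ev]. lookup. rewrite E9. fold r. unfold rr. lia. }
  apply wp_seq, wp_set with (v := key).
  { cbn [safe ev]. lookup. rewrite E8, E4. fold md. change (2 ^ 2) with 4. fold key.
    repeat split; auto; try lia. }
  { cbn [ev]. lookup. rewrite E8, E4. reflexivity. }
  apply wp_seq, wp_set with (v := row_of beta key).
  { cbn [safe ev]. lookup. rewrite E3. unfold row_of in TR. rewrite Nat.add_1_r.
    repeat split; auto; lia. }
  { cbn [ev]. lookup. rewrite E3, Nat.add_1_r. reflexivity. }
  apply wp_set with (v := length (dec_ones (key_state b key) (key_bits b key))).
  { cbn [safe ev]. lookup. repeat split; auto; lia. }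
  { cbn [ev]. lookup. rewrite MT by lia.
    destruct Ht as (_ & _ & _ & _ & HG). apply (HG key (proj1 Key)). }
  split; [lia|]. split; [|split].
  - unfold in_chunk, scanning. lookup. fold md r. fold a o.
    split; [|split; [exact Key|split; [reflexivity|split; reflexivity]]].
    repeat (split; [assumption|]). assumption.
  - reflexivity.
  - intros y Hy. lookup. now rewrite !upd_neq by lia.
Qed.

Lemma wp_advance j s :
  j * b < l -> in_chunk j s ->
  wp w K advance_cmd (fun s' t => t <= 11 /\ scanning (S j) s' /\ mem s' = mem s /\
    forall y, 12 <= y < 20 -> regs s' y = regs s y) s.
Proof.
  intros Hj (HS & HKey & E21 & E22 & E23).
  destruct HS as (E0 & E2 & E3 & E4 & E5 & E67 & E7 & E8 & E9 & E10 & E11 & (WM & MT & MI)).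
  destruct (chunk_step j _ HKey) as (C1 & C2 & C3 & C4).
  set (key := regs s 20) in *. set (q := key_state b key) in *. set (bs := key_bits b key) in *.
  set (e := snd (q_at j) - b) in *.
  destruct big_room as (BR1 & BR2 & BR3 & wK). assert (BP := b_pow).
  assert (PWw := pow2_pos w). assert (Pcw := pow2_pos (c * w)).
  destruct (counter_le j ltac:(lia)) as (CL & CL').
  destruct (counter_le (S j) ltac:(lia)) as (CL2 & CL2').
  assert (PL := pos_le j ltac:(lia)). assert (PL2 := pos_le (S j) ltac:(lia)).
  destruct (table_row key (proj1 HKey)) as (TR & TW).
  assert (HG : good_row beta tab key) by (apply Ht; apply HKey).
  destruct HG as (G0 & G1 & G2 & _ & _). fold q bs in G0, G1, G2.
  assert (HD : dec_total q bs * 2 ^ e <= pos_at (S j)) by lia.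
  assert (HPS : pos_at (S j) < 2 ^ (w * K)) by lia.
  assert (He : e <= w * K) by (unfold e; lia).
  assert (Q4 : fst (dec_state q bs) < 4).
  { rewrite C1 in *. assert (X := q_at_ok (S j)). rewrite C1 in X. destruct X as [X|X].
    - simpl in X. lia.
    - inversion X. lia. }
  assert (QW : snd (dec_state q bs) * 4 + fst (dec_state q bs) < 2 ^ w).
  { rewrite <- G0, <- MT by lia. apply WM. }
  assert (cntS : cnt_at (S j) = cnt_at j + length (dec_ones q bs)).
  { unfold cnt_at. rewrite C3, length_app, length_map. reflexivity. }
  assert (cntle : cnt_at (S j) <= S j * b).
  { unfold cnt_at, ones_at. eapply Nat.le_trans; [apply dec_ones_length|].
    rewrite window_length. lia. }
  assert (HSj : S j * b < 2 ^ (w * K) /\ cnt_at (S j) < 2 ^ (w * K)) by lia.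
  assert (Ha : regs s 6 + 1 < 2 ^ (w * K)).
  { assert (regs s 6 <= j * b) by (apply Nat.le_trans with (regs s 6 * w); [apply le_mul_of_pos with w|]; lia). lia. }
  apply wp_seq, wp_set with (v := pos_at (S j)).
  { cbn [safe ev]. rewrite E21, E23, E10, MT, G1 by lia. repeat split; auto; lia. }
  { cbn [ev]. rewrite E21, E23, E10, MT, G1 by lia. symmetry. exact C2. }
  apply wp_seq, wp_set with (v := cnt_at (S j)).
  { cbn [safe ev]. lookup. rewrite E11, E22. repeat split; auto; lia. }
  { cbn [ev]. lookup. rewrite E11, E22. symmetry. exact cntS. }
  apply wp_seq, wp_set with (v := snd (dec_state q bs) * 4 + fst (dec_state q bs)).
  { exact I. }
  { cbn [ev]. lookup. now rewrite E21, MT, G0 by lia. }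
  destruct (div_mod_unique (snd (dec_state q bs) * 4 + fst (dec_state q bs)) 4 _ _ Q4 eq_refl) as (D4 & M4).
  apply wp_seq, wp_set with (v := fst (q_at (S j))).
  { apply safe_lowbits; cbn [safe ev]; lookup; auto; lia. }
  { rewrite ev_lowbits. cbn [ev]. lookup. change (2 ^ 2) with 4. rewrite M4, C1. reflexivity. }
  apply wp_seq, wp_set with (v := snd (q_at (S j))).
  { cbn [safe ev]. lookup. change (2 ^ 2) with 4. rewrite D4, E23.
    rewrite C1 in CL2, CL2'. cbn [snd] in CL2, CL2'. repeat split; auto; lia. }
  { cbn [ev]. lookup. change (2 ^ 2) with 4. rewrite D4, E23, C1. reflexivity. }
  apply wp_seq, wp_set with (v := regs s 7 + b).
  { cbn [safe ev]. lookup. rewrite E4. repeat split; auto; lia. }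
  { cbn [ev]. lookup. now rewrite E4. }
  apply wp_seq.
  (* The common continuation of both branches: the offset stays within the word, or it wraps and the
     word index increases. *)
  assert (HS5 : forall s2 t2, (forall y, y < 8 -> y <> 5 -> y <> 6 -> y <> 7 -> regs s2 y = regs s y) ->
    regs s2 5 = j * b -> regs s2 6 * w + regs s2 7 = S j * b -> regs s2 7 < w ->
    regs s2 8 = fst (q_at (S j)) -> regs s2 9 = snd (q_at (S j)) -> regs s2 10 = pos_at (S j) ->
    regs s2 11 = cnt_at (S j) -> mem s2 = mem s ->
    (forall y, 12 <= y < 20 -> regs s2 y = regs s y) -> t2 <= 4 ->
    wp w K (HSet 5 (EAdd (EVar 5) (EVar 4))) (fun s' t => 1 + (1 + (1 + (1 + (1 + (1 + (t2 + t)))))) <= 11 /\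
      scanning (S j) s' /\ mem s' = mem s /\ (forall y, 12 <= y < 20 -> regs s' y = regs s y)) s2).
  { intros s2 t2 H1 H5 H67 H7 H8 H9 H10 H11 HM HY Ht2.
    apply wp_set with (v := S j * b).
    { cbn [safe ev]. rewrite H5, (H1 4), E4 by lia. repeat split; auto; lia. }
    { cbn [ev]. rewrite H5, (H1 4), E4 by lia. lia. }
    split; [lia|]. split; [|split].
    - unfold scanning. lookup. rewrite HM, (H1 0), (H1 2), (H1 3), (H1 4) by lia.
      repeat (split; [assumption || reflexivity|]). assumption.
    - exact HM.
    - intros y Hy. lookup. rewrite upd_neq by lia. now apply HY. }
  branch Hlt; rewrite E2 in Hlt.
  - apply wp_skip. apply HS5; lookup; auto; try lia.
    + intros y Y0 Y1 Y2 Y3. now rewrite !upd_neq by lia.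
    + intros y Y0. now rewrite !upd_neq by lia.
  - apply wp_seq, wp_set with (v := regs s 7 + b - w).
    { cbn [safe ev]. lookup. rewrite E2. repeat split; auto; lia. }
    { cbn [ev]. lookup. now rewrite E2. }
    apply wp_set with (v := regs s 6 + 1).
    { cbn [safe ev]. lookup. repeat split; auto; lia. }
    { cbn [ev]. lookup. reflexivity. }
    apply HS5; lookup; auto; try lia.
    + intros y Y0 Y1 Y2 Y3. now rewrite !upd_neq by lia.
    + intros y Y0. now rewrite !upd_neq by lia.
Qed.

(* The hook of a scan may use the variables 12 to 19 and the array [OUT]. *)
Lemma wp_scan hook (J : nat -> state -> Prop) NC T s :
  (forall j, j < NC -> j * b < l) -> l <= NC * b ->
  (forall j s s', (forall y, 12 <= y < 20 -> regs s' y = regs s y) -> mem s' = mem s -> J j s -> J j s') ->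
  (forall j s, j * b < l -> in_chunk j s -> J j s ->
     wp w K hook (fun s' t => t <= T /\ in_chunk j s' /\ J (S j) s') s) ->
  regs s 0 = l -> regs s 2 = w -> regs s 3 = beta -> regs s 4 = b -> good_memory (mem s) -> J 0 s ->
  wp w K (scan_cmd hook) (fun s' t => t <= NC * (T + 20) + 8 /\ scanning NC s' /\ J NC s') s.
Proof.
  intros HN HN' HJ HH E0 E2 E3 E4 GM J0.
  assert (Zw := pow2_pos w).
  unfold scan_cmd, rewind_cmd. apply wp_seq.
  do 6 (apply wp_seq, wp_set with (v := 0); [exact Zw | reflexivity |]).
  apply wp_set with (v := 0); [exact Zw | reflexivity |].
  eapply wp_mono.
  { apply wp_while_lt with (n := NC) (T := T + 19)
      (I := fun j s => scanning j s /\ J j s); [assumption|assumption| | |].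
    - intros j s1 Hj (HS & HJ1). assert (Hjl := HN j Hj).
      assert (F0 : regs s1 0 = l) by apply HS. assert (F5 : regs s1 5 = j * b) by apply HS.
      split; [exact I|]. split; [exact I|]. cbn [ev]. rewrite F0, F5. split; [exact Hjl|].
      apply wp_seq. eapply wp_mono; [apply wp_next_chunk; eauto|].
      intros s2 t2 (-> & C2 & M2 & F2).
      apply wp_seq. eapply wp_mono; [apply (HH j); eauto|].
      intros s3 t3 (Ht3 & C3 & J3).
      eapply wp_mono; [apply wp_advance with (j := j); eauto|].
      intros s4 t4 (Ht4 & C4 & M4 & F4). split; [lia|]. split; [exact C4|].
      apply HJ with s3; auto.
    - intros s1 (HS & _).
      assert (F0 : regs s1 0 = l) by apply HS. assert (F5 : regs s1 5 = NC * b) by apply HS.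
      split; [exact I|]. split; [exact I|]. cbn [ev]. rewrite F0, F5. exact HN'.
    - destruct at_0 as (X & Y & Z). split.
      + unfold scanning, cnt_at. lookup. rewrite X, Y, Z. cbn [fst snd length].
        destruct GM as (G1 & G2 & G3). repeat split; auto; lia.
      + apply HJ with s; auto. intros y Hy. lookup. now rewrite !upd_neq by lia. }
  intros s' t (Ht' & HS & HJ'). split; [lia|auto].
Qed.

End Scan.

End Scan.
Import Scan.

(** * Looking up the chunk of a one *)

Lemma popcount_ext n x y :
  (forall p, p < n -> Nat.testbit x p = Nat.testbit y p) -> popcount n x = popcount n y.
Proof. induction n; simpl; intros H; auto. rewrite IHn, H; auto. Qed.

Lemma popcount_0 n : popcount n 0 = 0.
Proof. induction n; simpl; auto. now rewrite IHn, Nat.bits_0. Qed.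

Lemma popcount_add n x p : x < 2 ^ p -> p < n -> popcount n (x + 2 ^ p) = S (popcount n x).
Proof.
  intros Hx. replace (x + 2 ^ p) with (x + 1 * 2 ^ p) by lia.
  induction n; intros Hp; [lia|]. cbn [popcount].
  rewrite testbit_concat by assumption.
  destruct (Nat.eq_dec p n) as [->|].
  - rewrite Nat.ltb_irrefl, Nat.sub_diag. rewrite (testbit_small x n n) by auto.
    rewrite (popcount_ext n (x + 1 * 2 ^ n) x).
    + cbn. lia.
    + intros q Hq. rewrite testbit_concat by assumption. destruct (Nat.ltb_spec q n); [auto|lia].
  - rewrite IHn by lia. destruct (Nat.ltb_spec n p); [lia|].
    rewrite (testbit_small x p n) by (auto; lia).
    destruct (n - p) as [|k] eqn:E; [lia|].
    simpl. rewrite Nat.bits_0. simpl. lia.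
Qed.

Lemma mod_add_pow2 x p k : k <= p -> (x + 2 ^ p) mod 2 ^ k = x mod 2 ^ k.
Proof.
  intros H. replace (2 ^ p) with (2 ^ (p - k) * 2 ^ k).
  - apply Nat.Div0.mod_add.
  - rewrite <- Nat.pow_add_r. f_equal. lia.
Qed.

Section Lookup.
Context (b : nat) (cnt : nat -> nat) (stored : nat -> nat -> nat -> nat -> Prop).
Context (Hb : 0 < b) (Hmono : forall j, cnt j <= cnt (S j)) (Hgrow : forall j, cnt (S j) <= cnt j + b).

(* [g] maps item numbers to values: items [8 t + 8], [8 t + 9] and [8 t + 10]
   describe the [t]-th chunk with ones, and items [8 k + 11] and [8 k + 12] the
   [k]-th block of [b] ones: which of them are the first of their chunk, and how
   many chunks start before the block.  [stored j] accepts the items of chunk [j]. *)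
Definition chunk_found (g : nat -> nat) (rec i : nat) : Prop :=
  let k := i / b in
  let t := g (8 * k + 12) + popcount b (g (8 * k + 11) mod 2 ^ S (i mod b)) in
  1 <= t <= rec /\ exists j, cnt j <= i < cnt (S j) /\
    stored j (g (8 * (t - 1) + 8)) (g (8 * (t - 1) + 9)) (g (8 * (t - 1) + 10)).

(** [blk] is the block being filled, [mb] its marks so far and [mr] the number of chunks recorded
    before it. Its two items are constrained only once a one has been seen, as nothing is written
    earlier. *)
Definition index_inv (j : nat) (g : nat -> nat) (rec mb mr blk : nat) : Prop :=
  blk = cnt j / b /\ mr + popcount b mb = rec /\ mb < 2 ^ (cnt j mod b) /\ rec <= j /\
  (0 < cnt j -> g (8 * blk + 11) = mb /\ g (8 * blk + 12) = mr) /\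
  forall i, i < cnt j -> chunk_found g rec i.

Lemma index_step_same j g rec mb mr blk :
  index_inv j g rec mb mr blk -> cnt (S j) = cnt j -> index_inv (S j) g rec mb mr blk.
Proof.
  intros (A & B & C & D & E & F) H. unfold index_inv. rewrite H.
  split; [|split; [|split; [|split; [|split]]]]; auto.
Qed.

(** A chunk with ones sets one mark, at its first one. Having at most b ones, it reaches at most
    into the next block, where the mask is still empty and the base count alone identifies the
    chunk. Earlier ones keep their answers, since the new mark lies above the prefix of the mask
    that they look at. *)
Lemma index_step j g g' rec mb mr blk mb' mr' blk' :
  index_inv j g rec mb mr blk -> cnt j < cnt (S j) ->
  blk' = cnt (S j) / b ->
  (blk' = blk /\ mb' = mb + 2 ^ (cnt j mod b) /\ mr' = mr \/
   blk' = S blk /\ mb' = 0 /\ mr' = S rec /\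
     g' (8 * blk + 11) = mb + 2 ^ (cnt j mod b) /\ g' (8 * blk + 12) = mr) ->
  g' (8 * blk' + 11) = mb' -> g' (8 * blk' + 12) = mr' ->
  stored j (g' (8 * rec + 8)) (g' (8 * rec + 9)) (g' (8 * rec + 10)) ->
  (forall t, t < rec -> g' (8 * t + 8) = g (8 * t + 8) /\ g' (8 * t + 9) = g (8 * t + 9) /\
     g' (8 * t + 10) = g (8 * t + 10)) ->
  (forall k, k < blk -> g' (8 * k + 11) = g (8 * k + 11) /\ g' (8 * k + 12) = g (8 * k + 12)) ->
  index_inv (S j) g' (S rec) mb' mr' blk'.
Proof.
  intros (A & B & C & D & E & F) Hlt Hblk' Hcase G1 G2 HS Hrec Hk.
  assert (Hm : cnt j mod b < b) by (apply Nat.mod_upper_bound; lia).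
  assert (Dj := Nat.div_mod_eq (cnt j) b). rewrite <- A in Dj.
  assert (DS := Nat.div_mod_eq (cnt (S j)) b). rewrite <- Hblk' in DS.
  assert (HmS : cnt (S j) mod b < b) by (apply Nat.mod_upper_bound; lia).
  assert (Hg := Hgrow j). assert (Hmo := Hmono j).
  set (m := cnt j mod b) in *. set (mS := cnt (S j) mod b) in *.
  assert (PC : popcount b (mb + 2 ^ m) = S (popcount b mb)) by now apply popcount_add.
  assert (Hcur : g' (8 * blk + 11) = mb + 2 ^ m /\ g' (8 * blk + 12) = mr).
  { destruct Hcase as [(-> & -> & ->)|(_ & _ & _ & X & Y)]; auto. }
  destruct Hcur as (Hc1 & Hc2).
  assert (Pm : 2 ^ m + 2 ^ m = 2 ^ S m) by (simpl; lia).
  split; [assumption|]. split; [|split; [|split; [|split]]].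
  - destruct Hcase as [(-> & -> & ->)|(-> & -> & -> & _)]; [lia|]. rewrite popcount_0. lia.
  - destruct Hcase as [(HB & -> & _)|(_ & -> & _)]; [|apply pow2_pos].
    rewrite HB in DS. assert (m < mS) by lia.
    apply Nat.lt_le_trans with (2 ^ S m); [lia|]. apply Nat.pow_le_mono_r; lia.
  - lia.
  - auto.
  - intros i Hi. assert (Di := Nat.div_mod_eq i b).
    assert (Hmi : i mod b < b) by (apply Nat.mod_upper_bound; lia).
    destruct (Nat.lt_ge_cases i (cnt j)) as [Hold|Hnew].
    + destruct (F i Hold) as (T1 & jj & T2 & T3). unfold chunk_found.
      set (k := i / b) in *. set (o := i mod b) in *.
      assert (Hkle : k <= blk) by (unfold k; rewrite A; apply Nat.Div0.div_le_mono; lia).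
      assert (ET : g' (8 * k + 12) + popcount b (g' (8 * k + 11) mod 2 ^ S o) =
                   g (8 * k + 12) + popcount b (g (8 * k + 11) mod 2 ^ S o)).
      { destruct (Nat.eq_dec k blk) as [Ek|Ek].
        - rewrite Ek, Hc1, Hc2. destruct (E ltac:(lia)) as (-> & ->).
          rewrite mod_add_pow2; auto. rewrite Ek in Di. lia.
        - destruct (Hk k ltac:(lia)) as (-> & ->). reflexivity. }
      rewrite ET. set (t := g (8 * k + 12) + _) in *.
      split; [lia|]. exists jj. split; [assumption|].
      destruct (Hrec (t - 1) ltac:(lia)) as (-> & -> & ->). assumption.
    + unfold chunk_found. set (k := i / b) in *. set (o := i mod b) in *.
      assert (ET : g' (8 * k + 12) + popcount b (g' (8 * k + 11) mod 2 ^ S o) = S rec).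
      { assert (Hkge : blk <= k) by (unfold k; rewrite A; apply Nat.Div0.div_le_mono; lia).
        assert (Hkle : k <= blk') by (unfold k; rewrite Hblk'; apply Nat.Div0.div_le_mono; lia).
        destruct (Nat.eq_dec k blk) as [Ek|Ek].
        - rewrite Ek, Hc1, Hc2. rewrite Nat.mod_small; [lia|].
          rewrite Ek in Di. assert (m <= o) by lia.
          apply Nat.lt_le_trans with (2 ^ S m); [lia|]. apply Nat.pow_le_mono_r; lia.
        - destruct Hcase as [(HB & _)|(HB & -> & -> & _)]; [lia|].
          assert (k = blk') by lia. subst k. rewrite H, G1, G2, Nat.Div0.mod_0_l, popcount_0. lia. }
      rewrite ET. split; [lia|]. exists j. split; [lia|].
      replace (S rec - 1) with rec by lia. assumption.
Qed.

End Lookup.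

(** * Building the structure *)

Module Layout.

(* Doubling [2^e] whenever the counter exceeds [2 b 2^e] makes [b 2^e] at most
   the larger of [b] and the logarithm of the length. *)
Definition measure_cmd : hcmd :=
  HIf (ELt (EShl (ECst 1) (EAdd (EAdd (EVar 3) (EVar 12)) (ECst 1))) (EVar 9))
    (HSet 12 (EAdd (EVar 12) (ECst 1))) HSkip.

(** Both building and querying recompute the layout from e and cell 3 of the table. Once e reaches
    that cell, a word has no room for two fields of 2^phi bits, and every field gets a whole
    word. *)
Definition layout_cmd (kp : nat) : hcmd :=
  HSeq (HSet 15 (EAdd (EAdd (EVar 3) (EVar 12)) (ECst kp)))
  (HSeq (HSet 30 (ERd TAB (ECst 3)))
        (HIf (ELt (EVar 12) (EVar 30))
           (HSeq (HSet 13 (ESub (EVar 30) (EVar 12))) (HSet 14 (EShl (ECst 1) (EVar 15))))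
           (HSeq (HSet 13 (ECst 0)) (HSet 14 (EVar 2))))).

(** Chunk records and block records are interleaved in groups of eight items, so that neither array
    needs to know the length of the other. Group 0 is left to the header. *)
Definition item_index (x i : nat) : expr := EAdd (EShl (EVar x) (ECst 3)) (ECst (8 + i)).

Definition write_block_cmd (K ks : nat) : hcmd :=
  HSeq (set_item K ks (item_index 19 3) (EVar 17)) (set_item K ks (item_index 19 4) (EVar 18)).

(** The current block is written before and after a possible change of block: one chunk may complete
    a block and open the next. Rewriting an unfinished block keeps the structure valid after every
    chunk, and no final flush is needed. *)
Definition emit_cmd (K ks : nat) : hcmd :=
  HIf (ELt (ECst 0) (EVar 22))
    (HSeq (HSet 17 (EAdd (EVar 17) (EShl (ECst 1) (lowbits (EVar 11) (EVar 3)))))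
    (HSeq (write_block_cmd K ks)
    (HSeq (set_item K ks (item_index 16 0) (EVar 10))
    (HSeq (set_item K ks (item_index 16 1) (EVar 11))
    (HSeq (set_item K ks (item_index 16 2) (EVar 20))
    (HSeq (HSet 16 (EAdd (EVar 16) (ECst 1)))
    (HSeq (HIf (ELt (EVar 19) (EShr (EAdd (EVar 11) (EVar 22)) (EVar 3)))
             (HSeq (HSet 19 (EAdd (EVar 19) (ECst 1)))
             (HSeq (HSet 17 (ECst 0)) (HSet 18 (EVar 16))))
             HSkip)
          (write_block_cmd K ks))))))))
    HSkip.

Definition build_large_cmd (K ks kp : nat) : hcmd :=
  HSeq (HSet 12 (ECst 0))
  (HSeq (scan_cmd measure_cmd)
  (HSeq (layout_cmd kp)
  (HSeq (HSet 29 (EAdd (EShl (EVar 12) (ECst 1)) (ECst 1)))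
  (HSeq (set_item K ks (ECst 0) (EVar 29))
  (HSeq (HSet 16 (ECst 0))
  (HSeq (HSet 17 (ECst 0))
  (HSeq (HSet 18 (ECst 0))
  (HSeq (HSet 19 (ECst 0))
        (scan_cmd (emit_cmd K ks)))))))))).

Section Build.
Context (w K c ks kp kr beta : nat) (tab : nat -> nat) (A : list bool) (inp : nat -> nat).
Notation b := (2 ^ beta).
Notation n := (length A).
Notation l := (length (senc_mask A)).
Context (HK : 8 <= K) (Hw : 4 * (K * w) + 4 * K < 2 ^ w) (HcK : 2 * c + 4 <= K) (Hks : K <= 2 ^ ks).
Context (Hb : 4 * b <= w) (Hb8 : 8 <= b) (Ht : good_tables kp kr w beta tab).
Context (Hn : n <= 2 ^ (c * w)) (Hl : l <= 2 ^ (c * w)) (Hp : packed w inp (senc_mask A)).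
Context (Hl8 : l <= 2 ^ (8 * c * b)) (Hkp : 8 * c + 16 <= 2 ^ kp) (Hkw : kp + kr + ks + 16 < w).

Notation q_at := (q_at w beta inp).
Notation pos_at := (pos_at w beta inp).
Notation cnt_at := (cnt_at w beta inp).
Notation is_key := (is_key w beta inp).
Notation in_chunk := (in_chunk w beta tab A inp).
Notation good_memory := (good_memory w beta tab inp).

Definition chunks : nat := (l + b - 1) / b.
Definition phi_of (e : nat) : nat := beta + kp + e.
Definition rho_of (e : nat) : nat := tab 3 - e.
Definition width_of (e : nat) : nat := if e <? tab 3 then 2 ^ phi_of e else w.

(** Both inequalities come from the counter that caused the last doubling. The first pays for the
    wide fields; the second bounds e by the encoding, so that e fits into the header. *)
Definition small_exponent (e : nat) : Prop := e = 0 \/ 2 ^ (b * 2 ^ e) <= n /\ b * 2 ^ e <= l.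

Lemma chunks_spec : (forall j, j < chunks -> j * b < l) /\ l <= chunks * b /\ chunks <= l.
Proof.
  unfold chunks. assert (D := Nat.div_mod_eq (l + b - 1) b).
  assert (M : (l + b - 1) mod b < b) by (apply Nat.mod_upper_bound; lia).
  set (q := (l + b - 1) / b) in *.
  split; [|split]; [|lia|].
  - intros j Hj. assert (b * S j <= b * q) by (apply Nat.mul_le_mono_l; lia). lia.
  - destruct (Nat.eq_0_gt_0_cases q) as [->|Hq]; [lia|].
    assert (X : b * q <= l + b - 1) by lia.
    assert (q - 1 <= b * (q - 1)) by nia. nia.
Qed.

Lemma log_spec : tab 3 < w /\ good_log kp kr w beta (tab 3).
Proof.
  destruct Ht as (_ & _ & _ & X & _). split; [|assumption]. destruct X as ([->|X] & _); [lia|].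
  assert (beta + kp + tab 3 < 2 ^ (beta + kp + tab 3)) by (apply Nat.pow_gt_lin_r; lia). lia.
Qed.

Lemma triple_w : 3 * w <= w * K.
Proof. rewrite Nat.mul_comm. apply Nat.mul_le_mono_l. lia. Qed.

Lemma beta_lt : beta < b.
Proof. apply Nat.pow_gt_lin_r. lia. Qed.

Lemma small_exponent_le e : small_exponent e -> e <= c * w /\ phi_of e + 2 <= w * K.
Proof.
  intros H. assert (X := beta_lt).
  assert (E : e <= c * w).
  { destruct H as [->|[H _]]; [lia|].
    assert (b * 2 ^ e <= c * w) by (apply (Nat.pow_le_mono_r_iff 2); lia).
    assert (e < 2 ^ e) by (apply Nat.pow_gt_lin_r; lia).
    assert (2 ^ e <= b * 2 ^ e); [|lia]. apply Nat.le_mul_l. lia. }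
  split; [assumption|]. unfold phi_of.
  assert (c * w + 4 * w <= w * K) by nia. lia.
Qed.

Lemma layout_of e : layout_ok w (rho_of e) (width_of e) (phi_of e).
Proof.
  destruct log_spec as (L1 & L2 & _). unfold layout_ok, rho_of, width_of.
  destruct (Nat.ltb_spec e (tab 3)) as [H|H].
  - destruct L2 as [L2|L2]; [lia|].
    assert (E : tab 3 - e + phi_of e = beta + kp + tab 3) by (unfold phi_of; lia).
    rewrite E. assert (P := pow2_pos (phi_of e)).
    assert (2 ^ phi_of e <= 2 ^ (beta + kp + tab 3)) by (apply Nat.pow_le_mono_r; lia).
    split; [lia|auto].
  - split; [lia|]. left. lia.
Qed.

Lemma storable_of e x : x < 2 ^ (w * K) -> x < 2 ^ (2 ^ phi_of e) -> storable w K (width_of e) x.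
Proof.
  intros H1 H2. split; [assumption|]. intros j Hj. unfold width_of.
  destruct (e <? tab 3).
  - eapply Nat.le_lt_trans; [|exact H2]. eapply Nat.le_trans; [apply Nat.Div0.mod_le|].
    apply Nat.Div0.div_le_upper_bound. assert (P := pow2_pos (w * j)).
    rewrite <- (Nat.mul_1_l x) at 1. apply Nat.mul_le_mono_r. lia.
  - apply Nat.mod_upper_bound, Nat.pow_nonzero. lia.
Qed.

Lemma q_at_grow j : snd (q_at (S j)) <= snd (q_at j) + b.
Proof.
  unfold Scan.q_at. rewrite window_chunk_S, dec_state_app.
  eapply Nat.le_trans; [apply dec_state_le|]. unfold chunk_at. rewrite window_length. lia.
Qed.

Lemma q_at_le j : snd (q_at j) <= j * b.
Proof.
  unfold Scan.q_at. eapply Nat.le_trans; [apply dec_state_le|]. rewrite window_length. simpl. lia.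
Qed.

Lemma pos_at_grow j : pos_at (S j) <= pos_at j + b * 2 ^ (snd (q_at j) + b).
Proof.
  unfold Scan.pos_at. rewrite window_chunk_S, dec_total_app. apply Nat.add_le_mono_l.
  eapply Nat.le_trans; [apply dec_total_le|]. unfold chunk_at. rewrite window_length. reflexivity.
Qed.

(** Each chunk gains at most b times 2 to its counter plus b, so bounded counters give positions of
    O(b 2^e) bits beyond the logarithm of the number of bits read. The layout relies on this, as n
    is unknown to it. *)
Lemma pos_at_le e j :
  (forall i, i < j -> snd (q_at i) <= 2 * b * 2 ^ e) -> pos_at j <= j * b * 2 ^ (2 * b * 2 ^ e + b).
Proof.
  induction j; intros H; [destruct (at_0 w beta inp) as (_ & -> & _); lia|].
  eapply Nat.le_trans; [apply pos_at_grow|].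
  assert (X := IHj ltac:(auto)). assert (Y := H j ltac:(lia)).
  assert (2 ^ (snd (q_at j) + b) <= 2 ^ (2 * b * 2 ^ e + b)) by (apply Nat.pow_le_mono_r; lia).
  set (P := 2 ^ (2 * b * 2 ^ e + b)) in *.
  assert (b * 2 ^ (snd (q_at j) + b) <= b * P) by (apply Nat.mul_le_mono_l; assumption).
  lia.
Qed.

Lemma cnt_at_le j : cnt_at j <= j * b.
Proof.
  unfold Scan.cnt_at, ones_at. eapply Nat.le_trans; [apply dec_ones_length|]. rewrite window_length. lia.
Qed.

Lemma cnt_at_S j : cnt_at j <= cnt_at (S j) <= cnt_at j + b.
Proof.
  unfold Scan.cnt_at, ones_at. rewrite window_chunk_S, dec_ones_app, length_app, length_map.
  assert (X := dec_ones_length (dec_state (0, 0) (window (stream w inp) 0 (j * b))) (chunk_at w beta inp j)).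
  unfold chunk_at in *. rewrite window_length in X. lia.
Qed.

(** The constant 2^kp in the field width absorbs all constants of the following bounds: 8 c b bits
    for counting up to l, 3 b 2^e for positions, and some slack. *)
Lemma width_exponent e : (8 * c + 16) * b * 2 ^ e <= 2 ^ phi_of e.
Proof.
  unfold phi_of. rewrite !Nat.pow_add_r. apply Nat.mul_le_mono_r.
  rewrite Nat.mul_comm. apply Nat.mul_le_mono_l. assumption.
Qed.

Lemma fits_small e x : x <= 2 ^ ((8 * c + 8) * b) -> x < 2 ^ (2 ^ phi_of e).
Proof.
  intros H. eapply Nat.le_lt_trans; [exact H|]. apply Nat.pow_lt_mono_r; [lia|].
  assert (X := width_exponent e). assert (P := pow2_pos e).
  assert ((8 * c + 16) * b * 1 <= (8 * c + 16) * b * 2 ^ e) by (apply Nat.mul_le_mono_l; lia).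
  lia.
Qed.

Lemma bits_fit j : b <= l -> j <= chunks -> j * b <= 2 ^ ((8 * c + 1) * b).
Proof.
  intros Hbl Hj. destruct chunks_spec as (X & _).
  assert (j * b <= 2 * l).
  { destruct j; [lia|]. assert (Y := X j ltac:(lia)). lia. }
  replace ((8 * c + 1) * b) with (8 * c * b + b) by lia. rewrite Nat.pow_add_r.
  assert (2 ^ 1 <= 2 ^ b) by (apply Nat.pow_le_mono_r; lia).
  assert (2 ^ (8 * c * b) * 2 ^ 1 <= 2 ^ (8 * c * b) * 2 ^ b) by (apply Nat.mul_le_mono_l; assumption).
  change (2 ^ 1) with 2 in *. lia.
Qed.

Lemma pos_fits e j :
  b <= l -> j <= chunks -> (forall i, i < j -> snd (q_at i) <= 2 * b * 2 ^ e) ->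
  pos_at j < 2 ^ (2 ^ phi_of e).
Proof.
  intros Hbl Hj H. eapply Nat.le_lt_trans; [now apply pos_at_le with (e := e)|].
  eapply Nat.le_lt_trans; [apply Nat.mul_le_mono_r, bits_fit; assumption|].
  rewrite <- Nat.pow_add_r. apply Nat.pow_lt_mono_r; [lia|].
  assert (X := width_exponent e). assert (P := pow2_pos e).
  assert (Y : (8 * c + 2) * b * 1 <= (8 * c + 2) * b * 2 ^ e) by (apply Nat.mul_le_mono_l; lia).
  assert (Z : 0 < b * 2 ^ e) by (apply Nat.mul_pos_pos; lia). lia.
Qed.

(** The counter at hand may exceed the threshold 2 b 2^e by b, its largest growth over one chunk.
    Since b <= b 2^e, one doubling restores the bound, and the command needs no loop. *)
Definition measure_inv (m : memory) (j : nat) (s : state) : Prop :=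
  let e := regs s 12 in
  mem s = m /\ small_exponent e /\
  (forall i, i < j -> snd (q_at i) <= 2 * b * 2 ^ e) /\ snd (q_at j) <= 2 * b * 2 ^ e + b.

Lemma wp_measure m j s :
  j * b < l -> in_chunk j s -> measure_inv m j s ->
  wp w K measure_cmd (fun s' t => t <= 3 /\ in_chunk j s' /\ measure_inv m (S j) s') s.
Proof.
  intros Hj HC (HM & HE & HQ & HQ'). assert (HS := proj1 HC).
  destruct HS as (_ & E2 & E3 & E4 & E5 & _ & _ & _ & E9 & _ & _ & HG).
  set (e := regs s 12) in *. destruct (small_exponent_le e HE) as (E1 & E1').
  assert (Q1 := q_at_grow j). assert (Pe := pow2_pos e). assert (X := beta_lt).
  assert (Y : c * w + 4 * w <= w * K) by nia.
  assert (Z : beta + e + 1 <= w * K) by lia.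
  assert (BE : 2 ^ (beta + e + 1) = 2 * b * 2 ^ e) by (rewrite !Nat.pow_add_r, Nat.pow_1_r; lia).
  assert (BB : b * 2 ^ e >= b * 1) by (apply Nat.mul_le_mono_l; lia).
  assert (BW : 2 ^ (beta + e + 1) < 2 ^ (w * K)) by (apply Nat.pow_lt_mono_r; lia).
  assert (ww : w < 2 ^ w) by (apply Nat.pow_gt_lin_r; lia).
  assert (wK : w * K < 2 ^ (w * K)) by (apply Nat.pow_gt_lin_r; lia).
  apply wp_if_lt; [assumption|assumption| |exact I| |]; cbn [safe ev]; fold e; rewrite ?E3, ?E9.
  - repeat split; auto; lia.
  - intros Hlt. rewrite Nat.mul_1_l, BE in Hlt.
    apply wp_set with (v := S e).
    { cbn [safe ev]. fold e. repeat split; auto; lia. }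
    { cbn [ev]. fold e. lia. }
    split; [lia|]. split.
    + apply in_chunk_frame with (s := s); [assumption| |assumption].
      intros y Hy. lookup. now rewrite upd_neq by lia.
    + unfold measure_inv. lookup. cbn [Nat.pow].
      split; [assumption|]. split; [|split].
      * right. destruct (at_bounds w beta A inp Hp j ltac:(lia)) as (_ & AB).
        specialize (AB ltac:(lia)). assert (QL := q_at_le j). split; [|simpl; lia].
        eapply Nat.le_trans; [|exact AB]. apply Nat.pow_le_mono_r; [lia|]. simpl. lia.
      * intros i Hi. destruct (Nat.eq_dec i j) as [->|]; [lia|].
        assert (W := HQ i ltac:(lia)). lia.
      * lia.
  - intros Hlt. rewrite Nat.mul_1_l, BE in Hlt. apply wp_skip. split; [lia|]. split; [assumption|].
    unfold measure_inv. fold e. split; [assumption|]. split; [assumption|]. split; [|lia].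
    intros i Hi. destruct (Nat.eq_dec i j) as [->|]; [lia|]. apply HQ. lia.
Qed.

Lemma wp_layout s e :
  regs s 2 = w -> regs s 3 = beta -> regs s 12 = e -> small_exponent e -> good_memory (mem s) ->
  wp w K (layout_cmd kp) (fun s' t => t <= 5 /\ mem s' = mem s /\
    (forall y, y < 13 \/ 16 <= y < 30 -> regs s' y = regs s y) /\
    has_layout w (rho_of e) (width_of e) (phi_of e) s') s.
Proof.
  intros E2 E3 E12 HE (WM & MT & _).
  destruct (small_exponent_le e HE) as (E1 & E1').
  assert (ww : w < 2 ^ w) by (apply Nat.pow_gt_lin_r; lia).
  assert (wK : w * K < 2 ^ (w * K)) by (apply Nat.pow_gt_lin_r; nia).
  assert (TS : 8 <= table_size beta) by (unfold table_size, row_of; lia).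
  assert (LG := log_spec).
  apply wp_seq, wp_set with (v := phi_of e).
  { cbn [safe ev]. rewrite E3, E12. unfold phi_of in *. repeat split; auto; lia. }
  { cbn [ev]. rewrite E3, E12. unfold phi_of. lia. }
  apply wp_seq, wp_set with (v := tab 3).
  { cbn [safe]. lia. }
  { cbn [ev]. lookup. apply MT. lia. }
  apply wp_if_lt; [assumption|assumption|exact I|exact I| |]; cbn [ev]; lookup; rewrite E12; intros Hlt.
  - apply wp_seq, wp_set with (v := rho_of e).
    { cbn [safe ev]. lookup. rewrite E12. repeat split; auto; lia. }
    { cbn [ev]. lookup. rewrite E12. reflexivity. }
    apply wp_set with (v := width_of e).
    { cbn [safe ev]. lookup. rewrite Nat.mul_1_l.
      assert (2 ^ phi_of e < 2 ^ (w * K)) by (apply Nat.pow_lt_mono_r; lia). repeat split; auto; lia. }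
    { cbn [ev]. lookup. rewrite Nat.mul_1_l. unfold width_of. apply Nat.ltb_lt in Hlt. now rewrite Hlt. }
    split; [lia|]. split; [reflexivity|]. split.
    + intros y Hy. lookup. now rewrite !upd_neq by lia.
    + unfold has_layout. lookup. auto.
  - apply wp_seq, wp_set with (v := rho_of e).
    { cbn [safe]. lia. }
    { cbn [ev]. unfold rho_of. lia. }
    apply wp_set with (v := width_of e).
    { exact I. }
    { cbn [ev]. lookup. unfold width_of. apply Nat.ltb_ge in Hlt. now rewrite Hlt. }
    split; [lia|]. split; [reflexivity|]. split.
    + intros y Hy. lookup. now rewrite !upd_neq by lia.
    + unfold has_layout. lookup. auto.
Qed.

(** Groups of eight items for the header, for each chunk, and for a block opened by the last
    chunk. *)
Definition field_count : nat := 8 * (chunks + 3) * 2 ^ ks.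

Definition item_of (e : nat) (m : memory) (u : nat) : nat :=
  item w K ks (rho_of e) (width_of e) (phi_of e) (m OUT) u.

Lemma field_count_le : field_count <= 2 ^ (w * K).
Proof.
  destruct chunks_spec as (_ & _ & X). unfold field_count.
  assert (Pc := pow2_pos (c * w)).
  apply Nat.le_trans with (32 * 2 ^ (c * w) * 2 ^ ks); [apply Nat.mul_le_mono_r; lia|].
  change 32 with (2 ^ 5). rewrite <- !Nat.pow_add_r. apply Nat.pow_le_mono_r; [lia|].
  assert (c * w + 4 * w <= w * K) by nia. lia.
Qed.

Lemma item_fits t i : t <= S chunks -> i <= 4 -> (t * 8 + (8 + i) + 1) * 2 ^ ks <= field_count.
Proof. intros H H'. unfold field_count. apply Nat.mul_le_mono_r. lia. Qed.

Lemma good_memory_out rho V m m' :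
  good_memory m -> out_only rho V m m' -> word_memory w m' -> good_memory m'.
Proof.
  intros (X & Y & Z) O W. split; [assumption|]. split.
  - intros a Ha. rewrite O; [auto|]. intros [E _]. discriminate.
  - intros a. rewrite O; [auto|]. intros [E _]. discriminate.
Qed.

Lemma wp_put e s x i y t v :
  small_exponent e -> has_layout w (rho_of e) (width_of e) (phi_of e) s ->
  regs s x = t -> regs s y = v -> y < 30 -> i <= 4 -> t <= S chunks ->
  v < 2 ^ (w * K) -> v < 2 ^ (2 ^ phi_of e) ->
  wp w K (set_item K ks (item_index x i) (EVar y)) (fun s' t' => t' = 8 * K + 3 /\
    (forall y, y < 30 -> regs s' y = regs s y) /\
    has_layout w (rho_of e) (width_of e) (phi_of e) s' /\
    out_only (rho_of e) field_count (mem s) (mem s') /\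
    forall u, item_of e (mem s') u = if u =? 8 * t + 8 + i then v else item_of e (mem s) u) s.
Proof.
  intros HE HL Ex Ey Hy Hi Htc Hv1 Hv2.
  destruct (small_exponent_le e HE) as (E1 & E1').
  assert (LG := log_spec). assert (FC := field_count_le). assert (IF := item_fits t i Htc Hi).
  assert (ww : w < 2 ^ w) by (apply Nat.pow_gt_lin_r; lia).
  assert (Pks := pow2_pos ks).
  assert (Hu : t * 8 + (8 + i) < 2 ^ (w * K)).
  { assert (t * 8 + (8 + i) + 1 <= field_count) by (apply le_mul_of_pos with (2 ^ ks); assumption). lia. }
  assert (wK : w + w + w <= w * K) by nia.
  eapply wp_mono.
  { apply wp_set_item with (rho := rho_of e) (f := width_of e) (phi := phi_of e) (u := t * 8 + (8 + i))
      (x := v) (V := field_count); auto; try lia.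
    - apply layout_of.
    - unfold rho_of. lia.
    - unfold item_index. cbn [safe ev]. rewrite Ex. change (2 ^ 3) with 8. repeat split; auto; lia.
    - exact I.
    - unfold item_index. cbn [ev]. now rewrite Ex.
    - intros z. cbn [ev]. lookup. now rewrite upd_neq by lia.
    - intros z. exact I.
    - now apply storable_of. }
  intros s' t' (-> & F & W & O & IT). split; [reflexivity|]. split; [assumption|]. split.
  - destruct HL as (L2 & L13 & L14 & L15 & _). repeat split; try (rewrite F by lia; assumption). assumption.
  - split; [assumption|]. intros u. unfold item_of. rewrite IT.
    replace (8 * t + 8 + i) with (t * 8 + (8 + i)) by lia. reflexivity.
Qed.

Definition stored (j p cn key : nat) : Prop :=
  p = pos_at j /\ cn = cnt_at j /\ is_key j key /\ snd (q_at j) <= b.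

Definition emit_inv (e : nat) (m : memory) (j : nat) (s : state) : Prop :=
  regs s 12 = e /\ regs s 13 = rho_of e /\ regs s 14 = width_of e /\ regs s 15 = phi_of e /\
  index_inv b cnt_at stored j (item_of e (mem s)) (regs s 16) (regs s 17) (regs s 18) (regs s 19) /\
  item_of e (mem s) 0 = 2 * e + 1 /\ out_only (rho_of e) field_count m (mem s).

Ltac find_item :=
  repeat match goal with
  | |- context [?x =? ?y] => destruct (Nat.eqb_spec x y); [try lia|]
  end; try lia.

Lemma wp_write_block e s k x y :
  small_exponent e -> has_layout w (rho_of e) (width_of e) (phi_of e) s ->
  regs s 19 = k -> regs s 17 = x -> regs s 18 = y -> k <= S chunks ->
  x < 2 ^ (w * K) -> x < 2 ^ (2 ^ phi_of e) -> y < 2 ^ (w * K) -> y < 2 ^ (2 ^ phi_of e) ->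
  wp w K (write_block_cmd K ks) (fun s' t' => t' = 16 * K + 6 /\
    (forall y, y < 30 -> regs s' y = regs s y) /\
    has_layout w (rho_of e) (width_of e) (phi_of e) s' /\
    out_only (rho_of e) field_count (mem s) (mem s') /\
    forall u, item_of e (mem s') u = if u =? 8 * k + 12 then y
      else if u =? 8 * k + 11 then x else item_of e (mem s) u) s.
Proof.
  intros HE HL E19 E17 E18 Hk Hx1 Hx2 Hy1 Hy2.
  apply wp_seq. eapply wp_mono.
  { apply wp_put with (e := e) (t := k) (v := x); auto; lia. }
  intros s1 t1 (-> & F1 & L1 & O1 & I1). eapply wp_mono.
  { apply wp_put with (e := e) (t := k) (v := y); auto; try lia; rewrite F1 by lia; assumption. }
  intros s2 t2 (-> & F2 & L2 & O2 & I2). split; [lia|]. split; [|split; [assumption|split]].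
  - intros z Hz. rewrite F2, F1; auto.
  - eapply out_only_trans; eauto.
  - intros u. rewrite I2, I1. replace (8 * k + 8 + 4) with (8 * k + 12) by lia.
    replace (8 * k + 8 + 3) with (8 * k + 11) by lia. reflexivity.
Qed.

Lemma wp_emit e m j s :
  small_exponent e -> (forall i, i < chunks -> snd (q_at i) <= 2 * b * 2 ^ e) -> b <= l ->
  j * b < l -> in_chunk j s -> emit_inv e m j s ->
  wp w K (emit_cmd K ks) (fun s' t => t <= 60 * K + 60 /\ in_chunk j s' /\ emit_inv e m (S j) s') s.
Proof.
  intros HE HQ Hbl Hj HC (E12 & E13 & E14 & E15 & HI & H0 & HO).
  assert (HS := HC). destruct HS as (HS & HKey & E21 & E22 & E23).
  destruct HS as (E0 & E2 & E3 & E4 & E5 & _ & _ & _ & E9 & E10 & E11 & HG).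
  destruct (chunk_step w beta tab inp j _ HKey) as (_ & _ & C3 & C4).
  assert (cntS : cnt_at (S j) = cnt_at j + regs s 22).
  { rewrite E22. unfold Scan.cnt_at. now rewrite C3, length_app, length_map. }
  assert (Hd : 0 < regs s 22 -> snd (q_at j) <= b).
  { intros Hd. apply C4. intros Z. rewrite Z in E22. simpl in E22. lia. }
  assert (HL : has_layout w (rho_of e) (width_of e) (phi_of e) s) by (repeat split; auto; apply HG).
  apply wp_if_lt; [assumption|assumption|apply pow2_pos|exact I| |]; cbn [ev]; intros Hlt.
  2:{ apply wp_skip. split; [lia|]. split; [assumption|]. unfold emit_inv.
      repeat (split; [assumption|]). split; [|auto]. apply index_step_same; auto. lia. }
  specialize (Hd Hlt).
  set (key := regs s 20) in *. set (rec := regs s 16) in *. set (mb := regs s 17) in *.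
  set (mr := regs s 18) in *. set (blk := regs s 19) in *. set (d := regs s 22) in *.
  assert (HI' := HI). destruct HI' as (Hblk & Hpop & Hmb & Hrec & _ & _).
  set (mo := cnt_at j mod b) in *.
  assert (Hmo : mo < b) by (apply Nat.mod_upper_bound; lia).
  destruct chunks_spec as (CS1 & CS2 & CS3).
  assert (Hjc : j < chunks).
  { apply Nat.nle_gt. intros X. assert (chunks * b <= j * b) by (apply Nat.mul_le_mono_r; lia). lia. }
  assert (CL := cnt_at_le j). assert (CLS := cnt_at_le (S j)). assert (CG := cnt_at_S j).
  assert (Hblkj : blk <= j).
  { rewrite Hblk. apply Nat.Div0.div_le_upper_bound. lia. }
  assert (HblkS : cnt_at (S j) / b <= S j) by (apply Nat.Div0.div_le_upper_bound; lia).
  assert (HblkS' : blk <= cnt_at (S j) / b <= S blk).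
  { rewrite Hblk. split; [apply Nat.Div0.div_le_mono; lia|].
    apply Nat.le_trans with ((cnt_at j + 1 * b) / b); [apply Nat.Div0.div_le_mono; lia|].
    rewrite Nat.div_add by lia. lia. }
  assert (BF := bits_fit (S j) Hbl Hjc).
  assert (B8 : 2 ^ ((8 * c + 1) * b) <= 2 ^ ((8 * c + 8) * b)) by (apply Nat.pow_le_mono_r; [lia|apply Nat.mul_le_mono_r; lia]).
  assert (B2 : 2 ^ (2 * b) <= 2 ^ ((8 * c + 8) * b)) by (apply Nat.pow_le_mono_r; [lia|apply Nat.mul_le_mono_r; lia]).
  assert (B4 : 2 ^ (4 * b) <= 2 ^ ((8 * c + 8) * b)) by (apply Nat.pow_le_mono_r; [lia|apply Nat.mul_le_mono_r; lia]).
  assert (BW : 2 ^ ((8 * c + 8) * b) < 2 ^ (w * K)).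
  { apply Nat.pow_lt_mono_r; [lia|].
    apply Nat.le_lt_trans with ((2 * c + 2) * (4 * b)); [lia|].
    apply Nat.le_lt_trans with ((2 * c + 2) * w); [apply Nat.mul_le_mono_l; assumption|].
    rewrite Nat.mul_comm. apply Nat.mul_lt_mono_pos_l; lia. }
  assert (Fit : forall x, x <= 2 ^ ((8 * c + 8) * b) -> x < 2 ^ (w * K) /\ x < 2 ^ (2 ^ phi_of e)).
  { intros x Hx. split; [lia|]. now apply fits_small. }
  assert (jb : S j <= S j * b) by (apply le_mul_of_pos with b; [lia|]; assert (S j * b * 1 <= S j * b * b) by (apply Nat.mul_le_mono_l; lia); lia).
  assert (Pmo : 2 ^ mo <= 2 ^ b) by (apply Nat.pow_le_mono_r; lia).
  assert (P2b : 2 ^ b + 2 ^ b <= 2 ^ (2 * b)).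
  { replace (2 ^ b + 2 ^ b) with (2 ^ S b) by (simpl; lia). apply Nat.pow_le_mono_r; lia. }
  destruct (Fit (mb + 2 ^ mo)) as (M1 & M2); [lia|].
  destruct (Fit mr) as (R1 & R2); [lia|].
  destruct (Fit (S rec)) as (R3 & R4); [lia|].
  destruct (Fit 0) as (Z1 & Z2); [lia|].
  destruct (Fit (cnt_at j)) as (N1 & N2); [lia|].
  assert (KC := key_count_le w K beta HK Hw Hb Hb8).
  assert (HKey1 := proj1 HKey).
  assert (KC' : key_count b <= key_count b * (2 * b)) by (apply Nat.le_mul_r; lia).
  destruct (Fit key) as (Y1 & Y2); [lia|].
  assert (PF := pos_fits e j Hbl ltac:(lia) ltac:(intros; apply HQ; lia)).
  destruct (at_bounds w beta A inp Hp j ltac:(lia)) as (PN & _).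
  assert (PW : pos_at j < 2 ^ (w * K)).
  { eapply Nat.le_lt_trans; [exact PN|]. eapply Nat.le_lt_trans; [exact Hn|].
    apply Nat.pow_lt_mono_r; [lia|]. rewrite Nat.mul_comm. apply Nat.mul_lt_mono_pos_l; lia. }
  assert (ww : w < 2 ^ w) by (apply Nat.pow_gt_lin_r; lia). assert (wK := triple_w).
  assert (BL := beta_lt).
  apply wp_seq, wp_set with (v := mb + 2 ^ mo).
  { cbn [safe]. cbn [ev]. rewrite ev_lowbits. cbn [ev]. rewrite E11, E3. fold mb mo.
    split; [exact I|]. split; [|rewrite Nat.mul_1_l; assumption].
    split; [lia|]. split; [apply safe_lowbits; cbn [safe ev]; rewrite ?E3, ?E11; auto; lia|].
    rewrite Nat.mul_1_l. lia. }
  { cbn [ev]. rewrite ev_lowbits. cbn [ev]. rewrite E11, E3, Nat.mul_1_l. reflexivity. }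
  set (s0 := set_reg s 17 (mb + 2 ^ mo)).
  assert (L0 : has_layout w (rho_of e) (width_of e) (phi_of e) s0) by exact HL.
  apply wp_seq. eapply wp_mono.
  { apply wp_write_block with (e := e) (k := blk) (x := mb + 2 ^ mo) (y := mr); auto; try lia. }
  intros s2 t2 (-> & F2 & L2 & O2 & I2).
  apply wp_seq. eapply wp_mono.
  { apply wp_put with (e := e) (t := rec) (v := pos_at j); auto; try lia; rewrite F2 by lia; auto. }
  intros s3 t3 (-> & F3 & L3 & O3 & I3).
  apply wp_seq. eapply wp_mono.
  { apply wp_put with (e := e) (t := rec) (v := cnt_at j); auto; try lia; rewrite F3, F2 by lia; auto. }
  intros s4 t4 (-> & F4 & L4 & O4 & I4).
  apply wp_seq. eapply wp_mono.
  { apply wp_put with (e := e) (t := rec) (v := key); auto; try lia; rewrite F4, F3, F2 by lia; auto. }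
  intros s5 t5 (-> & F5 & L5 & O5 & I5).
  assert (F : forall y, y < 30 -> regs s5 y = regs s0 y).
  { intros y Hy. now rewrite F5, F4, F3, F2. }
  clear F2 F3 F4 F5.
  assert (O : out_only (rho_of e) field_count (mem s) (mem s5)).
  { eapply out_only_trans; [exact O2|]. eapply out_only_trans; [exact O3|].
    eapply out_only_trans; eauto. }
  clear O2 O3 O4 O5. change (mem s0) with (mem s) in I2.
  apply wp_seq, wp_set with (v := S rec).
  { cbn [safe ev]. rewrite F by lia. unfold s0. lookup. fold rec. repeat split; auto; lia. }
  { cbn [ev]. rewrite F by lia. unfold s0. lookup. fold rec. lia. }
  set (blk' := cnt_at (S j) / b) in *.
  (* Marks and base count of the block that will contain the next one: either the old block with its
     new mark, or an empty block preceded by all recorded chunks. *)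
  set (mb' := if blk' =? blk then mb + 2 ^ mo else 0).
  set (mr' := if blk' =? blk then mr else S rec).
  apply wp_seq. apply wp_mono with (fun s' t => t <= 4 /\ mem s' = mem s5 /\
    regs s' 16 = S rec /\ regs s' 17 = mb' /\ regs s' 18 = mr' /\ regs s' 19 = blk' /\
    forall y, y < 16 \/ 20 <= y < 30 -> regs s' y = regs s y).
  { apply wp_if_lt; [assumption|assumption|exact I| | |].
    - cbn [safe ev]. lookup. rewrite !F by lia. unfold s0. lookup. rewrite E11, E3.
      fold d. rewrite <- cntS. repeat split; auto; lia.
    - cbn [ev]. lookup. rewrite !F by lia. unfold s0. lookup. rewrite E11, E3. fold d blk.
      rewrite <- cntS. fold blk'. intros Hc. assert (Eb : blk' = S blk) by lia.
      apply wp_seq, wp_set with (v := S blk).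
      { cbn [safe ev]. lookup. rewrite F by lia. unfold s0. lookup. fold blk. repeat split; auto; lia. }
      { cbn [ev]. lookup. rewrite F by lia. unfold s0. lookup. fold blk. lia. }
      apply wp_seq, wp_set with (v := 0); [apply pow2_pos|reflexivity|].
      apply wp_set with (v := S rec); [exact I|cbn [ev]; lookup; reflexivity|].
      unfold mb', mr'. rewrite Eb. destruct (Nat.eqb_spec (S blk) blk); [lia|]. lookup.
      repeat split; auto. intros y Hy. rewrite !upd_neq, F by lia. unfold s0. lookup.
      now rewrite upd_neq by lia.
    - cbn [ev]. lookup. rewrite !F by lia. unfold s0. lookup. rewrite E11, E3. fold d blk.
      rewrite <- cntS. fold blk'. intros Hc. assert (Eb : blk' = blk) by lia.
      apply wp_skip. unfold mb', mr'. rewrite Eb, Nat.eqb_refl. lookup. rewrite !F by lia. unfold s0.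
      lookup. repeat split; auto. intros y Hy. rewrite !upd_neq, F by lia. unfold s0. lookup.
      now rewrite upd_neq by lia. }
  intros s6 t6 (Ht6 & M6 & G16 & G17 & G18 & G19 & G).
  assert (L6 : has_layout w (rho_of e) (width_of e) (phi_of e) s6).
  { unfold has_layout. rewrite M6, !G by lia. repeat split; auto. apply L5. }
  assert (Q1 : mb' < 2 ^ (w * K) /\ mb' < 2 ^ (2 ^ phi_of e)) by (unfold mb'; destruct (_ =? _); auto).
  assert (Q2 : mr' < 2 ^ (w * K) /\ mr' < 2 ^ (2 ^ phi_of e)) by (unfold mr'; destruct (_ =? _); auto).
  eapply wp_mono.
  { apply wp_write_block with (e := e) (k := blk') (x := mb') (y := mr'); auto; try tauto; lia. }
  intros s7 t7 (-> & F7 & L7 & O7 & I7). rewrite M6 in O7, I7.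
  assert (O' : out_only (rho_of e) field_count (mem s) (mem s7)) by (eapply out_only_trans; eauto).
  assert (W7 : word_memory w (mem s7)) by apply L7.
  split; [lia|]. split.
  { apply in_chunk_frame with (s := s); auto.
    - intros y Hy. rewrite F7, G by lia. reflexivity.
    - eapply good_memory_out; eauto. }
  unfold emit_inv. rewrite !F7 by lia. rewrite G16, G17, G18, G19, !G by lia.
  do 4 (split; [assumption|]). split; [|split].
  - apply index_step with (g := item_of e (mem s)) (mb := mb) (mr := mr) (blk := blk); auto; try lia.
    + intros i. destruct (cnt_at_S i). assumption.
    + intros i. destruct (cnt_at_S i). assumption.
    + unfold mb', mr'. destruct (Nat.eqb_spec blk' blk); [left; auto|right].
      split; [lia|]. split; [reflexivity|]. split; [reflexivity|].
      rewrite !I7, !I5, !I4, !I3, !I2. split; find_item; reflexivity.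
    + rewrite I7. find_item; reflexivity.
    + rewrite I7. find_item; reflexivity.
    + rewrite !I7, !I5, !I4, !I3, !I2. unfold stored.
      repeat split; try assumption; find_item; try reflexivity; apply HKey.
    + intros t Htr. rewrite !I7, !I5, !I4, !I3, !I2. repeat split; find_item; reflexivity.
    + intros k Hkb. rewrite !I7, !I5, !I4, !I3, !I2. repeat split; find_item; reflexivity.
  - rewrite I7, I5, I4, I3, I2. find_item; assumption.
  - eapply out_only_trans; eauto.
Qed.

Definition index_built (e rec : nat) (m m' : memory) : Prop :=
  small_exponent e /\ word_memory w m' /\ out_only (rho_of e) field_count m m' /\
  item_of e m' 0 = 2 * e + 1 /\ rec <= chunks /\
  forall i, i < cnt_at chunks -> chunk_found b cnt_at stored (item_of e m') rec i.

Lemma exponent_header e : small_exponent e -> b <= l -> 2 * e + 1 <= 2 ^ ((8 * c + 8) * b).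
Proof.
  intros H Hbl.
  assert (E : e <= l).
  { destruct H as [->|[_ H]]; [lia|]. assert (e < 2 ^ e) by (apply Nat.pow_gt_lin_r; lia).
    assert (2 ^ e <= b * 2 ^ e) by (apply Nat.le_mul_l; lia). lia. }
  assert (X : 2 ^ (8 * c * b) * 2 ^ (2 * b) <= 2 ^ ((8 * c + 8) * b)).
  { rewrite <- Nat.pow_add_r. apply Nat.pow_le_mono_r; lia. }
  assert (Y : 4 <= 2 ^ (2 * b)) by (change 4 with (2 ^ 2); apply Nat.pow_le_mono_r; lia).
  assert (Z : 2 ^ (8 * c * b) * 4 <= 2 ^ (8 * c * b) * 2 ^ (2 * b)) by (apply Nat.mul_le_mono_l; assumption).
  assert (P := pow2_pos (8 * c * b)). lia.
Qed.

Lemma wp_build_large s :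
  regs s 0 = l -> regs s 2 = w -> regs s 3 = beta -> regs s 4 = b ->
  good_memory (mem s) -> b < l ->
  wp w K (build_large_cmd K ks kp) (fun s' t => exists e rec,
    t <= (60 * K + 120) * chunks + 8 * K + 40 /\ index_built e rec (mem s) (mem s')) s.
Proof.
  intros E0 E2 E3 E4 HG Hbl.
  assert (HcK8 : c + 4 <= K) by lia.
  assert (Pw := pow2_pos w).
  destruct chunks_spec as (CS1 & CS2 & _).
  apply wp_seq, wp_set with (v := 0); [exact Pw|reflexivity|].
  destruct (at_0 w beta inp) as (Q0 & P0 & N0).
  apply wp_seq. eapply wp_mono.
  { apply (wp_scan w K c kp kr beta tab A inp) with (J := measure_inv (mem s)) (NC := chunks) (T := 3); auto.
    - intros j s1 s2 F M (M1 & J1 & J2 & J3). unfold measure_inv. rewrite F, M by lia. auto.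
    - intros j s1 Hj HC HJ. eapply wp_measure; eauto.
    - unfold measure_inv. lookup. rewrite Q0. split; [reflexivity|]. split; [left; reflexivity|].
      split; [lia|]. simpl. lia. }
  intros s1 t1 (Ht1 & SC1 & (M1 & J1 & J2 & _)).
  set (e := regs s1 12) in *.
  assert (SC1' := SC1). destruct SC1' as (F0 & F2 & F3 & F4 & _ & _ & _ & _ & _ & _ & _ & HG1).
  apply wp_seq. eapply wp_mono.
  { apply wp_layout with (e := e); auto. }
  intros s2 t2 (Ht2 & M2 & G2 & L2).
  assert (EH := exponent_header e J1 ltac:(lia)).
  assert (BW : 2 ^ ((8 * c + 8) * b) < 2 ^ (w * K)).
  { apply Nat.pow_lt_mono_r; [lia|].
    apply Nat.le_lt_trans with ((2 * c + 2) * (4 * b)); [lia|].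
    apply Nat.le_lt_trans with ((2 * c + 2) * w); [apply Nat.mul_le_mono_l; assumption|].
    rewrite Nat.mul_comm. apply Nat.mul_lt_mono_pos_l; lia. }
  assert (EF : 2 * e + 1 < 2 ^ (2 ^ phi_of e)) by now apply fits_small.
  assert (wK := triple_w). assert (FC := field_count_le). assert (LG := log_spec).
  destruct (small_exponent_le e J1) as (EE & EE').
  apply wp_seq, wp_set with (v := 2 * e + 1).
  { cbn [safe ev]. rewrite G2 by lia. fold e. rewrite Nat.pow_1_r. repeat split; auto; lia. }
  { cbn [ev]. rewrite G2 by lia. fold e. rewrite Nat.pow_1_r. lia. }
  set (s3 := set_reg s2 29 (2 * e + 1)).
  assert (L3 : has_layout w (rho_of e) (width_of e) (phi_of e) s3) by exact L2.
  apply wp_seq. eapply wp_mono.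
  { apply wp_set_item with (rho := rho_of e) (f := width_of e) (phi := phi_of e) (u := 0)
      (x := 2 * e + 1) (V := field_count); auto.
    - apply layout_of.
    - unfold rho_of. lia.
    - lia.
    - exact I.
    - intros v. exact I.
    - apply storable_of; lia.
    - unfold field_count. apply Nat.mul_le_mono_r. lia. }
  intros s4 t4 (-> & F4' & W4 & O4 & I4).
  do 4 (apply wp_seq, wp_set with (v := 0); [exact Pw|reflexivity|]).
  set (s5 := set_reg (set_reg (set_reg (set_reg s4 16 0) 17 0) 18 0) 19 0).
  assert (O5 : out_only (rho_of e) field_count (mem s) (mem s5)).
  { replace (mem s) with (mem s3); [exact O4|]. unfold s3. lookup. congruence. }
  assert (HG5 : good_memory (mem s5)).
  { apply good_memory_out with (rho := rho_of e) (V := field_count) (m := mem s); auto. }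
  assert (R5 : forall y, y < 16 -> regs s5 y = regs s2 y).
  { intros y Hy. unfold s5. lookup. rewrite !upd_neq, F4' by lia. unfold s3. lookup. now rewrite upd_neq by lia. }
  eapply wp_mono.
  { apply (wp_scan w K c kp kr beta tab A inp) with (J := emit_inv e (mem s)) (NC := chunks) (T := 60 * K + 60); auto.
    - intros j s6 s7 F M HJ. unfold emit_inv in *. rewrite !F, M by lia. exact HJ.
    - intros j s6 Hj HC HJ. apply wp_emit; auto. lia.
    - rewrite R5, G2 by lia. assumption.
    - rewrite R5, G2 by lia. assumption.
    - rewrite R5, G2 by lia. assumption.
    - rewrite R5, G2 by lia. assumption.
    - unfold emit_inv. rewrite !R5 by lia. destruct L2 as (_ & L13 & L14 & L15 & _).
      rewrite L13, L14, L15, G2 by lia. do 4 (split; [reflexivity|]). split; [|split; [|exact O5]].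
      + change (regs s5 16) with 0. change (regs s5 17) with 0. change (regs s5 18) with 0.
        change (regs s5 19) with 0. unfold index_inv.
        assert (C0 : cnt_at 0 = 0) by (unfold Scan.cnt_at; now rewrite N0).
        rewrite C0, Nat.Div0.div_0_l, Nat.Div0.mod_0_l, popcount_0. repeat split; auto; lia.
      + change (mem s5) with (mem s4). unfold item_of. rewrite I4. reflexivity. }
  intros s' t (Ht' & SC & (_ & _ & _ & _ & HI & H0 & HO)).
  exists e, (regs s' 16). split; [lia|].
  destruct HI as (_ & _ & _ & Hrec & _ & HF).
  split; [assumption|]. split; [apply SC|]. auto.
Qed.

End Build.

End Layout.
Import Layout.

(** * Answering queries *)

Definition row_expr (k : expr) : expr := EAdd (ECst 8) (EShl k (EAdd (EVar 3) (ECst 1))).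

(** Items 3 and 4 of a group give the mask of the block, cut off after the queried one, and its base
    count. The mask is then used as a key, with state (0, 0), whose cell 3 is its population
    count. *)
Definition query_large_cmd (K ks kp : nat) : hcmd :=
  HSeq (layout_cmd kp)
  (HSeq (HSet 5 (ESub (EVar 0) (ECst 1)))
  (HSeq (HSet 6 (EShr (EVar 5) (EVar 3)))
  (HSeq (HSet 7 (EAdd (lowbits (EVar 5) (EVar 3)) (ECst 1)))
  (HSeq (get_item K ks (item_index 6 3))
  (HSeq (HSet 8 (lowbits (EVar 41) (EVar 7)))
  (HSeq (get_item K ks (item_index 6 4))
  (HSeq (HSet 9 (ESub (EAdd (EVar 41) (ERd TAB (EAdd (row_expr (EVar 8)) (ECst 3)))) (ECst 1)))
  (HSeq (get_item K ks (item_index 9 0))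
  (HSeq (HSet 10 (EVar 41))
  (HSeq (get_item K ks (item_index 9 1))
  (HSeq (HSet 11 (EVar 41))
  (HSeq (get_item K ks (item_index 9 2))
  (HSeq (HSet 20 (EVar 41))
        (HSet 0 (EAdd (EVar 10) (ERd TAB (EAdd (EAdd (row_expr (EVar 20)) (EVar 4))
                                               (ESub (EVar 5) (EVar 11))))))))))))))))))).

Definition query_small_cmd : hcmd :=
  HSet 0 (ERd TAB (EAdd (EAdd (row_expr (EVar 12)) (EVar 4)) (ESub (EVar 0) (ECst 1)))).

Definition setup_cmd : hcmd :=
  HSeq (HSet 2 (ERd TAB (ECst 0)))
  (HSeq (HSet 3 (ERd TAB (ECst 2))) (HSet 4 (EShl (ECst 1) (EVar 3)))).

(** Bit 0 of the structure selects the variant. The b bits after it are e in the large variant and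
    the padded encoding itself in the small one. *)
Definition query_cmd (K ks kp : nat) : hcmd :=
  HSeq setup_cmd
  (HSeq (HSet 24 (ERd OUT (ECst 0)))
  (HSeq (HSet 12 (lowbits (EShr (EVar 24) (ECst 1)) (EVar 4)))
        (HIf (ELt (ECst 0) (lowbits (EVar 24) (ECst 1)))
           (query_large_cmd K ks kp) query_small_cmd))).

(** A short encoding is stored shifted by one, with tag bit 0. Dropping the top bit first keeps the
    shifted word in range, and no bit of the encoding is lost because l <= b < w. *)
Definition build_cmd (K ks kp : nat) : hcmd :=
  HSeq setup_cmd
    (HIf (ELt (EVar 4) (EVar 0))
       (build_large_cmd K ks kp)
       (HIf (ELt (ECst 0) (EVar 0))
          (HWrite OUT (ECst 0)
             (EShl (lowbits (ERd INP (ECst 0)) (ESub (EVar 2) (ECst 1))) (ECst 1)))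
          HSkip)).

Section Query.
Context (w K c ks kp kr beta : nat) (tab : nat -> nat) (A : list bool) (inp : nat -> nat).
Notation b := (2 ^ beta).
Notation n := (length A).
Notation l := (length (senc_mask A)).
Context (HK : 8 <= K) (Hw : 4 * (K * w) + 4 * K < 2 ^ w) (HcK : 2 * c + 4 <= K) (Hks : K <= 2 ^ ks).
Context (Hb : 4 * b <= w) (Hb8 : 8 <= b) (Ht : good_tables kp kr w beta tab).
Context (Hn : n <= 2 ^ (c * w)) (Hl : l <= 2 ^ (c * w)) (Hp : packed w inp (senc_mask A)).
Context (Hl8 : l <= 2 ^ (8 * c * b)) (Hkp : 8 * c + 16 <= 2 ^ kp) (Hkw : kp + kr + ks + 16 < w).
Context (Hkr : 16 * c + 8 <= 2 ^ kr) (Hksb : ks <= b) (Hcb : 8 * c * b < 2 ^ b).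

Notation chunks := (chunks beta A).
Notation item_of := (item_of w K ks kp beta tab).
Notation small_exponent := (small_exponent beta A).
Notation rho_of := (rho_of tab).
Notation width_of := (width_of w kp beta tab).
Notation phi_of := (phi_of kp beta).
Notation field_count := (field_count ks beta A).
Notation index_built := (index_built w K ks kp beta tab A inp).
Notation ones_at := (ones_at w beta inp).
Notation cnt_at := (cnt_at w beta inp).

(** The factor 2 pays for the idle bits of the words, which are fewer than the occupied ones in a
    full word. *)
Definition used_bits (e : nat) : nat := 2 * field_count * 2 ^ phi_of e.

(** As 2^e <= l <= 2^(8 c b), the exponent is at most 8 c b, and so fits into the b bits after the
    tag. *)
Lemma exponent_bounds e : small_exponent e -> b <= l -> 2 ^ e <= 2 ^ ((8 * c + 1) * b) /\ e < 2 ^ b.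
Proof.
  intros H Hbl. destruct H as [->|[_ H]].
  - split; [apply Nat.pow_le_mono_r; lia|]. apply pow2_pos.
  - assert (2 ^ e <= b * 2 ^ e) by (apply Nat.le_mul_l; lia).
    assert (X : 2 ^ e <= 2 ^ (8 * c * b)) by lia.
    assert (e <= 8 * c * b) by (apply (Nat.pow_le_mono_r_iff 2); lia).
    split; [|lia]. apply Nat.pow_le_mono_r; lia.
Qed.

Lemma chunk_le : 0 < l -> chunks <= l.
Proof.
  intros H. unfold Layout.chunks. apply Nat.Div0.div_le_upper_bound.
  assert (l + b - 1 <= b * l); [|lia]. nia.
Qed.

(** Justifies the cap on [tab 3]: at the cap, the logarithm of the number of slots per word is at
    least (16 c + 8) b - e. This exceeds the logarithm of the number of fields, so a longer search
    would gain nothing. *)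
Lemma fields_in_first_word e : small_exponent e -> b <= l ->
  tab 3 = b * 2 ^ kr -> e < tab 3 /\ field_count <= 2 ^ rho_of e.
Proof.
  intros HE Hbl HR. destruct (exponent_bounds e HE Hbl) as (H1 & _).
  assert (CL := chunk_le ltac:(lia)).
  assert (FC : field_count <= 2 ^ ((8 * c + 2) * b)).
  { unfold Layout.field_count.
    assert (Pc := pow2_pos (8 * c * b)).
    apply Nat.le_trans with (32 * 2 ^ (8 * c * b) * 2 ^ ks); [apply Nat.mul_le_mono_r; lia|].
    change 32 with (2 ^ 5). rewrite <- !Nat.pow_add_r. apply Nat.pow_le_mono_r; lia. }
  assert (HR' : (16 * c + 8) * b <= tab 3).
  { rewrite HR, Nat.mul_comm. apply Nat.mul_le_mono_l. assumption. }
  assert (HeR : e <= (8 * c + 1) * b) by (apply (Nat.pow_le_mono_r_iff 2); lia).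
  split; [lia|]. eapply Nat.le_trans; [exact FC|]. unfold Layout.rho_of. apply Nat.pow_le_mono_r; lia.
Qed.

(* Words hold fields up to a factor of two of their size, except possibly when
   all fields are in the first word. *)
Lemma field_end e v :
  small_exponent e -> b <= l -> v < field_count ->
  v / 2 ^ rho_of e * w + slot_pos (rho_of e) (phi_of e) v + width_of e <= used_bits e.
Proof.
  intros HE Hbl Hv. unfold used_bits.
  assert (FF := fields_in_first_word e HE Hbl).
  destruct Ht as (_ & _ & _ & (_ & HR & _) & _).
  assert (G : forall x, x <= 2 * (v + 1) * 2 ^ phi_of e -> x <= 2 * field_count * 2 ^ phi_of e).
  { intros x Hx. eapply Nat.le_trans; [exact Hx|]. apply Nat.mul_le_mono_r. lia. }
  apply G. clear G. assert (P := pow2_pos (phi_of e)).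
  assert (DV := Nat.div_mod_eq v (2 ^ rho_of e)).
  unfold slot_pos, Layout.width_of. destruct (Nat.ltb_spec e (tab 3)) as [He|He].
  - destruct HR as [HR|HR].
    + destruct (FF HR) as (_ & X). rewrite Nat.div_small, Nat.mod_small by lia. nia.
    + assert (E : w < 2 * (2 ^ rho_of e * 2 ^ phi_of e)).
      { rewrite <- Nat.pow_add_r. replace (2 * 2 ^ (rho_of e + phi_of e)) with (2 ^ S (rho_of e + phi_of e)) by (simpl; lia).
        replace (S (rho_of e + phi_of e)) with (beta + kp + S (tab 3)); [exact HR|].
        unfold Layout.rho_of, Layout.phi_of. lia. }
      set (q := v / 2 ^ rho_of e) in *. set (m := v mod 2 ^ rho_of e) in *.
      set (F := 2 ^ phi_of e) in *. set (RR := 2 ^ rho_of e) in *.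
      assert (q * w <= q * (2 * (RR * F))) by (apply Nat.mul_le_mono_l; lia).
      assert (2 * (v + 1) * F = q * (2 * (RR * F)) + 2 * (m + 1) * F) by (rewrite DV; lia).
      lia.
  - destruct HR as [HR|HR]; [destruct (FF HR); lia|].
    assert (E : w < 2 * 2 ^ phi_of e).
    { eapply Nat.lt_le_trans; [exact HR|]. replace (2 * 2 ^ phi_of e) with (2 ^ S (phi_of e)) by (simpl; lia).
      apply Nat.pow_le_mono_r; [lia|]. unfold Layout.phi_of. lia. }
    replace (rho_of e) with 0 in * by (unfold Layout.rho_of; lia).
    rewrite Nat.pow_0_r, Nat.div_1_r, Nat.mod_1_r in *. nia.
Qed.

(** A query may meet any memory that agrees with the built one on the bits of D; every field ends
    before [used_bits e] and is thus determined by them. *)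
Lemma item_of_packed e m m' u :
  small_exponent e -> b <= l -> (u + 1) * 2 ^ ks <= field_count ->
  (forall p, p < used_bits e ->
     Nat.testbit (m' OUT (p / w)) (p mod w) = Nat.testbit (m OUT (p / w)) (p mod w)) ->
  item_of e m' u = item_of e m u.
Proof.
  intros HE Hbl Hu H. apply limbsum_ext. intros j Hj. apply field_ext. intros p Hpf.
  assert (HL := layout_of w K c ks kp kr beta tab A HK Hw HcK Hks Hb Hb8 Ht Hn Hl Hl8 Hkp Hkw e).
  set (v := u * 2 ^ ks + j).
  assert (Hv : v < field_count) by (unfold v; nia).
  assert (FE := field_end e v HE Hbl Hv).
  assert (SP := slot_pos_le w (rho_of e) (width_of e) (phi_of e) HL v).
  set (sl := slot_pos (rho_of e) (phi_of e) v) in *.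
  destruct (div_mod_unique (v / 2 ^ rho_of e * w + (p + sl)) w (v / 2 ^ rho_of e) (p + sl))
    as (D & M); [lia|reflexivity|].
  assert (H' := H (v / 2 ^ rho_of e * w + (p + sl)) ltac:(lia)). rewrite D, M in H'. exact H'.
Qed.

(** Resolves the circularity that e is needed to find the fields: in every layout field 0 starts at
    bit 0 of word 0 and has at least b + 1 bits. *)
Lemma field_0 e m :
  small_exponent e -> b <= l -> item_of e m 0 = 2 * e + 1 ->
  m OUT 0 mod 2 = 1 /\ (m OUT 0 / 2) mod 2 ^ b = e.
Proof.
  intros HE Hbl H. destruct (exponent_bounds e HE Hbl) as (_ & He).
  assert (HL := layout_of w K c ks kp kr beta tab A HK Hw HcK Hks Hb Hb8 Ht Hn Hl Hl8 Hkp Hkw e).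
  assert (X : b + 1 <= width_of e).
  { unfold Layout.width_of. destruct (e <? tab 3); [|lia].
    assert (Y := width_exponent c kp beta Hkp e).
    assert (P := pow2_pos e).
    assert ((8 * c + 16) * b * 1 <= (8 * c + 16) * b * 2 ^ e) by (apply Nat.mul_le_mono_l; lia).
    unfold Layout.phi_of in *. lia. }
  assert (F0 : field (rho_of e) (width_of e) (phi_of e) (m OUT) 0 = 2 * e + 1).
  { assert (D := limbsum_digit w (fun j => field (rho_of e) (width_of e) (phi_of e) (m OUT) (0 * 2 ^ ks + j)) K 0).
    cbn [Nat.mul Nat.add] in D. rewrite Nat.mul_0_r, Nat.pow_0_r, Nat.div_1_r in D.
    rewrite <- D; [| |lia].
    - change (item_of e m 0 mod 2 ^ w = 2 * e + 1). rewrite H. apply Nat.mod_small.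
      apply Nat.lt_le_trans with (2 ^ S b); [simpl; lia|]. apply Nat.pow_le_mono_r; lia.
    - intros j Hj. eapply Nat.lt_le_trans; [apply field_lt|]. apply Nat.pow_le_mono_r; [lia|apply HL]. }
  unfold field, slot_pos in F0. rewrite Nat.Div0.div_0_l, Nat.Div0.mod_0_l, Nat.mul_0_l, Nat.pow_0_r, Nat.div_1_r in F0.
  set (x := m OUT 0) in *.
  assert (E : x = 2 * e + 1 + 2 * (2 ^ b * (2 ^ (width_of e - S b) * (x / 2 ^ width_of e)))).
  { rewrite (Nat.div_mod_eq x (2 ^ width_of e)) at 1. rewrite F0.
    replace (2 ^ width_of e) with (2 * 2 ^ b * 2 ^ (width_of e - S b)) at 1; [lia|].
    rewrite <- Nat.pow_succ_r', <- Nat.pow_add_r. f_equal. lia. }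
  set (z := 2 ^ (width_of e - S b) * (x / 2 ^ width_of e)) in E. clearbody z.
  assert (D2 : x / 2 = e + 2 ^ b * z /\ x mod 2 = 1).
  { apply div_mod_unique; lia. }
  destruct D2 as (-> & ->). split; [reflexivity|].
  rewrite Nat.mul_comm, Nat.Div0.mod_add. apply Nat.mod_small. assumption.
Qed.

Lemma ones_at_app j k : exists ys, ones_at (j + k) = ones_at j ++ ys.
Proof.
  unfold Scan.ones_at. rewrite Nat.mul_add_distr_r, window_app, dec_ones_app. eauto.
Qed.

Lemma select_at i :
  1 <= i <= length (ones A) ->
  i <= cnt_at chunks /\ nth (i - 1) (ones_at chunks) 0 = select A i.
Proof.
  intros Hi. apply (dec_select (stream w inp) A).
  - intros j Hj. apply stream_senc; assumption.
  - apply (chunks_spec w K c ks kp kr beta A); assumption.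
  - assumption.
Qed.

Definition table_memory (m : memory) : Prop :=
  word_memory w m /\ forall a, a < table_size beta -> m TAB a = tab a.

Lemma small_key key : key < 2 ^ b -> key < key_count b.
Proof. intros H. unfold key_count. rewrite Nat.pow_add_r. change (2 ^ 2) with 4. nia. Qed.

Lemma table_bounds key :
  key < key_count b -> key < 2 ^ w /\ row_of beta key + 2 * b <= 2 ^ w /\
  row_of beta key + 2 * b <= table_size beta.
Proof.
  intros H.
  destruct (table_row w K c beta A HK Hw ltac:(lia) Hb Hb8 Hn Hl key H) as (X & Y).
  split; [|lia]. assert (Z := X). unfold row_of in Z. rewrite Nat.pow_succ_r' in Z.
  apply Nat.le_lt_trans with (key * (2 * b)); [apply le_mul_of_pos with (2 * b)|]; lia.
Qed.

Lemma safe_row s k key :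
  regs s 3 = beta -> safe w K s k -> ev s k = key -> key < key_count b ->
  safe w K s (row_expr k) /\ ev s (row_expr k) = row_of beta key.
Proof.
  intros E3 Hs Hk Hlt. destruct (table_bounds key Hlt) as (T1 & T2 & _).
  assert (BL : beta < b) by (apply Nat.pow_gt_lin_r; lia).
  assert (WK := word_lt_big w K HK). assert (wK := w_le_wK w K HK).
  assert (ww : w < 2 ^ w) by (apply Nat.pow_gt_lin_r; lia).
  assert (WK' : 2 ^ w <= 2 ^ (w * K)) by (apply Nat.pow_le_mono_r; lia).
  unfold row_expr. cbn [safe ev]. rewrite E3, Hk, Nat.add_1_r. unfold row_of in *.
  split; [|reflexivity]. repeat split; auto; lia.
Qed.

Lemma ones_nth j i key :
  is_key w beta inp j key -> cnt_at j <= i < cnt_at (S j) ->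
  i - cnt_at j < length (dec_ones (key_state b key) (key_bits b key)) /\
  nth i (ones_at (S j)) 0 =
  pos_at w beta inp j + nth (i - cnt_at j) (dec_ones (key_state b key) (key_bits b key)) 0.
Proof.
  intros HKey Hi. destruct (chunk_step w beta tab inp j key HKey) as (_ & _ & X & _).
  unfold Scan.cnt_at in *. rewrite X in *. rewrite length_app, length_map in Hi.
  split; [lia|]. rewrite app_nth2 by lia.
  rewrite nth_indep with (d' := pos_at w beta inp j + 0) by (rewrite length_map; lia).
  apply map_nth.
Qed.

Lemma wp_query_large s i e rec m m' :
  regs s 0 = i -> regs s 2 = w -> regs s 3 = beta -> regs s 4 = b -> regs s 12 = e ->
  table_memory (mem s) -> b < l -> index_built e rec m m' ->
  (forall u, (u + 1) * 2 ^ ks <= field_count -> item_of e (mem s) u = item_of e m' u) ->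
  1 <= i <= length (ones A) ->
  wp w K (query_large_cmd K ks kp) (fun s' t => t <= 12 * K + 40 /\
    regs s' 0 = select A i /\ mem s' = mem s) s.
Proof.
  intros E0 E2 E3 E4 E12 (WM & MT) Hbl (HE & _ & _ & _ & Hrec & HF) HI Hi.
  destruct (select_at i Hi) as (S1 & S2).
  destruct (HF (i - 1) ltac:(lia)) as (T1 & j & T2 & (T3 & T4 & T5 & T6)).
  destruct (chunks_spec w K c ks kp kr beta A HK Hw HcK Hks Hb Hb8 Hn Hl Hl8 Hkp Hkw) as (CS1 & CS2 & CS3).
  assert (FC := field_count_le w K c ks kp kr beta A HK Hw HcK Hks Hb Hb8 Hn Hl Hl8 Hkp Hkw).
  assert (IFits := item_fits w K c ks kp kr beta A HK Hw HcK Hks Hb Hb8 Hn Hl Hl8 Hkp Hkw).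
  assert (HL := layout_of w K c ks kp kr beta tab A HK Hw HcK Hks Hb Hb8 Ht Hn Hl Hl8 Hkp Hkw e).
  assert (LG := log_spec w K c ks kp kr beta tab A HK Hw HcK Hks Hb Hb8 Ht Hn Hl Hl8 Hkp Hkw).
  destruct (small_exponent_le w K c ks kp kr beta A HK Hw HcK Hks Hb Hb8 Hn Hl Hl8 Hkp Hkw e HE) as (EE & EE').
  assert (wK := triple_w w K c ks kp kr beta A HK Hw HcK Hks Hb Hb8 Hn Hl Hl8 Hkp Hkw).
  assert (Hrho : rho_of e <= w * K) by (unfold Layout.rho_of; lia).
  assert (Hphi : phi_of e <= w * K) by lia.
  destruct (big_room w K c beta A HK Hw ltac:(lia) Hb Hb8 Hn Hl) as (BR1 & BR2 & _ & _).
  assert (ww : w < 2 ^ w) by (apply Nat.pow_gt_lin_r; lia).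
  assert (BL : beta < b) by (apply Nat.pow_gt_lin_r; lia).
  set (i0 := i - 1) in *. set (k := i0 / b) in *. set (o := i0 mod b) in *.
  assert (Ho : o < b) by (apply Nat.mod_upper_bound; lia).
  set (bits := item_of e m' (8 * k + 11) mod 2 ^ S o) in *.
  assert (Hbits : bits < 2 ^ b).
  { eapply Nat.lt_le_trans; [apply Nat.mod_upper_bound, Nat.pow_nonzero; lia|]. apply Nat.pow_le_mono_r; lia. }
  set (t := item_of e m' (8 * k + 12) + popcount b bits) in *.
  assert (CC := cnt_at_le w K c ks kp kr beta A inp HK Hw HcK Hks Hb Hb8 Hn Hl Hl8 Hkp Hkw chunks).
  assert (Hk : k <= chunks) by (apply Nat.Div0.div_le_upper_bound; lia).
  assert (Pc := pow2_pos (c * w)).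
  assert (Hi0 : i0 < 2 ^ (w * K)).
  { assert (X : chunks * b <= l + b).
    { destruct (Nat.eq_0_gt_0_cases chunks) as [->|Hc]; [lia|].
      assert (Y := CS1 (chunks - 1) ltac:(lia)). rewrite Nat.mul_sub_distr_r in Y. lia. }
    assert (b <= 2 ^ w) by lia. unfold i0. lia. }
  apply wp_seq. eapply wp_mono.
  (* The input array may have changed since the build; the lemma is instantiated with its present
     contents, whatever they are. *)
  { apply (wp_layout w K c ks kp kr beta tab A (mem s INP) HK Hw HcK Hks Hb Hb8 Ht Hn Hl Hl8 Hkp Hkw) with (e := e); auto.
    split; [assumption|]. split; [assumption|reflexivity]. }
  intros s1 t1 (Ht1 & M1 & G1 & L1).
  apply wp_seq, wp_set with (v := i0).
  { cbn [safe ev]. rewrite G1 by lia. rewrite E0. repeat split; auto; lia. }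
  { cbn [ev]. rewrite G1 by lia. now rewrite E0. }
  apply wp_seq, wp_set with (v := k).
  { cbn [safe ev]. lookup. rewrite G1 by lia. rewrite E3. repeat split; auto; lia. }
  { cbn [ev]. lookup. rewrite G1 by lia. now rewrite E3. }
  apply wp_seq, wp_set with (v := S o).
  { cbn [safe]. rewrite ev_lowbits. cbn [ev]. lookup. rewrite G1 by lia. rewrite E3. fold o.
    split; [apply safe_lowbits; cbn [safe ev]; lookup; rewrite ?G1 by lia; rewrite ?E3; auto; lia|].
    split; lia. }
  { cbn [ev]. rewrite ev_lowbits. cbn [ev]. lookup. rewrite G1 by lia. rewrite E3. fold o. lia. }
  set (s2 := set_reg (set_reg (set_reg s1 5 i0) 6 k) 7 (S o)).
  assert (R2 : forall y, y < 5 -> regs s2 y = regs s y).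
  { intros y Hy. unfold s2. lookup. rewrite !upd_neq, G1 by lia. reflexivity. }
  assert (L2 : has_layout w (rho_of e) (width_of e) (phi_of e) s2) by exact L1.
  assert (Hidx : forall x t' i' s', regs s' x = t' -> t' <= S chunks -> i' <= 4 ->
    safe w K s' (item_index x i') /\ ev s' (item_index x i') = 8 * t' + 8 + i' /\
    (8 * t' + 8 + i' + 1) * 2 ^ ks <= field_count).
  { intros x t' i' s' Hx Ht' Hi'. assert (IF := IFits t' i' Ht' Hi').
    assert (t' * 8 + (8 + i') + 1 <= field_count) by (apply le_mul_of_pos with (2 ^ ks); [apply pow2_pos|assumption]).
    unfold item_index. cbn [safe ev]. rewrite Hx. change (2 ^ 3) with 8.
    split; [repeat split; auto; lia|]. split; [lia|].
    replace (8 * t' + 8 + i' + 1) with (t' * 8 + (8 + i') + 1) by lia. assumption. }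
  assert (Get : forall x t' i' s', has_layout w (rho_of e) (width_of e) (phi_of e) s' ->
    mem s' = mem s -> regs s' x = t' -> t' <= S chunks -> i' <= 4 ->
    wp w K (get_item K ks (item_index x i')) (fun s'' t => t = 2 * K + 3 /\
      (forall y, y < 30 -> regs s'' y = regs s' y) /\ mem s'' = mem s /\
      has_layout w (rho_of e) (width_of e) (phi_of e) s'' /\
      regs s'' 41 = item_of e m' (8 * t' + 8 + i')) s').
  { intros x t' i' s' HLs HMs Hx Ht' Hi'. destruct (Hidx x t' i' s' Hx Ht' Hi') as (I1 & I2 & I3).
    eapply wp_mono.
    { apply (wp_get_item w K ks (rho_of e) (width_of e) (phi_of e)) with (u := 8 * t' + 8 + i') (V := field_count); auto. }
    intros s'' t'' (-> & F & M & R). split; [reflexivity|]. split; [assumption|].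
    split; [congruence|]. split.
    - destruct HLs as (X1 & X2 & X3 & X4 & X5). unfold has_layout. rewrite !F, M by lia. auto.
    - rewrite R, HMs. apply HI. exact I3. }
  apply wp_seq. eapply wp_mono; [apply Get with (t' := k); auto; lia|].
  intros s3 t3 (-> & F3 & M3 & L3 & R3).
  replace (8 * k + 8 + 3) with (8 * k + 11) in R3 by lia.
  assert (IL : forall u, item_of e m' u < 2 ^ (w * K)) by (intros u; apply item_lt; assumption).
  apply wp_seq, wp_set with (v := bits).
  { apply safe_lowbits; cbn [safe ev]; auto.
    - rewrite F3 by lia. change (regs s2 7) with (S o). lia.
    - rewrite R3. apply IL. }
  { rewrite ev_lowbits. cbn [ev]. rewrite R3, F3 by lia. reflexivity. }
  apply wp_seq. eapply wp_mono.
  { apply Get with (t' := k); auto; try lia. cbn [set_reg regs]. rewrite upd_neq by lia.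
    rewrite F3 by lia. reflexivity. }
  intros s4 t4 (-> & F4 & M4 & L4 & R4). revert F4. lookup. intros F4.
  replace (8 * k + 8 + 4) with (8 * k + 12) in R4 by lia.
  assert (R4' : forall y, y < 8 -> regs s4 y = regs s2 y).
  { intros y Hy. rewrite F4, upd_neq, F3 by lia. reflexivity. }
  assert (E8 : regs s4 8 = bits) by (rewrite F4 by lia; lookup; reflexivity).
  assert (E3' : regs s4 3 = beta) by (rewrite R4', R2 by lia; assumption).
  destruct (safe_row s4 (EVar 8) bits E3' I E8 (small_key bits Hbits)) as (SR & ER).
  destruct (table_bounds bits (small_key bits Hbits)) as (_ & TB1 & TB2).
  assert (PT : mem s4 TAB (row_of beta bits + 3) = popcount b bits).
  { rewrite M4, MT by lia. destruct Ht as (_ & _ & _ & _ & HG). apply (HG bits (small_key bits Hbits)). }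
  assert (TL : t < 2 ^ (w * K)) by lia.
  (* [t] counts the chunks that start at or before the queried one, while records are numbered from
     0; [T1] gives 1 <= t. *)
  apply wp_seq, wp_set with (v := t - 1).
  { cbn [safe ev]. rewrite ER, PT, R4. fold t.
    split; [split; [exact I|split; [split; [exact SR|split; lia]|lia]]|split; lia]. }
  { cbn [ev]. rewrite ER, PT, R4. reflexivity. }
  apply wp_seq. eapply wp_mono.
  { apply Get with (t' := t - 1); auto; try lia. }
  intros s5 t5 (-> & F5 & M5 & L5 & R5). rewrite Nat.add_0_r, T3 in R5.
  revert F5. lookup. intros F5.
  apply wp_seq, wp_set with (v := pos_at w beta inp j); [exact I|exact R5|].
  apply wp_seq. eapply wp_mono.
  { apply Get with (t' := t - 1); auto; try lia. lookup. rewrite F5 by lia. lookup. reflexivity. }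
  intros s6 t6 (-> & F6 & M6 & L6 & R6). revert F6. lookup. intros F6.
  replace (8 * (t - 1) + 8 + 1) with (8 * (t - 1) + 9) in R6 by lia. rewrite T4 in R6.
  apply wp_seq, wp_set with (v := cnt_at j); [exact I|exact R6|].
  apply wp_seq. eapply wp_mono.
  { apply Get with (t' := t - 1); auto; try lia. lookup. rewrite F6 by lia. lookup.
    rewrite F5 by lia. lookup. reflexivity. }
  intros s7 t7 (-> & F7 & M7 & L7 & R7). revert F7. lookup. intros F7.
  replace (8 * (t - 1) + 8 + 2) with (8 * (t - 1) + 10) in R7 by lia.
  set (key := item_of e m' (8 * (t - 1) + 10)) in *.
  apply wp_seq, wp_set with (v := key); [exact I|exact R7|].
  destruct (ones_nth j i0 key T5 T2) as (N1 & N2).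
  set (q := nth (i0 - cnt_at j) (dec_ones (key_state b key) (key_bits b key)) 0) in *.
  set (s8 := set_reg s7 20 key).
  assert (V : forall y, y < 8 -> regs s8 y = regs s2 y).
  { intros y Hy. unfold s8. lookup. rewrite upd_neq, F7 by lia. rewrite upd_neq, F6 by lia.
    rewrite upd_neq, F5 by lia. rewrite upd_neq by lia. apply R4'. assumption. }
  assert (E3'' : regs s8 3 = beta) by (rewrite V, R2 by lia; assumption).
  destruct (safe_row s8 (EVar 20) key E3'' I ltac:(reflexivity) (proj1 T5)) as (SK & EK).
  destruct (table_bounds key (proj1 T5)) as (_ & TB3 & TB4).
  assert (LB : length (dec_ones (key_state b key) (key_bits b key)) <= b).
  { eapply Nat.le_trans; [apply dec_ones_length|]. unfold key_bits. rewrite window_length. lia. }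
  assert (PQ : mem s8 TAB (row_of beta key + b + (i0 - cnt_at j)) = q).
  { change (mem s8) with (mem s7). rewrite M7, MT by lia.
    destruct Ht as (_ & _ & _ & _ & HG). destruct (HG key (proj1 T5)) as (_ & _ & _ & _ & HQ).
    apply HQ. exact N1. }
  assert (Qw : q < 2 ^ w) by (rewrite <- PQ; apply L7).
  (* A chunk beyond the last would have all ones of the encoding before it, contradicting that it
     contains the queried one. *)
  assert (J1 : j * b < l + b).
  { apply Nat.nle_gt. intros X.
    assert (Y : cnt_at chunks <= cnt_at j).
    { destruct (Nat.le_exists_sub chunks j) as (dd & -> & _).
      - apply (Nat.mul_le_mono_pos_r _ _ b); [lia|].
        destruct (Nat.eq_0_gt_0_cases chunks) as [->|Hc]; [lia|].
        assert (Z := CS1 (chunks - 1) ltac:(lia)). rewrite Nat.mul_sub_distr_r in Z. lia.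
      - rewrite Nat.add_comm. destruct (ones_at_app chunks dd) as (ys & Z).
        unfold Scan.cnt_at. rewrite Z, length_app. lia. }
    lia. }
  assert (PL := pos_le w K c beta A inp Hp HK Hw ltac:(lia) Hb Hb8 Hn Hl j J1).
  assert (BP := b_pow w K c beta A HK Hw ltac:(lia) Hb Hb8 Hn Hl).
  apply wp_set with (v := select A i).
  { cbn [safe ev]. rewrite EK. rewrite (V 4), (V 5), R2, E4 by lia. change (regs s2 5) with i0.
    replace (regs s8 11) with (cnt_at j).
    2:{ unfold s8. lookup. rewrite F7 by lia. lookup. reflexivity. }
    replace (regs s8 10) with (pos_at w beta inp j).
    2:{ unfold s8. lookup. rewrite F7 by lia. lookup. rewrite F6 by lia. lookup. reflexivity. }
    rewrite PQ. split; [exact I|]. split; [|lia].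
    split; [split; [exact SK|split; [exact I|lia]]|]. split; [split; [exact I|split; [exact I|lia]]|lia]. }
  { cbn [ev]. rewrite EK. rewrite (V 4), (V 5), R2, E4 by lia. change (regs s2 5) with i0.
    replace (regs s8 11) with (cnt_at j).
    2:{ unfold s8. lookup. rewrite F7 by lia. lookup. reflexivity. }
    replace (regs s8 10) with (pos_at w beta inp j).
    2:{ unfold s8. lookup. rewrite F7 by lia. lookup. rewrite F6 by lia. lookup. reflexivity. }
    rewrite PQ, <- N2, <- S2.
    (* The record speaks of the ones up to its own chunk, [select_at] of those of all chunks; one
       list is a prefix of the other, and the index is valid in both. *)
    destruct (Nat.le_ge_cases (S j) chunks) as [Hj|Hj].
    - destruct (Nat.le_exists_sub (S j) chunks Hj) as (dd & -> & _).
      rewrite Nat.add_comm. destruct (ones_at_app (S j) dd) as (ys & ->).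
      rewrite app_nth1; [reflexivity|]. apply T2.
    - destruct (Nat.le_exists_sub chunks (S j) Hj) as (dd & -> & _).
      rewrite Nat.add_comm. destruct (ones_at_app chunks dd) as (ys & ->).
      rewrite app_nth1; [reflexivity|]. unfold Scan.cnt_at in S1. lia. }
  split; [lia|]. split; [reflexivity|]. exact M7.
Qed.

(** The whole encoding is one chunk read from state (0, 0), so a single row of the table already
    lists all its ones. *)
Lemma wp_query_small s i :
  regs s 0 = i -> regs s 3 = beta -> regs s 4 = b -> table_memory (mem s) ->
  regs s 12 < 2 ^ b -> (forall p, p < l -> Nat.testbit (regs s 12) p = nth p (senc_mask A) false) ->
  l <= b -> 1 <= i <= length (ones A) ->
  wp w K query_small_cmd (fun s' t => t = 1 /\ regs s' 0 = select A i /\ mem s' = mem s) s.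
Proof.
  intros E0 E3 E4 (WM & MT) Hkey Hbits Hlb Hi.
  set (key := regs s 12) in *.
  destruct (dec_select (Nat.testbit key) A b i Hbits Hlb Hi) as (S1 & S2).
  assert (HS : key_state b key = (0, 0)).
  { unfold key_state. rewrite Nat.div_small by assumption. reflexivity. }
  fold (key_bits b key) in S1, S2. rewrite <- HS in S1, S2.
  assert (LB : length (dec_ones (key_state b key) (key_bits b key)) <= b).
  { eapply Nat.le_trans; [apply dec_ones_length|]. unfold key_bits. rewrite window_length. lia. }
  destruct (safe_row s (EVar 12) key E3 I eq_refl (small_key key Hkey)) as (SK & EK).
  destruct (table_bounds key (small_key key Hkey)) as (_ & TB1 & TB2).
  assert (ww : w < 2 ^ w) by (apply Nat.pow_gt_lin_r; lia).
  assert (WK' : 2 ^ w <= 2 ^ (w * K)) by (apply Nat.pow_le_mono_r; [lia|apply w_le_wK; lia]).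
  apply wp_set with (v := select A i).
  { cbn [safe ev]. rewrite EK, E0, E4.
    split; [split; [exact SK|split; [exact I|lia]]|]. split; [split; [exact I|split; lia]|lia]. }
  { cbn [ev]. rewrite EK, E0, E4, MT by lia.
    destruct Ht as (_ & _ & _ & _ & HG). destruct (HG key (small_key key Hkey)) as (_ & _ & _ & _ & HQ).
    rewrite HQ by lia. exact S2. }
  auto.
Qed.

End Query.

(** * Building and querying combined, over all encoding lengths *)

Section Structure.
Context (w K c ks kp kr beta : nat) (tab : nat -> nat) (A : list bool) (inp : nat -> nat).
Notation b := (2 ^ beta).
Notation n := (length A).
Notation l := (length (senc_mask A)).
Context (HK : 8 <= K) (Hw : 4 * (K * w) + 4 * K < 2 ^ w) (HcK : 2 * c + 4 <= K) (Hks : K <= 2 ^ ks).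
Context (Hb : 4 * b <= w) (Hb8 : 8 <= b) (Ht : good_tables kp kr w beta tab).
Context (Hn : n <= 2 ^ (c * w)) (Hl : l <= 2 ^ (c * w)) (Hp : packed w inp (senc_mask A)).
Context (Hl8 : l <= 2 ^ (8 * c * b)) (Hkp : 8 * c + 16 <= 2 ^ kp) (Hkw : kp + kr + ks + 16 < w).
Context (Hkr : 16 * c + 8 <= 2 ^ kr) (Hksb : ks <= b) (Hcb : 8 * c * b < 2 ^ b).

Notation table_memory := (table_memory w beta tab).

Lemma wp_setup s (Q : state -> nat -> Prop) :
  table_memory (mem s) ->
  Q (set_reg (set_reg (set_reg s 2 w) 3 beta) 4 b) 3 ->
  wp w K setup_cmd Q s.
Proof.
  intros (WM & MT) HQ. assert (TS : 8 <= table_size beta) by (unfold table_size, row_of; lia).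
  destruct Ht as (T0 & _ & T2 & _).
  assert (BL : beta < b) by (apply Nat.pow_gt_lin_r; lia).
  assert (wK := w_le_wK w K HK).
  assert (Bw : b < 2 ^ (w * K)).
  { apply word_lt_big; auto. apply Nat.le_lt_trans with w; [lia|]. apply Nat.pow_gt_lin_r. lia. }
  apply wp_seq, wp_set with (v := w); [apply pow2_pos|cbn [ev]; rewrite MT by lia; assumption|].
  apply wp_seq, wp_set with (v := beta).
  { cbn [safe]. lia. }
  { cbn [ev]. lookup. rewrite MT by lia. assumption. }
  apply wp_set with (v := b).
  { cbn [safe ev]. lookup. repeat split; auto; lia. }
  { cbn [ev]. lookup. lia. }
  exact HQ.
Qed.

Definition read_bits (m : memory) (u : nat) : list bool :=
  map (fun p => Nat.testbit (m OUT (p / w)) (p mod w)) (seq 0 u).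

Lemma read_bits_packed m u : packed w (m OUT) (read_bits m u).
Proof.
  intros j Hj. unfold read_bits in *. rewrite length_map, length_seq in Hj.
  rewrite nth_indep with (d' := Nat.testbit (m OUT (0 / w)) (0 mod w))
    by now rewrite length_map, length_seq.
  rewrite map_nth with (d := 0) (f := fun p => Nat.testbit (m OUT (p / w)) (p mod w)).
  now rewrite seq_nth.
Qed.

Lemma packed_read_bits m m' u p :
  packed w (m' OUT) (read_bits m u) -> p < u ->
  Nat.testbit (m' OUT (p / w)) (p mod w) = Nat.testbit (m OUT (p / w)) (p mod w).
Proof.
  intros H Hpu. assert (L : length (read_bits m u) = u) by (unfold read_bits; now rewrite length_map, length_seq).
  rewrite H by lia. symmetry. apply read_bits_packed. lia.
Qed.

(** The counterpart of [answers_select] in the language over big numbers. *)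
Definition answers (D : list bool) (T : nat) : Prop :=
  forall s i, table_memory (mem s) -> packed w (mem s OUT) D -> regs s 0 = i ->
  1 <= i <= length (ones A) ->
  wp w K (query_cmd K ks kp) (fun s' t => t <= T /\ regs s' 0 = select A i /\ mem s' = mem s) s.

Lemma wp_query_prefix s (Q : state -> nat -> Prop) x :
  table_memory (mem s) -> mem s OUT 0 = x ->
  (x mod 2 = 1 -> wp w K (query_large_cmd K ks kp) (fun s' t => Q s' (t + 6))
     (set_reg (set_reg (set_reg (set_reg (set_reg s 2 w) 3 beta) 4 b) 24 x) 12 ((x / 2) mod 2 ^ b))) ->
  (x mod 2 = 0 -> wp w K query_small_cmd (fun s' t => Q s' (t + 6))
     (set_reg (set_reg (set_reg (set_reg (set_reg s 2 w) 3 beta) 4 b) 24 x) 12 ((x / 2) mod 2 ^ b))) ->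
  wp w K (query_cmd K ks kp) Q s.
Proof.
  intros HT Hx H1 H0. assert (WK := word_lt_big w K HK). assert (wK := w_le_wK w K HK).
  assert (Hxw : x < 2 ^ w) by (rewrite <- Hx; apply HT).
  assert (Hxd : x / 2 <= x) by (apply Nat.Div0.div_le_upper_bound; lia).
  assert (ww : w < 2 ^ w) by (apply Nat.pow_gt_lin_r; lia).
  assert (Hxb := WK x Hxw).
  assert (Hm : x mod 2 < 2) by (apply Nat.mod_upper_bound; lia).
  apply wp_seq, wp_setup; [assumption|].
  apply wp_seq, wp_set with (v := x); [apply pow2_pos|exact Hx|].
  apply wp_seq, wp_set with (v := (x / 2) mod 2 ^ b).
  { apply safe_lowbits; cbn [safe ev]; lookup; rewrite ?Nat.pow_1_r; auto; lia. }
  { rewrite ev_lowbits. cbn [ev]. lookup. now rewrite Nat.pow_1_r. }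
  apply wp_if_lt; [assumption|assumption|apply pow2_pos| | |].
  - apply safe_lowbits; cbn [safe ev]; lookup; auto; lia.
  - rewrite ev_lowbits. cbn [ev]. lookup. rewrite Nat.pow_1_r. intros Hlt.
    eapply wp_mono; [apply H1; lia|]. intros s' t HQ. replace (3 + (1 + (1 + S t))) with (t + 6) by lia. exact HQ.
  - rewrite ev_lowbits. cbn [ev]. lookup. rewrite Nat.pow_1_r. intros Hlt.
    eapply wp_mono; [apply H0; lia|]. intros s' t HQ. replace (3 + (1 + (1 + S t))) with (t + 6) by lia. exact HQ.
Qed.

Lemma answers_large e rec m m' :
  b < l -> index_built w K ks kp beta tab A inp e rec m m' ->
  answers (read_bits m' (used_bits ks kp beta A e)) (12 * K + 46).
Proof.
  intros Hbl HB s i HT HP E0 Hi.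
  assert (HE := proj1 HB).
  assert (HI : forall u, (u + 1) * 2 ^ ks <= field_count ks beta A ->
    item_of w K ks kp beta tab e (mem s) u = item_of w K ks kp beta tab e m' u).
  { intros u Hu.
    apply (item_of_packed w K c ks kp kr beta tab A) with (m := m'); auto; try lia.
    intros p Hpu. now apply packed_read_bits with (u := used_bits ks kp beta A e). }
  assert (H0 : item_of w K ks kp beta tab e (mem s) 0 = 2 * e + 1).
  { rewrite HI; [apply HB|]. unfold field_count. apply Nat.mul_le_mono_r. lia. }
  destruct (field_0 w K c ks kp kr beta tab A) with (e := e) (m := mem s) as (X0 & X1); auto; try lia.
  apply wp_query_prefix with (x := mem s OUT 0); [assumption|reflexivity| |].
  - intros _. rewrite X1. eapply wp_mono.
    { apply (wp_query_large w K c ks kp kr beta tab A inp) with (e := e) (rec := rec) (m := m) (m' := m') (i := i); auto. }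
    intros s' t (Ht' & R & M). split; [lia|]. split; [assumption|]. exact M.
  - intros X. lia.
Qed.

Lemma answers_small : l <= b -> answers (false :: senc_mask A) 7.
Proof.
  intros Hlb s i HT HP E0 Hi.
  assert (P0 := HP 0 ltac:(simpl; lia)). rewrite Nat.Div0.div_0_l, Nat.Div0.mod_0_l in P0.
  cbn [nth] in P0.
  set (x := mem s OUT 0) in *.
  assert (HxB : forall p, p < l -> Nat.testbit x (S p) = nth p (senc_mask A) false).
  { intros p Hpl. assert (X := HP (S p) ltac:(simpl; lia)).
    rewrite Nat.div_small, Nat.mod_small in X by lia. exact X. }
  apply wp_query_prefix with (x := x); [assumption|reflexivity| |].
  - intros X. exfalso. assert (Y := Nat.bit0_mod x). rewrite P0, X in Y. discriminate.
  - intros _. eapply wp_mono.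
    { apply (wp_query_small w K c ks kp kr beta tab A) with (i := i); auto.
      - apply Nat.mod_upper_bound, Nat.pow_nonzero. lia.
      - intros p Hpl. lookup. rewrite Nat.mod_pow2_bits_low by lia.
        replace (x / 2) with (x / 2 ^ 1) by now rewrite Nat.pow_1_r.
        rewrite Nat.div_pow2_bits, Nat.add_1_r. now apply HxB. }
    intros s' t (-> & R & M). split; [lia|]. split; [assumption|]. exact M.
Qed.

(** All chunks but the last are full, and b < l; so the chunks and the three extra groups account
    for at most 5 l bits of encoding. *)
Lemma used_bits_le e :
  b < l -> used_bits ks kp beta A e <= 80 * 2 ^ ks * 2 ^ kp * l * 2 ^ e.
Proof.
  intros Hbl. unfold used_bits, field_count, phi_of.
  destruct (chunks_spec w K c ks kp kr beta A) as (X & _); auto.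
  assert (Y : (chunks beta A + 3) * b <= 5 * l).
  { destruct (Nat.eq_0_gt_0_cases (chunks beta A)) as [->|Hc]; [lia|].
    assert (Z := X (chunks beta A - 1) ltac:(lia)). rewrite Nat.mul_sub_distr_r in Z. lia. }
  rewrite !Nat.pow_add_r.
  replace (2 * (8 * (chunks beta A + 3) * 2 ^ ks) * (b * 2 ^ kp * 2 ^ e))
    with (16 * 2 ^ ks * 2 ^ kp * ((chunks beta A + 3) * b) * 2 ^ e) by lia.
  replace (80 * 2 ^ ks * 2 ^ kp * l * 2 ^ e) with (16 * 2 ^ ks * 2 ^ kp * (5 * l) * 2 ^ e) by lia.
  apply Nat.mul_le_mono_r, Nat.mul_le_mono_l. assumption.
Qed.

Lemma wp_build s :
  regs s 0 = l -> good_memory w beta tab inp (mem s) ->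
  wp w K (build_cmd K ks kp) (fun s' t => exists u e D,
    t <= (60 * K + 120) * chunks beta A + 8 * K + 50 /\
    small_exponent beta A e /\ u <= 80 * 2 ^ ks * 2 ^ kp * l * 2 ^ e /\ length D <= u /\
    (forall k a, ~ (k = OUT /\ a * w < u) -> mem s' k a = mem s k a) /\
    packed w (mem s' OUT) D /\ answers D (12 * K + 46)) s.
Proof.
  intros E0 HG. assert (HT : table_memory (mem s)) by (split; apply HG).
  assert (Pks := pow2_pos ks). assert (Pkp := pow2_pos kp).
  apply wp_seq, wp_setup; [assumption|].
  apply wp_if_lt; [assumption|assumption|exact I|exact I| |]; cbn [ev]; lookup; rewrite E0; intros Hlt.
  - eapply wp_mono.
    { apply (wp_build_large w K c ks kp kr beta tab A inp); auto. }
    intros s' t (e & rec & Ht' & HB). lookup.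
    exists (used_bits ks kp beta A e), e, (read_bits (mem s') (used_bits ks kp beta A e)).
    split; [lia|]. assert (HE := proj1 HB). split; [assumption|].
    split; [now apply used_bits_le|]. split; [unfold read_bits; rewrite length_map, length_seq; lia|].
    split; [|split; [apply read_bits_packed|eapply answers_large; eauto]].
    intros k a Ha. destruct HB as (_ & _ & HO & _). apply HO. intros (-> & v & Hv & ->).
    apply Ha. split; [reflexivity|].
    assert (HL := layout_of w K c ks kp kr beta tab A HK Hw HcK Hks Hb Hb8 Ht Hn Hl Hl8 Hkp Hkw e).
    enough (X : v / 2 ^ rho_of tab e * w + slot_pos (rho_of tab e) (phi_of kp beta e) v + width_of w kp beta tab e
       <= used_bits ks kp beta A e) by (destruct HL; lia).
    apply (field_end w K c ks kp kr beta tab A) ; auto; lia.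
  - apply wp_if_lt; [assumption|assumption|apply pow2_pos|exact I| |]; cbn [ev]; lookup; rewrite E0; intros Hl0.
    + assert (Hx : mem s INP 0 < 2 ^ w) by apply HG. set (x := mem s INP 0) in *.
      assert (Hxm : x mod 2 ^ (w - 1) < 2 ^ (w - 1)) by (apply Nat.mod_upper_bound, Nat.pow_nonzero; lia).
      assert (W2 : 2 ^ w = 2 * 2 ^ (w - 1)) by (rewrite <- Nat.pow_succ_r'; f_equal; lia).
      assert (WK := word_lt_big w K HK). assert (wK := w_le_wK w K HK).
      apply wp_write with (i := 0) (v := x mod 2 ^ (w - 1) * 2).
      * apply pow2_pos.
      * cbn [safe]. rewrite ev_lowbits. cbn [ev]. lookup. fold x. rewrite Nat.pow_1_r.
        split; [apply safe_lowbits; cbn [safe ev]; lookup; auto; try lia|].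
        assert (P1 := pow2_pos (w - 1)). split; [lia|]. split; [apply WK; lia|lia].
      * reflexivity.
      * cbn [ev]. rewrite ev_lowbits. cbn [ev]. lookup. now rewrite Nat.pow_1_r.
      * lia.
      * exists (S l), 0, (false :: senc_mask A). lookup.
        split; [lia|]. split; [left; reflexivity|].
        assert (Y : 1 * 1 <= 2 ^ ks * 2 ^ kp) by (apply Nat.mul_le_mono; lia).
        split; [rewrite Nat.pow_0_r; nia|]. split; [simpl; lia|]. split; [|split].
        -- intros k a Ha. unfold upd. destruct (Nat.eqb_spec k OUT) as [->|]; auto.
           destruct (Nat.eqb_spec a 0) as [->|]; auto. exfalso. apply Ha. split; [reflexivity|lia].
        -- intros p Hpl. cbn [length] in Hpl. rewrite (Nat.div_small p w), (Nat.mod_small p w) by lia.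
           rewrite upd_eq. replace (x mod 2 ^ (w - 1) * 2) with (0 + x mod 2 ^ (w - 1) * 2 ^ 1) by (rewrite Nat.pow_1_r; lia).
           rewrite testbit_concat by (simpl; lia). destruct p as [|p]; [reflexivity|].
           destruct (Nat.ltb_spec (S p) 1); [lia|]. cbn [nth].
           replace (S p - 1) with p by lia. rewrite Nat.mod_pow2_bits_low by lia.
           unfold x. rewrite (proj2 (proj2 HG)). rewrite <- Hp by lia.
           now rewrite Nat.div_small, Nat.mod_small by lia.
        -- intros s0 i H1 H2 H3 H4. eapply wp_mono; [apply answers_small; eauto; lia|].
           intros s' t (? & ? & ?). split; [lia|auto].
    (* For an empty encoding the space bound is 0: not even a tag bit may be written. There are no
       ones either, so no query has to be answered. *)
    + apply wp_skip. exists 0, 0, []. lookup.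
      split; [lia|]. split; [left; reflexivity|]. split; [lia|]. split; [simpl; lia|]. split; [reflexivity|].
      split; [intros p Hpl; simpl in Hpl; lia|].
      intros s0 i H1 H2 H3 H4. exfalso.
      assert (X := dec_ones_length (0, 0) (senc_mask A)).
      destruct (dec_senc_mask A) as (_ & _ & E). rewrite E in X. lia.
Qed.

End Structure.

(** * Bounded inputs *)

(** [w'] is the width assumed when the program text is made, [w] the actual one. They may differ
    only for a constant that fits into its lowest limb, where both widths give the same digits. *)
Definition fits (w w' v : nat) : Prop := w' = w \/ w' <= w /\ v < 2 ^ w'.

Lemma fits_digit w w' v j : fits w w' v -> v / 2 ^ (w' * j) mod 2 ^ w = v / 2 ^ (w * j) mod 2 ^ w.
Proof.
  intros [->|(H & Hv)]; [reflexivity|]. destruct j as [|j]; [now rewrite !Nat.mul_0_r|].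
  rewrite !(Nat.div_small v); auto.
  - apply Nat.lt_le_trans with (2 ^ w'); auto. apply Nat.pow_le_mono_r; nia.
  - apply Nat.lt_le_trans with (2 ^ w'); auto. apply Nat.pow_le_mono_r; nia.
Qed.

Definition const_num (q base w' v : nat) : cmd :=
  for_cmd q (fun j => Const (base + j) (v / 2 ^ (w' * j))).

Lemma run_const_num w q base w' v s :
  fits w w' v ->
  mem (run w (const_num q base w' v) s) = mem s /\
  (forall j, j < q -> regs (run w (const_num q base w' v) s) (base + j) = v / 2 ^ (w * j) mod 2 ^ w) /\
  (forall r, r < base \/ base + q <= r -> regs (run w (const_num q base w' v) s) r = regs s r).
Proof.
  intros F. unfold const_num. induction q as [|q IH]; cbn [for_cmd run].
  - repeat split; auto. intros; lia.
  - destruct IH as (M & A & B). cbn [set_reg mem regs]. split; [exact M|]. split.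
    + intros j Hj. destruct (Nat.eq_dec j q) as [->|].
      * rewrite upd_eq. now apply fits_digit.
      * rewrite upd_neq by lia. apply A. lia.
    + intros r Hr. rewrite upd_neq by lia. apply B. lia.
Qed.

Lemma loopfree_const_num q base w' v : loopfree (const_num q base w' v) = true.
Proof. now apply loopfree_for. Qed.

Lemma of_limbs_mod w q v f base :
  (forall j, j < q -> f (base + j) = v / 2 ^ (w * j) mod 2 ^ w) ->
  of_limbs w (map f (seq base q)) = v mod 2 ^ (w * q).
Proof.
  intros H. rewrite of_limbs_limbsum, <- limbsum_digits. now apply limbsum_ext.
Qed.

(** A linear chain of tests. Its length is a constant depending on [c] only, so the search costs
    O(1). *)
Fixpoint cases (test : nat -> cmd) (r : nat) (f : nat -> cmd) (other : cmd) (n v : nat) : cmd :=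
  match n with
  | 0 => other
  | S n' => Seq (test v) (If r (f v) (cases test r f other n' (S v)))
  end.

Lemma run_cases w test r f other (ok : state -> Prop) k n v s :
  (forall u s, v <= u < k -> ok s -> ok (run w (test u) s) /\ regs (run w (test u) s) r = 0) ->
  (forall s, k < v + n -> ok s -> ok (run w (test k) s) /\ regs (run w (test k) s) r <> 0) ->
  ok s -> v <= k ->
  exists s', ok s' /\ run w (cases test r f other n v) s = run w (if k <? v + n then f k else other) s'.
Proof.
  revert v s. induction n as [|n IH]; intros v s H1 H2 Hs Hv.
  - exists s. split; auto. destruct (Nat.ltb_spec k (v + 0)); [lia|reflexivity].
  - cbn [cases run]. destruct (Nat.eq_dec v k) as [->|Hne].
    + destruct (H2 s ltac:(lia) Hs) as (A & B). apply Nat.eqb_neq in B. rewrite B.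
      eexists. split; [exact A|]. destruct (Nat.ltb_spec k (k + S n)); [reflexivity|lia].
    + destruct (H1 v s ltac:(lia) Hs) as (A & B). rewrite B, Nat.eqb_refl.
      replace (v + S n) with (S v + n) by lia. apply IH; auto; try lia.
      * intros u s' Hu. apply H1. lia.
      * intros s' Hu. apply H2. lia.
Qed.

Lemma loopfree_cases test r f other n v :
  (forall u, loopfree (test u) = true) -> (forall u, loopfree (f u) = true) ->
  loopfree other = true -> loopfree (cases test r f other n v) = true.
Proof. intros A B C. revert v. induction n; intros v; simpl; auto. rewrite A, B, IHn. reflexivity. Qed.

Section Fallback.
Context (q L W1 : nat).

(* The argument is in registers 0, ..., q - 1, and q, ..., 2 q - 1 hold constants. *)
Notation tw := (2 * q).
Notation tc := (2 * q + 1).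
Notation tr := (2 * q + 2).

Definition same_args (s s' : state) : Prop :=
  mem s' = mem s /\ forall r, r < q -> regs s' r = regs s r.

Definition width_test (u : nat) : cmd := Seq (Const tc u) (Op tr Eq tw tc).

(** The program text cannot mention [w], so [w] is read from the table and compared with 0, ..., W1
    - 1. All larger widths share the branch for W1, where the constants fit into one word. *)
Definition for_width (f : nat -> cmd) : cmd :=
  Seq (Const tc 0) (Seq (Read tw TAB [tc]) (cases width_test tr f (f W1) W1 0)).

Lemma run_for_width w f s :
  mem s TAB 0 = w ->
  exists s', same_args s s' /\ run w (for_width f) s = run w (f (Nat.min w W1)) s'.
Proof.
  intros T. assert (ww : w < 2 ^ w) by (apply Nat.pow_gt_lin_r; lia).
  unfold for_width. rewrite !run_seq.
  set (s1 := run w (Read tw TAB [tc]) (run w (Const tc 0) s)).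
  destruct (run_cases w width_test tr f (f W1)
    (fun s' => same_args s s' /\ regs s' tw = w) w W1 0 s1) as (s' & (A & B) & E); try lia.
  - intros u s' Hu ((M & A) & E). unfold width_test, same_args. cbn [run set_reg regs mem].
    split; [split; [split|]|].
    + exact M.
    + intros r Hr. rewrite !upd_neq by lia. now apply A.
    + rewrite !upd_neq by lia. exact E.
    + rewrite !upd_eq, upd_neq, E, Nat.mod_small by lia. cbn [eval_op].
      destruct (Nat.eqb_spec w u); [lia|reflexivity].
  - intros s' Hu ((M & A) & E). unfold width_test, same_args. cbn [run set_reg regs mem].
    split; [split; [split|]|].
    + exact M.
    + intros r Hr. rewrite !upd_neq by lia. now apply A.
    + rewrite !upd_neq by lia. exact E.
    + rewrite !upd_eq, upd_neq, E, Nat.mod_small by lia. cbn [eval_op]. now rewrite Nat.eqb_refl.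
  - unfold s1, same_args. cbn [run set_reg regs mem]. repeat split; auto.
    + intros r Hr. now rewrite !upd_neq by lia.
    + rewrite upd_eq. unfold index. cbn. rewrite upd_eq, Nat.Div0.mod_0_l, Nat.mul_0_r. exact T.
  - exists s'. split; auto. rewrite E. cbn [Nat.add].
    destruct (Nat.ltb_spec w W1); f_equal; f_equal; lia.
Qed.

Lemma loopfree_for_width f : (forall u, loopfree (f u) = true) -> loopfree (for_width f) = true.
Proof. intros H. cbn [for_width loopfree andb]. now apply loopfree_cases. Qed.

Definition arg_test (w' v : nat) : cmd :=
  Seq (const_num q q w' v) (Seq (Const tr 1)
    (for_cmd q (fun j => Seq (Op tc Eq j (q + j)) (Op tr And tr tc)))).

Lemma run_arg_test w w' v i s :
  0 < w -> fits w w' v -> v < 2 ^ (w * q) -> i < 2 ^ (w * q) ->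
  (forall j, j < q -> regs s j = i / 2 ^ (w * j) mod 2 ^ w) ->
  same_args s (run w (arg_test w' v) s) /\ regs (run w (arg_test w' v) s) tr = Nat.b2n (i =? v).
Proof.
  intros Wp F Hv Hi HA. unfold arg_test. rewrite !run_seq.
  destruct (run_const_num w q q w' v s F) as (M & A & B).
  set (s1 := run w (const_num q q w' v) s) in *.
  set (s2 := run w (Const tr 1) s1).
  assert (G : forall n, n <= q -> let s3 := run w (for_cmd n (fun j => Seq (Op tc Eq j (q + j)) (Op tr And tr tc))) s2 in
    mem s3 = mem s /\ (forall r, r < 2 * q -> regs s3 r = regs s1 r) /\
    regs s3 tr = Nat.b2n (forallb (fun j => i / 2 ^ (w * j) mod 2 ^ w =? v / 2 ^ (w * j) mod 2 ^ w) (seq 0 n))).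
  { induction n as [|n IH]; intros Hn; cbv zeta.
    - cbn [for_cmd run]. unfold s2. cbn [run set_reg regs mem]. rewrite upd_eq. repeat split; auto.
      + intros r Hr. now rewrite upd_neq by lia.
      + apply Nat.mod_small. now apply Nat.pow_gt_1; lia.
    - destruct (IH ltac:(lia)) as (M' & A' & E). cbn [for_cmd run].
      set (s3 := run w (for_cmd n _) s2) in *. cbn [set_reg mem regs].
      rewrite upd_eq. split; [exact M'|]. split.
      + intros r Hr. rewrite !upd_neq by lia. now apply A'.
      + rewrite seq_S, forallb_app, upd_eq, upd_neq, E by lia. cbn [forallb Nat.add].
        rewrite !A' by lia. rewrite B, HA, A by lia. cbn [eval_op].
        rewrite andb_true_r. destruct (forallb _ _), (_ =? _); reflexivity. }
  destruct (G q (le_n _)) as (M' & A' & E). split.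
  - split; [assumption|]. intros r Hr. rewrite A' by lia. apply B. lia.
  - rewrite E. f_equal. apply eq_true_iff_eq. rewrite forallb_forall, Nat.eqb_eq. split.
    + intros H. rewrite <- (Nat.mod_small i (2 ^ (w * q))), <- (Nat.mod_small v (2 ^ (w * q))) by assumption.
      rewrite <- !limbsum_digits. apply limbsum_ext. intros j Hj. apply Nat.eqb_eq, H, in_seq. lia.
    + intros ->. intros j _. apply Nat.eqb_refl.
Qed.

Lemma loopfree_arg_test w' v : loopfree (arg_test w' v) = true.
Proof.
  cbn [arg_test loopfree]. rewrite loopfree_const_num. cbn. now apply loopfree_for.
Qed.

Definition copy_cell (w' a : nat) : cmd :=
  Seq (const_num q q w' a) (Seq (Read tc INP (seq q q)) (Write OUT (seq q q) tc)).

(** A plain copy of the encoding. The initial test for length 0 is forced by the space bound, which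
    then is 0; for words of at least W1 bits one cell holds the whole encoding. *)
Definition fallback_build : cmd :=
  Seq (arg_test 0 0) (If tr Skip
    (for_width (fun w' => for_cmd (if w' <? W1 then L else 1) (copy_cell w')))).

Lemma run_copy_cells w w' n s :
  (forall a, a < n -> fits w w' a) ->
  (forall a, a < n -> a < 2 ^ (w * q) -> mem (run w (for_cmd n (copy_cell w')) s) OUT a = mem s INP a) /\
  forall k a, ~ (k = OUT /\ a < n) -> mem (run w (for_cmd n (copy_cell w')) s) k a = mem s k a.
Proof.
  intros F. induction n as [|n IH]; cbn [for_cmd]; [split; auto; intros; lia|].
  rewrite run_seq. destruct IH as (A1 & A2); auto. set (s1 := run w (for_cmd n _) s) in *.
  unfold copy_cell. rewrite !run_seq.
  destruct (run_const_num w q q w' n s1 (F n ltac:(lia))) as (M & C & D).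
  set (s2 := run w (const_num q q w' n) s1) in *.
  assert (I2 : index w s2 (seq q q) = n mod 2 ^ (w * q)) by now apply of_limbs_mod.
  set (s3 := run w (Read tc INP (seq q q)) s2).
  assert (I3 : index w s3 (seq q q) = n mod 2 ^ (w * q)).
  { rewrite <- I2. unfold index. f_equal. apply map_ext_in. intros r Hr. apply in_seq in Hr.
    unfold s3. cbn [run set_reg regs]. apply upd_neq. lia. }
  cbn [run]. rewrite I3. unfold s3. cbn [run set_reg set_mem mem regs]. rewrite upd_eq, I2, M.
  rewrite A2 by (unfold INP, OUT; lia).
  assert (Hn := Nat.Div0.mod_le n (2 ^ (w * q))). split.
  - intros a Ha Hb. rewrite upd_eq. unfold upd. destruct (Nat.eqb_spec a (n mod 2 ^ (w * q))) as [->|Hne]; auto.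
    apply A1; auto. destruct (Nat.eq_dec a n) as [->|]; [|lia]. rewrite Nat.mod_small in Hne; lia.
  - intros k a Hk. unfold upd. destruct (Nat.eqb_spec k OUT) as [->|]; [|apply A2; lia].
    destruct (Nat.eqb_spec a (n mod 2 ^ (w * q))) as [->|]; [lia|]. apply A2. lia.
Qed.

Lemma loopfree_fallback_build : loopfree fallback_build = true.
Proof.
  cbn [fallback_build loopfree]. rewrite loopfree_arg_test. apply loopfree_for_width.
  intros u. apply loopfree_for. intros a _. cbn [copy_cell loopfree]. now rewrite loopfree_const_num.
Qed.

Definition bit_test (w' p : nat) : cmd :=
  Seq (const_num q q w' (p / w')) (Seq (Read tr OUT (seq q q))
    (Seq (Const tc (p mod w')) (Seq (Op tr Shr tr tc) (Seq (Const tc 1) (Op tr And tr tc))))).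

Definition bit_at (w w' : nat) (m : memory) (p : nat) : bool :=
  Nat.testbit (m OUT ((p / w') mod 2 ^ (w * q))) (p mod w').

Lemma run_bit_test w w' p s :
  0 < w' <= w -> fits w w' (p / w') ->
  same_args s (run w (bit_test w' p) s) /\
  regs (run w (bit_test w' p) s) tr = Nat.b2n (bit_at w w' (mem s) p).
Proof.
  intros Hw F. unfold bit_test, same_args. rewrite !run_seq.
  assert (ww : w < 2 ^ w) by (apply Nat.pow_gt_lin_r; lia).
  destruct (run_const_num w q q w' (p / w') s F) as (M & A & B).
  set (s1 := run w (const_num q q w' (p / w')) s) in *.
  assert (I : index w s1 (seq q q) = (p / w') mod 2 ^ (w * q)) by now apply of_limbs_mod.
  cbn [run set_reg regs mem]. rewrite I. split; [split|].
  - exact M.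
  - intros r Hr. rewrite !upd_neq by lia. apply B. lia.
  - assert (Hm : p mod w' < w') by (apply Nat.mod_upper_bound; lia).
    rewrite !upd_eq, !upd_neq, !upd_eq, M by lia. cbn [eval_op].
    rewrite (Nat.mod_small (p mod w')), (Nat.mod_small 1) by lia. rewrite upd_neq, upd_eq by lia. unfold bit_at.
    rewrite (Nat.land_ones _ 1), Nat.pow_1_r, <- Nat.bit0_mod, Nat.shiftr_spec' by lia. reflexivity.
Qed.

Lemma loopfree_bit_test w' p : loopfree (bit_test w' p) = true.
Proof. cbn [bit_test loopfree]. now rewrite loopfree_const_num. Qed.

Fixpoint bit_tree (leaf : list bool -> cmd) (w' n : nat) (acc : list bool) : cmd :=
  match n with
  | 0 => leaf acc
  | S n' => Seq (bit_test w' (length acc))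
      (If tr (bit_tree leaf w' n' (acc ++ [true])) (bit_tree leaf w' n' (acc ++ [false])))
  end.

Lemma run_bit_tree w leaf w' n acc s :
  0 < w' <= w -> (forall p, p < length acc + n -> fits w w' (p / w')) ->
  exists s', same_args s s' /\ run w (bit_tree leaf w' n acc) s =
    run w (leaf (acc ++ window (bit_at w w' (mem s)) (length acc) n)) s'.
Proof.
  intros Hw. revert acc s. induction n as [|n IH]; intros acc s F.
  - exists s. split; [split; auto|]. unfold window. simpl. now rewrite app_nil_r.
  - cbn [bit_tree run].
    destruct (run_bit_test w w' (length acc) s Hw (F (length acc) ltac:(lia))) as ((M & A) & E).
    set (s1 := run w (bit_test w' (length acc)) s) in *. rewrite E.
    destruct (IH (acc ++ [bit_at w w' (mem s) (length acc)]) s1) as (s2 & (M2 & A2) & E2).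
    { rewrite length_app. intros p Hp. apply F. simpl in Hp. lia. }
    exists s2. split; [split; [congruence|]|].
    { intros r Hr. rewrite A2 by assumption. now apply A. }
    rewrite length_app, M, <- app_assoc in E2. cbn [length] in E2.
    replace (length acc + 1) with (S (length acc)) in E2 by lia.
    change (window (bit_at w w' (mem s)) (length acc) (S n)) with
      ([bit_at w w' (mem s) (length acc)] ++ window (bit_at w w' (mem s)) (S (length acc)) n).
    rewrite <- E2. destruct (bit_at w w' (mem s) (length acc)); reflexivity.
Qed.

Lemma loopfree_bit_tree leaf w' n acc :
  (forall xs, loopfree (leaf xs) = true) -> loopfree (bit_tree leaf w' n acc) = true.
Proof.
  intros H. revert acc. induction n; intros acc; cbn [bit_tree loopfree]; auto.
  rewrite loopfree_bit_test. cbn [andb]. now rewrite !IHn.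
Qed.

(** At a leaf the bits are known, so decoding happens while the program text is made; at run time
    only the argument is compared and a constant loaded. *)
Definition answer_leaf (w' : nat) (xs : list bool) : cmd :=
  cases (arg_test w') tr (fun i => const_num q 0 w' (nth (i - 1) (dec_ones (0, 0) xs) 0)) Skip L 1.

Definition fallback_select : cmd :=
  for_width (fun w' => bit_tree (answer_leaf w') w' L []).

Lemma loopfree_fallback_select : loopfree fallback_select = true.
Proof.
  apply loopfree_for_width. intros u. apply loopfree_bit_tree. intros xs.
  apply loopfree_cases; auto using loopfree_arg_test. intros i. apply loopfree_const_num.
Qed.

Context (HW1 : W1 = 2 * L) (HL : 0 < L).

Lemma fits_min w v : v < 2 ^ W1 -> fits w (Nat.min w W1) v.
Proof.
  intros H. destruct (Nat.le_gt_cases w W1); [left; lia|].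
  right. rewrite Nat.min_r by lia. split; [lia|assumption].
Qed.

Lemma run_fallback_build w l s0 :
  0 < w -> mem s0 TAB 0 = w -> l <= L -> l < 2 ^ (w * q) ->
  (forall j, j < q -> regs s0 j = l / 2 ^ (w * j) mod 2 ^ w) ->
  let s := run w fallback_build s0 in
  (forall a, a * w < l -> mem s OUT a = mem s0 INP a) /\
  (forall k a, ~ (k = OUT /\ a * w < L * W1 * l) -> mem s k a = mem s0 k a).
Proof.
  intros Wp HT HlL Hl HA. unfold fallback_build. cbv zeta. rewrite run_seq.
  assert (P1 := pow2_pos (w * q)).
  destruct (run_arg_test w 0 0 l s0) as ((M & A) & E); auto.
  { right. split; [lia|]. apply pow2_pos. }
  set (s1 := run w (arg_test 0 0) _) in *. cbn [run]. rewrite E.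
  destruct (Nat.eqb_spec l 0) as [->|Hl0]; cbn [Nat.b2n Nat.eqb].
  { split; [lia|]. intros. now rewrite M. }
  destruct (run_for_width w
    (fun w' => for_cmd (if w' <? W1 then L else 1) (copy_cell w')) s1) as (s2 & (M2 & _) & ->).
  { now rewrite M. }
  assert (HmS : mem s2 = mem s0) by congruence.
  set (w' := Nat.min w W1).
  (* For wide words a single cell holds the whole input. *)
  assert (X : exists n, (if w' <? W1 then L else 1) = n /\ n <= L /\
    (forall a, a * w < l -> a < n) /\ (forall a, a < n -> a * w < L * W1 * l)).
  { eexists. split; [reflexivity|]. unfold w'. destruct (Nat.ltb_spec (Nat.min w W1) W1).
    - split; [lia|]. split; intros a Ha; [nia|].
      assert (a * w <= L * w) by (apply Nat.mul_le_mono_r; lia).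
      assert (L * w < L * W1) by (apply Nat.mul_lt_mono_pos_l; lia).
      assert (L * W1 * 1 <= L * W1 * l) by (apply Nat.mul_le_mono_l; lia). lia.
    - split; [lia|]. split; intros a Ha; [destruct a; [lia|]; nia|].
      replace a with 0 by lia. assert (0 < L * W1) by nia. nia. }
  destruct X as (n & -> & HnL & Hin & Hout).
  assert (LL : L < 2 ^ W1).
  { apply Nat.lt_le_trans with (2 ^ L); [apply Nat.pow_gt_lin_r; lia|]. apply Nat.pow_le_mono_r; lia. }
  destruct (run_copy_cells w w' n s2) as (C1 & C2).
  { intros a Ha. apply fits_min. lia. }
  rewrite HmS in *. split.
  - intros a Ha. apply C1; auto. apply Nat.le_lt_trans with (a * w); [nia|lia].
  - intros k a Ha. apply C2. intros (-> & Hn). apply Ha. auto.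
Qed.

Lemma run_fallback_select w A i s0 :
  0 < w -> mem s0 TAB 0 = w -> length (senc_mask A) <= L -> length (senc_mask A) < 2 ^ (w * q) ->
  packed w (mem s0 OUT) (senc_mask A) -> 1 <= i <= length (ones A) ->
  (forall j, j < q -> regs s0 j = i / 2 ^ (w * j) mod 2 ^ w) ->
  let s := run w fallback_select s0 in
  mem s = mem s0 /\ result q s = limbs w q (select A i).
Proof.
  intros Wp HT HlL Hl HP Hi HA. cbv zeta. unfold fallback_select.
  assert (Hil : length (ones A) <= length (senc_mask A)).
  { destruct (dec_senc_mask A) as (_ & _ & <-). apply dec_ones_length. }
  destruct (run_for_width w (fun w' => bit_tree (answer_leaf w') w' L []) s0 HT) as (s1 & (M1 & A1) & ->).
  set (w' := Nat.min w W1).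
  assert (Hp : forall p, p < L -> fits w w' (p / w')).
  { intros p Hpl. apply fits_min. apply Nat.le_lt_trans with p; [apply Nat.Div0.div_le_upper_bound; unfold w'; nia|].
    apply Nat.lt_trans with (2 ^ p); [apply Nat.pow_gt_lin_r; lia|]. apply Nat.pow_lt_mono_r; lia. }
  destruct (run_bit_tree w (answer_leaf w') w' L [] s1) as (s2 & (M2 & A2) & ->); [unfold w'; lia|exact Hp|].
  cbn [app length]. rewrite M1. set (m := mem s0) in *.
  destruct (dec_select (bit_at w w' m) A L i) as (_ & E); auto.
  { intros p Hpl. rewrite <- HP by assumption. unfold bit_at.
    (* If the word is wider than W1, all positions below L lie in word 0, for the assumed width as
       well as for the actual one. *)
    assert (W' : w' = w \/ p / w' = p / w /\ p mod w' = p mod w).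
    { unfold w'. destruct (Nat.le_gt_cases w W1); [left; lia|right].
      rewrite Nat.min_r by lia. rewrite !Nat.div_small, !Nat.mod_small by lia. auto. }
    assert (Y : p / w' = p / w /\ p mod w' = p mod w) by (destruct W' as [->|]; auto).
    destruct Y as (-> & ->). rewrite Nat.mod_small; [reflexivity|].
    apply Nat.le_lt_trans with p; [apply Nat.Div0.div_le_upper_bound; nia|lia]. }
  set (xs := window (bit_at w w' m) 0 L) in *.
  set (v := fun i => nth (i - 1) (dec_ones (0, 0) xs) 0).
  (* The origin of W1 = 2 L: the gain over L bits, and with it every answer, is at most L 2^L, which
     is below 2^(2 L). *)
  assert (Hv : v i < 2 ^ W1).
  { assert (T := dec_total_le (0, 0) xs). unfold xs in T. rewrite window_length in T. fold xs in T.
    cbn [snd Nat.add] in T. rewrite HW1. replace (2 * L) with (L + L) by lia. rewrite Nat.pow_add_r.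
    assert (LL : L < 2 ^ L) by (apply Nat.pow_gt_lin_r; lia).
    assert (P2 := pow2_pos L).
    apply Nat.le_lt_trans with (L * 2 ^ L); [|apply Nat.mul_lt_mono_pos_r; lia].
    apply Nat.le_trans with (dec_total (0, 0) xs); [|assumption].
    unfold v. destruct (Nat.lt_ge_cases (i - 1) (length (dec_ones (0, 0) xs))).
    - now apply dec_ones_le, nth_In.
    - rewrite nth_overflow by assumption. lia. }
  assert (Hsmall : forall u, u <= L -> u < 2 ^ W1).
  { intros u Hu. apply Nat.lt_le_trans with (2 ^ u); [apply Nat.pow_gt_lin_r; lia|].
    apply Nat.pow_le_mono_r; lia. }
  assert (HA2 : forall s, same_args s2 s -> forall j, j < q -> regs s j = i / 2 ^ (w * j) mod 2 ^ w).
  { intros s (_ & H) j Hj. rewrite H, A2, A1 by assumption. auto. }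
  destruct (run_cases w (arg_test w') tr (fun i => const_num q 0 w' (v i)) Skip (same_args s2) i L 1 s2)
    as (s3 & (M3 & A3) & E3); try lia.
  - intros u s Hu Hs.
    destruct (run_arg_test w w' u i s) as ((M & B) & R); auto; try lia.
    { apply fits_min, Hsmall. lia. }
    split; [destruct Hs; split; [congruence|]; intros r Hr; rewrite B by assumption; auto|].
    rewrite R. destruct (Nat.eqb_spec i u); [lia|reflexivity].
  - intros s Hu Hs.
    destruct (run_arg_test w w' i i s) as ((M & B) & R); auto; try lia.
    { apply fits_min, Hsmall. lia. }
    split; [destruct Hs; split; [congruence|]; intros r Hr; rewrite B by assumption; auto|].
    rewrite R, Nat.eqb_refl. discriminate.
  - split; auto.
  - change (run w (answer_leaf w' xs) s2 = run w (if i <? 1 + L then const_num q 0 w' (v i) else Skip) s3) in E3. rewrite E3. destruct (Nat.ltb_spec i (1 + L)); [|lia].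
    destruct (run_const_num w q 0 w' (v i) s3) as (M4 & A4 & _); [now apply fits_min|].
    split; [congruence|]. rewrite <- E. change (nth (i - 1) (dec_ones (0, 0) xs) 0) with (v i).
    unfold result, limbs. apply map_ext_in. intros r Hr. apply in_seq in Hr. apply A4. lia.
Qed.

End Fallback.

(** * The three programs *)

Lemma three_le_width w N : 5 <= N <= 2 ^ w -> 3 <= w.
Proof. intros H. destruct w as [|[|[|w]]]; simpl in H; lia. Qed.

Lemma nth_limbs w q x j : x < 2 ^ (w * q) -> nth j (limbs w q x) 0 = x / 2 ^ (w * j) mod 2 ^ w.
Proof.
  intros H. unfold limbs. destruct (Nat.lt_ge_cases j q).
  - rewrite nth_indep with (d' := x / 2 ^ (w * 0) mod 2 ^ w) by now rewrite length_map, length_seq.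
    rewrite map_nth with (f := fun j => x / 2 ^ (w * j) mod 2 ^ w). now rewrite seq_nth.
  - rewrite nth_overflow by now rewrite length_map, length_seq.
    rewrite Nat.div_small; [now rewrite Nat.Div0.mod_0_l|].
    apply Nat.lt_le_trans with (2 ^ (w * q)); auto. apply Nat.pow_le_mono_r; nia.
Qed.

Lemma word_state_start w args m :
  (forall x, In x args -> x < 2 ^ w) -> word_memory w m -> word_state w (start args m).
Proof.
  intros H M. split; [|exact M]. intros r. cbn [start regs].
  destruct (Nat.lt_ge_cases r (length args)); [now apply H, nth_In|].
  rewrite nth_overflow by assumption. apply pow2_pos.
Qed.

Lemma limbs_lt w q x y : In y (limbs w q x) -> y < 2 ^ w.
Proof.
  intros H. apply in_map_iff in H. destruct H as (j & <- & _).
  apply Nat.mod_upper_bound, Nat.pow_nonzero. lia.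
Qed.

Section Programs.
Context (K : nat).

Definition start_compiled (c : hcmd) : cmd := compile K (S (hvars c)) c.

Definition compiled_cost (c : hcmd) : nat := hcost K (S (hvars c)) c.

Lemma exec_compiled w c Q S0 :
  8 <= K -> 4 * (K * w) + 4 * K < 2 ^ w ->
  word_state w S0 -> regs S0 (scratch K 0) = w ->
  wp w K c Q (State (val w K S0) (mem S0)) ->
  exists S' t' s' t, exec w (start_compiled c) S0 S' t' /\ t' <= compiled_cost c * t /\
    Q s' t /\ mem S' = mem s' /\ val w K S' 0 = regs s' 0 /\ word_state w S'.
Proof.
  intros HK Hw WS D (s' & t & X & HQ).
  destruct (compile_sound w K HK Hw c _ s' t (S (hvars c)) X) with (S := S0)
    as (S' & t' & E & (W' & _ & M & V) & L); try lia.
  { repeat split; auto; apply WS. }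
  exists S', t', s', t. repeat split; auto; try apply W'. apply V. lia.
Qed.

Definition move (d a : nat) : cmd := Op d Or a a.

(** [N] takes two limbs because N = 2^w is allowed. The targets lie at register K >= 8 or higher, so
    no argument is overwritten before it is copied. *)
Definition load_args : cmd :=
  Seq (move (scratch K 0) 0)
  (Seq (move (reg K 2 0) 0)
  (Seq (move (reg K 24 0) 1) (move (reg K 24 1) 2))).

Definition mark_fallback : cmd :=
  Seq (Const 1 0) (Seq (Const 2 1) (Seq (Write TAB [1] 0) (Write TAB [2] 2))).

Definition pre_cmd (w0 : nat) (c : hcmd) : cmd :=
  Seq (Const 3 w0) (Seq (Op 3 Lt 0 3) (If 3 mark_fallback (Seq load_args (start_compiled c)))).

(* Cell 1 of the table says whether the fallback is in use, and cell 0 holds w. *)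
Definition with_tables (fallback : cmd) (c : hcmd) : cmd :=
  Seq (Const (scratch K 1) 1) (Seq (Read (scratch K 1) TAB [scratch K 1])
    (If (scratch K 1) fallback
       (Seq (Const (scratch K 1) 0) (Seq (Read (scratch K 0) TAB [scratch K 1]) (start_compiled c))))).

Lemma exec_with_tables_fallback w q x fb c m :
  0 < w -> q <= K -> m TAB 1 = 1 -> loopfree fb = true -> x < 2 ^ (w * q) ->
  exists s t s0, exec w (with_tables fb c) (start (limbs w q x) m) s t /\ t <= 3 + cost fb /\
    s = run w fb s0 /\ mem s0 = m /\ (forall j, j < q -> regs s0 j = x / 2 ^ (w * j) mod 2 ^ w).
Proof.
  intros Wp Hq F LF Hx. set (s1 := start (limbs w q x) m).
  set (s2 := run w (Const (scratch K 1) 1) s1).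
  set (s3 := run w (Read (scratch K 1) TAB [scratch K 1]) s2).
  destruct (run_exec w fb s3 LF) as (t & Ht & X).
  exists (run w fb s3), (1 + (1 + S t)), s3. split; [|split; [lia|split; [reflexivity|split; [reflexivity|]]]].
  - eapply exec_Seq; [apply exec_Const|]. eapply exec_Seq; [apply exec_Read|].
    apply exec_If_true; [|exact X]. cbn [set_reg regs mem]. rewrite upd_eq.
    unfold index. cbn [map of_limbs fold_right set_reg set_mem regs mem]. change (mem s1) with m. rewrite upd_eq, Nat.mul_0_r, Nat.add_0_r, Nat.mod_small, F; [lia|].
    apply Nat.pow_gt_1; lia.
  - intros j Hj. unfold s3, s2. cbn [run set_reg regs mem].
    rewrite !upd_neq by (unfold scratch; lia). now apply nth_limbs.
Qed.

Lemma val_args w q x m f :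
  q <= K -> x < 2 ^ (w * q) -> (forall j, j < K -> regs f j = regs (start (limbs w q x) m) j) ->
  val w K f 0 = x.
Proof.
  intros Hq Hx H. unfold val. rewrite limbsum_ext with (h := fun j => x / 2 ^ (w * j) mod 2 ^ w).
  - rewrite limbsum_digits. apply Nat.mod_small. apply Nat.lt_le_trans with (2 ^ (w * q)); auto.
    apply Nat.pow_le_mono_r; nia.
  - intros j Hj. replace (reg K 0 j) with j by (unfold reg; cbn; lia). rewrite H by assumption.
    now apply nth_limbs.
Qed.

Lemma exec_with_tables w q x fb c m Q :
  8 <= K -> 4 * (K * w) + 4 * K < 2 ^ w -> q <= K ->
  word_memory w m -> m TAB 0 = w -> m TAB 1 = 0 -> x < 2 ^ (w * q) ->
  (forall s, regs s 0 = x -> mem s = m -> wp w K c Q s) ->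
  exists S' t' s' t, exec w (with_tables fb c) (start (limbs w q x) m) S' t' /\
    t' <= 5 + compiled_cost c * t /\ Q s' t /\ mem S' = mem s' /\
    val w K S' 0 = regs s' 0 /\ word_state w S'.
Proof.
  intros HK Hw Hq WM T0 T1 Hx HW. assert (Wp : 0 < w) by (eapply w_pos; eauto).
  assert (W1 : 1 < 2 ^ w) by (apply Nat.pow_gt_1; lia).
  set (s1 := start (limbs w q x) m).
  assert (WS1 : word_state w s1) by (apply word_state_start; auto; intros; eapply limbs_lt; eauto).
  set (s2 := run w (Const (scratch K 1) 1) s1).
  set (s3 := run w (Read (scratch K 1) TAB [scratch K 1]) s2).
  set (s4 := run w (Const (scratch K 1) 0) s3).
  set (s5 := run w (Read (scratch K 0) TAB [scratch K 1]) s4).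
  assert (WS5 : word_state w s5) by (repeat apply run_word_state; auto).
  assert (E3 : regs s3 (scratch K 1) = 0).
  { unfold s3, s2. cbn [run set_reg regs mem]. rewrite upd_eq. unfold index. cbn [map of_limbs fold_right set_reg set_mem regs mem].
    change (mem s1) with m. now rewrite upd_eq, Nat.mul_0_r, Nat.add_0_r, Nat.mod_small, T1 by assumption. }
  assert (E5 : regs s5 (scratch K 0) = w).
  { unfold s5, s4. cbn [run set_reg regs mem]. rewrite upd_eq. unfold index. cbn [map of_limbs fold_right set_reg set_mem regs mem].
    rewrite upd_eq, Nat.Div0.mod_0_l, Nat.mul_0_r. exact T0. }
  destruct (exec_compiled w c Q s5) as (S' & t' & s' & t & X & L & R); auto.
  { apply HW; [|reflexivity]. cbn [regs]. apply val_args with (q := q) (m := m); auto.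
    intros j Hj. unfold s5, s4, s3, s2. cbn [run set_reg regs mem].
    rewrite !upd_neq by (unfold scratch; lia). reflexivity. }
  exists S', (1 + (1 + S (1 + (1 + t')))), s', t. split; [|split; [lia|exact R]].
  eapply exec_Seq; [apply exec_Const|]. eapply exec_Seq; [apply exec_Read|].
  apply exec_If_false; [exact E3|].
  eapply exec_Seq; [apply exec_Const|]. eapply exec_Seq; [apply exec_Read|]. exact X.
Qed.

Lemma result_val w q S' x :
  q <= K -> word_state w S' -> val w K S' 0 = x -> result q S' = limbs w q x.
Proof.
  intros Hq (W & _) <-. unfold result, limbs. apply map_ext_in. intros j Hj. apply in_seq in Hj.
  unfold val. rewrite limbsum_digit; [|intros; apply W|lia]. f_equal. unfold reg. cbn. lia.
Qed.

(** A constant is reduced modulo 2^w before anything is known about [w]. A threshold of the form 2^k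
    - 1 survives this: for w < k it becomes 2^w - 1, still larger than [w] because 3 <= w. *)
Lemma width_lt w k : 3 <= w -> (w <? (2 ^ k - 1) mod 2 ^ w) = (w <? 2 ^ k - 1).
Proof.
  intros Hw. destruct (Nat.le_gt_cases k w) as [H|H].
  - rewrite Nat.mod_small; [reflexivity|].
    assert (2 ^ k <= 2 ^ w) by (apply Nat.pow_le_mono_r; lia). assert (X := pow2_pos k). lia.
  - assert (A : w < k) by assumption.
    assert (L : S w < 2 ^ w).
    { destruct w as [|[|[|w]]]; try lia. clear. induction w; [simpl; lia|].
      rewrite Nat.pow_succ_r'. lia. }
    assert (P := pow2_pos (k - w)). assert (Pw := pow2_pos w).
    replace ((2 ^ k - 1) mod 2 ^ w) with (2 ^ w - 1).
    + assert (2 ^ w <= 2 ^ k) by (apply Nat.pow_le_mono_r; lia).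
      destruct (Nat.ltb_spec w (2 ^ w - 1)), (Nat.ltb_spec w (2 ^ k - 1)); auto; lia.
    + replace (2 ^ k - 1) with (2 ^ w - 1 + (2 ^ (k - w) - 1) * 2 ^ w).
      * rewrite Nat.Div0.mod_add, Nat.mod_small; lia.
      * replace k with (k - w + w) at 2 by lia. rewrite Nat.pow_add_r.
        rewrite Nat.mul_sub_distr_r. nia.
Qed.

Context (b0 kp kr k : nat) (HK : 8 <= K) (Hb0 : 8 <= b0).
Notation w0 := (2 ^ k - 1).
Context (Hlarge : forall w, w0 <= w -> 4 * (K * w) + 4 * K < 2 ^ w /\ b0 + kp + kr + 16 < w).

(** The first outcome, recorded in two cells only, is the fallback: the width or [N] is bounded by a
    constant. Its last clause is what bounds the encoding length there. *)
Definition prepared (w N : nat) (m0 m : memory) (T : nat) : Prop :=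
  T <= N /\ (forall k a, ~ (k = TAB /\ a < T) -> m k a = m0 k a) /\
  (T = 2 /\ m TAB 0 = w /\ m TAB 1 = 1 /\ (w < w0 \/ N < 2 ^ (8 * b0)) \/
   exists beta, T = table_size beta /\ w0 <= w /\ b0 <= 2 ^ beta /\ N < 2 ^ (8 * 2 ^ beta) /\
     2 ^ (4 * 2 ^ beta) <= N /\ good_tables kp kr w beta (m TAB)).

Lemma table_size_le w beta :
  4 * (K * w) + 4 * K < 2 ^ w -> 4 * 2 ^ beta <= w -> 8 <= 2 ^ beta ->
  table_size beta <= 2 ^ (4 * 2 ^ beta).
Proof.
  intros Hw Hb Hb8. assert (A := key_count_le w K beta HK Hw Hb Hb8).
  unfold table_size, row_of. rewrite Nat.pow_succ_r'. lia.
Qed.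

Lemma exec_pre w N m0 :
  5 <= N <= 2 ^ w -> word_memory w m0 ->
  exists st t T, exec w (pre_cmd w0 (prep_cmd b0 kp kr)) (start (w :: limbs w 2 N) m0) st t /\
    t <= (compiled_cost (prep_cmd b0 kp kr) * (2 * 2 ^ kr + 60) + 7) * N /\
    prepared w N m0 (mem st) T.
Proof.
  intros HN WM. assert (W3 := three_le_width w N HN).
  assert (ww : w < 2 ^ w) by (apply Nat.pow_gt_lin_r; lia).
  assert (W1 : 1 < 2 ^ w) by lia.
  set (s1 := start (w :: limbs w 2 N) m0).
  assert (WS1 : word_state w s1).
  { apply word_state_start; auto. intros x [<-|H]; auto. eapply limbs_lt; eauto. }
  set (s2 := run w (Const 3 w0) s1). set (s3 := run w (Op 3 Lt 0 3) s2).
  assert (E3 : regs s3 3 = Nat.b2n (w <? w0)).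
  { unfold s3, s2. cbn [run set_reg regs mem]. rewrite !upd_eq, upd_neq by lia. cbn [eval_op].
    rewrite width_lt by assumption. reflexivity. }
  destruct (Nat.ltb_spec w w0) as [Hlt|Hge].
  - exists (run w mark_fallback s3), (1 + (1 + S 4)), 2. split; [|split].
    + eapply exec_Seq; [apply exec_Const|]. eapply exec_Seq; [apply exec_Op|].
      apply exec_If_true; [change (regs s3 3 <> 0); rewrite E3; discriminate|].
      destruct (run_exec w mark_fallback (set_reg s2 3 (eval_op w Lt (regs s2 0) (regs s2 3))) eq_refl) as (t & Ht & X).
      change 4 with (1 + (1 + (1 + 1))). repeat (eapply exec_Seq; [constructor|]). constructor.
    + nia.
    + split; [lia|]. assert (Em : forall k a, mem (run w mark_fallback s3) k a =
        upd (upd m0 TAB (upd (m0 TAB) 0 w)) TAB (upd (upd (m0 TAB) 0 w) 1 1) k a).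
      { intros k' a. unfold mark_fallback. cbn [run set_reg set_mem regs mem].
        unfold index. cbn [map of_limbs fold_right set_reg set_mem regs mem].
        rewrite ?upd_eq, ?upd_neq, ?upd_eq by lia.
        rewrite ?Nat.Div0.mod_0_l, ?Nat.mul_0_r, (Nat.mod_small 1) by lia.
        reflexivity. }
      split; [|left].
      * intros k' a Ha. rewrite Em. unfold upd. destruct (Nat.eqb_spec k' TAB) as [->|]; auto.
        destruct (Nat.eqb_spec a 1) as [->|]; [exfalso; apply Ha; split; auto|].
        destruct (Nat.eqb_spec a 0) as [->|]; [exfalso; apply Ha; split; auto|]. reflexivity.
      * rewrite !Em. unfold upd, TAB. cbn. auto.
  - destruct (Hlarge w Hge) as (Hw & Hc).
    set (s4 := run w load_args s3).
    assert (WS4 : word_state w s4) by (repeat apply run_word_state; auto; lia).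
    assert (N2 : N < 2 ^ (w * 2)).
    { apply Nat.le_lt_trans with (2 ^ w); [lia|]. apply Nat.pow_lt_mono_r; lia. }
    assert (E3' : forall r, r <> 3 -> regs s3 r = nth r (w :: limbs w 2 N) 0).
    { intros r Hr. unfold s3, s2. cbn [run set_reg regs mem]. now rewrite !upd_neq by assumption. }
    assert (E4 : regs s4 (scratch K 0) = w /\
      (forall j, j < K -> regs s4 (reg K 2 j) = if j =? 0 then w else 0) /\
      forall j, j < K -> regs s4 (reg K 24 j) = nth j (limbs w 2 N) 0).
    { unfold s4, load_args, move. cbn [run set_reg regs mem eval_op]. rewrite !Nat.lor_diag.
      assert (NE : forall x i y j, i < K -> j < K -> x <> y \/ i <> j -> reg K x i <> reg K y j)
        by (intros; now apply reg_neq with (w := w)).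
      assert (NS : forall x j, j < K -> reg K x j <> scratch K 0) by (intros; apply reg_neq_scratch with (w := w); lia).
      assert (RK : forall x j, x <> 0 -> K + K <= reg K x j).
      { intros [|x] j Hx; [lia|]. unfold reg. cbn [slot]. nia. }
      assert (SK : scratch K 0 = K) by (unfold scratch; lia).
      assert (A2 := RK 2 0 ltac:(lia)). assert (A24 := RK 24 0 ltac:(lia)). assert (A24' := RK 24 1 ltac:(lia)).
      split; [|split].
      - rewrite !upd_neq by (apply not_eq_sym, NS; lia). rewrite upd_eq. now rewrite E3' by lia.
      - intros j Hj. rewrite (upd_neq _ (reg K 24 1)), (upd_neq _ (reg K 24 0)) by (apply NE; lia).
        destruct (Nat.eqb_spec j 0) as [->|Hj0].
        + rewrite upd_eq, upd_neq, E3' by lia. reflexivity.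
        + rewrite upd_neq by (apply NE; lia). rewrite upd_neq by (apply NS; lia).
          assert (B := RK 2 j ltac:(lia)). rewrite E3' by lia.
          apply nth_overflow. unfold limbs. simpl. lia.
      - intros j Hj. destruct (Nat.eq_dec j 1) as [->|Hj1].
        { rewrite upd_eq. rewrite !upd_neq, E3' by lia. reflexivity. }
        rewrite upd_neq by (apply NE; lia). destruct (Nat.eq_dec j 0) as [->|Hj0].
        { rewrite upd_eq. rewrite !upd_neq, E3' by lia. reflexivity. }
        rewrite !upd_neq by (apply NE; lia). rewrite upd_neq by (apply NS; lia).
        assert (B := RK 24 j ltac:(lia)). rewrite E3' by lia.
        rewrite !nth_overflow; auto; unfold limbs; simpl; lia. }
    destruct E4 as (E4 & V2 & V24).
    assert (VW : val w K s4 2 = w).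
    {   unfold val. rewrite limbsum_ext with (h := fun j => w / 2 ^ (w * j) mod 2 ^ w).
        + rewrite limbsum_digits. apply Nat.mod_small, word_lt_big; auto.
        + intros j Hj. rewrite V2 by assumption. destruct (Nat.eqb_spec j 0) as [->|].
          * now rewrite Nat.mul_0_r, Nat.pow_0_r, Nat.div_1_r, Nat.mod_small.
          * rewrite Nat.div_small; [now rewrite Nat.Div0.mod_0_l|].
            apply Nat.lt_le_trans with (2 ^ w); auto. apply Nat.pow_le_mono_r; nia.
    }
    assert (VN : val w K s4 24 = N).
    {   unfold val. rewrite limbsum_ext with (h := fun j => N / 2 ^ (w * j) mod 2 ^ w).
        + rewrite limbsum_digits. apply Nat.mod_small. apply Nat.lt_le_trans with (2 ^ (w * 2)); auto.
          apply Nat.pow_le_mono_r; nia.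
        + intros j Hj. rewrite V24 by assumption. now apply nth_limbs. }
    destruct (exec_compiled w (prep_cmd b0 kp kr) _ s4 HK Hw WS4 E4
      (wp_prep b0 kp kr w K HK Hw Hc Hb0 (State (val w K s4) (mem s4)) N VW VN HN (proj2 WS4)))
      as (S' & t' & s' & t & X & L & (beta & Ht & HN1 & HC) & M & _).
    destruct (run_exec w load_args s3 eq_refl) as (t4 & Ht4 & X4).
    change (cost load_args) with 4 in Ht4.
    assert (HT : t' <= compiled_cost (prep_cmd b0 kp kr) * (2 * 2 ^ kr + 60) * N).
    { apply Nat.le_trans with (1 := L). rewrite <- Nat.mul_assoc. now apply Nat.mul_le_mono_l. }
    assert (XX : exec w (pre_cmd w0 (prep_cmd b0 kp kr)) s1 S' (1 + (1 + S (t4 + t')))).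
    { eapply exec_Seq; [apply exec_Const|]. eapply exec_Seq; [apply exec_Op|].
      apply exec_If_false; [change (regs s3 3 = 0); rewrite E3; reflexivity|].
      eapply exec_Seq; [exact X4|exact X]. }
    assert (HTT : 1 + (1 + S (t4 + t')) <= (compiled_cost (prep_cmd b0 kp kr) * (2 * 2 ^ kr + 60) + 7) * N) by nia.
    destruct HC as [(C1 & C2 & C3 & C4)|(C1 & C2 & C3 & C4)].
    + exists S', (1 + (1 + S (t4 + t'))), 2. split; [exact XX|]. split; [exact HTT|].
      split; [lia|]. rewrite M. split; [exact C4|left]. split; [reflexivity|]. split; [exact C2|]. split; [exact C3|].
      right. apply Nat.lt_le_trans with (1 := HN1). apply Nat.pow_le_mono_r; lia.
    + exists S', (1 + (1 + S (t4 + t'))), (table_size beta). split; [exact XX|]. split; [exact HTT|].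
      split; [apply Nat.le_trans with (2 := C2), table_size_le with (w := w); auto; [|lia]; apply (Nat.pow_le_mono_r_iff 2); lia|]. rewrite M. split; [exact C4|right].
      exists beta. split; [reflexivity|]. split; [exact Hge|]. split; [exact C1|]. split; [exact HN1|].
      split; [exact C2|exact C3].
Qed.

End Programs.

(** * Logarithms and the choice of the constants *)

Lemma pow2_ge_square x : 4 <= x -> x * x <= 2 ^ x.
Proof.
  intros H. induction H as [|x H IH]; [simpl; lia|]. rewrite Nat.pow_succ_r'. nia.
Qed.

Lemma le_lg a x : 2 ^ a <= x -> (INR a <= lg (INR x))%R.
Proof.
  intros H. unfold lg. assert (L2 : (0 < ln 2)%R) by (rewrite <- ln_1; apply ln_increasing; lra).
  apply Rmult_le_reg_r with (ln 2); auto. unfold Rdiv. rewrite Rmult_assoc, Rinv_l, Rmult_1_r by lra.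
  rewrite <- ln_pow by lra.
  assert (P : (0 < 2 ^ a)%R) by (apply pow_lt; lra).
  assert (Q : (2 ^ a <= Rmax 1 (INR x))%R).
  { apply Rle_trans with (INR x); [|apply Rmax_r]. apply le_INR in H. rewrite pow_INR in H. exact H. }
  destruct Q as [Q| ->]; [left; now apply ln_increasing|right; reflexivity].
Qed.

Lemma lg_le a x : x <= 2 ^ a -> (lg (INR x) <= INR a)%R.
Proof.
  intros H. unfold lg. assert (L2 : (0 < ln 2)%R) by (rewrite <- ln_1; apply ln_increasing; lra).
  apply Rmult_le_reg_r with (ln 2); auto. unfold Rdiv. rewrite Rmult_assoc, Rinv_l, Rmult_1_r by lra.
  rewrite <- ln_pow by lra.
  assert (P : (0 < Rmax 1 (INR x))%R) by (apply Rlt_le_trans with 1%R; [lra|apply Rmax_l]).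
  assert (Q : (Rmax 1 (INR x) <= 2 ^ a)%R).
  { apply Rmax_lub; [apply pow_R1_Rle; lra|]. apply le_INR in H. rewrite pow_INR in H. exact H. }
  destruct Q as [Q| ->]; [left; now apply ln_increasing|right; reflexivity].
Qed.

Section Assembly.
Context (c : nat).

(** Counts and masks are at most 2^((8 c + 8) b), and 4 b <= w, so 2 c + 2 words hold them; the rest
    is room for intermediate results. *)
Definition digits : nat := 2 * c + 8.
(** These logarithms are not minimal: taking the number itself as its logarithm is justified by x <
    2^x. *)
Definition item_log : nat := digits.
Definition field_log : nat := 8 * c + 16.
Definition range_log : nat := 16 * c + 8.
(** Large enough that 8 c b < b b <= 2^b, so the exponent e fits into b bits, and that [item_log] is
    at most b. *)
Definition min_block : nat := 16 * c + 16.
Definition word_log : nat := 8 * digits + min_block + field_log + range_log + item_log + 20.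
Notation w0 := (2 ^ word_log - 1).
(** In the fallback w < w0 or N < 2^(8 min_block), and l <= N^c with N <= 2^w; adding the two
    exponents covers both cases. *)
Definition small_length : nat := 2 ^ ((w0 + 8 * min_block) * c).

Definition preprocess : cmd := pre_cmd digits w0 (prep_cmd min_block field_log range_log).
Definition build_prog : cmd :=
  with_tables digits (fallback_build (S c) small_length (2 * small_length))
    (build_cmd digits item_log field_log).
Definition select_prog : cmd :=
  with_tables digits (fallback_select (S c) small_length (2 * small_length))
    (query_cmd digits item_log field_log).

Lemma large_words w :
  w0 <= w -> 4 * (digits * w) + 4 * digits < 2 ^ w /\
  min_block + field_log + range_log + 16 < w /\ field_log + range_log + item_log + 16 < w.
Proof.
  intros H. assert (X : word_log < 2 ^ word_log) by (apply Nat.pow_gt_lin_r; lia).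
  assert (Y : word_log <= w) by lia. clear X H.
  assert (Z : 8 * digits < w /\ 8 <= w) by (unfold word_log in Y; lia).
  split; [|unfold word_log, item_log in *; lia].
  apply Nat.lt_le_trans with (w * w); [nia|]. apply pow2_ge_square. lia.
Qed.

Lemma small_case w A m1 :
  let l := length (senc_mask A) in
  3 <= w -> m1 TAB 0 = w -> m1 TAB 1 = 1 -> l <= small_length -> l < 2 ^ (w * S c) ->
  packed w (m1 INP) (senc_mask A) ->
  exists s2 t2, exec w build_prog (start (limbs w (S c) l) m1) s2 t2 /\
    t2 <= 3 + cost (fallback_build (S c) small_length (2 * small_length)) /\
    (forall k a, ~ (k = OUT /\ a * w < small_length * (2 * small_length) * l) -> mem s2 k a = m1 k a) /\
    packed w (mem s2 OUT) (senc_mask A) /\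
    forall m i, m TAB 0 = w -> m TAB 1 = 1 -> packed w (m OUT) (senc_mask A) ->
      1 <= i <= length (ones A) ->
      exists s t', exec w select_prog (start (limbs w (S c) i) m) s t' /\
        t' <= 3 + cost (fallback_select (S c) small_length (2 * small_length)) /\
        mem s = m /\ result (S c) s = limbs w (S c) (select A i).
Proof.
  intros l Hw T0 T1 Hl Hlw HP. assert (SL := pow2_pos ((w0 + 8 * min_block) * c)). fold small_length in SL.
  assert (QK : S c <= digits) by (unfold digits; lia).
  destruct (exec_with_tables_fallback digits w (S c) l (fallback_build (S c) small_length (2 * small_length))
    (build_cmd digits item_log field_log) m1) as (s2 & t2 & s0 & X & Ht & E & M & R); auto; try lia.
  { apply loopfree_fallback_build. }
  exists s2, t2. split; [exact X|]. split; [exact Ht|].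
  destruct (run_fallback_build (S c) small_length (2 * small_length) eq_refl SL w l s0) as (B1 & B2);
    auto; try lia; try congruence.
  rewrite <- E, M in B1, B2. split; [exact B2|]. split.
  { intros j Hj. rewrite <- HP by assumption. rewrite B1; [reflexivity|].
    apply Nat.le_lt_trans with (2 := Hj). rewrite Nat.mul_comm. apply Nat.Div0.mul_div_le. }
  intros m i T0' T1' HP' Hi.
  assert (Hil : length (ones A) <= length (senc_mask A)).
  { destruct (dec_senc_mask A) as (_ & _ & <-). apply dec_ones_length. }
  destruct (exec_with_tables_fallback digits w (S c) i (fallback_select (S c) small_length (2 * small_length))
    (query_cmd digits item_log field_log) m) as (s & t' & s0' & X' & Ht' & E' & M' & R'); auto; try lia.
  { apply loopfree_fallback_select. }
  exists s, t'. split; [exact X'|]. split; [exact Ht'|].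
  destruct (run_fallback_select (S c) small_length (2 * small_length) eq_refl SL w A i s0') as (B3 & B4);
    auto; try lia; try congruence.
  { now rewrite M'. }
  rewrite <- E' in B3, B4. split; [congruence|exact B4].
Qed.

Lemma large_case w N beta tab A m1 :
  let n := length A in
  let l := length (senc_mask A) in
  w0 <= w -> min_block <= 2 ^ beta -> 2 ^ (4 * 2 ^ beta) <= N -> N < 2 ^ (8 * 2 ^ beta) -> N <= 2 ^ w ->
  good_tables field_log range_log w beta tab ->
  n <= 2 ^ (c * w) -> l <= N ^ c -> word_memory w m1 ->
  (forall a, a < table_size beta -> m1 TAB a = tab a) ->
  packed w (m1 INP) (senc_mask A) ->
  exists s2 t2 u e D, exec w build_prog (start (limbs w (S c) l) m1) s2 t2 /\
    t2 <= 5 + compiled_cost digits (build_cmd digits item_log field_log) *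
            ((60 * digits + 120) * chunks beta A + 8 * digits + 50) /\
    small_exponent beta A e /\ u <= 80 * 2 ^ item_log * 2 ^ field_log * l * 2 ^ e /\ length D <= u /\
    (forall k a, ~ (k = OUT /\ a * w < u) -> mem s2 k a = m1 k a) /\
    packed w (mem s2 OUT) D /\ chunks beta A * 2 ^ beta <= l + 2 ^ beta /\
    forall m i, word_memory w m -> (forall a, a < table_size beta -> m TAB a = tab a) ->
      packed w (m OUT) D -> 1 <= i <= length (ones A) ->
      exists s t', exec w select_prog (start (limbs w (S c) i) m) s t' /\
        t' <= 5 + compiled_cost digits (query_cmd digits item_log field_log) * (12 * digits + 46) /\
        mem s = m /\ result (S c) s = limbs w (S c) (select A i).
Proof.
  intros n l Hge Hb0 HN1 HN2 HNw Ht Hn Hl WM HT HP.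
  destruct (large_words w Hge) as (Hw & Hc1 & Hc2).
  assert (HK : 8 <= digits) by (unfold digits; lia).
  assert (QK : S c <= digits) by (unfold digits; lia).
  assert (Hb : 4 * 2 ^ beta <= w) by (apply (Nat.pow_le_mono_r_iff 2); lia).
  assert (Hb8 : 8 <= 2 ^ beta) by (unfold min_block in Hb0; lia).
  assert (Hlw : l <= 2 ^ (c * w)).
  { apply Nat.le_trans with (1 := Hl). rewrite Nat.mul_comm, Nat.pow_mul_r. now apply Nat.pow_le_mono_l. }
  assert (Hl8 : l <= 2 ^ (8 * c * 2 ^ beta)).
  { apply Nat.le_trans with (1 := Hl). replace (8 * c * 2 ^ beta) with (8 * 2 ^ beta * c) by lia.
    rewrite Nat.pow_mul_r. apply Nat.pow_le_mono_l. lia. }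
  assert (HcK : 2 * c + 4 <= digits) by (unfold digits; lia).
  assert (Hks : digits <= 2 ^ item_log) by (apply Nat.lt_le_incl, Nat.pow_gt_lin_r; lia).
  assert (Hkp : 8 * c + 16 <= 2 ^ field_log) by (apply Nat.lt_le_incl, Nat.pow_gt_lin_r; lia).
  assert (Hkr : 16 * c + 8 <= 2 ^ range_log) by (apply Nat.lt_le_incl, Nat.pow_gt_lin_r; lia).
  assert (Hksb : item_log <= 2 ^ beta) by (unfold item_log, digits, min_block in *; lia).
  assert (Hcb : 8 * c * 2 ^ beta < 2 ^ 2 ^ beta).
  { apply Nat.lt_le_trans with (2 ^ beta * 2 ^ beta); [|apply pow2_ge_square; lia].
    apply Nat.mul_lt_mono_pos_r; unfold min_block in Hb0; lia. }
  assert (TS : 8 <= table_size beta) by (unfold table_size, row_of; lia).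
  assert (T01 : forall m : memory, (forall a, a < table_size beta -> m TAB a = tab a) -> m TAB 0 = w /\ m TAB 1 = 0).
  { intros m H. rewrite !H by lia. split; apply Ht. }
  assert (LW : 2 ^ (c * w) < 2 ^ (w * S c)) by (apply Nat.pow_lt_mono_r; lia).
  destruct (T01 m1 HT) as (T0 & T1).
  destruct (exec_with_tables digits w (S c) l (fallback_build (S c) small_length (2 * small_length))
    (build_cmd digits item_log field_log) m1
    (fun s' t => exists u e D,
      t <= (60 * digits + 120) * chunks beta A + 8 * digits + 50 /\
      small_exponent beta A e /\ u <= 80 * 2 ^ item_log * 2 ^ field_log * l * 2 ^ e /\ length D <= u /\
      (forall k a, ~ (k = OUT /\ a * w < u) -> mem s' k a = m1 k a) /\
      packed w (mem s' OUT) D /\ answers w digits item_log field_log beta tab A D (12 * digits + 46)))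
    as (s2 & t2 & s' & t & X & Ht2 & (u & e & D & Ht' & HE & HU & HD & HF & HPD & HA) & M & _); auto; try lia.
  { intros s E0 Em. rewrite <- Em. apply (wp_build w digits c item_log field_log range_log beta tab A (m1 INP)); auto.
    rewrite Em. repeat split; auto. }
  exists s2, t2, u, e, D. rewrite M.
  split; [exact X|]. split; [apply Nat.le_trans with (1 := Ht2), Nat.add_le_mono_l, Nat.mul_le_mono_l, Ht'|].
  split; [exact HE|]. split; [exact HU|]. split; [exact HD|]. split; [exact HF|]. split; [exact HPD|].
  split.
  { unfold chunks. fold l. assert (Y := Nat.Div0.mul_div_le (l + 2 ^ beta - 1) (2 ^ beta)). lia. }
  intros m i WMm HTm HPm Hi. destruct (T01 m HTm) as (T0' & T1').
  assert (Hil : length (ones A) <= l).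
  { destruct (dec_senc_mask A) as (_ & _ & <-). apply dec_ones_length. }
  destruct (exec_with_tables digits w (S c) i (fallback_select (S c) small_length (2 * small_length))
    (query_cmd digits item_log field_log) m
    (fun s' t => t <= 12 * digits + 46 /\ regs s' 0 = select A i /\ mem s' = m))
    as (s & t' & s'' & t'' & X' & Ht'' & (A1 & A2 & A3) & M' & V & WS); auto; try lia.
  { intros s E0 Em. rewrite <- Em. apply HA; rewrite ?Em; auto. split; auto. }
  exists s, t'. split; [exact X'|].
  split; [apply Nat.le_trans with (1 := Ht''), Nat.add_le_mono_l, Nat.mul_le_mono_l, A1|].
  split; [congruence|]. apply result_val with (K := digits); auto. congruence.
Qed.

End Assembly.

(** * From block lengths to the real-valued bounds *)

Lemma lg_nonneg x : (0 <= lg (INR x))%R.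
Proof.
  destruct (Nat.eq_dec x 0) as [->|].
  - unfold lg. simpl INR. rewrite Rmax_left by lra. rewrite ln_1. unfold Rdiv. lra.
  - apply (le_lg 0). simpl. lia.
Qed.

Lemma poly_bound (C x y : nat) (g : R) : (1 <= g)%R -> x <= C * y -> (INR x <= INR C * INR y * g ^ C)%R.
Proof.
  intros Hg H. apply le_INR in H. rewrite mult_INR in H. apply Rle_trans with (1 := H).
  rewrite <- Rmult_1_r at 1. apply Rmult_le_compat_l.
  - apply Rmult_le_pos; apply pos_INR.
  - now apply pow_R1_Rle.
Qed.

Lemma overhead_bound (a B x y z : nat) : x <= y * (z + 1) -> a + B * x <= (a + B * y) * (z + 1).
Proof.
  intros H. assert (B * x <= B * (y * (z + 1))) by now apply Nat.mul_le_mono_l. nia.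
Qed.

(* With block length [b], the bound [N < 2^(8 b)] turns divisions by [b] into
   divisions by [lg N]. *)
Lemma div_lg_bound (x y b : nat) (g : R) :
  (0 < g)%R -> (g <= INR (8 * b))%R -> y * b <= x -> (INR y <= 8 * (INR x / g))%R.
Proof.
  intros Hg Hb H. apply Rmult_le_reg_r with g; auto.
  replace (8 * (INR x / g) * g)%R with (8 * INR x)%R by (field; lra).
  apply le_INR in H. rewrite mult_INR in *. simpl in Hb.
  assert (A := pos_INR y). assert (B : (INR y * g <= INR y * (8 * INR b))%R) by (apply Rmult_le_compat_l; lra).
  lra.
Qed.

Lemma time_bound (B C l chunks b t : nat) (g : R) :
  (0 < g)%R -> (g <= INR (8 * b))%R -> chunks * b <= l + b -> 0 < b -> t <= B * (chunks + 1) -> 16 * B <= C ->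
  (INR t <= INR C * (1 + INR l / g))%R.
Proof.
  intros Hg Hb Hc Hb0 Ht HC.
  (* The last chunk may be mostly padding; it is paid by the additive 1 and only the others are
     charged to the encoding. *)
  assert (X : (INR (chunks - 1) <= 8 * (INR l / g))%R).
  { apply div_lg_bound with b; auto. rewrite Nat.mul_sub_distr_r. lia. }
  assert (Y : (INR chunks <= 1 + 8 * (INR l / g))%R).
  { assert (Z : chunks <= 1 + (chunks - 1)) by lia. apply le_INR in Z. rewrite plus_INR in Z. simpl (INR 1) in Z. lra. }
  assert (LG : (0 <= INR l / g)%R) by (apply Rmult_le_pos; [apply pos_INR|left; now apply Rinv_0_lt_compat]).
  apply le_INR in Ht. rewrite mult_INR, plus_INR in Ht. simpl (INR 1) in Ht.
  apply le_INR in HC. rewrite mult_INR in HC. replace (INR 16) with 16%R in HC by (simpl; lra).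
  assert (PB := pos_INR B).
  apply Rle_trans with (16 * INR B * (1 + INR l / g))%R; [|apply Rmult_le_compat_r; lra].
  apply Rle_trans with (1 := Ht). replace (16 * INR B * (1 + INR l / g))%R with (INR B * (16 * (1 + INR l / g)))%R by ring.
  apply Rmult_le_compat_l; lra.
Qed.

(** If e is not 0, then b 2^e <= lg n, while lg N <= 8 b; so 2^e is at most 8 lg n / lg N. *)
Lemma space_bound (B C l e b n u : nat) (g : R) :
  (0 < g)%R -> (g <= INR (8 * b))%R -> e = 0 \/ 2 ^ (b * 2 ^ e) <= n -> u <= B * l * 2 ^ e -> 8 * B <= C ->
  (INR u <= INR C * (INR l * (1 + lg (INR n) / g)))%R.
Proof.
  intros Hg Hb He Hu HC. assert (LN := lg_nonneg n).
  assert (LG : (0 <= lg (INR n) / g)%R) by (apply Rmult_le_pos; [assumption|left; now apply Rinv_0_lt_compat]).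
  assert (X : (INR (2 ^ e) <= 8 * (1 + lg (INR n) / g))%R).
  { destruct He as [->|He]; [simpl; lra|].
    apply le_lg in He. apply Rle_trans with (8 * (lg (INR n) / g))%R; [|lra].
    apply Rmult_le_reg_r with g; auto.
    replace (8 * (lg (INR n) / g) * g)%R with (8 * lg (INR n))%R by (field; lra).
    rewrite mult_INR in He. rewrite mult_INR in Hb. replace (INR 8) with 8%R in Hb by (simpl; lra).
    assert (A := pos_INR (2 ^ e)).
    assert (INR (2 ^ e) * g <= INR (2 ^ e) * (8 * INR b))%R by (apply Rmult_le_compat_l; lra). lra. }
  apply le_INR in Hu. rewrite !mult_INR in Hu.
  apply le_INR in HC. rewrite mult_INR in HC. replace (INR 8) with 8%R in HC by (simpl; lra).
  assert (PB := pos_INR B). assert (PL := pos_INR l).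
  apply Rle_trans with (1 := Hu).
  apply Rle_trans with (INR B * INR l * (8 * (1 + lg (INR n) / g)))%R.
  { apply Rmult_le_compat_l; [now apply Rmult_le_pos|exact X]. }
  replace (INR B * INR l * (8 * (1 + lg (INR n) / g)))%R
    with (8 * INR B * (INR l * (1 + lg (INR n) / g)))%R by ring.
  apply Rmult_le_compat_r; [|exact HC]. apply Rmult_le_pos; lra.
Qed.

Lemma writes_within_bits_intro w u (S : R) m m' :
  (INR u <= S)%R -> (forall k a, ~ (k = OUT /\ a * w < u) -> m' k a = m k a) ->
  writes_within_bits w OUT S m m'.
Proof.
  intros HS H k a Ha. apply H. intros (-> & Hlt). apply Ha. split; [reflexivity|].
  apply Rlt_le_trans with (INR u); auto. now apply lt_INR.
Qed.

(* [c] is the constant of the hypotheses (n in 2^O(w) and |senc(A)| = O(poly(N)));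
   [C] is the constant of the conclusions.  The programs are uniform in w and N. *)
Theorem lemma6p18 :
  forall c : nat,
  exists (C : nat) (pre build sel : cmd),
  forall w N : nat,
    5 <= N <= 2 ^ w ->
  forall m0 : memory, word_memory w m0 ->
  exists (st : state) (t T : nat),
    exec w pre (start (w :: limbs w 2 N) m0) st t /\
    (INR t <= INR C * INR N * lg (INR N) ^ C)%R /\
    (INR T <= INR C * INR N * lg (INR N) ^ C)%R /\
    (forall k a, ~ (k = TAB /\ a < T) -> mem st k a = m0 k a) /\
    forall (A : list bool) (m1 : memory),
      let n := length A in
      let l := length (senc_mask A) in
      let space := (INR C * (INR l * (1 + lg (INR n) / lg (INR N))))%R in
      n <= 2 ^ (c * w) ->
      l <= N ^ c ->
      word_memory w m1 ->
      same_tables T (mem st) m1 ->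
      packed w (m1 INP) (senc_mask A) ->
      exists (s2 : state) (t2 : nat) (D : list bool),
        exec w build (start (limbs w (width c) l) m1) s2 t2 /\
        (INR t2 <= INR C * (1 + INR l / lg (INR N)))%R /\
        writes_within_bits w OUT space m1 (mem s2) /\
        (INR (length D) <= space)%R /\
        packed w (mem s2 OUT) D /\
        answers_select w c T (mem st) D A sel C.
Proof.
  intros c. set (K := digits c).
  set (C1 := compiled_cost K (prep_cmd (min_block c) (field_log c) (range_log c)) * (2 * 2 ^ range_log c + 60) + 7).
  set (C2 := 5 + compiled_cost K (build_cmd K (item_log c) (field_log c)) * (60 * K + 120)).
  set (C3 := 5 + compiled_cost K (query_cmd K (item_log c) (field_log c)) * (12 * K + 46)).
  set (C4 := 80 * 2 ^ item_log c * 2 ^ field_log c).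
  set (C5 := small_length c * (2 * small_length c)).
  set (C6 := 3 + cost (fallback_build (S c) (small_length c) (2 * small_length c))).
  set (C7 := 3 + cost (fallback_select (S c) (small_length c) (2 * small_length c))).
  (* One constant serves all time and space bounds and is also the exponent of the logarithm. The
     factors 16 and 8 are those lost in [time_bound] and [space_bound]. *)
  set (C := C1 + 16 * C2 + C3 + 8 * C4 + 8 * C5 + 16 * C6 + C7 + 8).
  exists C, (preprocess c), (build_prog c), (select_prog c).
  intros w N HN m0 WM.
  assert (HK : 8 <= K) by (unfold K, digits; lia).
  assert (W3 := three_le_width w N HN).
  assert (G1 : (1 <= lg (INR N))%R) by (apply (le_lg 1); simpl; lia).
  destruct (exec_pre K (min_block c) (field_log c) (range_log c) (word_log c)) with (w := w) (N := N) (m0 := m0)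
    as (st & t & T & X & Ht & HT & HF & HC); auto.
  { unfold min_block. lia. }
  { intros w' Hw'. destruct (large_words c w' Hw') as (? & ? & ?). auto. }
  exists st, t, T. split; [exact X|].
  split; [apply poly_bound; auto; apply Nat.le_trans with (1 := Ht), Nat.mul_le_mono_r; unfold C; lia|].
  split; [apply poly_bound; auto; unfold C; lia|].
  split; [exact HF|].
  intros A m1 n l space Hn Hl WM1 ST HP.
  assert (NW : forall x y, N <= 2 ^ x -> x * c <= y -> l <= 2 ^ y).
  { intros x y Hx Hxy. apply Nat.le_trans with (1 := Hl). apply Nat.le_trans with ((2 ^ x) ^ c).
    - now apply Nat.pow_le_mono_l.
    - rewrite <- Nat.pow_mul_r. apply Nat.pow_le_mono_r; lia. }
  assert (Hlw : l < 2 ^ (w * S c)).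
  { apply Nat.le_lt_trans with (2 ^ (w * c)); [apply (NW w); lia|]. apply Nat.pow_lt_mono_r; lia. }
  destruct HC as [(-> & T0 & T1 & HS)|(beta & -> & Hw0 & Hb & HN2 & HN1 & HT2)].
  - assert (Hsl : l <= small_length c).
    { unfold small_length. destruct HS as [HS|HS].
      - apply (NW w); [lia|]. apply Nat.mul_le_mono_r. lia.
      - apply (NW (8 * min_block c)); [lia|]. apply Nat.mul_le_mono_r. lia. }
    destruct (small_case c w A m1) as (s2 & t2 & X2 & Ht2 & HF2 & HP2 & HA); auto.
    { rewrite ST by lia. exact T0. }
    { rewrite ST by lia. exact T1. }
    (* The fallback has no blocks, so the numerical bounds are used with b = N, e = 0 and no chunks;
       they ask of b only that it be positive and lg N <= 8 b. *)
    assert (GN : (lg (INR N) <= INR (8 * N))%R).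
    { apply Rle_trans with (INR N); [apply lg_le, Nat.lt_le_incl, Nat.pow_gt_lin_r; lia|apply le_INR; lia]. }
    exists s2, t2, (senc_mask A). split; [exact X2|]. split; [|split; [|split; [|split]]].
    + apply time_bound with (B := C6) (chunks := 0) (b := N); unfold C; try lra; try lia.
    + apply writes_within_bits_intro with (u := C5 * l); [|exact HF2].
      apply space_bound with (B := C5) (e := 0) (b := N); auto; unfold C; try lra; rewrite ?Nat.pow_0_r; lia.
    + apply space_bound with (B := 1) (e := 0) (b := N); auto; unfold C; try lra; fold l; rewrite ?Nat.pow_0_r; lia.
    + exact HP2.
    + intros m i WMm STm HPm Hi. destruct (HA m i) as (s & t' & X' & Ht' & Em & R); auto.
      { rewrite STm by lia. exact T0. }
      { rewrite STm by lia. exact T1. }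
      exists s, t'. split; [exact X'|]. split; [unfold C; lia|]. split; [intros; now rewrite Em|exact R].
  - destruct (large_case c w N beta (mem st TAB) A m1)
      as (s2 & t2 & u & e & D & X2 & Ht2 & HE & HU & HD & HF2 & HP2 & HCH & HA); auto; try lia.
    assert (G8 : (lg (INR N) <= INR (8 * 2 ^ beta))%R) by (apply lg_le; lia).
    assert (SP : (INR u <= space)%R).
    { apply space_bound with (B := C4) (e := e) (b := 2 ^ beta); auto; unfold C; try lra; try lia.
      destruct HE as [->|(HE & _)]; auto. }
    exists s2, t2, D. split; [exact X2|]. split; [|split; [|split; [|split]]].
    + apply time_bound with (B := C2) (chunks := chunks beta A) (b := 2 ^ beta); auto; unfold C; try lra; try lia.
      { apply pow2_pos. }
      apply Nat.le_trans with (1 := Ht2). unfold C2. fold K.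
      apply overhead_bound. lia.
    + now apply writes_within_bits_intro with (u := u).
    + apply Rle_trans with (INR u); auto. now apply le_INR.
    + exact HP2.
    + intros m i WMm STm HPm Hi. destruct (HA m i) as (s & t' & X' & Ht' & Em & R); auto.
      exists s, t'. split; [exact X'|]. split; [unfold C, C3; fold K in Ht'; lia|]. split; [intros; now rewrite Em|exact R].
Qed.
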